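(* There exists a closed prime orientable 3-manifold $\mathcal{M}$ and nodes $\nu_1,\nu_2$ of the restricted Pachner graph $\mathscr{P}_1(\mathcal{M})$, both at level $\beta_1(\mathcal{M})$, for which every path in $\mathscr{P}_1(\mathcal{M})$ that joins $\nu_1$ with $\nu_2$ has excess height $\geq 3$.
   Context: All 3-manifolds and triangulations are connected. The 3-sphere is not regarded as prime. A (3-manifold) triangulation of size $n$ is a collection of $n$ abstract tetrahedra whose $4n$ faces are affinely identified in $2n$ pairs so that the resulting topological space is a closed 3-manifold. Two faces of the same tetrahedron may be identified, and distinct edges or vertices of the same tetrahedron may become identified. A vertex (edge, face) of the triangulation is an equivalence class of tetrahedron vertices (edges, faces) under these identifications. A one-vertex triangulation is one with exactly one vertex. Two triangulations are isomorphic if they are identical up to relabelling tetrahedra and reordering the four vertices of each tetrahedron. A 2-3 move replaces two distinct tetrahedra joined along a common face by three distinct tetrahedra joined around a new common edge (retriangulating the interior of the triangular bipyramid, whose boundary is unchanged); a 3-2 move is the inverse operation, performed around an edge of degree three that meets three distinct tetrahedra. These moves preserve the manifold and the number of vertices. The restricted Pachner graph $\mathscr{P}_1(\mathcal{M})$ of a closed 3-manifold $\mathcal{M}$ is the infinite graph whose nodes are the isomorphism classes of one-vertex triangulations of $\mathcal{M}$, with two nodes joined by an arc if and only if some 2-3 or 3-2 move converts one class into the other. Level $n$ consists of the nodes corresponding to triangulations with $n$ tetrahedra; each arc joins adjacent levels. The base level $\beta_1(\mathcal{M})$ is the smallest $n\geq 2$ for which there exists an $n$-tetrahedron one-vertex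 triangulation of $\mathcal{M}$. For a path $p$ from level $i$ to level $j$, the excess height of $p$ is the smallest $h\geq 0$ for which the entire path stays in or below level $\max\{i,j\}+h$. *)

(* Defs.v *)
From HB Require Import structures.
From Stdlib Require Import Relation_Operators.
From mathcomp Require Import all_boot all_order all_algebra all_fingroup.
From mathcomp Require Import generic_quotient all_classical all_reals all_analysis.

Set Implicit Arguments.
Unset Strict Implicit.
Unset Printing Implicit Defensive.

Import Order.TTheory GRing.Theory Num.Theory.
Import numFieldTopology.Exports numFieldNormedType.Exports.

Local Open Scope classical_set_scope.
Local Open Scope quotient_scope.
Local Open Scope ring_scope.

Definition homeomorphic (X Y : topologicalType) : Prop :=
  exists (f : X -> Y) (g : Y -> X),
    [/\ cancel f g, cancel g f, continuous f & continuous g].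

Definition open_embedding (X Y : topologicalType) (f : X -> Y) : Prop :=
  [/\ injective f, continuous f & forall A : set X, open A -> open (f @` A)].

Section Identification.
Context {X : topologicalType} (E : X -> X -> Prop).

Definition identified (x y : X) : bool := `[< clos_refl_sym_trans X E x y >].

Lemma identified_refl : reflexive identified.
Proof. by move=> x; apply/asboolP; exact: rst_refl. Qed.

Lemma identified_sym : symmetric identified.
Proof. by move=> x y; apply/asboolP/asboolP => h; exact: rst_sym. Qed.

Lemma identified_trans : transitive identified.
Proof.
move=> y x z /asboolP xy /asboolP yz; apply/asboolP.
exact: rst_trans xy yz.
Qed.

Canonical identified_equiv :=
  EquivRel identified identified_refl identified_sym identified_trans.

(** The quotient of [X] by the equivalence relation generated by [E]. *)
Definition identification_space : topologicalType :=
  quotient_topology {eq_quot identified_equiv}.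
End Identification.

Section Manifolds.
Variable R : realType.

Definition sqnorm n (x : 'rV[R]_n) : R := \sum_i x 0 i ^+ 2.

Definition sphere n : set 'rV[R]_n.+1 := [set x | sqnorm x = 1].

Definition S3 : topologicalType := set_type (@sphere 3).

Definition locally_euclidean3 (M : topologicalType) : Prop :=
  forall x : M, exists2 phi : 'rV[R]_3 -> M, open_embedding phi & range phi x.

Definition closed_3manifold (M : topologicalType) : Prop :=
  [/\ [set: M] !=set0, connected [set: M], compact [set: M],
      hausdorff_space M & @second_countable M /\ locally_euclidean3 M].

Definition homotopic (X Y : topologicalType) (A : set X) (B : set Y)
    (f g : X -> Y) : Prop :=
  exists H : R * X -> Y,
    [/\ {within `[0, 1]%classic `*` A, continuous H},
        forall t x, 0 <= t <= 1 -> A x -> B (H (t, x)),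
        forall x, A x -> H (0, x) = f x &
        forall x, A x -> H (1, x) = g x].

(** An injective continuous [h], defined near [y], preserves orientation at
    [y] iff its local degree at [y] is 1 (it is always 1 or -1). The degree is
    taken in the homotopy form: the image of a small sphere around [y] is
    homotopic in the complement of [h y] to a standard sphere around [h y]. *)
Definition orientation_preserving_at (h : 'rV[R]_3 -> 'rV[R]_3) (y : 'rV[R]_3)
    : Prop :=
  \forall e \near (0 : R)^'+,
    @homotopic 'rV[R]_3 'rV[R]_3 (@sphere 2) [set~ 0]
      (fun v => h (y + e *: v) - h y) id.

(** The charts of an atlas are given by their inverses, which are open
    embeddings of R^3. [transition phi psi] is [phi^-1 \o psi] on
    [psi @^-1` range phi]; outside this open set its values are irrelevant. *)
Definition transition (M : topologicalType) (phi psi : 'rV[R]_3 -> M)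
    (y : 'rV[R]_3) : 'rV[R]_3 :=
  xget 0 [set x | phi x = psi y].

Definition oriented_atlas (M : topologicalType) (A : set ('rV[R]_3 -> M))
    : Prop :=
  [/\ forall phi, A phi -> open_embedding phi,
      forall x : M, exists2 phi, A phi & range phi x &
      forall phi psi y, A phi -> A psi -> range phi (psi y) ->
        orientation_preserving_at (transition phi psi) y].

Definition orientable (M : topologicalType) : Prop :=
  exists A : set ('rV[R]_3 -> M), oriented_atlas A.

(** What is left of [P] when the open unit ball of a chart is removed. *)
Definition punctured (P : topologicalType) (phi : 'rV[R]_3 -> P)
    : topologicalType :=
  set_type (~` (phi @` [set v | sqnorm v < 1])).

Definition punctured_pair (P Q : topologicalType)
    (phi : 'rV[R]_3 -> P) (psi : 'rV[R]_3 -> Q) (b : bool) : topologicalType :=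
  if b then punctured phi else punctured psi.

Definition boundary_glued (P Q : topologicalType)
    (phi : 'rV[R]_3 -> P) (psi : 'rV[R]_3 -> Q)
    (p q : {b : bool & punctured_pair phi psi b}) : Prop :=
  exists (x : punctured phi) (y : punctured psi) (v : 'rV[R]_3),
    [/\ sphere v, p = existT (punctured_pair phi psi) true x,
        q = existT (punctured_pair phi psi) false y,
        set_val x = phi v & set_val y = psi v].

(** Every gluing homeomorphism of the two boundary spheres is covered: it
    extends radially to R^3, hence can be absorbed into [psi]. *)
Definition connected_sum (P Q : topologicalType)
    (phi : 'rV[R]_3 -> P) (psi : 'rV[R]_3 -> Q) : topologicalType :=
  identification_space (@boundary_glued P Q phi psi).

Definition is_connected_sum (M P Q : topologicalType) : Prop :=
  exists (phi : 'rV[R]_3 -> P) (psi : 'rV[R]_3 -> Q),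
    [/\ open_embedding phi, open_embedding psi &
        homeomorphic M (connected_sum phi psi)].

Definition prime_3manifold (M : topologicalType) : Prop :=
  ~ homeomorphic M S3 /\
  forall P Q : topologicalType,
    closed_3manifold P -> closed_3manifold Q -> is_connected_sum M P Q ->
    homeomorphic P S3 \/ homeomorphic Q S3.

End Manifolds.

(** The vertices of each tetrahedron are numbered by ['I_4], and [(t, f)] is
    the face of [t] opposite vertex [f]. If [G (t, f) = (u, p)] then this face
    is glued to face [p f] of [u], each vertex [i != f] of [t] going to vertex
    [p i] of [u]; an affine bijection between the two faces corresponds to
    exactly one such permutation [p]. *)
Definition gluing (S : finType) : Type := {ffun S * 'I_4 -> S * 'S_4}.

Section Gluings.
Variable S : finType.
Implicit Type G : gluing S.

Definition glued_face G (F : S * 'I_4) : S * 'I_4 := ((G F).1, (G F).2 F.2).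

Definition face_pairing G : Prop :=
  forall F, [/\ glued_face G F != F, glued_face G (glued_face G F) = F &
                (G (glued_face G F)).2 = (G F).2^-1%g].

Definition vertex_glued G : rel (S * 'I_4) :=
  fun u v => [exists f, [&& f != u.2, v.1 == (G (u.1, f)).1 &
                            v.2 == (G (u.1, f)).2 u.2]].

Definition vertices G : {set {set S * 'I_4}} :=
  equivalence_partition (connect (vertex_glued G)) [set: S * 'I_4].

Variable R : realType.

(** The standard tetrahedron, in barycentric coordinates. *)
Definition simplex3 : set 'rV[R]_4 :=
  [set x | (forall i, 0 <= x 0 i) /\ \sum_i x 0 i = 1].

Definition point_glued G (x y : {t : S & set_type simplex3}) : Prop :=
  exists f : 'I_4,
    [/\ set_val (tagged x) 0 f = 0, tag y = (G (tag x, f)).1 &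
        forall i, set_val (tagged y) 0 ((G (tag x, f)).2 i)
                  = set_val (tagged x) 0 i].

Definition realization G : topologicalType := identification_space (point_glued G).

End Gluings.

Definition isomorphic (S S' : finType) (G : gluing S) (G' : gluing S') : Prop :=
  exists (s : S -> S') (r : S -> 'S_4),
    bijective s /\
    forall t f, G' (s t, r t f) =
      (s (G (t, f)).1, (r t)^-1 * (G (t, f)).2 * r (G (t, f)).1)%g.

(** The bipyramid has apexes N, S and equator 0, 1, 2. The two old tetrahedra
    are [true] (with N) and [false] (with S): their vertices 0, 1, 2 lie on the
    equator and vertex 3 is the apex. The new tetrahedron [k : 'I_3] contains
    both apexes and the two equatorial vertices [i != k], in position [i];
    its position [k] holds N and its position 3 holds S. *)
Section Move23.
Variable K : finType.  (* the tetrahedra not involved in the move *)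

Definition equator (k : 'I_3) : 'I_4 := lift ord_max k.
Definition apex : 'I_4 := ord_max.

(** The faces other than those interior to the bipyramid. *)
Definition outer_face : Type := ((K * 'I_4) + (bool * 'I_3))%type.

Definition old_face (F : outer_face) : (K + bool) * 'I_4 :=
  match F with
  | inl (t, f) => (inl t, f)
  | inr (a, k) => (inr a, equator k)
  end.

Definition new_tet (F : outer_face) : K + 'I_3 :=
  match F with
  | inl (t, _) => inl t
  | inr (_, k) => inr k
  end.

(** Sends the vertices of a face in the old tetrahedron to the same points of
    the bipyramid in the new one. *)
Definition relabel (F : outer_face) : 'S_4 :=
  match F with
  | inr (true, k) => tperm (equator k) apex
  | _ => 1%g
  end.

Definition new_face (F : outer_face) : (K + 'I_3) * 'I_4 :=
  (new_tet F, relabel F (old_face F).2).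

Definition standard_move23 (A : gluing (K + bool)%type)
    (B : gluing (K + 'I_3)%type) : Prop :=
  [/\ A (inr true, apex) = (inr false, 1%g),
      forall k l : 'I_3, k != l ->
        B (inr k, equator l) = (inr l, tperm (equator k) (equator l)) &
      forall F F' : outer_face, glued_face A (old_face F) = old_face F' ->
        B (new_face F) =
          (new_tet F', ((relabel F)^-1 * (A (old_face F)).2 * relabel F')%g)].

End Move23.

Definition triangulation : Type := {n : nat & gluing 'I_n}.

Definition move23 (T T' : triangulation) : Prop :=
  exists (k : nat) (A : gluing ('I_k + bool)%type)
         (B : gluing ('I_k + 'I_3)%type),
    [/\ isomorphic (tagged T) A, isomorphic (tagged T') B &
        standard_move23 A B].

Lemma isomorphic_refl (S : finType) (G : gluing S) : isomorphic G G.
Proof.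
exists id, (fun=> 1%g); split; first by exists id.
by move=> t f; rewrite perm1 invg1 mul1g mulg1; case: (G (t, f)).
Qed.

Lemma isomorphic_sym (S S' : finType) (G : gluing S) (G' : gluing S') :
  isomorphic G G' -> isomorphic G' G.
Proof.
move=> [s [r [[s' sK s'K] GG']]].
exists s', (fun t => (r (s' t))^-1%g); split; first by exists s.
move=> t f; set f' := (_ : 'S_4) f.
have -> : G' (t, f) = G' (s (s' t), r (s' t) f') by rewrite s'K permKV.
rewrite GG' /= sK invgK !mulgA mulgV mul1g mulgK.
by case: (G _).
Qed.

Lemma isomorphic_trans (S S1 S2 : finType) (G1 : gluing S) (G2 : gluing S1)
    (G3 : gluing S2) :
  isomorphic G1 G2 -> isomorphic G2 G3 -> isomorphic G1 G3.
Proof.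
move=> [s [r [bs G12]]] [s' [r' [bs' G23]]].
exists (s' \o s), (fun t => (r t * r' (s t))%g); split; first exact: bij_comp.
by move=> t f /=; rewrite permM G23 G12 /= invMg !mulgA.
Qed.

Definition isomorphicb (T T' : triangulation) : bool :=
  `[< isomorphic (tagged T) (tagged T') >].

Lemma isomorphicb_refl : reflexive isomorphicb.
Proof. by move=> T; apply/asboolP; exact: isomorphic_refl. Qed.

Lemma isomorphicb_sym : symmetric isomorphicb.
Proof. by move=> T T'; apply/asboolP/asboolP; exact: isomorphic_sym. Qed.

Lemma isomorphicb_trans : transitive isomorphicb.
Proof.
move=> T' T T'' /asboolP h /asboolP h'; apply/asboolP.
exact: isomorphic_trans h h'.
Qed.

Canonical isomorphic_equiv :=
  EquivRel isomorphicb isomorphicb_refl isomorphicb_sym isomorphicb_trans.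

Definition isomorphism_class : choiceType := {eq_quot isomorphic_equiv}.

Definition class_of (T : triangulation) : isomorphism_class :=
  \pi_{eq_quot isomorphic_equiv} T.

(** The number of tetrahedra, which isomorphisms preserve. *)
Definition level (c : isomorphism_class) : nat :=
  tag (repr (c : {eq_quot isomorphic_equiv})).

Section PachnerGraph.
Variables (R : realType) (M : topologicalType).

Definition one_vertex_triangulation_of (T : triangulation) : Prop :=
  [/\ face_pairing (tagged T), #|vertices (tagged T)| = 1%N &
      homeomorphic (realization R (tagged T)) M].

Definition pachner_node (c : isomorphism_class) : Prop :=
  exists2 T, c = class_of T & one_vertex_triangulation_of T.

Definition pachner_arc : rel isomorphism_class := fun c d =>
  `[< [/\ pachner_node c, pachner_node d &
          exists T T', [/\ c = class_of T, d = class_of T' &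
                           move23 T T' \/ move23 T' T]] >].

Definition base_level (b : nat) : Prop :=
  let has_level n := exists2 T, one_vertex_triangulation_of T & tag T = n in
  [/\ (2 <= b)%N, has_level b &
      forall n, (2 <= n)%N -> has_level n -> (b <= n)%N].

End PachnerGraph.

(** A path is given by its first node [c] and the list [s] of its other nodes. *)
Definition within_height (c : isomorphism_class) (s : seq isomorphism_class)
    (h : nat) : bool :=
  all (fun d => (level d <= maxn (level c) (level (last c s)) + h)%N) (c :: s).

Lemma within_height_exists c s : exists h, within_height c s h.
Proof.
exists (\sum_(d <- c :: s) level d)%N; apply/allP => d ds.
by rewrite (big_rem d) //= addnCA leq_addr.
Qed.

Definition excess_height c s : nat := ex_minn (within_height_exists c s).

(* Main.v *)
(** The manifold is the lens space L(3,1), the quotient of the unit quaternions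
    by left multiplication by [om], a cube root of unity, and the base level is 2.

    L(3,1) is prime: in a connected sum decomposition the separating sphere
    lifts, with a collar, to the 3-sphere, and the three translates of the lift
    are disjoint, so one of them has a side that contains no other. That
    side maps homeomorphically onto a summand with a ball removed, and Brown's
    proof of the Schoenflies theorem shows that it is a ball, so this summand is
    a sphere. L(3,1) is not the sphere because a section of the covering would
    have a clopen image.

    The nodes are two one-vertex triangulations with two tetrahedra, [table_a]
    and [table_b]. The component of [table_b] in levels at most 4 of the Pachner
    graph has at most five nodes, by an enumeration of all moves, and it does not
    contain [table_a]; hence a path between the two climbs to level 5. Both
    realize L(3,1) because bistellar moves, which exchange two complementary
    parts of the boundary of the 4-simplex, connect them to an explicit
    triangulation of L(3,1) with two vertices. *)
From HB Require Import structures.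
From Stdlib Require Import Relation_Operators.
From mathcomp Require Import all_boot all_order all_algebra all_fingroup.
From mathcomp Require Import generic_quotient all_classical all_reals all_analysis.
From mathcomp Require Import ring lra zify.
Require Import Defs.

Set Implicit Arguments.
Unset Strict Implicit.
Unset Printing Implicit Defensive.

Import Order.TTheory GRing.Theory Num.Theory.
Import numFieldTopology.Exports numFieldNormedType.Exports.

Local Open Scope classical_set_scope.
Local Open Scope quotient_scope.
Local Open Scope ring_scope.

(** * Open maps and connectedness *)

(** Homology and fundamental groups do not occur. That a lifted collar separates the 3-sphere is
    read off from the covering: a map to L(3,1) that crosses the collar while running around a loop
    whose lifts are not closed can itself be lifted, because the 3-sphere is a union of two cells
    with connected intersection, and this lift takes different values beyond the two ends of the
    collar. Connected sums are formed along arbitrary topological charts; these extend past the unit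
    ball, which gives the collar that Brown's argument needs. Sides are then compared by showing
    that some clopen set misses a point and so is empty. Orientability is stated through homotopies,
    so the atlas consists of central projections: its transitions are the projective maps induced by
    [x |-> w0 x w1] on quaternions, and their differentials are deformed to the identity by moving
    both factors to positive multiples of 1. For the graph, gluings become tables of numbers,
    isomorphism is tested by comparing the tables that a labelled traversal writes down, and every
    labelling that exhibits a move is tried. *)

Section OpenMaps.
Implicit Types X Y Z : topologicalType.

Lemma nbhsS X (x : X) (A B : set X) : A `<=` B -> nbhs x A -> nbhs x B.
Proof. exact: filterS. Qed.

Lemma pair_continuousr X Y (x : X) : continuous (fun y : Y => (x, y)).
Proof.
move=> y A [[B C] [/= Bx Cy] BC]; apply: nbhsS Cy => z Cz.
by apply: BC; split=> //; exact: nbhs_singleton Bx.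
Qed.

Lemma pair_continuousl X Y (y : Y) : continuous (fun x : X => (x, y)).
Proof.
move=> x A [[B C] [/= Bx Cy] BC]; apply: nbhsS Bx => z Bz.
by apply: BC; split=> //; exact: nbhs_singleton Cy.
Qed.

(** Openness at one point: several maps below are defined by cases and are open only off an
    exceptional point. *)
Definition open_at X Y (f : X -> Y) (x : X) : Prop :=
  forall N, nbhs x N -> nbhs (f x) (f @` N).

Lemma open_at_open X Y (f : X -> Y) :
  (forall x, open_at f x) -> forall A, open A -> open (f @` A).
Proof.
move=> fo A oA; rewrite openE => _ [x Ax <-].
by apply: fo; exact: open_nbhs_nbhs.
Qed.

Lemma open_open_at X Y (f : X -> Y) :
  (forall A, open A -> open (f @` A)) -> forall x, open_at f x.
Proof.
move=> fo x N; rewrite nbhsE => -[B [oB Bx] BN].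
apply: (@filterS _ _ _ (f @` B)); first exact: image_subset.
by apply: open_nbhs_nbhs; split; [exact: fo|exists x].
Qed.

Lemma open_embeddingP X Y (f : X -> Y) :
  open_embedding f <->
  [/\ injective f, continuous f & forall x, open_at f x].
Proof.
split=> -[fi fc fo]; split=> //; first exact: open_open_at.
exact: open_at_open.
Qed.

Lemma open_at_comp X Y Z (f : X -> Y) (g : Y -> Z) x :
  open_at f x -> open_at g (f x) -> open_at (g \o f) x.
Proof. by move=> fo go N /fo /go; rewrite -image_comp. Qed.

Lemma open_at_near X Y (f g : X -> Y) x :
  (\forall y \near x, f y = g y) -> open_at f x -> open_at g x.
Proof.
move=> fg fo N Nx; rewrite -(nbhs_singleton fg).
apply: nbhsS (fo _ (filterI Nx fg)) => _ [y [Ny fgy] <-].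
by exists y.
Qed.

Lemma continuous_near X Y (f g : X -> Y) x :
  (\forall y \near x, f y = g y) -> {for x, continuous f} ->
  {for x, continuous g}.
Proof.
move=> fg fc; rewrite /prop_for /continuous_at -(nbhs_singleton fg).
apply: cvg_trans fc; apply: near_eq_cvg.
by apply: filterS fg => y ->.
Qed.

Lemma open_at_cancel X Y (f : X -> Y) (g : Y -> X) x :
  cancel g f -> g (f x) = x -> {for f x, continuous g} -> open_at f x.
Proof.
move=> gf gx gc N Nx; have := gc N; rewrite gx => /(_ Nx).
by apply: nbhsS => y Ny; exists (g y).
Qed.

Lemma open_embedding_comp X Y Z (f : X -> Y) (g : Y -> Z) :
  open_embedding f -> open_embedding g -> open_embedding (g \o f).
Proof.
move=> [fi fc fo] [gi gc go]; split.
- exact: inj_comp.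
- by move=> x; apply: continuous_comp; [exact: fc|exact: gc].
- by move=> A oA; rewrite -image_comp; apply: go; exact: fo.
Qed.

Lemma open_embedding_range X Y (f : X -> Y) :
  open_embedding f -> open (range f).
Proof. by move=> [_ _]; apply; exact: openT. Qed.

Lemma open_embedding_inv X Y (f : X -> Y) (g : Y -> X) :
  open_embedding f -> cancel f g -> forall x, {for f x, continuous g}.
Proof.
move=> [fi fc fo] fK x N; rewrite fK => Nx.
have /(_ x _ Nx) := open_open_at fo.
by apply: nbhsS => _ [y Ny <-] /=; rewrite fK.
Qed.

Lemma open_embedding_homeo X Y (f : X -> Y) (g : Y -> X) :
  cancel f g -> cancel g f -> continuous f -> continuous g ->
  open_embedding f.
Proof.
move=> fK gK fc gc; apply/open_embeddingP; split=> //; first exact: can_inj fK.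
by move=> x; apply: (open_at_cancel gK) => //; exact: gc.
Qed.

Lemma homeomorphic_sym X Y : homeomorphic X Y -> homeomorphic Y X.
Proof. by move=> [f [g [fK gK fc gc]]]; exists g, f. Qed.

Lemma homeomorphic_trans X Y Z :
  homeomorphic X Y -> homeomorphic Y Z -> homeomorphic X Z.
Proof.
move=> [f [g [fK gK fc gc]]] [f' [g' [fK' gK' fc' gc']]].
exists (f' \o f), (g \o g'); split.
- exact: can_comp.
- exact: can_comp.
- by move=> x; apply: continuous_comp; [exact: fc|exact: fc'].
- by move=> x; apply: continuous_comp; [exact: gc'|exact: gc].
Qed.

Lemma compact_bij_homeo X Y (f : X -> Y) :
  compact [set: X] -> hausdorff_space Y -> continuous f -> injective f ->
  (forall y, exists x, f x = y) -> homeomorphic X Y.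
Proof.
move=> cX hY fc fi fs; have [g gK] := choice fs.
exists f, g; split=> //; first by move=> x; apply: fi; rewrite gK.
apply/continuous_closedP => A cA.
have -> : g @^-1` A = f @` A.
  apply/seteqP; split=> [y Ay|_ [x Ax <-] /=]; first by exists (g y).
  by rewrite (_ : g (f x) = x)//; apply: fi; rewrite gK.
apply: compact_closed => //; apply: continuous_compact.
  exact: continuous_subspaceT.
exact: subclosed_compact cA cX _.
Qed.

End OpenMaps.

Section Connectedness.
Variable T : topologicalType.

Lemma clopen_all (A : set T) : connected [set: T] -> open A -> closed A ->
  A !=set0 -> A = setT.
Proof.
move=> cT oA cA A0; apply: cT => //.
  by exists A => //; rewrite setTI.
by exists A => //; rewrite setTI.
Qed.

(** Both the part of [C] where [P] holds and the part where it fails are relatively open. *)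
Lemma connected_stable (C : set T) (P : T -> Prop) :
  connected C ->
  (forall x, C x -> \forall y \near x, C y -> (P y <-> P x)) ->
  forall x y, C x -> C y -> P x -> P y.
Proof.
move=> cC lP x y Cx Cy Px; pose B := [set z | C z /\ P z].
suff BC : B = C by have [] : B y by rewrite BC.
apply: cC; first by exists x.
- exists (\bigcup_(z in B) ([set w | C w -> (P w <-> P z)]°)).
    by apply: bigcup_open => z _; exact: open_interior.
  apply/seteqP; split=> [z [Cz Pz]|z [Cz [w [Cw Pw]]]].
    by split=> //; exists z => //; exact: lP.
  by move=> /interior_subset /= /(_ Cz) h; split=> //; exact/h.
- exists (~` \bigcup_(z in C `&` [set z | ~ P z])
      ([set w | C w -> (P w <-> P z)]°)).
    by apply: open_closedC; apply: bigcup_open => z _; exact: open_interior.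
  apply/seteqP; split=> [z [Cz Pz]|z [Cz zN]].
    split=> // -[w [Cw nPw]] /interior_subset /= /(_ Cz) /proj1 h.
    by apply: nPw; exact: h.
  split=> //; apply: contrapT => nPz; apply: zN.
  by exists z => //; exact: lP.
Qed.

End Connectedness.

(** * Radial homeomorphisms *)

Section RadialMaps.
Variable R : realType.

(** For [a < b <= b' < d] this is the piecewise linear map that fixes everything up to [a] and from
    [d] on and carries [b] to [b']. *)
Definition stretch_up (a b b' d r : R) : R :=
  Num.max r (Num.min (a + (r - a) * ((b' - a) / (b - a)))
                     (d + (r - d) * ((d - b') / (d - b)))).

Definition stretch_down (a b b' d r : R) : R :=
  Num.min r (Num.max (a + (r - a) * ((b - a) / (b' - a)))
                     (d + (r - d) * ((d - b) / (d - b')))).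

Lemma line_continuous (c m : R) : continuous (fun r : R => c + (r - c) * m).
Proof.
move=> r; apply: cvgD; first exact: cvg_cst.
by apply: cvgMl; apply: cvgB; [exact: cvg_id|exact: cvg_cst].
Qed.

Lemma line_inv (c m1 m2 r s : R) : m1 * m2 = 1 -> 0 < m1 ->
  (c + (r - c) * m1 <= s) = (r <= c + (s - c) * m2).
Proof.
move=> m12 m1p.
have -> : (c + (r - c) * m1 <= s) = ((r - c) * m1 <= s - c).
  by rewrite lerBrDl.
have -> : (r <= c + (s - c) * m2) = (r - c <= (s - c) * m2).
  by rewrite lerBlDl.
rewrite -(ler_pM2r m1p (r - c)) -mulrA (mulrC m2) m12 mulr1.
by [].
Qed.

Section Stretch.
Variables a b b' d : R.
Hypotheses (ab : a < b) (bb : b <= b') (bd : b' < d).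

Local Notation m1 := ((b' - a) / (b - a)).
Local Notation n1 := ((b - a) / (b' - a)).
Local Notation m2 := ((d - b') / (d - b)).
Local Notation n2 := ((d - b) / (d - b')).

Let ba0 : 0 < b - a. Proof. by rewrite subr_gt0. Qed.
Let ba1 : 0 < b' - a. Proof. by rewrite subr_gt0 (lt_le_trans ab). Qed.
Let bd0 : 0 < d - b. Proof. by rewrite subr_gt0 (le_lt_trans bb). Qed.
Let bd1 : 0 < d - b'. Proof. by rewrite subr_gt0. Qed.

Let mn1 : m1 * n1 = 1.
Proof. by rewrite mulrA divfK ?divff ?gt_eqF. Qed.

Let mn2 : m2 * n2 = 1.
Proof. by rewrite mulrA divfK ?divff ?gt_eqF. Qed.

Let m1_ge1 : 1 <= m1. Proof. by rewrite ler_pdivlMr // mul1r lerB. Qed.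
Let m1_gt0 : 0 < m1. Proof. by rewrite divr_gt0. Qed.
Let m2_gt0 : 0 < m2. Proof. by rewrite divr_gt0. Qed.
Let m2_le1 : m2 <= 1. Proof. by rewrite ler_pdivrMr // mul1r lerB. Qed.
Let n1_gt0 : 0 < n1. Proof. by rewrite divr_gt0. Qed.
Let n2_gt0 : 0 < n2. Proof. by rewrite divr_gt0. Qed.

(** [stretch_up] is [max id (min l1 l2)] for two increasing lines, so its
    inverse is [min id (max l1^-1 l2^-1)]. *)
Lemma stretch_galois r s :
  (stretch_up a b b' d r <= s) = (r <= stretch_down a b b' d s).
Proof.
rewrite /stretch_up /stretch_down ge_max ge_min le_min le_max.
by rewrite (line_inv _ _ _ mn1) // (line_inv _ _ _ mn2).
Qed.

Lemma stretch_galoisV r s :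
  (s <= stretch_up a b b' d r) = (stretch_down a b b' d s <= r).
Proof.
rewrite /stretch_up /stretch_down le_max le_min ge_min ge_max.
have nm1 := mn1; have nm2 := mn2; rewrite mulrC in nm1; rewrite mulrC in nm2.
by rewrite (line_inv _ _ _ nm1) // (line_inv _ _ _ nm2).
Qed.

Lemma stretch_upK : cancel (stretch_up a b b' d) (stretch_down a b b' d).
Proof.
by move=> r; apply/eqP; rewrite eq_le -stretch_galois -stretch_galoisV !lexx.
Qed.

Lemma stretch_downK : cancel (stretch_down a b b' d) (stretch_up a b b' d).
Proof.
by move=> r; apply/eqP; rewrite eq_le stretch_galois stretch_galoisV !lexx.
Qed.

Lemma stretch_up_lo r : r <= a -> stretch_up a b b' d r = r.
Proof.
move=> ra; apply/max_idPl; rewrite ge_min; apply/orP; left.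
by rewrite -lerBrDl -subr_ge0 -{1}[r - a]mulr1 -mulrBr mulr_le0 // subr_le0.
Qed.

Lemma stretch_up_hi r : d <= r -> stretch_up a b b' d r = r.
Proof.
move=> ra; apply/max_idPl; rewrite ge_min; apply/orP; right.
by rewrite -lerBrDl -subr_ge0 -{1}[r - d]mulr1 -mulrBr mulr_ge0 // subr_ge0.
Qed.

Lemma stretch_up_mid : stretch_up a b b' d b = b'.
Proof.
rewrite /stretch_up.
have -> : a + (b - a) * ((b' - a) / (b - a)) = b'.
  by rewrite mulrC divfK ?gt_eqF // addrC subrK.
have -> : d + (b - d) * ((d - b') / (d - b)) = b'.
  by rewrite mulrC -[b - d]opprB mulrN divfK ?gt_eqF // opprB addrC subrK.
by rewrite minxx; apply/max_idPr.
Qed.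

End Stretch.

Lemma stretch_up_continuous a b b' d : continuous (stretch_up a b b' d).
Proof.
move=> r; apply: (@continuous_max _ _ _ _ r); first exact: cvg_id.
by apply: (@continuous_min _ _ _ _ r); exact: line_continuous.
Qed.

Lemma stretch_down_continuous a b b' d : continuous (stretch_down a b b' d).
Proof.
move=> r; apply: (@continuous_min _ _ _ _ r); first exact: cvg_id.
by apply: (@continuous_max _ _ _ _ r); exact: line_continuous.
Qed.

Definition radial (V : normedModType R) (c : V) (m : R -> R) (x : V) : V :=
  c + (m `|x - c| / `|x - c|) *: (x - c).

Section Radial.
Variables (V : normedModType R) (c : V) (a : R).
Hypothesis a0 : 0 < a.

Lemma radial_norm m x : (forall r, r <= a -> m r = r) ->
  {mono m : r s / r <= s} -> `|radial c m x - c| = m `|x - c|.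
Proof.
move=> ma mm; rewrite /radial [c + _]addrC addrK.
have [->|xc] := eqVneq (x - c) 0.
  by rewrite scaler0 normr0 ma // ltW.
have m0 : 0 <= m `|x - c| by rewrite -[0](ma 0) ?mm // ltW.
by rewrite normrZ normrM normfV normr_id ger0_norm // divfK // normr_eq0.
Qed.

Lemma radial_id m x : m `|x - c| = `|x - c| -> radial c m x = x.
Proof.
move=> mx; rewrite /radial mx; have [xc|xc] := eqVneq (x - c) 0.
  by rewrite xc scaler0 addr0; apply/esym/eqP; rewrite -subr_eq0 xc.
by rewrite divff ?normr_eq0 // scale1r addrC subrK.
Qed.

Lemma radialK m n : cancel m n ->
  (forall r, r <= a -> m r = r) -> (forall r, r <= a -> n r = r) ->
  {mono m : r s / r <= s} -> cancel (radial c m) (radial c n).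
Proof.
move=> mK ma na mm x.
rewrite {1}/radial radial_norm // mK.
rewrite {1}/radial [c + (_ / _) *: (x - c) - c]addrC addKr scalerA.
have [xc|xc] := eqVneq (x - c) 0.
  by rewrite xc scaler0 addr0; apply/esym/eqP; rewrite -subr_eq0 xc.
have mx0 : m `|x - c| != 0.
  apply/eqP => m0; have : m `|x - c| <= m 0 by rewrite m0 (ma 0) // ltW.
  by rewrite mm normr_le0; exact/negP.
by rewrite mulrA divfK // divff ?normr_eq0 // scale1r addrC subrK.
Qed.

(** The formula divides by 0 at the centre, but the map is the identity near it because [m] is the
    identity up to [a > 0]. *)
Lemma radial_continuous m : continuous m -> (forall r, r <= a -> m r = r) ->
  continuous (radial c m).
Proof.
move=> mc ma x.
have nc : {for x, continuous (fun y : V => `|y - c|)}.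
  by apply: cvg_norm; apply: cvgB; [exact: cvg_id|exact: cvg_cst].
have [xa|xa] := ltP `|x - c| a.
  apply: (@continuous_near _ _ id); last exact: cvg_id.
  have : \forall y \near x, `|y - c| < a by apply: (cvgr_lt _ nc).
  by apply: nbhsS => y ya; rewrite radial_id // ma // ltW.
apply: cvgD; first exact: cvg_cst.
apply: cvgZ; last by apply: cvgB; [exact: cvg_id|exact: cvg_cst].
apply: cvgM; first by apply: continuous_comp; [exact: nc|exact: mc].
by apply: cvgV => //; apply/lt0r_neq0/(lt_le_trans a0).
Qed.

End Radial.

(** The elementary move of Brown's proof: a ball is expanded or compressed between two regions that
    stay fixed. The last clause allows a chosen point to be sent to a prescribed one. *)
Lemma radial_homeo (V : normedModType R) (c : V) (a b b' d : R) :
  0 < a -> a < b -> a < b' -> b < d -> b' < d ->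
  exists f g : V -> V,
    [/\ cancel f g, cancel g f, continuous f, continuous g &
        [/\ forall x, `|x - c| <= a -> f x = x,
            forall x, d <= `|x - c| -> f x = x,
            forall x, (`|f x - c| <= b') = (`|x - c| <= b),
            forall x, (`|f x - c| < b') = (`|x - c| < b) &
            forall x, `|x - c| = b -> f x = c + (b' / b) *: (x - c)]].
Proof.
move=> a0 ab ab' bd b'd.
suff [m [n [[mK nK mc nc] [ma na mm nm] [md mb]]]] : exists m n : R -> R,
  [/\ [/\ cancel m n, cancel n m, continuous m & continuous n],
      [/\ forall r, r <= a -> m r = r, forall r, r <= a -> n r = r,
          {mono m : r s / r <= s} & {mono n : r s / r <= s}] &
      (forall r, d <= r -> m r = r) /\ m b = b'].
  exists (radial c m), (radial c n); split.
  - by apply: (@radialK _ _ _ a0).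
  - by apply: (@radialK _ _ _ a0).
  - by apply: (@radial_continuous _ _ _ a0).
  - by apply: (@radial_continuous _ _ _ a0).
  split=> x.
  - by move=> xa; apply: radial_id; exact: ma.
  - by move=> xd; apply: radial_id; exact: md.
  - by rewrite (@radial_norm V c a a0) // -mb mm.
  - by rewrite (@radial_norm V c a a0) // -mb !ltNge mm.
  - by move=> xb; rewrite /radial xb mb.
(* If [b'] is smaller than [b], the inverse of the map for the exchanged radii serves. *)
wlog bb : b b' ab ab' bd b'd / b <= b' => [wh|].
  have [|/ltW b'b] := leP b b'; first exact: wh.
  have [m [n [[mK nK mc nc] [ma na mm nm] [md mb]]]] := wh b' b ab' ab b'd bd b'b.
  exists n, m; split=> //; split=> [r dr|]; last by rewrite -mb mK.
  by rewrite -{1}(md _ dr) mK.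
exists (stretch_up a b b' d), (stretch_down a b b' d); split; split.
- exact: stretch_upK.
- exact: stretch_downK.
- exact: stretch_up_continuous.
- exact: stretch_down_continuous.
- by move=> r; exact: stretch_up_lo.
- move=> r ra; have {1}-> : r = stretch_up a b b' d r by rewrite stretch_up_lo.
  exact: stretch_upK.
- by move=> r s; rewrite stretch_galois // stretch_upK.
- by move=> r s; rewrite -stretch_galois // stretch_downK.
- by move=> r; exact: stretch_up_hi.
- exact: stretch_up_mid.
Qed.

End RadialMaps.

(** * Pointwise continuity and balls in normed spaces *)

Section Balls.
Variable R : realType.
Local Notation E := 'rV[R]_3.

Lemma dist_continuous (V : normedModType R) (c : V) :
  continuous (fun v : V => `|v - c|).
Proof.
by move=> v; apply: cvg_norm; apply: cvgB; [exact: cvg_id|exact: cvg_cst].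
Qed.

Section PointwiseContinuity.
Variables (X : topologicalType) (x : X).

Lemma cont_add (V : normedModType R) (f h : X -> V) :
  {for x, continuous f} -> {for x, continuous h} ->
  {for x, continuous (fun y => f y + h y)}.
Proof. by move=> fc hc; exact: cvgD fc hc. Qed.

Lemma cont_sub (V : normedModType R) (f h : X -> V) :
  {for x, continuous f} -> {for x, continuous h} ->
  {for x, continuous (fun y => f y - h y)}.
Proof. by move=> fc hc; exact: cvgB fc hc. Qed.

Lemma cont_scale (V : normedModType R) (a : X -> R) (f : X -> V) :
  {for x, continuous a} -> {for x, continuous f} ->
  {for x, continuous (fun y => a y *: f y)}.
Proof. by move=> ac fc; exact: cvgZ ac fc. Qed.

Lemma cont_mul (f h : X -> R) :
  {for x, continuous f} -> {for x, continuous h} ->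
  {for x, continuous (fun y => f y * h y)}.
Proof. by move=> fc hc; exact: cvgM fc hc. Qed.

Lemma cont_addr (f h : X -> R) :
  {for x, continuous f} -> {for x, continuous h} ->
  {for x, continuous (fun y => f y + h y)}.
Proof. by move=> fc hc; exact: (@cvgD _ R^o _ _ _ f h _ _ fc hc). Qed.

Lemma cont_subr (f h : X -> R) :
  {for x, continuous f} -> {for x, continuous h} ->
  {for x, continuous (fun y => f y - h y)}.
Proof. by move=> fc hc; exact: (@cvgB _ R^o _ _ _ f h _ _ fc hc). Qed.

Lemma cont_inv (f : X -> R) : f x != 0 ->
  {for x, continuous f} -> {for x, continuous (fun y => (f y)^-1)}.
Proof. by move=> f0 fc; exact: cvgV f0 fc. Qed.

Lemma cont_norm (V : normedModType R) (f : X -> V) :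
  {for x, continuous f} -> {for x, continuous (fun y => `|f y|)}.
Proof. by move=> fc; exact: cvg_norm fc. Qed.

Lemma cont_cst (Y : topologicalType) (c : Y) :
  {for x, continuous (fun _ : X => c)}.
Proof. exact: cvg_cst. Qed.

Lemma cont_id : {for x, continuous (fun y : X => y)}.
Proof. exact: cvg_id. Qed.

Lemma cont_sum (I : Type) (s : seq I) (f : I -> X -> R) :
  (forall i, {for x, continuous (f i)}) ->
  {for x, continuous (fun y => \sum_(i <- s) f i y)}.
Proof.
move=> fc; elim: s => [|i s IH].
  apply: (@continuous_near _ _ (fun=> 0)); last exact: cont_cst.
  by near=> y; rewrite big_nil.
apply: (@continuous_near _ _ (fun y => f i y + \sum_(i <- s) f i y)).
  by near=> y; rewrite big_cons.
exact: cont_addr.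
Unshelve. all: by end_near. Qed.

Lemma cont_comp (Y Z : topologicalType) (f : X -> Y) (h : Y -> Z) :
  {for x, continuous f} -> {for f x, continuous h} ->
  {for x, continuous (fun y => h (f y))}.
Proof. exact: continuous_comp. Qed.

End PointwiseContinuity.

Lemma continuous_subc (X : topologicalType) (V : normedModType R) (g : X -> V)
    (c : V) (x : X) :
  {for x, continuous g} -> {for x, continuous (fun y => g y - c)}.
Proof. by move=> gc; apply: cvgB; [exact: gc|exact: cvg_cst]. Qed.

Lemma affine_continuous (V : normedModType R) (c : V) (r : R) :
  continuous (fun v : V => c + r *: v).
Proof.
by move=> v; apply: cvgD; [exact: cvg_cst|apply: cvgZr; exact: cvg_id].
Qed.

Lemma affine_inv_continuous (V : normedModType R) (c : V) (r : R) :
  continuous (fun v : V => r *: (v - c)).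
Proof.
by move=> v; apply: cvgZr; apply: cvgB; [exact: cvg_id|exact: cvg_cst].
Qed.

Lemma squash_continuous (V : normedModType R) (r : R) :
  continuous (fun v : V => (r / (1 + `|v|)) *: v).
Proof.
move=> v; apply: cvgZ; last exact: cvg_id.
apply: cvgM; first exact: cvg_cst.
apply: cvgV; first by rewrite gt_eqF // ltr_pwDl.
by apply: cvgD; [exact: cvg_cst|apply: cvg_norm; exact: cvg_id].
Qed.

Lemma unsquash_continuous (V : normedModType R) (r : R) (w : V) : `|w| < r ->
  {for w, continuous (fun v : V => (r - `|v|)^-1 *: v)}.
Proof.
move=> wr; apply: cvgZ; last exact: cvg_id.
apply: cvgV; first by rewrite gt_eqF // subr_gt0.
by apply: cvgB; [exact: cvg_cst|apply: cvg_norm; exact: cvg_id].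
Qed.

(** The norm on row vectors is the maximum norm, so these balls are cubes. *)
Lemma ball_compact (c : E) r : compact [set v : E | `|v - c| <= r].
Proof.
apply: bounded_closed_compact.
  exists (`|c| + r); split; first exact: num_real.
  move=> s rs v /= vr; apply: le_trans (ltW rs).
  by rewrite -[v](subrK c) (le_trans (ler_normD _ _))// addrC lerD2l.
apply: (@preimage_closed _ _ (fun v : E => `|v - c|) [set s | s <= r]).
  by move=> v _; exact: dist_continuous.
exact: closed_le.
Qed.

Lemma ball0_compact r : compact [set v : E | `|v| <= r].
Proof.
rewrite (_ : [set v : E | `|v| <= r] = [set v : E | `|v - 0| <= r]).
  exact: ball_compact.
by apply/seteqP; split=> v /=; rewrite subr0.
Qed.

Lemma open_ball_open (c : E) r : open [set v : E | `|v - c| < r].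
Proof.
apply: (@open_comp _ _ (fun v : E => `|v - c|) [set s | s < r]); last exact: open_lt.
by move=> v _; exact: dist_continuous.
Qed.

Lemma open_ball0_open r : open [set v : E | `|v| < r].
Proof.
rewrite (_ : [set v : E | `|v| < r] = [set v : E | `|v - 0| < r]).
  exact: open_ball_open.
by apply/seteqP; split=> v /=; rewrite subr0.
Qed.

End Balls.


(** * Local homeomorphisms *)

Section LocalHomeomorphisms.
Implicit Types X Y Z : topologicalType.

(** Injectivity is kept apart: it is always proved globally, and then yields an open embedding. *)
Definition loc_homeo X Y (f : X -> Y) (x : X) : Prop :=
  {for x, continuous f} /\ open_at f x.

Lemma loc_homeo_id X (x : X) : loc_homeo id x.
Proof. by split=> [|N Nx]; [exact: cvg_id|rewrite image_id]. Qed.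

Lemma loc_homeo_comp X Y Z (f : X -> Y) (g : Y -> Z) x :
  loc_homeo f x -> loc_homeo g (f x) -> loc_homeo (g \o f) x.
Proof.
move=> [fc fo] [gc go]; split; first exact: continuous_comp.
exact: open_at_comp.
Qed.

Lemma loc_homeo_near X Y (f g : X -> Y) x :
  (\forall y \near x, f y = g y) -> loc_homeo f x -> loc_homeo g x.
Proof.
move=> fg [fc fo]; split; first exact: continuous_near fg fc.
exact: open_at_near fg fo.
Qed.

Lemma loc_homeo_embedding X Y (f : X -> Y) :
  open_embedding f <-> injective f /\ forall x, loc_homeo f x.
Proof.
split=> [/open_embeddingP[fi fc fo]|[fi fl]].
  by split=> // x; split; [exact: fc|exact: fo].
by apply/open_embeddingP; split=> // x; have [] := fl x.
Qed.

Lemma loc_homeo_can X Y (f : X -> Y) (g : Y -> X) :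
  cancel f g -> cancel g f -> continuous f -> continuous g ->
  forall x, loc_homeo f x.
Proof.
move=> fK gK fc gc.
by have /loc_homeo_embedding[] := open_embedding_homeo fK gK fc gc.
Qed.

Lemma loc_homeo_inv X Y (f : X -> Y) (g : Y -> X) (D : set X) x :
  open D -> D x -> (forall y, D y -> g (f y) = y) ->
  (forall y, D y -> loc_homeo f y) -> loc_homeo g (f x).
Proof.
move=> oD Dx gK fl; have gx := gK _ Dx; split.
  move=> N; rewrite gx => Nx.
  have nD : nbhs x D by exact: open_nbhs_nbhs.
  apply: nbhsS ((fl x Dx).2 _ (filterI Nx nD)) => _ [y [Ny Dy] <-] /=.
  by rewrite gK.
have fDn : nbhs (f x) (f @` D).
  by apply: (fl x Dx).2; exact: open_nbhs_nbhs.
move=> N Nfx; rewrite gx.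
have nD : nbhs x D by exact: open_nbhs_nbhs.
have fN : nbhs x (f @^-1` N) by exact: (fl x Dx).1.
apply: nbhsS (filterI nD fN) => y [Dy Ny]; exists (f y) => //.
exact: gK.
Qed.

End LocalHomeomorphisms.

(** * Inverses of partial parametrizations *)

Section PartialInverse.
Variables (R : realType) (T : topologicalType).
Local Notation E := 'rV[R]_3.
Variables (e : E -> T) (D : set E).

(** The default value 0 off the image matters: for a collar it collapses the set at the end
    [v --> 0] to the origin. *)
Definition pinv (x : T) : E := xget 0 [set v | D v /\ e v = x].

Hypothesis ei : forall v w, D v -> D w -> e v = e w -> v = w.

Lemma pinvK v : D v -> pinv (e v) = v.
Proof.
move=> Dv; rewrite /pinv; case: xgetP => [w _ [Dw ewv]|/(_ v)/=[]//].
exact: ei.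
Qed.

Lemma pinv_im x : (e @` D) x -> D (pinv x) /\ e (pinv x) = x.
Proof. by move=> [v Dv <-]; rewrite pinvK. Qed.

Lemma pinv_out x : ~ (e @` D) x -> pinv x = 0.
Proof.
move=> xe; rewrite /pinv; case: xgetP => // w _ [Dw ewx].
by case: xe; exists w.
Qed.

Lemma pinv_loc_homeo : open D -> (forall v, D v -> loc_homeo e v) ->
  forall v, D v -> loc_homeo pinv (e v).
Proof. by move=> oD el v Dv; apply: loc_homeo_inv el => // w; exact: pinvK. Qed.

Lemma im_open : (forall v, D v -> loc_homeo e v) -> open D ->
  open (e @` D).
Proof.
move=> el oD; rewrite openE => _ [v Dv <-]; apply: (el v Dv).2.
exact: open_nbhs_nbhs.
Qed.

(** A homeomorphism of the parameter space supported in a compact subset of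
    the domain [D] of a parametrization transports to the whole space. *)
Lemma push_homeo (K : set E) (l l' : E -> E) :
  hausdorff_space T -> open D -> (forall v, D v -> loc_homeo e v) ->
  compact K -> K `<=` D ->
  cancel l l' -> cancel l' l -> continuous l -> continuous l' ->
  (forall v, ~ K v -> l v = v) ->
  exists r r' : T -> T,
    [/\ [/\ cancel r r', cancel r' r, continuous r & continuous r'],
        forall v, D v -> r (e v) = e (l v),
        forall v, D v -> r' (e v) = e (l' v),
        forall x, ~ (e @` K) x -> r x = x &
        forall x, ~ (e @` K) x -> r' x = x].
Proof.
move=> hT oD el cK KD lK lK' lc lc' lid.
have lid' v : ~ K v -> l' v = v by move=> Kv; rewrite -{1}(lid v Kv) lK.
(* The hypotheses are symmetric in [l] and [l'], so it is enough to transport one of them. *)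
suff gen (m m' : E -> E) : cancel m m' -> cancel m' m -> continuous m ->
    (forall v, ~ K v -> m v = v) -> (forall v, ~ K v -> m' v = v) ->
    exists r : T -> T, [/\ continuous r, forall v, D v -> r (e v) = e (m v),
      forall x, ~ (e @` K) x -> r x = x &
      forall v, D v -> D (m v)].
  have [r [rc re rid Dl]] := gen l l' lK lK' lc lid lid'.
  have [r' [rc' re' rid' Dl']] := gen l' l lK' lK lc' lid' lid.
  have KDe x : (e @` K) x -> exists2 v, D v & e v = x.
    by move=> [v Kv <-]; exists v => //; exact: KD.
  exists r, r'; split=> //; split=> // x.
    have [/KDe[v Dv <-]|xK] := pselect ((e @` K) x).
      by rewrite re // re' ?lK //; exact: Dl.
    by rewrite !(rid, rid').
  have [/KDe[v Dv <-]|xK] := pselect ((e @` K) x).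
    by rewrite re' // re ?lK' //; exact: Dl'.
  by rewrite !(rid, rid').
move=> mK mK' mc mid mid'.
(* [m] preserves [K], because [m'] fixes every point outside [K]. *)
have Dm v : D v -> D (m v).
  have [Kv _|Kv] := pselect (K v); last by rewrite mid.
  apply: KD; apply: contrapT => Kmv; apply: (Kmv).
  by have := mid' _ Kmv; rewrite mK => <-.
pose r x := if `[< (e @` D) x >] then e (m (pinv x)) else x.
have re v : D v -> r (e v) = e (m v).
  move=> Dv; rewrite /r; case: asboolP => [_|[]]; first by rewrite pinvK.
  by exists v.
have rid x : ~ (e @` K) x -> r x = x.
  rewrite /r; case: asboolP => // -[v Dv <-] Kv; rewrite pinvK // mid //.
exists r; split=> // x.
have [[v Dv <-]|xD] := pselect ((e @` D) x).
  apply: (@continuous_near _ _ (e \o (m \o pinv))).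
    have : nbhs (e v) (e @` D).
      by apply: open_nbhs_nbhs; split; [exact: im_open|exists v].
    apply: nbhsS => _ [w Dw <-] /=; by rewrite re // pinvK.
  have [pc _] := pinv_loc_homeo oD el Dv.
  apply: continuous_comp; last by rewrite /= pinvK //; exact: (el _ (Dm _ Dv)).1.
  by apply: continuous_comp; [exact: pc|exact: mc].
(* Off the image of [D] the map is the identity nearby, since the image of [K] is compact and hence
   closed. *)
apply: (@continuous_near _ _ id); last exact: cvg_id.
have cl : closed (e @` K).
  apply: compact_closed => //; apply: continuous_compact => //.
  apply: continuous_in_subspaceT => v /set_mem Kv.
  exact: (el _ (KD _ Kv)).1.
have : nbhs x (~` (e @` K)).
  apply: open_nbhs_nbhs; split; first exact: closed_openC.
  by move=> [v Kv vx]; apply: xD; exists v => //; exact: KD.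
by apply: nbhsS => y yK; rewrite rid.
Qed.

End PartialInverse.

(** * Brown's theorem *)

Section Brown.
Variables (R : realType) (T : topologicalType).
Local Notation E := 'rV[R]_3.
Variables (e : E -> T) (A : set T).

Definition punctured_space : set E := [set v | v != 0].
Local Notation D := punctured_space.

(** [e] parametrizes a collar of [A] whose end [v --> 0] abuts on [A]; a core is [A] with the collar
    up to radius [r]. *)
Definition core r : set T := A `|` e @` [set v | v != 0 /\ `|v| <= r].
Definition open_core r : set T := A `|` e @` [set v | v != 0 /\ `|v| < r].
Definition cored : set T := A `|` e @` D.

Lemma punctured_open : open D.
Proof.
have -> : D = ~` [set 0].
  by apply/seteqP; split=> [v /eqP|v v0]; [|apply/eqP].
by apply: closed_openC; apply: accessible_closed_set1;
  apply: hausdorff_accessible; exact: norm_hausdorff.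
Qed.

(** The 3-sphere enters as a compact Hausdorff space in which the complement of every point is a
    cell. The last two clauses say that the collar closes up on [A]. *)
Definition brown_data : Prop :=
  [/\ compact [set: T], hausdorff_space T,
      forall p : T, exists s : E -> T,
        open_embedding s /\ range s = ~` [set p] & A !=set0]
  /\ [/\ forall v w, D v -> D w -> e v = e w -> v = w,
      forall v, D v -> loc_homeo e v,
      forall v, D v -> ~ A (e v),
      forall r, 0 < r -> open (open_core r) &
      forall r, 0 < r -> closed (core r)].

Hypothesis bd : brown_data.

Let cT : compact [set: T]. Proof. by case: bd => -[]. Qed.
Let hT : hausdorff_space T. Proof. by case: bd => -[]. Qed.
Let charts (p : T) : exists s : E -> T,
  open_embedding s /\ range s = ~` [set p].
Proof. by case: bd => -[]. Qed.
Let A0 : A !=set0. Proof. by case: bd => -[]. Qed.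
Let ei v w : D v -> D w -> e v = e w -> v = w.
Proof. by case: bd => _ []; auto. Qed.
Let el v : D v -> loc_homeo e v.
Proof. by case: bd => _ []; auto. Qed.
Let eA v : D v -> ~ A (e v).
Proof. by case: bd => _ []; auto. Qed.
Let oc r : 0 < r -> open (open_core r).
Proof. by case: bd => _ []; auto. Qed.
Let cc r : 0 < r -> closed (core r).
Proof. by case: bd => _ []; auto. Qed.

Local Notation f := (pinv e D).

Let fe v : D v -> f (e v) = v. Proof. exact: pinvK. Qed.

Let fA x : A x -> f x = 0.
Proof. by move=> Ax; apply: pinv_out => -[v Dv vx]; apply: (eA Dv); rewrite vx. Qed.

Let core_le r s : r <= s -> core r `<=` core s.
Proof.
move=> rs x [Ax|[v [v0 vr] <-]]; first by left.
by right; exists v => //; split=> //; exact: le_trans rs.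
Qed.

Let open_core_core r : open_core r `<=` core r.
Proof.
move=> x [Ax|[v [v0 vr] <-]]; first by left.
by right; exists v => //; split=> //; exact: ltW.
Qed.

Let core_open_core r s : r < s -> core r `<=` open_core s.
Proof.
move=> rs x [Ax|[v [v0 vr] <-]]; first by left.
by right; exists v => //; split=> //; exact: le_lt_trans rs.
Qed.

Let core_cored r : core r `<=` cored.
Proof. by move=> x [Ax|[v [v0 _] <-]]; [left|right; exists v]. Qed.

Let core_e r v : D v -> core r (e v) -> `|v| <= r.
Proof. by move=> Dv [/(eA Dv)//|[w [w0 wr] /(ei w0 Dv) <-]]. Qed.

(** The complement of [U] is compact, each of its points has a neighbourhood missed by some core,
    and cores shrink with [r]. *)
Lemma core_small (U : set T) : open U -> A `<=` U ->
  exists2 r, 0 < r & core r `<=` U.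
Proof.
move=> oU AU.
have cU : compact (~` U) by apply: (subclosed_compact _ cT) => //; exact: open_closedC.
have /compact_near_coveringP/(_ _ (0^'+) (fun r x => ~ core r x)) := cU.
move=> /(_ _) nU; have [|r0 /= r0p r0U] := nU.
  move=> x Ux.
  have [r [rp xr]] : exists r, 0 < r /\ ~ core r x.
    have [[v Dv vx]|xD] := pselect ((e @` D) x); last first.
      exists 1; split=> // -[/AU//|[v [v0 _] vx]]; by apply: xD; exists v.
    exists (`|v| / 2); split; first by rewrite divr_gt0 ?normr_gt0.
    rewrite -vx => /(core_e Dv); rewrite leNgt => /negP; apply.
    by rewrite ltr_pdivrMr // mulr_natr mulr2n ltrDl normr_gt0.
  exists (~` core r, [set s | s <= r]) => /=.
    split; first by apply: open_nbhs_nbhs; split=> //; apply: closed_openC; exact: cc.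
    by apply: nbhs_right_le.
  by move=> [y s] /= [yr sr] /(core_le sr).
exists (r0 / 2); first by rewrite divr_gt0.
move=> x xr; apply: contrapT => Ux; apply: (r0U (r0 / 2)) xr => //=.
  by rewrite sub0r normrN gtr0_norm ?divr_gt0 // ltr_pdivrMr // mulr_natr mulr2n ltrDl.
by rewrite divr_gt0.
Qed.

Lemma core_big (K : set T) : compact K -> K `<=` cored ->
  exists m0, forall m, m0 < m -> K `<=` open_core m.
Proof.
move=> /compact_near_coveringP/(_ _ (+oo : set_system R) (fun m x => open_core m x)) nK KO.
have [|m0 [m0r m0K]] := nK _; last by exists m0 => m /m0K.
move=> x Kx.
have [r [rp xr]] : exists r, 0 < r /\ open_core r x.
  have [Ax|[v Dv <-]] := KO _ Kx; first by exists 1; split=> //; left.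
  exists (`|v| + 1); split; first by rewrite ltr_wpDl.
  by right; exists v => //; split=> //; rewrite ltrDl.
exists (open_core r, [set s | r <= s]) => /=.
  split; first by apply: open_nbhs_nbhs; split => //; exact: oc.
  by exists r; split; [exact: num_real|move=> s /ltW].
move=> [y s] /= [[Ay|[v [v0 vr] <-]] rs]; first by left.
by right; exists v => //; split=> //; exact: lt_le_trans rs.
Qed.

Lemma cored_open : open cored.
Proof.
have -> : cored = \bigcup_(r in [set r : R | 0 < r]) open_core r.
  apply/seteqP; split=> [x [Ax|[v Dv <-]]|x [r _ /open_core_core/core_cored//]].
    by exists 1; [exact: ltr01|left].
  exists (`|v| + 1); first by rewrite /= ltr_wpDl.
  by right; exists v => //; split=> //; rewrite ltrDl.
by apply: bigcup_open => r; exact: oc.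
Qed.

Lemma A_closed : closed A.
Proof.
have -> : A = ~` ((e @` D) `|` ~` core 1).
  apply/seteqP; split=> [x Ax [[v Dv vx]|]|x]; first by apply: (eA Dv); rewrite vx.
    by apply; left.
  move=> xN; apply: contrapT => Ax; apply: xN.
  have [[//|[v [v0 _] vx]]|] := pselect (core 1 x); last by right.
  by left; exists v.
apply: open_closedC; apply: openU; last by apply: closed_openC; exact: cc.
apply: (im_open el); exact: punctured_open.
Qed.

(** Collapsing [A] to the origin is continuous because the open cores are neighbourhoods of [A] on
    which [f] has norm below [r]. *)
Lemma pinv_cored_continuous x : cored x -> {for x, continuous f}.
Proof.
move=> [Ax|[v Dv <-]]; last by have [] := pinv_loc_homeo ei punctured_open el Dv.
rewrite /prop_for /continuous_at (fA Ax); apply/cvgrPdist_lt => r r0.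
have : nbhs x (open_core r) by apply: open_nbhs_nbhs; split; [exact: oc|left].
apply: nbhsS => y [Ay|[v [Dv vr] <-]]; first by rewrite (fA Ay) subr0 normr0.
by rewrite fe // sub0r normrN.
Qed.

(** The new cell is [c' r c t]: [c] squeezes the image of the ball of radius [i] into a thin core,
    [r] expands a core along the collar past [core k], and [c'] undoes the squeeze. The squeezed
    ball lies where [r] is the identity, so [t] is unchanged on it. *)
Lemma engulf_step (t : E -> T) (i k : R) :
  open_embedding t -> range t `<=` cored -> 1 <= i ->
  A `<=` t @` [set v | `|v| < i + 1] -> A (t 0) ->
  exists t' : E -> T,
    [/\ open_embedding t', range t' `<=` cored,
        forall v, `|v| <= i -> t' v = t v &
        core k `<=` t' @` [set v | `|v| < i + 1]].
Proof.
move=> ot tO i1 At At0; have [ti tc to_] := ot.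
have tl v : loc_homeo t v by have [_] := (loc_homeo_embedding t).1 ot.
(* The core to be expanded; it already lies in the cell. *)
have [d0 d0p d0t] : exists2 r, 0 < r & core r `<=` t @` [set v | `|v| < i + 1].
  by apply: core_small => //; apply: to_; exact: open_ball0_open.
(* As [t 0] is in [A], a small ball about 0 goes into the core of half size, which [r] will fix. *)
have [n np nt] : exists2 n, 0 < n & forall v, `|v| <= n -> open_core (d0 / 2) (t v).
  have : nbhs (0 : E) (t @^-1` open_core (d0 / 2)).
    apply: tc; apply: open_nbhs_nbhs; split; last by left.
    by apply: oc; rewrite divr_gt0.
  move=> /nbhs_norm0P[/= r r0 rt]; exists (r / 2); first by rewrite divr_gt0.
  move=> v vr; apply: rt => /=; apply: le_lt_trans vr _.
  by rewrite ltr_pdivrMr // mulr_natr mulr2n ltrDl.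
pose n1 := Num.min n (1 / 2).
have n1p : 0 < n1 by rewrite lt_min np divr_gt0.
have n1i : n1 < i by rewrite gt_min; apply/orP; right; lra.
have n12 : n1 / 2 < n1 by lra.
have [|||||g [g' [gK gK' gc gc' [_ gid gle _ _]]]] :=
  @radial_homeo R E 0 (n1 / 2) i n1 (i + 1); [lra|lra|lra|lra|lra|].
have gid' v : ~ (`|v| <= i + 1) -> g v = v.
  by move=> /negP; rewrite -ltNge => /ltW vi; apply: gid; rewrite subr0.
have [c [c' [[cK cK' cc_ cc'] ct ct' cid cid']]] := @push_homeo R T t setT
  (fun v w _ _ => @ti v w) [set v | `|v| <= i + 1] g g' hT openT
  (fun v _ => tl v) (@ball0_compact R _) (fun _ _ => I) gK gK' gc gc' gid'.
have [m1 m1t] : exists m0, forall m, m0 < m ->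
    t @` [set v | `|v| <= i + 1] `<=` open_core m.
  apply: core_big.
    apply: continuous_compact; last exact: ball0_compact.
    exact: continuous_subspaceT.
  by move=> _ [v _ <-]; apply: tO; exists v.
(* Large enough for the open core of radius [m] to contain [core k] and the ball that [c] moves,
   hence [c] of [core k]. *)
pose m := 1 + Num.max m1 (Num.max k d0).
have mm1 : m1 < m by rewrite /m ltr_pwDl // le_max lexx.
have mk : k < m by rewrite /m ltr_pwDl // !le_max lexx orbT.
have md : d0 < m by rewrite /m ltr_pwDl // !le_max lexx !orbT.
have [|||||l [l' [lK lK' lc lc' [lo lid lle _ _]]]] :=
  @radial_homeo R E 0 (d0 / 2) d0 m (m + 1); [lra|lra|lra|lra|lra|].
pose K := [set v : E | `|v| <= m + 1] `&` ~` [set v | `|v| < d0 / 2].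
have cK0 : compact K.
  apply: (subclosed_compact _ (@ball0_compact R (m + 1))) => [|v []//].
  apply: closedI; last by apply: open_closedC; exact: open_ball0_open.
  by apply: compact_closed; [exact: norm_hausdorff|exact: ball0_compact].
have KD : K `<=` D.
  move=> v [_ /negP]; rewrite -leNgt => vd; rewrite /punctured_space /= -normr_gt0.
  by apply: lt_le_trans vd; rewrite divr_gt0.
have lid' v : ~ K v -> l v = v.
  move=> /not_andP[/negP|/contrapT vd]; last by apply: lo; rewrite subr0 ltW.
  by rewrite -ltNge => /ltW vi; apply: lid; rewrite subr0.
have [r [r' [[rK rK' rc rc'] re re' rid rid']]] := @push_homeo R T e D
  (fun v w => @ei v w) K l l' hT punctured_open (fun v => @el v) cK0 KD lK lK' lc lc' lid'.
have cO x : cored x -> cored (c x).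
  have [[v _ <-] _|xt] := pselect (range t x); first by rewrite ct //; apply: tO; exists (g v).
  by rewrite cid // => -[v _ vx]; apply: xt; exists v.
have cO' x : cored x -> cored (c' x).
  have [[v _ <-] _|xt] := pselect (range t x); first by rewrite ct' //; apply: tO; exists (g' v).
  by rewrite cid' // => -[v _ vx]; apply: xt; exists v.
have l0 : l 0 = 0 by rewrite lo // subrr normr0 divr_ge0 // ltW.
have lD v : D v -> D (l v).
  by move=> /eqP v0; apply/eqP => lv; apply: v0; rewrite -(lK v) lv -[0 in LHS]l0 lK.
have rO x : cored x -> cored (r x).
  move=> [Ax|[v Dv <-]]; last by right; exists (l v); [exact: lD|rewrite re].
  rewrite rid; first by left.
  by move=> [v Kv vx]; apply: (eA (KD _ Kv)); rewrite vx.
exists (c' \o r \o c \o t); split.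
- apply: open_embedding_comp => //; apply: open_embedding_comp.
    exact: open_embedding_homeo cK cK' cc_ cc'.
  apply: open_embedding_comp; first exact: open_embedding_homeo rK rK' rc rc'.
  exact: open_embedding_homeo cK' cK cc' cc_.
- by move=> _ [v _ <-]; apply: cO'; apply: rO; apply: cO; apply: tO; exists v.
- move=> v vi /=; suff -> : r (c (t v)) = c (t v) by rewrite cK.
  apply: rid; rewrite ct // => -[w wK wv]; have Dw := KD _ wK.
  have : open_core (d0 / 2) (t (g v)).
    apply: nt; have := gle v; rewrite !subr0 vi => gv.
    by apply: le_trans gv _; rewrite ge_min lexx.
  rewrite -wv => -[/(eA Dw)//|[u [u0 ud] /(ei u0 Dw) uw]].
  by case: wK => _; apply; rewrite /= -uw.
move=> y ky.
have my : open_core m (c y).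
  have [[v vi vy]|yt] := pselect ((t @` [set v | `|v| <= i + 1]) y); last first.
    by rewrite cid //; exact: core_open_core ky.
  rewrite -vy ct //; apply: (m1t _ mm1); exists (g v) => //=.
  rewrite leNgt; apply/negP => /[dup] gv /ltW; have := gid (g v); rewrite subr0 => h /h.
  by move=> /(can_inj gK) gvv; move: gv; rewrite gvv ltNge vi.
have : core d0 (r' (c y)).
  case: my => [Ac|[v [v0 vm] <-]].
    rewrite rid'; first by left.
    by move=> [v Kv vx]; apply: (eA (KD _ Kv)); rewrite vx.
  rewrite re' //; right; exists (l' v) => //; split.
    by apply: contra_neq v0 => lv; rewrite -(lK' v) lv l0.
  by have := lle (l' v); rewrite lK' !subr0 (ltW vm) => <-.
move=> /d0t[u ui ut]; exists (g' u) => /=; last first.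
  by rewrite ct // gK' ut rK' cK.
rewrite ltNge; apply/negP => iu; have := gid (g' u); rewrite subr0 gK' => /(_ iu) uu.
by move: ui; rewrite /= uu ltNge iu.
Qed.

(** Exhausting [cored] by the cells of [engulf_step]; the embeddings are
    eventually constant on every ball. *)
Lemma engulf_limit (t0 : E -> T) :
  open_embedding t0 -> range t0 `<=` cored ->
  A `<=` t0 @` [set v | `|v| < 2] -> A (t0 0) ->
  exists t : E -> T, open_embedding t /\ range t = cored.
Proof.
move=> ot0 tO0 At0 A00.
pose P (n : nat) (t : E -> T) := [/\ open_embedding t, range t `<=` cored,
  A `<=` t @` [set v | `|v| < n.+1%:R + 1] & A (t 0)].
have next n t : exists t', P n t -> P n.+1 t' /\
    (forall v, `|v| <= n.+1%:R -> t' v = t v) /\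
    core n.+1%:R `<=` t' @` [set v | `|v| < n.+1%:R + 1].
  have [[ot tO At t0A]|nP] := pselect (P n t); last by exists t.
  have n1 : (1 : R) <= n.+1%:R by rewrite ler1n.
  have [t' [ot' tO' tt' ct']] := engulf_step n.+1%:R ot tO n1 At t0A.
  exists t' => _; split; [split|split] => //.
    move=> x Ax; have [|v vn <-] := ct' x; first by left.
    by exists v => //=; apply: lt_trans vn _; rewrite ltrD2r ltr_nat.
  by rewrite tt' // normr0.
have /choice[F FP] : forall nt : nat * (E -> T), exists t', P nt.1 nt.2 ->
    P nt.1.+1 t' /\ (forall v, `|v| <= nt.1.+1%:R -> t' v = nt.2 v) /\
    core nt.1.+1%:R `<=` t' @` [set v | `|v| < nt.1.+1%:R + 1].
  by move=> [n t]; exact: next.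
pose t := fix t n := if n is n'.+1 then F (n', t n') else t0.
have Pt n : P n (t n).
  elim: n => [|n IH] /=; first by split=> //; rewrite -[X in _ + X]/1 -natr1.
  by have [] := FP (n, t n) IH.
have tS n v : `|v| <= n.+1%:R -> t n.+1 v = t n v.
  by have [_ [h _]] := FP (n, t n) (Pt n); exact: h.
have tc n : core n.+1%:R `<=` t n.+1 @` [set v | `|v| < n.+1%:R + 1].
  by have [_ [_ h]] := FP (n, t n) (Pt n).
have tD m n v : `|v| <= n.+1%:R -> t (m + n)%N v = t n v.
  move=> vn; elim: m => // m IH; rewrite addSn tS // (le_trans vn) // ler_nat.
  by rewrite ltnS leq_addl.
have tE m n v : `|v| <= n.+1%:R -> (n <= m)%N -> t m v = t n v.
  by move=> vn nm; rewrite -(subnK nm) tD.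
(* From index [n] on, all embeddings agree on the ball of radius [n + 1]; the limit is read off at
   the integer part of the norm. *)
pose b (v : E) := Num.truncn `|v|.
have bP v : `|v| < (b v).+1%:R by exact: truncnS_gt.
pose th v := t (b v) v.
have thE n v : `|v| <= n.+1%:R -> th v = t n v.
  move=> vn; rewrite /th; have [nb|/ltnW bn] := leqP n (b v); first exact: tE.
  by apply/esym; apply: tE => //; exact: ltW.
exists th; split.
  apply/loc_homeo_embedding; split=> [v w|v].
    pose n := maxn (b v) (b w).
    have vn : `|v| <= n.+1%:R.
      by rewrite (le_trans (ltW (bP v))) // ler_nat ltnS leq_maxl.
    have wn : `|w| <= n.+1%:R.
      by rewrite (le_trans (ltW (bP w))) // ler_nat ltnS leq_maxr.
    by rewrite (thE n) // (thE n w) //; have [[ti _ _] _ _ _] := Pt n; exact: ti.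
  have [/loc_homeo_embedding[_ tl] _ _ _] := Pt (b v).
  apply: (loc_homeo_near _ (tl v)).
  have : nbhs v [set w : E | `|w| < (b v).+1%:R].
    by apply: open_nbhs_nbhs; split; [exact: open_ball0_open|exact: bP].
  by apply: nbhsS => w /ltW wb; rewrite (thE (b v)).
apply/seteqP; split=> [_ [v _ <-]|x xO].
  by have [_ tO _ _] := Pt (b v); apply: tO; exists v.
have [m xm] : exists m : nat, core m.+1%:R x.
  case: xO => [Ax|[v v0 <-]]; first by exists 0; left.
  by exists (b v); right; exists v => //; split=> //; exact: ltW.
have [v vm <-] := tc m x xm.
by exists v => //; rewrite (thE m.+1) // (le_trans (ltW vm)) // natr1.
Qed.

Lemma squash_embedding r : 0 < r ->
  exists q : E -> E, open_embedding q /\ range q = [set v | `|v| < r].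
Proof.
move=> r0; pose q (v : E) := (r / (1 + `|v|)) *: v.
pose q' (w : E) := (r - `|w|)^-1 *: w.
have d0 (v : E) : 0 < 1 + `|v| by rewrite ltr_pwDl.
have nq v : `|q v| = r * `|v| / (1 + `|v|).
  by rewrite normrZ ger0_norm ?divr_ge0 ?ltW // mulrAC.
have qr v : `|q v| < r.
  by rewrite nq ltr_pdivrMr // mulrDr mulr1 ltrDr.
have qK : cancel q q'.
  move=> v; rewrite /q' nq scalerA.
  have -> : r - r * `|v| / (1 + `|v|) = r / (1 + `|v|).
    by field; rewrite gt_eqF.
  by rewrite mulVf ?scale1r // gt_eqF // divr_gt0.
have qK' w : `|w| < r -> q (q' w) = w.
  move=> wr; have rw : 0 < r - `|w| by rewrite subr_gt0.
  rewrite /q normrZ ger0_norm ?invr_ge0 ?ltW // scalerA.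
  have -> : 1 + (r - `|w|)^-1 * `|w| = r / (r - `|w|).
    by field; rewrite gt_eqF.
  have -> : r / (r / (r - `|w|)) / (r - `|w|) = 1 by field; rewrite !gt_eqF.
  by rewrite scale1r.
have qc : continuous q by exact: squash_continuous.
exists q; split; last first.
  apply/seteqP; split=> [_ [v _ <-]|w wr]; first exact: qr.
  by exists (q' w) => //; exact: qK'.
apply/open_embeddingP; split=> //; first exact: can_inj qK.
move=> v N Nv.
have qc' : {for q v, continuous q'} by apply: unsquash_continuous; exact: qr.
have := qc' N; rewrite qK => /(_ Nv) Nq.
have rn : nbhs (q v) [set w : E | `|w| < r].
  by apply: open_nbhs_nbhs; split; [exact: open_ball0_open|exact: qr].
have Nq' : nbhs (q v) (q' @^-1` N) by [].
apply: nbhsS (filterI Nq' rn) => w [Nw wr]; exists (q' w) => //.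
exact: qK'.
Qed.

Lemma compact_norm_bound (K : set T) (g : T -> E) :
  compact K -> (forall x, K x -> {for x, continuous g}) ->
  exists r, forall x, K x -> `|g x| < r.
Proof.
move=> cK gc; have cg : compact (g @` K).
  apply: continuous_compact cK; apply: continuous_in_subspaceT => x /set_mem.
  exact: gc.
have [M [_ MP]] := compact_bounded cg.
exists (M + 2) => x Kx; apply: (@le_lt_trans _ _ (M + 1)).
  by apply: (MP (M + 1)); [rewrite ltrDl|exists x].
by rewrite ltrD2l ltr1n.
Qed.

(** Brown's two-step trick: [F] collapses [A] to a point and is injective
    elsewhere, with image missing a neighbourhood of [A]; conjugating by [F] a
    contraction that fixes a neighbourhood of that point moves a cell
    containing [A] into [cored] without moving [A]. *)
Lemma cell_around : exists t : E -> T,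
  [/\ open_embedding t, range t `<=` cored & A `<=` range t].
Proof.
pose v0 : E := const_mx 1.
have v00 : v0 != 0.
  by apply/eqP => /matrixP/(_ 0 0); rewrite !mxE => /eqP; rewrite oner_eq0.
have nv : 0 < `|v0| by rewrite normr_gt0.
have Dv0 : D v0 by [].
(* A radial expansion about [2 v0]: it carries [v0], at distance the norm of [v0], to the origin, at
   twice that distance. *)
have [|||||h [h' [hK hK' hc hc' [_ hid _ _ hb]]]] :=
  @radial_homeo R E (v0 *+ 2) (`|v0| / 2) `|v0| (`|v0| * 2) (`|v0| * 3);
  [lra|lra|lra|lra|lra|].
have hv0 : h v0 = 0.
  have e1 : v0 - v0 *+ 2 = - v0 by rewrite mulr2n opprD addrA subrr sub0r.
  rewrite hb ?e1 ?normrN // mulrAC divff ?gt_eqF // mul1r scalerN scaler_nat.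
  by rewrite subrr.
have h00 : h 0 != 0 by apply: contra_neq v00 => h0; apply: (can_inj hK); rewrite hv0.
have hD v : v != v0 -> D (h v).
  by move=> vv; apply: contra_neq vv => hv; apply: (can_inj hK); rewrite hv0.
have hl v : loc_homeo h v by exact: loc_homeo_can hK hK' hc hc' v.
have hl' v : loc_homeo h' v by exact: loc_homeo_can hK' hK hc' hc v.
have hfar v : `|v0| * 5 < `|v| -> h v = v.
  move=> vf; apply: hid; apply: (le_trans _ (lerB_dist _ _)).
  by rewrite normrMn -mulr_natr lerBrDr; lra.
pose p := e v0.
have pO : cored p by right; exists v0.
(* On the collar this is [h], and on [A] it is constant, since [f] sends [A] to the origin. Off [p]
   it avoids [A], because [h] vanishes only at [v0]. *)
pose F x := if `[< cored x >] then e (h (f x)) else x.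
have FO x : cored x -> F x = e (h (f x)) by rewrite /F => xO; case: asboolP.
have FB x : ~ cored x -> F x = x by rewrite /F => xO; case: asboolP.
have FA x : A x -> F x = e (h 0) by move=> Ax; rewrite FO ?fA //; left.
have Fe v : D v -> F (e v) = e (h v) by move=> Dv; rewrite FO ?fe //; right; exists v.
have fp x : cored x -> x != p -> f x != v0.
  move=> [Ax _|[v Dv <-]]; first by rewrite fA // eq_sym.
  by rewrite fe //; apply: contra_neq => ->.
have Bfar x : ~ cored x -> \forall y \near x, F y = y.
  move=> xO; have : nbhs x (~` core (`|v0| * 5)).
    apply: open_nbhs_nbhs; split; last by move=> /core_cored.
    by apply: closed_openC; apply: cc; rewrite mulr_gt0.
  apply: nbhsS => y yc; have [yO|] := pselect (cored y); last exact: FB.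
  have [Ay|[v Dv vy]] := yO; first by case: yc; left.
  rewrite -vy Fe // hfar // ltNge; apply/negP => vl.
  by apply: yc; right; exists v.
have FnA x : x != p -> ~ A (F x).
  move=> xp; have [xO|xO] := pselect (cored x); last by rewrite FB // => Ax; apply: xO; left.
  by rewrite FO //; apply: eA; apply: hD; exact: fp.
have Fc x : x != p -> {for x, continuous F}.
  move=> xp; have [xO|xO] := pselect (cored x); last first.
    apply: (@continuous_near _ _ id); last exact: cvg_id.
    by apply: nbhsS (Bfar _ xO) => y.
  apply: (@continuous_near _ _ (e \o (h \o f))).
    have : nbhs x cored by apply: open_nbhs_nbhs; split=> //; exact: cored_open.
    by apply: nbhsS => y yO; rewrite FO.
  apply: continuous_comp; last exact: (el (hD _ (fp _ xO xp))).1.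
  by apply: continuous_comp; [exact: pinv_cored_continuous|exact: hc].
have Fl x : x != p -> ~ A x -> loc_homeo F x.
  move=> xp nA; have [[//|[v Dv vx]]|xO] := pselect (cored x); last first.
    apply: (@loc_homeo_near _ _ id); last exact: loc_homeo_id.
    by apply: nbhsS (Bfar _ xO) => y.
  have vv0 : v != v0 by apply: contra_neq xp => vv; rewrite -vx vv.
  apply: (@loc_homeo_near _ _ (e \o (h \o f))).
    have : nbhs x cored by apply: open_nbhs_nbhs; split; [exact: cored_open|right; exists v].
    by apply: nbhsS => y yO; rewrite FO.
  rewrite -vx; apply: loc_homeo_comp.
    by apply: loc_homeo_comp; [apply: pinv_loc_homeo => //; exact: punctured_open|exact: hl].
  by rewrite /= fe //; apply: el; exact: hD.
have Fi x y : x != p -> y != p -> ~ A x -> ~ A y -> F x = F y -> x = y.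
  move=> xp yp nAx nAy.
  have [[//|[v Dv vx]]|xO] := pselect (cored x);
  have [[//|[w Dw wy]]|yO] := pselect (cored y).
  - rewrite -vx -wy !Fe // => /ei.
    rewrite -vx in xp; rewrite -wy in yp.
    have vv0 : v != v0 by apply: contra_neq xp => ->.
    have wv0 : w != v0 by apply: contra_neq yp => ->.
    by move=> /(_ (hD _ vv0) (hD _ wv0)) /(can_inj hK) ->.
  - rewrite -vx Fe // (FB y yO) => hy; case: yO; right; exists (h v) => //.
    by apply: hD; apply: contra_neq xp => vv; rewrite -vx vv.
  - rewrite -wy Fe // (FB x xO) => hy; case: xO; right; exists (h w) => //.
    by apply: hD; apply: contra_neq yp => vv; rewrite -wy vv.
  - by rewrite !FB.
(* Since [F] avoids [A] off [p], its values lie in the cell [s] that omits a point of [A]; there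
   they can be contracted. *)
have [a0 Aa0] := A0.
have [s [os sr]] := charts a0.
have [si sl] := (loc_homeo_embedding s).1 os.
have [sg [osg sgr]] := charts p.
pose t := pinv s setT.
have tK : cancel s t by move=> v; rewrite /t pinvK // => v1 w1 _ _; exact: si.
have tK' x : x != a0 -> s (t x) = x.
  move=> /eqP xa; have : range s x by rewrite sr.
  by move=> [u _ <-]; rewrite tK.
have tl x : x != a0 -> loc_homeo t x.
  move=> xa; rewrite -(tK' _ xa); apply: (@pinv_loc_homeo _ _ s setT) => //.
  - by move=> v1 w1 _ _; exact: si.
  - exact: openT.
have Fa0 x : x != p -> F x != a0.
  by move=> xp; apply/eqP => Fx; apply: (FnA _ xp); rewrite Fx.
have [sgi sgl] := (loc_homeo_embedding sg).1 osg.
have sgp v : sg v != p by apply/eqP => vp; have : range sg p by [exists v]; rewrite sgr; apply.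
pose tg := pinv sg setT.
have Ap x : A x -> x != p.
  by move=> Ax; apply/eqP => xp; apply: (eA Dv0); rewrite -/p -xp.
have [r1 r1P] : exists r, forall x, A x -> `|tg x| < r.
  apply: compact_norm_bound; first exact: subclosed_compact A_closed cT _.
  move=> x /Ap/eqP xp; have : range sg x by rewrite sgr.
  move=> [v _ <-]; have [] // := @pinv_loc_homeo _ _ sg setT _ openT _ v I.
  by move=> v1 w1 _ _; exact: sgi.
have tgK x : x != p -> sg (tg x) = x.
  move=> /eqP xp; have xr : range sg x by rewrite sgr.
  by have [] := @pinv_im _ _ sg setT (fun v w _ _ => @sgi v w) x xr.
(* The cell [s'] contains [A] and stays in a bounded part of the chart that omits [p], so [t] after
   [F] is bounded on it. *)
pose r2 := Num.max r1 1.
have r20 : 0 < r2 by rewrite lt_max ltr01 orbT.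
have [q [oq qr]] := squash_embedding r20.
pose s' := sg \o q.
have os' : open_embedding s' by exact: open_embedding_comp.
have [s'i s'l] := (loc_homeo_embedding s').1 os'.
have s'p v : s' v != p by exact: sgp.
have As' x : A x -> range s' x.
  move=> Ax; have : range q (tg x).
    by rewrite qr /= lt_max r1P.
  by move=> [v _ vx]; exists v => //; rewrite /s' /= vx tgK // Ap.
pose u0 := t (e (h 0)).
have ea0 v : D v -> e v != a0 by move=> Dv; apply/eqP => va; apply: (eA Dv); rewrite va.
have su0 : s u0 = e (h 0) by rewrite /u0 tK' // ea0.
have [ep ep0 epP] : exists2 ep, 0 < ep &
    forall u, `|u - u0| <= ep -> (e @` D) (s u).
  have : nbhs u0 (s @^-1` (e @` D)).
    apply: (sl u0).1; rewrite su0; apply: open_nbhs_nbhs; split; last by exists (h 0).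
    by apply: im_open => //; exact: punctured_open.
  move=> /nbhs_normP[/= r r0 rP]; exists (r / 2); first by rewrite divr_gt0.
  move=> u ur; apply: rP => /=; rewrite distrC; apply: le_lt_trans ur _.
  by rewrite ltr_pdivrMr // mulr_natr mulr2n ltrDl.
have [r3 r3P] : exists r, forall x, (sg @` [set v | `|v| <= r2]) x -> `|t (F x) - u0| < r.
  apply: (@compact_norm_bound _ (fun x => t (F x) - u0)).
    apply: continuous_compact; last exact: ball0_compact.
    by apply: continuous_subspaceT => v; exact: (sgl v).1.
  move=> _ [v _ <-]; apply: continuous_subc.
  by apply: continuous_comp; [exact: Fc|exact: (tl _ (Fa0 _ (sgp v))).1].
have r3s' w : `|t (F (s' w)) - u0| < r3.
  apply: r3P; exists (q w) => //=; apply: ltW.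
  by have : range q (q w) by [exists w]; rewrite qr.
pose r4 := Num.max r3 ep + 1.
have r34 : r3 < r4 by rewrite /r4 ltr_pwDr // le_max lexx.
have ep4 : ep < r4 by rewrite /r4 ltr_pwDr // le_max lexx orbT.
(* The contraction: it takes all values of [t] after [F] on the cell into the [ep]-ball about [u0],
   whose image lies in the collar, and is the identity near [u0], the point that [A] is collapsed
   to. *)
have [|||||k [k' [kK kK' kc kc' [klo _ kle _ _]]]] :=
  @radial_homeo R E u0 (ep / 2) r4 ep (r4 + 1); [lra|lra|lra|lra|lra|].
have ku0 : k u0 = u0 by rewrite klo // subrr normr0 divr_ge0 // ltW.
have [de de0 deP] : exists2 de, 0 < de & forall v, `|v| < de -> `|t (e (h v)) - u0| <= ep / 2.
  have : {for 0 : E, continuous (fun v => t (e (h v)) - u0)}.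
    apply: continuous_subc.
    apply: (@continuous_comp _ _ _ (e \o h) t); last exact: (tl _ (ea0 _ h00)).1.
    by apply: continuous_comp; [exact: hc|exact: (el h00).1].
  move=> /cvgrPdist_lt/(_ (ep / 2)); rewrite divr_gt0 // => /(_ isT).
  move=> /nbhs_norm0P[/= r r0 rP]; exists r => // v vr; apply: ltW.
  by have := rP v vr; rewrite /= -/u0 subrr sub0r normrN.
pose d1 := Num.min de `|v0|.
have d10 : 0 < d1 by rewrite lt_min de0.
(* The contraction conjugated by [F]; close to [A], but off [A], it fixes every point. *)
pose G x := e (h' (f (s (k (t (F x)))))).
have Gcol w : (e @` D) (s (k (t (F (s' w))))).
  by apply: epP; rewrite kle ltW // (lt_trans (r3s' w)).
have GD w : ~ A (s' w) -> D (h' (f (s (k (t (F (s' w))))))).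
  move=> nA; have [Df ef] := pinv_im ei (Gcol w).
  apply/eqP => h0; have := congr1 h h0; rewrite hK' => fh; move: ef; rewrite fh -su0.
  move=> /si ku; have /(can_inj kK) tF : k (t (F (s' w))) = k u0 by rewrite ku0 -ku.
  have FF : F (s' w) = e (h 0) by rewrite -su0 -tF tK' // Fa0.
  have [[//|[v Dv vw]]|wO] := pselect (cored (s' w)).
    have vv0 : v != v0 by apply: contra_neq (s'p w) => vv; rewrite -vw vv.
    move: FF; rewrite -vw Fe // => /(ei (hD _ vv0) h00)/(can_inj hK) v00'.
    by move: Dv; rewrite v00' /punctured_space /= eqxx.
  by move: FF; rewrite FB // => FF; apply: wO; right; exists (h 0).
have Gl w : ~ A (s' w) -> loc_homeo G (s' w).
  move=> nA; have [Df ef] := pinv_im ei (Gcol w).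
  apply: (@loc_homeo_comp _ _ _ (f \o (s \o (k \o (t \o F)))) (e \o h')); last first.
    by apply: loc_homeo_comp; [exact: loc_homeo_can hK' hK hc' hc _|apply: el; exact: GD].
  apply: loc_homeo_comp; last first.
    rewrite /= -ef; apply: pinv_loc_homeo => //; exact: punctured_open.
  apply: loc_homeo_comp; last exact: sl.
  apply: loc_homeo_comp; last exact: loc_homeo_can kK kK' kc kc' _.
  by apply: loc_homeo_comp; [exact: Fl|apply: tl; exact: Fa0].
have Gi w w' : ~ A (s' w) -> ~ A (s' w') -> G (s' w) = G (s' w') -> w = w'.
  move=> nA nA' /(ei (GD _ nA) (GD _ nA')) /(can_inj hK').
  have [_ ef] := pinv_im ei (Gcol w); have [_ ef'] := pinv_im ei (Gcol w').
  move=> ff; have := congr1 e ff; rewrite ef ef' => /si/(can_inj kK) tt.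
  have := congr1 s tt; rewrite !tK' ?Fa0 // => /Fi FF.
  by apply: s'i; apply: FF.
have Gid w : ~ A (s' w) -> open_core d1 (s' w) -> G (s' w) = s' w.
  move=> nA [//|[v [v0' vd] vw]]; have Dv : D v by [].
  have vv0 : v != v0 by apply: contra_neq (s'p w) => vv; rewrite -vw vv.
  rewrite /G -vw Fe // klo; last by apply: deP; rewrite (lt_le_trans vd) // ge_min lexx.
  by rewrite tK' ?ea0 ?fe ?hK //; exact: hD.
(* The formula of [G] has no meaning on [A], which [F] collapses; there the cell is left as it
   is. *)
pose t1 w := if `[< A (s' w) >] then s' w else G (s' w).
have t1A w : A (s' w) -> t1 w = s' w by rewrite /t1 => Aw; case: asboolP.
have t1N w : ~ A (s' w) -> t1 w = G (s' w) by rewrite /t1 => Aw; case: asboolP.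
exists t1; split.
- apply/loc_homeo_embedding; split=> [w w'|w].
    have [Aw|Aw] := pselect (A (s' w)); have [Aw'|Aw'] := pselect (A (s' w')).
    + by rewrite !t1A //; exact: s'i.
    + by rewrite t1A // t1N // => ww; case: (eA (GD _ Aw')); rewrite -/(G _) -ww.
    + by rewrite t1N // t1A // => ww; case: (eA (GD _ Aw)); rewrite -/(G _) ww.
    + by rewrite !t1N //; exact: Gi.
  have [Aw|Aw] := pselect (A (s' w)); last first.
    apply: (@loc_homeo_near _ _ (G \o s')); last first.
      by apply: loc_homeo_comp; [exact: s'l|exact: Gl].
    have : nbhs w (s' @^-1` (~` A)).
      apply: (s'l w).1; apply: open_nbhs_nbhs; split=> //.
      by apply: closed_openC; exact: A_closed.
    by apply: nbhsS => y yA; rewrite t1N.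
  apply: (loc_homeo_near _ (s'l w)).
  have : nbhs w (s' @^-1` (open_core d1)).
    by apply: (s'l w).1; apply: open_nbhs_nbhs; split; [exact: oc|left].
  apply: nbhsS => y yd; have [Ay|Ay] := pselect (A (s' y)); first by rewrite t1A.
  by rewrite t1N // Gid.
- move=> _ [w _ <-]; have [Aw|Aw] := pselect (A (s' w)); first by rewrite t1A //; left.
  by rewrite t1N //; right; exists (h' (f (s (k (t (F (s' w))))))) => //; exact: GD.
- by move=> x Ax; have [w _ wx] := As' x Ax; exists w => //; rewrite t1A wx.
Qed.

(** The cell around [A] is recentred at a point of [A] and rescaled until [A] lies in the ball of
    radius 2, the initial state of the exhaustion. *)
Theorem brown : exists t : E -> T, open_embedding t /\ range t = cored.
Proof.
have [g [og gO Ag]] := cell_around.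
have [gi gl] := (loc_homeo_embedding g).1 og.
have [a0 Aa0] := A0; have [c _ ca] := Ag _ Aa0.
pose tg := pinv g setT.
have [r rP] : exists r, forall x, A x -> `|tg x - c| < r.
  apply: (@compact_norm_bound _ (fun x => tg x - c)).
    exact: subclosed_compact A_closed cT _.
  move=> x /Ag[v _ <-]; apply: continuous_subc.
  have [] // := @pinv_loc_homeo _ _ g setT _ openT _ v I.
  by move=> v1 w1 _ _; exact: gi.
pose r1 := Num.max r 1; have r10 : 0 < r1 by rewrite lt_max ltr01 orbT.
pose l (v : E) := c + r1 *: v; pose l' (v : E) := r1^-1 *: (v - c).
have lK : cancel l l'.
  by move=> v; rewrite /l /l' addrC addKr scalerA mulVf ?scale1r // gt_eqF.
have lK' : cancel l' l.
  by move=> v; rewrite /l /l' scalerA divff ?scale1r ?gt_eqF // addrC subrK.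
have lc : continuous l by exact: affine_continuous.
have lc' : continuous l' by exact: affine_inv_continuous.
apply: (@engulf_limit (g \o l)).
- apply: open_embedding_comp og; exact: open_embedding_homeo lK lK' lc lc'.
- by move=> _ [v _ <-]; apply: gO; exists (l v).
- move=> x Ax; exists (l' (tg x)) => /=; last first.
    rewrite lK'; have [] // := @pinv_im _ _ g setT (fun v w _ _ => @gi v w) x.
    exact: Ag.
  rewrite normrZ ger0_norm ?invr_ge0 ?ltW // mulrC ltr_pdivrMr //.
  by rewrite (lt_le_trans (rP _ Ax)) // (le_trans (_ : r <= r1)) ?le_max ?lexx //; lra.
- by rewrite /= /l scaler0 addr0 ca.
Qed.

End Brown.

(** * Lifting through a threefold covering *)

Section StarShaped.
Variable R : realType.
Local Notation E := 'rV[R]_3.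

Definition star_shaped (U : set E) (c : E) : Prop :=
  U c /\ forall v t, U v -> 0 <= t <= 1 -> U (c + t *: (v - c)).

Lemma star_connected U c : star_shaped U c -> connected U.
Proof.
move=> [Uc Us].
have -> : U = \bigcup_(v in U) ((fun t : R => c + t *: (v - c)) @` `[0, 1]).
  apply/seteqP; split=> [v Uv|w [v Uv [t t01 <-]]].
    exists v => //; exists 1; first by rewrite /= in_itv /= ler01 lexx.
    by rewrite scale1r addrC subrK.
  by apply: Us => //; move: t01; rewrite /= in_itv.
apply: bigcup_connected.
  exists c => v Uv; exists 0; first by rewrite /= in_itv /= ler01 lexx.
  by rewrite scale0r addr0.
move=> v Uv; apply: connected_continuous_connected; first exact: segment_connected.
apply: continuous_subspaceT => t.
by apply: cvgD; [exact: cvg_cst|apply: cvgZl; exact: cvg_id].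
Qed.

Lemma conv_gt0 (t a b : R) : 0 <= t <= 1 -> 0 < a -> 0 < b ->
  0 < (1 - t) * a + t * b.
Proof.
move=> /andP[t0 t1] a0 b0; have [->|tn0] := eqVneq t 0.
  by rewrite subr0 mul1r mul0r addr0.
apply: ltr_wpDl; first by rewrite mulr_ge0 ?subr_ge0 // ltW.
by rewrite mulr_gt0 // lt0r tn0.
Qed.

Definition halfspace (i : 'I_3) (s : R) : set E := [set v | 0 < s * v 0 i].

Lemma coord_cont (i : 'I_3) : continuous (fun v : E => v 0 i).
Proof. exact: coord_continuous. Qed.

Lemma halfspace_open i s : open (halfspace i s).
Proof.
apply: (@open_comp _ _ (fun v : E => s * v 0 i) [set x | 0 < x]).
  move=> v _; apply: (@continuous_comp _ _ _ (fun v : E => v 0 i) ( *%R s)).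
    exact: coord_cont.
  exact: mulrl_continuous.
exact: open_gt.
Qed.

Lemma halfspace_connected i s : s != 0 -> connected (halfspace i s).
Proof.
move=> s0; apply: (@star_connected _ (s *: delta_mx 0 i)); split.
  by rewrite /halfspace /= !mxE !eqxx mulr1 -expr2 exprn_even_gt0.
move=> v t; rewrite /halfspace /= => sv /andP[t0 t1]; rewrite !mxE !eqxx mulr1.
have s2 : 0 < s * s by rewrite -expr2 exprn_even_gt0.
have -> : s * (s + t * (v 0 i - s)) = (1 - t) * (s * s) + t * (s * v 0 i).
  by rewrite !(mulrDr, mulrBr, mulrBl, mul1r) (mulrCA s t); ring.
by apply: conv_gt0; rewrite ?t0.
Qed.

Let i0 : 'I_3 := ord0.
Let i1 : 'I_3 := lift ord0 ord0.
Let i2 : 'I_3 := ord_max.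

(** For [s != 0] this is the complement of a closed half of the third axis. The two slit spaces are
    star-shaped, cover punctured space, and meet in the complement of the axis, which is connected;
    so lifts over them can be glued. *)
Definition slit (s : R) : set E :=
  (halfspace i0 1 `|` halfspace i1 1 `|` halfspace i0 (-1) `|` halfspace i1 (-1))
  `|` halfspace i2 s.

Let rV3P (v : E) : (v != 0) = [|| v 0 i0 != 0, v 0 i1 != 0 | v 0 i2 != 0].
Proof.
apply/idP/idP => [v0|]; last first.
  by apply: contraTneq => ->; rewrite !mxE !eqxx.
apply: contraNT v0; rewrite !negb_or !negbK => /and3P[/eqP h0 /eqP h1 /eqP h2].
apply/eqP/rowP => i; rewrite mxE.
have : i \in [:: i0; i1; i2] by case: i => -[|[|[|]]].
by rewrite !inE => /or3P[] /eqP ->.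
Qed.

Let off_axis (v : E) : (halfspace i0 1 `|` halfspace i1 1 `|` halfspace i0 (-1)
    `|` halfspace i1 (-1)) v <-> (v 0 i0 != 0) || (v 0 i1 != 0).
Proof.
rewrite /halfspace /=; split.
  move=> [[[]|]|]; rewrite ?mul1r ?mulN1r ?oppr_gt0 => /[dup] h.
  - by rewrite lt_neqAle eq_sym => /andP[-> _].
  - by rewrite lt_neqAle eq_sym orbC => /andP[-> _].
  - by rewrite lt_neqAle => /andP[-> _].
  - by rewrite lt_neqAle orbC => /andP[-> _].
rewrite !mul1r !mulN1r !oppr_gt0; case/orP.
  by rewrite neq_lt => /orP[]; [left; right|left; left; left].
by rewrite neq_lt => /orP[]; [right|left; left; right].
Qed.

Lemma slit_star s : s != 0 -> star_shaped (slit s) (s *: delta_mx 0 i2).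
Proof.
move=> s0; have s2 : 0 < s * s by rewrite -expr2 exprn_even_gt0.
split; first by right; rewrite /halfspace /= !mxE !eqxx mulr1.
move=> v t sv /andP[t0 t1]; rewrite /slit /=.
have [->|tn0] := eqVneq t 0.
  by rewrite scale0r addr0; right; rewrite /halfspace /= !mxE !eqxx mulr1.
case: sv => [/off_axis v0|sv].
  left; apply/off_axis; rewrite !mxE /= !mulr0 !add0r !subr0 !mulf_eq0.
  by rewrite (negbTE tn0).
right; rewrite /halfspace /= !mxE !eqxx mulr1.
have -> : s * (s + t * (v 0 i2 - s)) = (1 - t) * (s * s) + t * (s * v 0 i2).
  by rewrite !(mulrDr, mulrBr, mulrBl, mul1r) (mulrCA s t); ring.
by apply: conv_gt0; rewrite ?t0.
Qed.

Lemma slit_open s : open (slit s).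
Proof. by rewrite /slit; do !apply: openU; exact: halfspace_open. Qed.

Lemma slitU : slit 1 `|` slit (-1) = [set v | v != 0].
Proof.
apply/seteqP; split=> v /=; rewrite rV3P orbA.
  move=> [] [/off_axis ->//|]; rewrite /halfspace /= ?mul1r ?mulN1r ?oppr_gt0.
    by rewrite lt_neqAle eq_sym => /andP[-> _]; rewrite orbT.
  by rewrite lt_neqAle => /andP[-> _]; rewrite orbT.
move=> /orP[/off_axis h|]; first by left; left.
rewrite neq_lt => /orP[h|h]; [right|left]; right; rewrite /halfspace /=.
  by rewrite mulN1r oppr_gt0.
by rewrite mul1r.
Qed.

Lemma slitI_connected : connected (slit 1 `&` slit (-1)).
Proof.
have n1 : (-1 : R) != 0 by rewrite oppr_eq0 oner_eq0.
have -> : slit 1 `&` slit (-1) =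
    halfspace i0 1 `|` halfspace i1 1 `|` halfspace i0 (-1) `|` halfspace i1 (-1).
  apply/seteqP; split=> [v [[//|h1] [//|h2]]|v h]; last by split; left.
  move: h1 h2; rewrite /halfspace /= mul1r mulN1r oppr_gt0 => h1 h2.
  by have := lt_trans h1 h2; rewrite ltxx.
pose w (a b : R) : E := \row_j (if j == i0 then a else b).
apply: connectedU; [|apply: connectedU; [|apply: connectedU|]|];
  try by apply: halfspace_connected; rewrite // oner_eq0.
- exists (w 1 (-1)); split; last by rewrite /halfspace /= mxE /= mulrNN mulr1.
  by left; left; rewrite /halfspace /= mxE /= mul1r.
- exists (w (-1) 1); split; last by rewrite /halfspace /= mxE /= mulrNN mulr1.
  by right; rewrite /halfspace /= mxE /= mul1r.
- by exists (w 1 1); split; rewrite /halfspace /= mxE /= mul1r.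
Qed.

Lemma slitI0 : slit 1 `&` slit (-1) !=set0.
Proof.
exists (delta_mx 0 i0); split; left; left; left; left;
by rewrite /halfspace /= mul1r mxE !eqxx.
Qed.

Lemma punctured_connected : connected [set v : E | v != 0].
Proof.
have n1 : (-1 : R) != 0 by rewrite oppr_eq0 oner_eq0.
rewrite -slitU; apply: connectedU; first exact: slitI0.
- by apply: (@star_connected _ (1 *: delta_mx 0 i2)); apply: slit_star; rewrite oner_eq0.
- by apply: (@star_connected _ (-1 *: delta_mx 0 i2)); apply: slit_star.
Qed.

Lemma space_star : star_shaped setT (0 : E).
Proof. by []. Qed.

End StarShaped.

(** * Threefold cyclic coverings: uniqueness and gluing of lifts *)

Section Cover.
Variables (T M : topologicalType) (g : T -> T) (pr : T -> M).

Definition cover_data : Prop :=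
  [/\ hausdorff_space T, continuous g, forall x, g (g (g x)) = x &
      forall x, g x != x] /\
  [/\ continuous pr, forall x, open_at pr x, forall m, exists x, pr x = m &
      forall x y, pr x = pr y <-> [\/ y = x, y = g x | y = g (g x)]].

Hypothesis cd : cover_data.

Let hT : hausdorff_space T. Proof. by case: cd => -[]. Qed.
Let gc : continuous g. Proof. by case: cd => -[]. Qed.
Let g3 x : g (g (g x)) = x. Proof. by case: cd => -[]. Qed.
Let gx x : g x != x. Proof. by case: cd => -[]. Qed.
Let pc : continuous pr. Proof. by case: cd => _ []. Qed.
Let po x : open_at pr x. Proof. by case: cd => _ [] _ h _ _; exact: h. Qed.
Let ps m : exists x, pr x = m. Proof. by case: cd => _ []. Qed.
Let pE x y : pr x = pr y <-> [\/ y = x, y = g x | y = g (g x)].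
Proof. by case: cd => _ []. Qed.

Lemma pr_g x : pr (g x) = pr x.
Proof. by apply/esym/pE; apply: Or32. Qed.

Lemma g_inj : injective g.
Proof. by move=> x y xy; rewrite -(g3 x) xy g3. Qed.

(** Separating [x] from [g x] is enough: [z = g (g y)] amounts to [y = g z], so a neighbourhood
    disjoint from its translate by [g] meets no fibre twice. *)
Lemma pr_loc_inj x : exists N : set T,
  [/\ open N, N x & forall y z, N y -> N z -> pr y = pr z -> y = z].
Proof.
move: hT; rewrite open_hausdorff => /(_ _ _ (gx x))[[A B] /=].
rewrite !inE => -[Agx Bx] [oA oB AB].
exists (B `&` g @^-1` A); split.
- by apply: openI => //; apply: open_comp => // z _; exact: gc.
- by split.
have ngN y : (B `&` g @^-1` A) y -> ~ (B `&` g @^-1` A) (g y).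
  move=> [_ /= Ay] [Bgy _]; have : (A `&` B) (g y) by [].
  by rewrite AB.
move=> y z Ny Nz /pE[->//|zy|zy]; first by case: (ngN y) => //; rewrite -zy.
by case: (ngN z) => //; rewrite zy g3.
Qed.

Lemma pr_loc_homeo x : loc_homeo pr x.
Proof. by split; [exact: pc|exact: po]. Qed.

(** The lifts agree on an open set by local injectivity of [pr], and differ on an open set because
    [T] is Hausdorff. *)
Lemma lift_unique (Z : topologicalType) (C : set Z) (F F' : Z -> T) z0 :
  connected C -> (forall z, C z -> {for z, continuous F}) ->
  (forall z, C z -> {for z, continuous F'}) ->
  (forall z, C z -> pr (F z) = pr (F' z)) ->
  C z0 -> F z0 = F' z0 -> forall z, C z -> F z = F' z.
Proof.
move=> cC Fc Fc' FF Cz0 e0 z Cz.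
apply: (@connected_stable _ C (fun z => F z = F' z) cC _ z0 z) => // x Cx.
have [xx|/eqP xx] := pselect (F x = F' x).
  have [N [oN Nx Ni]] := pr_loc_inj (F x).
  have n1 : nbhs x (F @^-1` N) by apply: Fc => //; exact: open_nbhs_nbhs.
  have n2 : nbhs x (F' @^-1` N) by apply: Fc' => //; apply: open_nbhs_nbhs; rewrite -xx.
  apply: nbhsS (filterI n1 n2) => y [N1 N2] Cy; split=> // _.
  by apply: Ni => //; exact: FF.
move: hT; rewrite open_hausdorff => /(_ _ _ xx)[[A B] /=].
rewrite !inE => -[Ax Bx] [oA oB AB].
have n1 : nbhs x (F @^-1` A) by apply: Fc => //; exact: open_nbhs_nbhs.
have n2 : nbhs x (F' @^-1` B) by apply: Fc' => //; exact: open_nbhs_nbhs.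
apply: nbhsS (filterI n1 n2) => y [N1 N2] Cy; split=> [yy|/eqP]; last by rewrite (negbTE xx).
have : (A `&` B) (F y) by split => //; rewrite yy.
by rewrite AB.
Qed.

(** Stands in for simple connectivity. The functions are total, with arbitrary values off [U]. *)
Definition liftable (Z : topologicalType) (U : set Z) : Prop :=
  forall f : Z -> M, (forall z, U z -> {for z, continuous f}) ->
  exists F : Z -> T, forall z, U z -> {for z, continuous F} /\ pr (F z) = f z.

(** A power of [g] makes the lift over [V] agree with the lift over [U] at one common point, hence
    on the whole connected intersection. *)
Lemma liftableU (Z : topologicalType) (U V : set Z) :
  open U -> open V -> connected (U `&` V) -> U `&` V !=set0 ->
  liftable U -> liftable V -> liftable (U `|` V).
Proof.
move=> oU oV cUV [w [Uw Vw]] lU lV f fc.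
have [F FP] := lU f (fun z Uz => fc z (or_introl Uz)).
have [F0 FP0] := lV f (fun z Vz => fc z (or_intror Vz)).
have [F' FP' FF'] : exists2 F', forall z, V z -> {for z, continuous F'} /\ pr (F' z) = f z
    & F w = F' w.
  have /pE[ww|ww|ww] : pr (F0 w) = pr (F w).
    by rewrite (FP0 _ Vw).2 (FP _ Uw).2.
  - by exists F0.
  - exists (g \o F0) => // z Vz; split; last by rewrite /= pr_g (FP0 _ Vz).2.
    by apply: continuous_comp; [exact: (FP0 _ Vz).1|exact: gc].
  - exists (g \o (g \o F0)) => // z Vz; split; last by rewrite /= !pr_g (FP0 _ Vz).2.
    do 2!apply: continuous_comp => //; last exact: gc.
      exact: (FP0 _ Vz).1.
    exact: gc.
have agree z : U z -> V z -> F z = F' z.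
  move=> Uz Vz; apply: (@lift_unique _ (U `&` V) F F' w) => // y [Uy Vy].
  - exact: (FP _ Uy).1.
  - exact: (FP' _ Vy).1.
  - by rewrite (FP _ Uy).2 (FP' _ Vy).2.
pose G z := if `[< U z >] then F z else F' z.
have GU z : U z -> G z = F z by rewrite /G => Uz; case: asboolP.
have GV z : V z -> G z = F' z.
  by rewrite /G => Vz; case: asboolP => // Uz; exact: agree.
exists G => z [Uz|Vz]; split.
- apply: (@continuous_near _ _ F); last exact: (FP _ Uz).1.
  have : nbhs z U by exact: open_nbhs_nbhs.
  by apply: nbhsS => y Uy; rewrite GU.
- by rewrite GU // (FP _ Uz).2.
- apply: (@continuous_near _ _ F'); last exact: (FP' _ Vz).1.
  have : nbhs z V by exact: open_nbhs_nbhs.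
  by apply: nbhsS => y Vy; rewrite GV.
- by rewrite GV // (FP' _ Vz).2.
Qed.

Lemma liftable_range (Z W : topologicalType) (s : Z -> W) :
  open_embedding s -> Z -> liftable [set: Z] -> liftable (range s).
Proof.
move=> os z1 lZ f fc; have [si sl] := (loc_homeo_embedding s).1 os.
have [F FP] : exists F : Z -> T, forall z, setT z -> {for z, continuous F} /\ pr (F z) = f (s z).
  apply: (lZ (f \o s)) => z _; apply: continuous_comp; first exact: (sl z).1.
  by apply: fc; exists z.
have /choice[t tP] : forall w, exists z, range s w -> s z = w.
  move=> w; have [[z _ zw]|nw] := pselect (range s w); first by exists z.
  by exists z1.
have tK z : t (s z) = z by apply: si; apply: tP; exists z.
exists (F \o t) => _ [z _ <-]; split; last by rewrite /= (FP _ I).2 tK.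
apply: continuous_comp; last by rewrite tK; exact: (FP _ I).1.
by apply: (@open_embedding_inv _ _ s t).
Qed.


(** * Lifting of homotopies *)

Section PathLifting.
Variable R : realType.
Local Notation E := 'rV[R]_3.
Variables (U : set E) (H : R * E -> M) (s0 : T).
Hypotheses (oU : open U)
  (Hc : forall t y, U y -> {for (t, y), continuous H})
  (H0 : forall t y, U y -> t <= 0 -> H (t, y) = pr s0).

Let near_pair (t : R) (y : E) (P : set (R * E)) : nbhs (t, y) P ->
  exists2 ep, 0 < ep & exists V : set E, [/\ open V, V y &
    forall t' y', `|t - t'| < ep -> V y' -> P (t', y')].
Proof.
move=> [[A B] /= [At By] AB].
have [ep /= ep0 epA] := At.
move: By; rewrite nbhsE => -[V [oV Vy] VB].
exists ep => //; exists V; split=> // t' y' tt Vy'.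
by apply: AB; split=> /=; [exact: epA|exact: VB].
Qed.

(** The lift is defined at times below [t] and pinned to [s0] at nonpositive times, where [H] is
    constant; this makes it unique. *)
Let part_lift (V : set E) (t : R) (F : R * E -> T) : Prop :=
  forall t' y, t' < t -> V y ->
    [/\ {for (t', y), continuous F}, pr (F (t', y)) = H (t', y) &
        (t' <= 0 -> F (t', y) = s0)].

Let local_lift (y0 : E) (t : R) : Prop :=
  exists V F, [/\ open V, V y0, V `<=` U & part_lift V t F].

Let nbhs_lt (t t1 : R) (y : E) : t < t1 ->
  nbhs (t, y) [set p : R * E | p.1 < t1].
Proof.
move=> tt; apply: (@open_nbhs_nbhs _ (t, y)); split => //.
by apply: (@open_comp _ _ fst [set x : R | x < t1]); [move=> x _; exact: cvg_fst|exact: open_lt].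
Qed.

Let nbhs_gt (t t1 : R) (y : E) : t1 < t ->
  nbhs (t, y) [set p : R * E | t1 < p.1].
Proof.
move=> tt; apply: (@open_nbhs_nbhs _ (t, y)); split => //.
by apply: (@open_comp _ _ fst [set x : R | t1 < x]); [move=> x _; exact: cvg_fst|exact: open_gt].
Qed.

(** [ep] depends on [T0] only: it comes from a neighbourhood in [M] with a continuous section, with
    which the given lift is continued. *)
Let extend y0 T0 : U y0 -> exists2 ep, 0 < ep &
  forall t, T0 - ep < t -> local_lift y0 t -> local_lift y0 (T0 + ep).
Proof.
move=> Uy0; have [x0 x0H] := ps (H (T0, y0)).
have [N [oN Nx0 Ni]] := pr_loc_inj x0.
have prN : nbhs (H (T0, y0)) (pr @` N).
  by rewrite -x0H; apply: po; exact: open_nbhs_nbhs.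
have [e2 e20 [V' [oV' Vy' HV']]] := near_pair (Hc Uy0 prN).
exists (e2 / 2); first by rewrite divr_gt0.
have e22 : e2 / 2 < e2 by rewrite ltr_pdivrMr // mulr_natr mulr2n ltrDl.
move=> t tT [V [F [oV Vy0 VU FP]]].
have [tT'|tT'] := leP (T0 + e2 / 2) t.
  exists V, F; split=> // t' y t't Vy; apply: FP => //.
  exact: lt_le_trans tT'.
(* A time before [t] but already in the window around [T0], at which the lift is switched to the
   section. *)
pose t1 := (Num.max (T0 - e2 / 2) (t - e2 / 2) + t) / 2.
have maxt : Num.max (T0 - e2 / 2) (t - e2 / 2) < t by rewrite gt_max tT; lra.
have t1t : t1 < t by rewrite /t1; lra.
have t1T : T0 - e2 / 2 < t1.
  have : T0 - e2 / 2 <= Num.max (T0 - e2 / 2) (t - e2 / 2) by rewrite le_max lexx.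
  by rewrite /t1; lra.
have [Fc0 F0 Fs0] := FP t1 y0 t1t Vy0.
have inO t' y : T0 - e2 / 2 < t' -> t' < T0 + e2 / 2 -> V' y -> (pr @` N) (H (t', y)).
  by move=> h1 h2 Vy; apply: HV' => //; rewrite ltr_norml; apply/andP; split; lra.
(* Among the three translates of [N] this is the sheet through the lift at the switching time. *)
have [N' [oN' N's Ni' NN']] : exists N' : set T, [/\ open N', N' (F (t1, y0)),
    forall y z, N' y -> N' z -> pr y = pr z -> y = z & pr @` N = pr @` N'].
  have [|x Nx xF] := inO t1 y0 t1T _ Vy'; first by lra.
  have gpre (n : T -> T) : continuous n -> (forall x, pr (n x) = pr x) ->
      (forall x, exists y, n y = x) -> injective n -> N (n (F (t1, y0))) ->
      exists N' : set T, [/\ open N', N' (F (t1, y0)),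
        forall y z, N' y -> N' z -> pr y = pr z -> y = z & pr @` N = pr @` N'].
    move=> nc np ns ni Nn; exists (n @^-1` N); split=> //.
    - by apply: open_comp => // z _; exact: nc.
    - by move=> y z Ny Nz yz; apply: ni; apply: Ni => //; rewrite !np.
    - apply/seteqP; split=> [_ [z Nz <-]|_ [z Nz <-]].
        by have [y yz] := ns z; exists y; [rewrite /= yz|rewrite -yz np].
      by exists (n z) => //; rewrite np.
  have : pr (F (t1, y0)) = pr x by rewrite F0 xF.
  move=> /pE[xx|xx|xx].
  - by apply: (gpre id) => //; [move=> z; exact: cvg_id|move=> z; exists z|rewrite -xx].
  - apply: (gpre g) => //; [exact: pr_g|by move=> z; exists (g (g z))|exact: g_inj|by rewrite -xx].
  - apply: (gpre (g \o g)) => //.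
    + by move=> z; apply: continuous_comp; exact: gc.
    + by move=> z; rewrite /= !pr_g.
    + by move=> z; exists (g z); rewrite /= g3.
    + by move=> a b /g_inj/g_inj.
    + by rewrite /= -xx.
have /choice[sg sgP] : forall m, exists x, (pr @` N) m -> N' x /\ pr x = m.
  move=> m; have [|nm] := pselect ((pr @` N) m); last by exists x0.
  by rewrite NN' => -[x Nx xm]; exists x.
have sgK x : N' x -> sg (pr x) = x.
  move=> N'x; have [] := sgP (pr x); first by rewrite NN'; exists x.
  by move=> ? /Ni'; apply.
have sgc m : (pr @` N) m -> {for m, continuous sg}.
  rewrite NN' => -[x N'x <-].
  by have [] := @loc_homeo_inv _ _ pr sg N' x oN' N'x sgK (fun y _ => pr_loc_homeo y).
have [e3 e30 [V'' [oV'' Vy'' FV'']]] := near_pair (Fc0 _ (open_nbhs_nbhs (conj oN' N's))).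
pose V3 := V `&` V' `&` V''.
(* Near time [t1] the old lift is the section applied to [H], so the switch is continuous. *)
have agree t' y : `|t1 - t'| < e3 -> t' < t -> V3 y -> F (t', y) = sg (H (t', y)).
  move=> h1 h2 [[Vy V'y] V''y]; have [_ <- _] := FP t' y h2 Vy.
  by rewrite sgK //; exact: FV''.
have V3o : open V3 by apply: openI => //; exact: openI.
pose F' p := if p.1 < t1 then F p else sg (H p).
exists V3, F'; split=> // [y [[Vy _] _]|t' y t'T V3y]; first exact: VU.
have [[Vy V'y] V''y] := V3y.
have sgH : T0 - e2 / 2 < t' -> {for (t', y), continuous (fun p => sg (H p))}.
  move=> t'0; apply: (@continuous_comp _ _ _ H sg); first exact: Hc (VU _ Vy).
  by apply: sgc; exact: inO.
have sgt1 : t1 <= t' -> F' (t', y) = sg (H (t', y)) by rewrite /F' /= leNgt => /negbTE ->.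
have [tlt|tgt|tt] := ltgtP t' t1.
- have t't := lt_trans tlt t1t; have [Fcy Fy Fsy] := FP t' y t't Vy.
  have -> : F' (t', y) = F (t', y) by rewrite /F' /= tlt.
  split=> //; apply: (@continuous_near _ _ F) => //.
  by apply: nbhsS (nbhs_lt y tlt) => p /= pt; rewrite /F' pt.
- have t'0 := lt_trans t1T tgt; rewrite sgt1 ?(ltW tgt)//; split.
  + apply: (@continuous_near _ _ (fun p => sg (H p))); last exact: sgH.
    by apply: nbhsS (nbhs_gt y tgt) => p /= pt; rewrite /F' ltNge (ltW pt).
  + by have [] := sgP (H (t', y)) (inO _ _ t'0 t'T V'y).
  + move=> t'le; have t1le := le_trans (ltW tgt) t'le.
    rewrite H0 //; last exact: VU.
    have [_ _ /(_ t1le) Fs] := FP t1 y t1t Vy.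
    have := agree t1 y; rewrite subrr normr0 Fs (H0 (VU _ Vy) t1le) => h.
    by rewrite -h.
- rewrite tt in t'T sgH sgt1 *; rewrite sgt1 //; split.
  + apply: (@continuous_near _ _ (fun p => sg (H p))); last exact: sgH.
    have near1 : nbhs (t1, y) [set p : R * E | `|t1 - p.1| < e3 /\ V3 p.2].
      exists (ball t1 e3, V3) => /=; last by move=> p [].
      by split; [exact: nbhsx_ballx|exact: open_nbhs_nbhs].
    apply: nbhsS (filterI near1 (nbhs_lt y t1t)) => -[a b] [/= [h1 h2] h3].
    by rewrite /F' /=; case: ifP => // _; rewrite agree.
  + by have [] := sgP (H (t1, y)) (inO _ _ t1T t'T V'y).
  + move=> t1le; have [_ _ /(_ t1le) <-] := FP t1 y t1t Vy.
    by rewrite agree // subrr normr0.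
Qed.

(** By [extend], having a lift up to time [t] is locally constant in [t]; the real line is
    connected, and up to time 0 the constant [s0] is a lift. *)
Let all_lift y0 t : U y0 -> local_lift y0 t.
Proof.
move=> Uy0.
have mono a b : a <= b -> local_lift y0 b -> local_lift y0 a.
  move=> ab [V [F [oV Vy VU FP]]]; exists V, F; split=> // t' y t'a Vy'.
  by apply: FP => //; exact: lt_le_trans ab.
have cR : connected [set: R] by apply/connected_intervalP.
apply: (@connected_stable _ setT (local_lift y0) cR _ 0 t) => //; last first.
  exists U, (fun=> s0); split=> // t' y t'0 Uy; split=> //.
    by move=> ? ; exact: cvg_cst.
  by rewrite H0 // ltW.
move=> x _; have [ep ep0 epP] := extend x Uy0.
have : nbhs x (ball x ep) by exact: nbhsx_ballx.
apply: nbhsS => y; rewrite /ball /= ltr_norml => /andP[h1 h2] _.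
have xx : x <= x + ep by rewrite lerDl ltW.
have yx : y <= x + ep by lra.
split=> l; first by apply: mono xx _; apply: epP l; lra.
by apply: mono yx _; apply: epP l; lra.
Qed.

(** Local lifts up to time 2 are glued at time 1: over a fixed point two of them agree, by
    uniqueness along the times below 2. *)
Lemma homotopy_lift : exists F : E -> T, forall y, U y ->
  {for y, continuous F} /\ pr (F y) = H (1, y).
Proof.
have /choice[VF VFP] : forall y0, exists VF : set E * (R * E -> T), U y0 ->
    [/\ open VF.1, VF.1 y0, VF.1 `<=` U & part_lift VF.1 2 VF.2].
  move=> y0; have [Uy0|nU] := pselect (U y0); last by exists (U, fun=> s0).
  by have [V [F FP]] := all_lift 2 Uy0; exists (V, F).
have h12 : (1 : R) < 2 by rewrite ltr1n.
exists (fun y => (VF y).2 (1, y)) => y Uy; have [oV Vy VU FP] := VFP _ Uy.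
have [Fc Fp _] := FP 1 y h12 Vy; split=> //.
apply: (@continuous_near _ _ (fun z => (VF y).2 (1, z))); last first.
  apply: (@continuous_comp _ _ _ (fun z : E => (1 : R, z)) (VF y).2) => //.
  exact: pair_continuousr.
have : nbhs y (VF y).1 by exact: open_nbhs_nbhs.
apply: nbhsS => z Vz; have [oV' Vz' VU' FP'] := VFP _ (VU _ Vz).
have pc2 (t : R) : {for t, continuous (fun t : R => (t, z))}.
  exact: pair_continuousl.
have cI : connected [set t : R | t < 2].
  by apply/connected_intervalP => a b /= a2 b2 c /andP[_ cb]; exact: le_lt_trans b2.
apply: (@lift_unique _ [set t : R | t < 2] (fun t => (VF y).2 (t, z))
  (fun t => (VF z).2 (t, z)) 0) => //=.
- move=> t t2; apply: (@continuous_comp _ _ _ (fun t : R => (t, z))) => //.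
  by have [] := FP t z t2 Vz.
- move=> t t2; apply: (@continuous_comp _ _ _ (fun t : R => (t, z))) => //.
  by have [] := FP' t z t2 Vz'.
- by move=> t t2; have [_ -> _] := FP t z t2 Vz; have [_ -> _] := FP' t z t2 Vz'.
- have h02 : (0 : R) < 2 by [].
  have [_ _ h1] := FP 0 z h02 Vz; have [_ _ h2] := FP' 0 z h02 Vz'.
  by rewrite h1 // h2.
Qed.

End PathLifting.

(** The contraction to the centre is lifted. Clamping its time extends it to the whole real line,
    constant at nonpositive times. *)
Lemma star_liftable (R : realType) (U : set 'rV[R]_3) c :
  open U -> star_shaped U c -> liftable U.
Proof.
move=> oU [Uc Us] f fc; have [s0 s0f] := ps (f c).
pose cl (t : R) := Num.min 1 (Num.max 0 t).
have cl01 t : 0 <= cl t <= 1.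
  by rewrite /cl le_min ler01 le_max lexx /= ge_min lexx.
pose H (p : R * 'rV[R]_3) := f (c + cl p.1 *: (p.2 - c)).
have [//|||F FP] := @homotopy_lift R U H s0.
- move=> t y Uy; apply: (@continuous_comp _ _ _
    (fun p : R * 'rV[R]_3 => c + cl p.1 *: (p.2 - c)) f); last by apply: fc; exact: Us.
  apply: cvgD; first exact: cvg_cst.
  apply: cvgZ; last by apply: cvgB; [exact: cvg_snd|exact: cvg_cst].
  apply: (@continuous_comp _ _ _ fst cl); first exact: cvg_fst.
  apply: (@continuous_min _ _ (fun=> 1) _ t); first exact: cvg_cst.
  by apply: (@continuous_max _ _ (fun=> 0) _ t); [exact: cvg_cst|exact: cvg_id].
- move=> t y Uy t0; rewrite /H /cl /= (max_idPl t0).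
  by rewrite (min_idPr ler01) scale0r addr0.
exists F => y Uy; have [Fc ->] := FP _ Uy; split=> //.
rewrite /H /cl /= (max_idPr ler01) minxx scale1r addrC subrK.
by [].
Qed.

Lemma punctured_liftable (R : realType) : liftable [set v : 'rV[R]_3 | v != 0].
Proof.
have n1 : (-1 : R) != 0 by rewrite oppr_eq0 oner_eq0.
rewrite -slitU; apply: liftableU; try exact: slit_open.
- exact: slitI_connected.
- exact: slitI0.
- apply: (@star_liftable _ _ (1 *: delta_mx 0 ord_max)); first exact: slit_open.
  by apply: slit_star; rewrite oner_eq0.
- apply: (@star_liftable _ _ (-1 *: delta_mx 0 ord_max)); first exact: slit_open.
  exact: slit_star.
Qed.

End Cover.

(** * Collars, their two sides, and the innermost side *)

Section Splitting.
Variable R : realType.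
Local Notation E := 'rV[R]_3.
Local Notation D := (@punctured_space R).

(** Exchanges the two ends of punctured space, and with them the two sides of a collar. *)
Definition inversion (v : E) : E := (`|v| ^- 2) *: v.

Lemma norm_inversion v : `|inversion v| = `|v|^-1.
Proof.
rewrite /inversion normrZ normfV normrX normr_id.
have [->|v0] := eqVneq v 0; first by rewrite !normr0 expr0n /= !invr0 mulr0.
by rewrite expr2 invfM -mulrA mulVf ?mulr1 // normr_eq0.
Qed.

Lemma inversionK : involutive inversion.
Proof.
move=> v; rewrite {1}/inversion norm_inversion /inversion scalerA.
have [->|v0] := eqVneq v 0; first by rewrite scaler0.
by rewrite exprVn invrK divff ?scale1r // expf_neq0 // normr_eq0.
Qed.

Lemma inversion_neq0 v : v != 0 -> inversion v != 0.
Proof. by rewrite -!normr_gt0 norm_inversion invr_gt0. Qed.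

Lemma inversion_continuous (V : normedModType R) (v : V) : v != 0 ->
  {for v, continuous (fun v : V => (`|v| ^- 2) *: v)}.
Proof.
move=> v0; apply: cvgZ; last exact: cvg_id.
apply: cvgV; first by rewrite expf_neq0 // normr_eq0.
apply: (@continuous_comp _ _ _ (fun v : V => `|v|) (fun x : R => x ^+ 2)).
  by apply: cvg_norm; exact: cvg_id.
exact: exprn_continuous.
Qed.

Lemma inversion_loc_homeo v : v != 0 -> loc_homeo inversion v.
Proof.
move=> v0; split; first exact: (@inversion_continuous E).
apply: (open_at_cancel inversionK); first by rewrite inversionK.
by apply: (@inversion_continuous E); exact: inversion_neq0.
Qed.

(** [k] parametrizes the complement of [X `|` Y] by [R^3] minus the origin,
    with [X] at the end [v --> 0] and [Y] at the end [v --> oo]. *)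
Definition splits (W : topologicalType) (k : E -> W) (X Y : set W) : Prop :=
  [/\ forall v w, D v -> D w -> k v = k w -> v = w,
      forall v, D v -> loc_homeo k v,
      forall v, D v -> ~ X (k v) &
      forall v, D v -> ~ Y (k v)] /\
  [/\ forall x, X x -> ~ Y x,
      forall x, [\/ X x, (k @` D) x | Y x],
      forall r, 0 < r -> open (open_core k X r) &
      forall r, 0 < r -> open (Y `|` k @` [set v | r < `|v|])].

Lemma far_punctured (r : R) v : 0 < r -> r < `|v| -> D v.
Proof. by move=> r0 rv; rewrite /punctured_space /= -normr_gt0 (lt_trans r0). Qed.

Lemma splits_inversion (W : topologicalType) (k : E -> W) (X Y : set W) :
  splits k X Y -> splits (k \o inversion) Y X.
Proof.
move=> [[ki kl kX kY] [XY cov oX oY]]; split; split.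
- move=> v w Dv Dw /(ki _ _ (inversion_neq0 Dv) (inversion_neq0 Dw)).
  exact: (can_inj inversionK).
- move=> v Dv; apply: loc_homeo_comp; first exact: inversion_loc_homeo.
  by apply: kl; exact: inversion_neq0.
- by move=> v Dv; apply: kY; exact: inversion_neq0.
- by move=> v Dv; apply: kX; exact: inversion_neq0.
- by move=> x Yx Xx; exact: XY Xx Yx.
- move=> x; have [Xx|[v Dv <-]|Yx] := cov x; [exact: Or33| |exact: Or31].
  by apply: Or32; exists (inversion v); [exact: inversion_neq0|rewrite /= inversionK].
- move=> r r0; rewrite (_ : open_core _ _ _ = Y `|` k @` [set v | r^-1 < `|v|]).
    by apply: oY; rewrite invr_gt0.
  apply/seteqP; split=> x [Yx|[v vr <-]]; try by left.
    right; exists (inversion v) => //=; case: vr => v0 vr.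
    by rewrite norm_inversion ltf_pV2 // posrE normr_gt0.
  right; have r1 : 0 < r^-1 by rewrite invr_gt0.
  have v0 := far_punctured r1 vr; exists (inversion v); last by rewrite /= inversionK.
  split; first exact: inversion_neq0.
  by rewrite norm_inversion -[r]invrK ltf_pV2 // posrE normr_gt0.
- move=> r r0; rewrite (_ : _ `|` _ = open_core k X r^-1).
    by apply: oX; rewrite invr_gt0.
  apply/seteqP; split=> x [Xx|[v vr <-]]; try by left.
    have v0 := far_punctured r0 vr.
    right; exists (inversion v) => //=; split; first exact: inversion_neq0.
    by rewrite norm_inversion ltf_pV2 // posrE normr_gt0.
  right; case: vr => v0 vr; exists (inversion v); last by rewrite /= inversionK.
  by rewrite /= norm_inversion -[r]invrK ltf_pV2 // posrE ?normr_gt0 // invr_gt0.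
Qed.

Lemma splits_core_closed (W : topologicalType) (k : E -> W) (X Y : set W) r :
  splits k X Y -> 0 < r -> closed (core k X r).
Proof.
move=> [[ki kl kX kY] [XY cov oX oY]] r0.
rewrite (_ : core k X r = ~` (Y `|` k @` [set v | r < `|v|])).
  by apply: open_closedC; exact: oY.
apply/seteqP; split=> x.
  move=> [Xx|[v [v0 vr] <-]] [Yx|[w wr wx]].
  - exact: XY Xx Yx.
  - by apply: (kX _ (far_punctured r0 wr)); rewrite wx.
  - exact: kY Yx.
  - have wv := ki _ _ (far_punctured r0 wr) v0 wx.
    by move: wr; rewrite wv /= ltNge vr.
move=> xN; have [Xx|[v Dv vx]|Yx] := cov x; first by left.
  right; exists v => //; split=> //; rewrite leNgt; apply/negP => rv.
  by apply: xN; right; exists v.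
by case: xN; left.
Qed.

Lemma splits_cored_open (W : topologicalType) (k : E -> W) (X Y : set W) :
  splits k X Y -> open (cored k X).
Proof.
move=> [[ki kl kX kY] [XY cov oX oY]].
have -> : cored k X = open_core k X 1 `|` k @` D.
  apply/seteqP; split=> x; first by move=> [Xx|kx]; [left; left|right].
  by move=> [[Xx|[v [v0 _] <-]]|kx]; [left|right; exists v|right].
apply: openU; first exact: oX.
apply: im_open => //; exact: punctured_open.
Qed.

Lemma splits_coredC (W : topologicalType) (k : E -> W) (X Y : set W) :
  splits k X Y -> ~` X = cored k Y.
Proof.
move=> [[ki kl kX kY] [XY cov oX oY]]; apply/seteqP; split=> x.
  by move=> nX; have [//|kx|Yx] := cov x; [right|left].
by move=> [Yx Xx|[v Dv <-]]; [exact: XY Xx Yx|exact: kX].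
Qed.

Lemma splits_cored_openr (W : topologicalType) (k : E -> W) (X Y : set W) :
  splits k X Y -> open (cored k Y).
Proof.
move=> s; have := splits_cored_open (splits_inversion s); congr open.
apply/seteqP; split=> x [Yx|[v v0 <-]]; try (by left);
  right; exists (inversion v); rewrite /= ?inversionK //; exact: inversion_neq0.
Qed.

Section Covering.
Variables (T M : topologicalType) (g : T -> T) (pr : T -> M).
Hypotheses (cd : cover_data g pr) (cT : compact [set: T])
  (coT : connected [set: T])
  (charts : forall p : T, exists s : E -> T,
    open_embedding s /\ range s = ~` [set p]).
Variables (s0 : T) (pth : R -> T).
Hypotheses (pthc : continuous pth) (pth0 : forall t, t <= 0 -> pth t = s0)
  (pth1 : forall t, 1 <= t -> pth t = g s0).

Let hT : hausdorff_space T. Proof. by case: cd => -[]. Qed.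
Let gc : continuous g. Proof. by case: cd => -[]. Qed.
Let g3 x : g (g (g x)) = x. Proof. by case: cd => -[]. Qed.
Let gx x : g x != x. Proof. by case: cd => -[]. Qed.
Let pc : continuous pr. Proof. by case: cd => _ []. Qed.
Let po x : open_at pr x. Proof. by case: cd => _ [] _ h _ _; exact: h. Qed.
Let ps m : exists x, pr x = m. Proof. by case: cd => _ []. Qed.
Let pE x y : pr x = pr y <-> [\/ y = x, y = g x | y = g (g x)].
Proof. by case: cd => _ []. Qed.

Lemma clopen_empty (W : topologicalType) (A : set W) x :
  connected [set: W] -> open A -> closed A -> ~ A x -> A = set0.
Proof.
move=> cW oA cA nA; have [//|/eqP/set0P An] := pselect (A = set0); exfalso.
by apply: nA; rewrite (clopen_all cW oA cA An).
Qed.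

(** The complements of [s0] and [g s0] are cells that cover [T]; they meet in a punctured cell,
    which is connected. *)
Lemma total_liftable : liftable pr [set: T].
Proof.
have [s [os sr]] := charts s0; have [s' [os' sr']] := charts (g s0).
have g0 := gx s0.
have -> : [set: T] = range s `|` range s'.
  apply/seteqP; split=> // x _; rewrite sr sr'.
  by have [->|] := pselect (x = s0); [right=> /esym/eqP; rewrite (negbTE g0)|left].
have [si sl] := (loc_homeo_embedding s).1 os.
have [u _ us] : range s (g s0) by rewrite sr; apply/eqP.
have sI : range s `&` range s' = (fun v => s (u + 1 *: v)) @` D.
  rewrite sr'; apply/seteqP; split=> [_ [[v _ <-] vg]|_ [v v0 <-]].
    exists (v - u); last by rewrite scale1r addrC subrK.
    by rewrite /punctured_space /= subr_eq0; apply/eqP => vu; apply: vg; rewrite vu us.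
  split; first by exists (u + 1 *: v).
  rewrite -us => /si /eqP; rewrite scale1r -subr_eq0 addrC addKr.
  exact/negP.
apply: (liftableU cd); try exact: open_embedding_range.
- rewrite sI; apply: connected_continuous_connected; first exact: punctured_connected.
  apply: continuous_subspaceT => v; apply: (@continuous_comp _ _ _ (fun v : E => u + 1 *: v) s).
    exact: (@affine_continuous R E).
  exact: (sl _).1.
- by rewrite sI; exists (s (u + 1 *: const_mx 1)); exists (const_mx 1) => //;
    apply/eqP => /matrixP/(_ 0 0); rewrite !mxE => /eqP; rewrite oner_eq0.
- apply: (liftable_range os (0 : E)).
  by apply: (star_liftable cd) (@space_star R); exact: openT.
- apply: (liftable_range os' (0 : E)).
  by apply: (star_liftable cd) (@space_star R); exact: openT.
Qed.

Lemma loc_homeo_lift (k : E -> T) (f : E -> M) v :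
  {for v, continuous k} -> loc_homeo f v ->
  (\forall w \near v, pr (k w) = f w) -> loc_homeo k v.
Proof.
move=> kc [fc fo] kf; split=> // N Nv.
have [N0 [oN0 N0v Ni]] := pr_loc_inj cd (k v).
have n0 : nbhs v (k @^-1` N0) by apply: kc; exact: open_nbhs_nbhs.
have n1 : nbhs (k v) (pr @^-1` (f @` (N `&` k @^-1` N0 `&` [set w | pr (k w) = f w]))).
  apply: pc; rewrite (nbhs_singleton kf); apply: fo.
  by apply: filterI; [exact: filterI|exact: kf].
have n2 : nbhs (k v) N0 by exact: open_nbhs_nbhs.
apply: nbhsS (filterI n1 n2) => y [[w [[Nw N0w] kfw] fy] N0y].
by exists w => //; apply: Ni => //; rewrite kfw.
Qed.

Section Lifted.
Variables (k : E -> T) (ka : E -> M).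
Hypotheses (kai : forall v w, D v -> D w -> ka v = ka w -> v = w)
  (kl : forall v, D v -> loc_homeo k v) (prk : forall v, D v -> pr (k v) = ka v).

Local Notation C := (k @` D).

Let ki v w : D v -> D w -> k v = k w -> v = w.
Proof. by move=> Dv Dw kvw; apply: kai => //; rewrite -!prk // kvw. Qed.

Let oC : open C. Proof. by apply: im_open => //; exact: punctured_open. Qed.

Let shell_closed a b : 0 < a -> closed (k @` [set v | a <= `|v| /\ `|v| <= b]).
Proof.
move=> a0; apply: compact_closed => //; apply: continuous_compact.
  apply: continuous_in_subspaceT => v /set_mem[av _].
  by apply: (kl _).1; rewrite /punctured_space /= -normr_gt0 (lt_le_trans a0).
apply: (subclosed_compact _ (@ball0_compact R b)) => [|v []//].
rewrite (_ : [set v | _] = [set v : E | `|v| <= b] `&` ~` [set v | `|v| < a]).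
  apply: closedI; last by apply: open_closedC; exact: open_ball0_open.
  by apply: compact_closed; [exact: norm_hausdorff|exact: ball0_compact].
apply/seteqP; split=> v [] /=; first by move=> av vb; split=> //=; rewrite ltNge av.
by move=> vb /negP; rewrite -leNgt.
Qed.

(** The map to [M] that runs once around the loop [pr \o pth] across the
    collar, and is constant elsewhere, lifts to a map that distinguishes the two
    sides of the collar. *)
Lemma separation : exists X Y : set T, splits k X Y.
Proof.
(* The loop is run while the radius goes from 1 to 2. On either side of this shell the value is
   [pr s0], because [pth] rests at [s0] and at [g s0]. *)
pose f x := if `[< C x >] then pr (pth (`|pinv k D x| - 1)) else pr s0.
have fk v : D v -> f (k v) = pr (pth (`|v| - 1)).
  by move=> Dv; rewrite /f; case: asboolP => [_|[]]; [rewrite pinvK|exists v].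
have fC x : ~ C x -> f x = pr s0 by rewrite /f; case: asboolP.
have fc x : {for x, continuous f}.
  have [[v Dv <-]|nC] := pselect (C x).
    apply: (@continuous_near _ _ (fun y => pr (pth (`|pinv k D y| - 1)))).
      have : nbhs (k v) C by apply: open_nbhs_nbhs; split=> //; exists v.
      by apply: nbhsS => _ [w Dw <-]; rewrite fk // pinvK.
    apply: (@continuous_comp _ _ _ (fun y => `|pinv k D y| - 1) (pr \o pth)); last first.
      by apply: continuous_comp; [exact: pthc|exact: pc].
    apply: (@continuous_subc R T R^o (fun y => `|pinv k D y|)).
    apply: (@continuous_comp _ _ _ (pinv k D) (fun v : E => `|v|)).
      by have [] := @pinv_loc_homeo R T k D ki (@punctured_open R) kl v Dv.
    exact: norm_continuous.
  apply: (@continuous_near _ _ (fun=> pr s0)); last exact: cvg_cst.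
  have : nbhs x (~` (k @` [set v | 1 <= `|v| /\ `|v| <= 2])).
    apply: open_nbhs_nbhs; split; first by apply: closed_openC; exact: shell_closed.
    move=> [v [v1 _] vx]; apply: nC; exists v => //.
    by rewrite /punctured_space /= -normr_gt0 (lt_le_trans ltr01).
  apply: nbhsS => y yN; have [[v Dv vy]|yC] := pselect (C y); last by rewrite fC.
  rewrite -vy fk //; have [v1|v1] := ltP `|v| 1; first by rewrite pth0 // subr_le0 ltW.
  have [v2|v2] := leP `|v| 2; first by case: yN; exists v.
  by rewrite pth1 ?(pr_g cd) //; lra.
have [F0 F0P] := total_liftable (fun z _ => fc z).
pose e1 : E := const_mx 1.
have De1 : D e1.
  by apply/eqP => /matrixP/(_ 0 0); rewrite !mxE => /eqP; rewrite oner_eq0.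
(* A power of [g] makes the lift agree with [pth] at one point of the collar; uniqueness of lifts
   extends this to the whole collar. *)
have [F Fc [FP Fe1]] : exists2 F : T -> T, continuous F &
    (forall x, pr (F x) = f x) /\ F (k e1) = pth (`|e1| - 1).
  have F0c : continuous F0 by move=> z; exact: (F0P z I).1.
  have : pr (F0 (k e1)) = pr (pth (`|e1| - 1)) by rewrite (F0P _ I).2 fk.
  move=> /pE[->|->|->].
  - by exists F0 => //; split=> // x; exact: (F0P x I).2.
  - exists (g \o F0); first by move=> z; apply: continuous_comp; [exact: F0c|exact: gc].
    by split=> // x; rewrite /= (pr_g cd); exact: (F0P x I).2.
  - exists (g \o (g \o F0)).
      move=> z; apply: continuous_comp; last exact: gc.
      by apply: continuous_comp; [exact: F0c|exact: gc].
    by split=> // x; rewrite /= !(pr_g cd); exact: (F0P x I).2.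
have Fk v : D v -> F (k v) = pth (`|v| - 1).
  move=> Dv; apply: (@lift_unique _ _ _ _ cd _ D (F \o k) (fun w => pth (`|w| - 1)) e1) => //=.
  - exact: punctured_connected.
  - by move=> w Dw; apply: continuous_comp; [exact: (kl Dw).1|exact: Fc].
  - move=> w _; apply: (@continuous_comp _ _ _ (fun w : E => `|w| - 1) pth) => //.
      by apply: (@continuous_subc R E R^o); exact: norm_continuous.
    exact: pthc.
  - by move=> w Dw; rewrite FP fk.
have Fout x : ~ C x -> [\/ F x = s0, F x = g s0 | F x = g (g s0)].
  by move=> nC; apply/pE; rewrite FP fC.
have g20 : g (g s0) != s0.
  by apply/eqP => h; have := g3 s0; rewrite h => /eqP; rewrite (negbTE (gx s0)).
have neq (a b : T) x : F x = a -> a != b -> \forall y \near x, F y != b.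
  move=> Fx ab; have : nbhs x (F @^-1` (~` [set b])).
    apply: Fc; apply: open_nbhs_nbhs; split; last by rewrite Fx; apply/eqP.
    by apply: closed_openC; apply: accessible_closed_set1; exact: hausdorff_accessible.
  by apply: nbhsS => y /eqP.
(* The shell is closed, so close to a point off the collar only the two ends of the collar occur,
   where [F] is [s0] or [g s0]. *)
have shell x r : 0 < r -> ~ C x -> \forall y \near x, forall v, D v -> k v = y ->
    (`|v| < r /\ F y = s0) \/ (r < `|v| /\ F y = g s0).
  move=> r0 nC; pose a := Num.min r 1; pose b := Num.max r 2.
  have a0 : 0 < a by rewrite lt_min r0 ltr01.
  have : nbhs x (~` (k @` [set v | a <= `|v| /\ `|v| <= b])).
    apply: open_nbhs_nbhs; split; first by apply: closed_openC; exact: shell_closed.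
    move=> [v [v1 _] vx]; apply: nC; exists v => //.
    by rewrite /punctured_space /= -normr_gt0 (lt_le_trans a0).
  apply: nbhsS => y yN v Dv vy; rewrite -vy Fk //.
  have [va|va] := ltP `|v| a.
    move: va; rewrite lt_min => /andP[vr v1]; left; split=> //.
    by rewrite pth0 // subr_le0 ltW.
  have [vb|vb] := leP `|v| b; first by case: yN; exists v.
  move: vb; rewrite gt_max => /andP[vr v1]; right; split=> //.
  by rewrite pth1 //; lra.
(* Off the collar the lift takes values in the fibre of [s0]. The values [s0] and [g s0] mark the
   two sides; the third one is taken on a clopen set that misses the collar, hence nowhere. *)
pose S a := [set x | ~ C x /\ F x = a].
have oX r : 0 < r -> open (open_core k (S s0) r).
  move=> r0; rewrite openE => x [[nC Fx]|[v [v0 vr] <-]]; last first.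
    have : nbhs (k v) (k @` [set w | w != 0 /\ `|w| < r]).
      apply: (kl v0).2; apply: filterI; apply: open_nbhs_nbhs; split=> //.
        exact: punctured_open.
      exact: open_ball0_open.
    by apply: nbhsS => y yk; right.
  have n1 := neq _ _ _ Fx (_ : s0 != g s0); have n2 := neq _ _ _ Fx (_ : s0 != g (g s0)).
  apply: nbhsS (filterI (filterI (n1 _) (n2 _)) (shell x r r0 nC));
    rewrite 1?eq_sym //= => y [[/eqP y1 /eqP y2] yv].
  have [[w Dw wy]|nCy] := pselect (C y).
    by have [[wr _]|[_ /y1//]] := yv _ Dw wy; right; exists w.
  by left; split=> //; have [|/y1|/y2] := Fout _ nCy.
have oY r : 0 < r -> open (S (g s0) `|` k @` [set v | r < `|v|]).
  move=> r0; rewrite openE => x [[nC Fx]|[v rv <-]]; last first.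
    have Dv := far_punctured r0 rv.
    have : nbhs (k v) (k @` [set w | r < `|w|]).
      apply: (kl Dv).2; apply: open_nbhs_nbhs; split=> //.
      apply: (@open_comp _ _ (fun v : E => `|v|) [set x | r < x]); last exact: open_gt.
      by move=> w _; exact: norm_continuous.
    by apply: nbhsS => y yk; right.
  have g21 : g s0 != g (g s0) by rewrite eq_sym gx.
  have n1 := neq _ _ _ Fx (gx s0); have n2 := neq _ _ _ Fx g21.
  apply: nbhsS (filterI (filterI n1 n2) (shell x r r0 nC)) => y [[/eqP y1 /eqP y2] yv].
  have [[w Dw wy]|nCy] := pselect (C y).
    by have [[_ /y1//]|[wr _]] := yv _ Dw wy; right; exists w.
  by left; split=> //; have [/y1| |/y2] := Fout _ nCy.
have oZ : open (S (g (g s0))).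
  rewrite openE => x [nC Fx].
  have n1 := neq _ _ _ Fx g20; have n2 := neq _ _ _ Fx (gx (g s0)).
  apply: nbhsS (filterI (filterI n1 n2) (shell x 1 ltr01 nC)) => y [[/eqP y1 /eqP y2] yv].
  have [[w Dw wy]|nCy] := pselect (C y).
    by have [[_ /y1]|[_ /y2]] := yv _ Dw wy.
  by split=> //; have [/y1|/y2|] := Fout _ nCy.
have Z0 : S (g (g s0)) = set0.
  apply: (@clopen_empty _ _ (k e1)) => //; last by move=> [+ _]; apply; exists e1.
  rewrite (_ : S _ = ~` (open_core k (S s0) 1 `|` C `|` (S (g s0) `|` k @` [set v | 1 < `|v|]))).
    apply: open_closedC; apply: openU; last exact: oY.
    by apply: openU => //; exact: oX.
  apply/seteqP; split=> x.
    move=> [nC Fx] [[[[_]|[v [v0 _] vx]]|//]|[[_]|[v v1 vx]]].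
    - by rewrite Fx => /eqP; rewrite (negbTE g20).
    - by apply: nC; exists v.
    - by rewrite Fx => /eqP; rewrite (negbTE (gx _)).
    - by apply: nC; exists v => //; exact: far_punctured v1.
  move=> xN; have nC : ~ C x by move=> Cx; apply: xN; left; right.
  split=> //; have [Fx|Fx|//] := Fout _ nC.
    by case: xN; left; left; left.
  by case: xN; right; left.
exists (S s0), (S (g s0)); split; split=> //.
- by move=> v Dv [+ _]; apply; exists v.
- by move=> v Dv [+ _]; apply; exists v.
- by move=> x [_ Fx] [_ Fx']; move: (gx s0); rewrite -Fx' Fx eqxx.
- move=> x; have [Cx|nC] := pselect (C x); first exact: Or32.
  have [Fx|Fx|Fx] := Fout _ nC; [exact: Or31|exact: Or33|].
  have : S (g (g s0)) x by [].
  by rewrite Z0.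
Qed.


(** If no other translate of the collar lies on the [X] side, that side is
    embedded by [pr]. *)
Lemma innermost (A B : set M) (X Y : set T) :
  splits ka A B -> splits k X Y -> A !=set0 ->
  (forall v, D v -> Y (g (k v))) -> (forall v, D v -> Y (g (g (k v)))) ->
  exists t : E -> M, open_embedding t /\ range t = cored ka A.
Proof.
move=> sM sT A0 C1 C2.
have [[_ kal kaA kaB] [AB covM oA oB]] := sM.
have [[_ _ kX kY] [XY covT oX oY]] := sT.
have oXC := splits_cored_open sT; have oYC := splits_cored_openr sT.
have gcn (S : set T) : open S -> open (g @^-1` S).
  by move=> oS; apply: open_comp => // z _; exact: gc.
have [v1 Dv1] : exists v : E, D v.
  exists (const_mx 1); apply/eqP => /matrixP/(_ 0 0).
  by rewrite !mxE => /eqP; rewrite oner_eq0.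
(* This set is clopen and misses the collar, so it is empty. *)
have XgX : X `&` g @^-1` X = set0.
  apply: (@clopen_empty _ _ (k v1) coT); last by move=> [/(kX _ Dv1)].
  - rewrite (_ : _ `&` _ = cored k X `&` g @^-1` cored k X).
      by apply: openI => //; exact: gcn.
    apply/seteqP; split=> x; first by move=> [Xx Xgx]; split; left.
    move=> [[Xx|[v Dv vx]] [/= Xgx|[w Dw /= wx]]] //.
    + by case: (XY x Xx); rewrite -(g3 x) -wx; exact: C2.
    + by case: (XY _ Xgx); rewrite -vx; exact: C1.
    + by case: (kY _ Dw); rewrite wx -vx; exact: C1.
  - rewrite (_ : _ `&` _ = ~` (cored k Y `|` g @^-1` cored k Y)).
      by apply: open_closedC; apply: openU => //; exact: gcn.
    rewrite -(splits_coredC sT); apply/seteqP; split=> x.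
      by move=> [Xx Xgx] [nX|]; [exact: nX|exact].
    by move=> nX; split; apply: contrapT => h; apply: nX; [left|right].
have XCgXC x : cored k X x -> cored k X (g x) -> False.
  move=> [Xx|[v Dv vx]] [Xgx|[w Dw wx]].
  - have : (X `&` g @^-1` X) x by [].
    by rewrite XgX.
  - by case: (XY x Xx); rewrite -(g3 x) -wx; exact: C2.
  - by case: (XY _ Xgx); rewrite -vx; exact: C1.
  - by case: (kY _ Dw); rewrite wx -vx; exact: C1.
have pri x y : cored k X x -> cored k X y -> pr x = pr y -> x = y.
  move=> Xx Xy /pE[->//|yg|yg].
    by case: (XCgXC x Xx); rewrite -yg.
  by case: (XCgXC y Xy); rewrite yg g3.
have nka x v : X x -> D v -> pr x <> ka v.
  move=> Xx Dv; rewrite -prk // => /pE[kx|kx|kx].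
  - by apply: (kX _ Dv); rewrite kx.
  - by case: (XY x Xx); rewrite -(g3 x) -kx; exact: C2.
  - by case: (XY x Xx); rewrite -(g3 x) -kx; exact: C1.
have oprC (S : set M) : open S -> open (pr @^-1` S).
  by move=> oS; apply: open_comp => // z _; exact: pc.
(* The part of [X] above [B] is clopen and misses the collar; hence [pr] maps [X] into [A]. *)
have XB : X `&` pr @^-1` B = set0.
  apply: (@clopen_empty _ _ (k v1) coT); last by move=> [/(kX _ Dv1)].
  - rewrite (_ : _ `&` _ = open_core k X 1 `&` pr @^-1` (B `|` ka @` [set v | 1 < `|v|])).
      by apply: openI; [exact: oX|apply: oprC; exact: oB].
    apply/seteqP; split=> x; first by move=> [Xx Bx]; split; left.
    move=> [[Xx|[v [v0 v1'] vx]] [/= Bx|[w w1 /= wx]]] //.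
    + by case: (nka x w) => //; exact: far_punctured w1.
    + by case: (kaB v v0); rewrite -prk // vx.
    + have wv := kai (far_punctured ltr01 w1) v0.
      move: w1; rewrite /= wv ?ltNge ?(ltW v1')//.
      by rewrite wx -vx prk.
  - rewrite (_ : _ `&` _ = ~` (cored k Y `|` pr @^-1` (cored ka A))).
      apply: open_closedC; apply: openU => //; apply: oprC.
      exact: splits_cored_open sM.
    rewrite -(splits_coredC sT).
    have := splits_coredC (splits_inversion sM).
    move=> BC; apply/seteqP; split=> x.
      move=> [Xx Bx] [//|[Ax|[v Dv vx]]]; first exact: AB Ax Bx.
      by apply: (kaB _ Dv); rewrite vx.
    move=> h; split; first by apply: contrapT => nX; apply: h; left.
    have [Ax|kx|//] := covM (pr x); case: h; right; [by left|by right].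
have XA x : X x -> A (pr x).
  move=> Xx; have [//|[v Dv vx]|Bx] := covM (pr x); first by case: (nka x v).
  have : (X `&` pr @^-1` B) x by [].
  by rewrite XB.
have cM : connected [set: M].
  rewrite (_ : [set: M] = pr @` [set: T]).
    by apply: connected_continuous_connected => //; exact: continuous_subspaceT.
  by apply/seteqP; split=> // m _; have [x xm] := ps m; exists x.
have pr_open (S : set T) : open S -> open (pr @` S).
  by apply: open_at_open; exact: po.
have pr_closed (S : set T) : closed S -> closed (pr @` S).
  move=> cS; rewrite (_ : pr @` S = ~` (pr @` ~` (S `|` g @^-1` S `|` g @^-1` (g @^-1` S)))).
    apply: open_closedC; apply: pr_open; apply: closed_openC.
    have gcl (Q : set T) : closed Q -> closed (g @^-1` Q).
      by move=> cQ; apply: preimage_closed => // z _; exact: gc.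
    by apply: closedU; [apply: closedU => //; exact: gcl|apply: (gcl); exact: gcl].
  apply/seteqP; split=> m.
    move=> [x Sx <-] [y nS] /pE yx; apply: nS.
    have [xy|xy|xy] := yx; rewrite xy in Sx; first by left; left.
      by left; right.
    by right.
  move=> nm; have [x xm] := ps m; apply: contrapT => nS; apply: nm.
  exists x => // -[[Sx|Sx]|Sx]; apply: nS.
  - by exists x.
  - by exists (g x); rewrite ?(pr_g cd).
  - by exists (g (g x)); rewrite ?(pr_g cd).
(* The part of [A] that [X] does not cover is clopen as well and misses the collar below; hence [X]
   maps onto [A]. *)
have SE : A `&` ~` (pr @` X) = set0.
  apply: (@clopen_empty _ _ (ka v1) cM); last by move=> [/(kaA _ Dv1)].
  - rewrite (_ : _ `&` _ = open_core ka A 1 `&` ~` (pr @` core k X 1)).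
      apply: openI; first exact: oA.
      by apply: closed_openC; apply: pr_closed; exact: splits_core_closed sT ltr01.
    apply/seteqP; split=> m.
      move=> [Am nX]; split; first by left.
      move=> [x [Xx|[v [v0 _] vx]] xm]; first by apply: nX; exists x.
      by apply: (kaA _ v0); rewrite -prk // vx xm.
    move=> [[Am|[v [v0 v1'] vm]] nX]; first split=> //.
      by move=> [x Xx xm]; apply: nX; exists x => //; left.
    case: nX; exists (k v); last by rewrite prk.
    by right; exists v => //; split=> //; exact: ltW.
  - rewrite (_ : _ `&` _ = ~` (cored ka B `|` pr @` cored k X)).
      by apply: open_closedC; apply: openU; [exact: splits_cored_openr sM|exact: pr_open].
    rewrite -(splits_coredC sM); apply/seteqP; split=> m.
      move=> [Am nX] [nA|[x [Xx|[v Dv vx]] xm]]; first exact: nA.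
        by apply: nX; exists x.
      by apply: (kaA _ Dv); rewrite -prk // vx xm.
    move=> h; split; first by apply: contrapT => nA; apply: h; left.
    by move=> [x Xx xm]; apply: h; right; exists x => //; left.
have XsubA m : A m -> exists2 x, X x & pr x = m.
  move=> Am; have [[x Xx xm]|nX] := pselect ((pr @` X) m); first by exists x.
  have : (A `&` ~` (pr @` X)) m by [].
  by rewrite SE.
have bd : brown_data k X.
  split; split => //.
  - by have [m /XsubA[x Xx _]] := A0; exists x.
  - by move=> r r0; exact: splits_core_closed sT r0.
have [t [ot tr]] := brown bd; have [ti tl] := (loc_homeo_embedding t).1 ot.
have tX v : cored k X (t v) by rewrite -tr; exists v.
exists (pr \o t); split.
  apply/loc_homeo_embedding; split; first by move=> v w /(pri _ _ (tX _) (tX _)) /ti.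
  by move=> v; apply: loc_homeo_comp; [exact: tl|exact: pr_loc_homeo cd _].
apply/seteqP; split=> m.
  move=> [v _ <-]; have [Xt|[w Dw wt]] := tX v; first by left; exact: XA.
  by right; exists w => //=; rewrite -wt prk.
have lift x : cored k X x -> range (pr \o t) (pr x).
  by rewrite -tr => -[v _ <-]; exists v.
move=> [/XsubA[x Xx <-]|[v Dv <-]]; first by apply: lift; left.
by rewrite -prk //; apply: lift; right; exists v.
Qed.

End Lifted.

(** Each of the two other translates of the lifted collar lies on one side of it. If both lie on the
    same side, the opposite side is innermost. If they lie on different sides, a power of [g] pulls
    [X] back into [X]; iterating it, as [g] has order 3, would put the collar itself into [X]. *)
Lemma innermost_side (ka : E -> M) (A B : set M) :
  splits ka A B -> A !=set0 -> B !=set0 ->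
  exists t : E -> M, open_embedding t /\
    (range t = cored ka A \/ range t = cored ka B).
Proof.
move=> sM A0 B0; have [[kai kal kaA kaB] [AB covM oA oB]] := sM.
have kac v : D v -> {for v, continuous ka} by move=> Dv; exact: (kal v Dv).1.
have [k kP] := punctured_liftable cd kac.
have prk v : D v -> pr (k v) = ka v by move=> Dv; exact: (kP v Dv).2.
have kl v : D v -> loc_homeo k v.
  move=> Dv; apply: (@loc_homeo_lift k ka); [exact: (kP v Dv).1|exact: kal|].
  have : nbhs v D by apply: open_nbhs_nbhs; split=> //; exact: punctured_open.
  by apply: nbhsS => w; exact: prk.
have [X [Y sT]] := separation kai kl prk.
have [[ki _ kX kY] [XY covT oX oY]] := sT.
have oXC := splits_cored_open sT; have oYC := splits_cored_openr sT.
have gcn (S : set T) : open S -> open (g @^-1` S).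
  by move=> oS; apply: open_comp => // z _; exact: gc.
have disj v w : D v -> D w -> k v <> g (k w).
  move=> Dv Dw vw; have : ka v = ka w by rewrite -!prk // vw (pr_g cd).
  by move=> /(kai _ _ Dv Dw) vw'; move: vw; rewrite vw' => /esym/eqP; rewrite (negbTE (gx _)).
have [v1 Dv1] : exists v : E, D v.
  exists (const_mx 1); apply/eqP => /matrixP/(_ 0 0).
  by rewrite !mxE => /eqP; rewrite oner_eq0.
(* each translate of the collar lies on one side of it *)
have side (h : T -> T) : continuous h -> (forall v w, D v -> D w -> k v <> h (k w)) ->
    (forall v, D v -> X (h (k v))) \/ (forall v, D v -> Y (h (k v))).
  move=> hc hk; have XorY v : D v -> X (h (k v)) \/ Y (h (k v)).
    by move=> Dv; have [Xh|[w Dw wh]|Yh] := covT (h (k v)); [left|case: (hk w v)|right].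
  have hkc v : D v -> {for v, continuous (h \o k)}.
    by move=> Dv; apply: continuous_comp; [exact: (kP v Dv).1|exact: hc].
  have loc v : D v -> \forall w \near v, D w -> X (h (k w)) <-> X (h (k v)).
    move=> Dv; have [Xv|Yv] := XorY v Dv.
      have : nbhs v ((h \o k) @^-1` cored k X).
        by apply: hkc => //; apply: open_nbhs_nbhs; split=> //; left.
      apply: nbhsS => w [Xw|[u Du uw]] Dw; first by split.
      by case: (hk u w).
    have : nbhs v ((h \o k) @^-1` cored k Y).
      by apply: hkc => //; apply: open_nbhs_nbhs; split=> //; left.
    apply: nbhsS => w [Yw|[u Du uw]] Dw; last by case: (hk u w).
    by split=> Xh; [case: (XY _ Xh Yw)|case: (XY _ Xh Yv)].
  have [X1|Y1] := XorY v1 Dv1; [left|right] => v Dv.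
    exact: (@connected_stable _ D (fun v => X (h (k v))) (@punctured_connected R) loc v1).
  have [Xv|//] := XorY v Dv; case: (XY (h (k v1))) => //.
  exact: (@connected_stable _ D (fun v => X (h (k v))) (@punctured_connected R) loc v).
have disj2 v w : D v -> D w -> k v <> g (g (k w)).
  by move=> Dv Dw vw; apply: (disj w v) => //; rewrite vw g3.
have g2c : continuous (g \o g) by move=> z; apply: continuous_comp; exact: gc.
have [X1|Y1] := side g gc disj; have [X2|Y2] := side (g \o g) g2c disj2.
(* Both translates lie in [X]; [inversion] swaps the ends, so that [Y] takes the role of the
   innermost side. *)
- have [t [ot tr]] : exists t : E -> M, open_embedding t /\
      range t = cored (ka \o inversion) B.
    apply: (@innermost (k \o inversion) (ka \o inversion) _ _ _ B A Y X) => //.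
    + move=> v w Dv Dw /(kai _ _ (inversion_neq0 Dv) (inversion_neq0 Dw)).
      exact: (can_inj inversionK).
    + move=> v Dv; apply: loc_homeo_comp; first exact: inversion_loc_homeo.
      by apply: kl; exact: inversion_neq0.
    + by move=> v Dv; rewrite /= prk //; exact: inversion_neq0.
    + exact: splits_inversion.
    + exact: splits_inversion.
    + by move=> v Dv; apply: X1; exact: inversion_neq0.
    + by move=> v Dv; apply: X2; exact: inversion_neq0.
  exists t; split=> //; right; rewrite tr; apply/seteqP.
  split=> x [Bx|[v v0 <-]]; try (by left);
    right; exists (inversion v); rewrite /= ?inversionK //; exact: inversion_neq0.
- exfalso; have YC : Y `&` g @^-1` (g @^-1` X) = set0.
    apply: (@clopen_empty _ _ (k v1) coT); last by move=> [/(kY _ Dv1)].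
      rewrite (_ : _ `&` _ = cored k Y `&` g @^-1` (g @^-1` cored k X)).
        by apply: openI => //; apply: (gcn); exact: gcn.
      apply/seteqP; split=> x; first by move=> [Yx Xx]; split; left.
      move=> [[Yx|[v Dv vx]] [/= Xx|[w Dw /= wx]]] //.
      + by case: (XY x) => //; rewrite -(g3 x) -wx; exact: X1.
      + by case: (XY _ Xx); rewrite -vx; exact: Y2.
      + by case: (disj2 w v) => //; rewrite wx -vx.
    rewrite (_ : _ `&` _ = ~` (cored k X `|` g @^-1` (g @^-1` cored k Y))).
      by apply: open_closedC; apply: openU => //; apply: (gcn); exact: gcn.
    have YE : ~` Y = cored k X.
      have := splits_coredC (splits_inversion sT); move=> ->.
      apply/seteqP; split=> x [Bx|[v v0 <-]]; try (by left);
        right; exists (inversion v); rewrite /= ?inversionK //; exact: inversion_neq0.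
    rewrite -YE -(splits_coredC sT); apply/seteqP; split=> x.
      by move=> [Yx Xx] [nY|]; [exact: nY|exact].
    by move=> nX; split; apply: contrapT => h; apply: nX; [left|right].
  have XX x : X (g (g x)) -> X x.
    move=> Xx; have [//|[v Dv vx]|Yx] := covT x.
      by case: (XY _ Xx); rewrite -vx; exact: Y2.
    have : (Y `&` g @^-1` (g @^-1` X)) x by [].
    by rewrite YC.
  by apply: (kX _ Dv1); apply: (XX); apply: (XX); rewrite g3; exact: X1.
- exfalso; have YC : Y `&` g @^-1` X = set0.
    apply: (@clopen_empty _ _ (k v1) coT); last by move=> [/(kY _ Dv1)].
      rewrite (_ : _ `&` _ = cored k Y `&` g @^-1` cored k X).
        by apply: openI => //; apply: gcn.
      apply/seteqP; split=> x; first by move=> [Yx Xx]; split; left.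
      move=> [[Yx|[v Dv vx]] [/= Xx|[w Dw /= wx]]] //.
      + by case: (XY x) => //; rewrite -(g3 x) -wx; exact: X2.
      + by case: (XY _ Xx); rewrite -vx; exact: Y1.
      + by case: (disj w v) => //; rewrite wx -vx.
    rewrite (_ : _ `&` _ = ~` (cored k X `|` g @^-1` cored k Y)).
      by apply: open_closedC; apply: openU => //; apply: gcn.
    have YE : ~` Y = cored k X.
      have := splits_coredC (splits_inversion sT); move=> ->.
      apply/seteqP; split=> x [Bx|[v v0 <-]]; try (by left);
        right; exists (inversion v); rewrite /= ?inversionK //; exact: inversion_neq0.
    rewrite -YE -(splits_coredC sT); apply/seteqP; split=> x.
      by move=> [Yx Xx] [nY|]; [exact: nY|exact].
    by move=> nX; split; apply: contrapT => h; apply: nX; [left|right].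
  have XX x : X (g x) -> X x.
    move=> Xx; have [//|[v Dv vx]|Yx] := covT x.
      by case: (XY _ Xx); rewrite -vx; exact: Y1.
    have : (Y `&` g @^-1` X) x by [].
    by rewrite YC.
  by apply: (kX _ Dv1); apply: (XX); apply: (XX); exact: X2.
- have [t [ot tr]] := innermost kai kl prk sM sT A0 Y1 Y2.
  by exists t; split=> //; left.
Qed.

End Covering.
End Splitting.

(** * Connected sums *)

Section EuclideanInversion.
Variable R : realType.

Lemma sqnorm_ge0 n (v : 'rV[R]_n) : 0 <= sqnorm v.
Proof. by apply: sumr_ge0 => i _; exact: sqr_ge0. Qed.

Lemma sqnorm_eq0 n (v : 'rV[R]_n) : (sqnorm v == 0) = (v == 0).
Proof.
rewrite psumr_eq0 => [|i _]; last exact: sqr_ge0.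
apply/allP/eqP => [h|-> i _]; last by rewrite mxE expr0n eqxx implybT.
apply/rowP => i; rewrite mxE; apply/eqP; rewrite -sqrf_eq0.
by have := h i (mem_index_enum i).
Qed.

Lemma sqnorm_gt0 n (v : 'rV[R]_n) : (0 < sqnorm v) = (v != 0).
Proof. by rewrite lt0r sqnorm_eq0 sqnorm_ge0 andbT. Qed.

Lemma sqnormZ n (a : R) (v : 'rV[R]_n) : sqnorm (a *: v) = a ^+ 2 * sqnorm v.
Proof. by rewrite /sqnorm mulr_sumr; apply: eq_bigr => i _; rewrite mxE exprMn. Qed.

Lemma sqnorm_continuous n : continuous (@sqnorm R n).
Proof.
move=> v; apply: cont_sum => i.
apply: (@cont_comp _ _ _ _ (fun v : 'rV[R]_n => v 0 i) (fun x : R => x ^+ 2)).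
  exact: coord_continuous.
exact: exprn_continuous.
Qed.

Lemma norm_le_sqnorm n (v : 'rV[R]_n) : `|v| ^+ 2 <= sqnorm v.
Proof.
have [->|/mx_norm_neq0[[i j] /= vi]] := eqVneq `|v| 0.
  by rewrite expr0n sqnorm_ge0.
rewrite [`|v|]vi (ord1 i) real_normK ?num_real // /sqnorm (bigD1 j) //=.
by rewrite lerDl; apply: sumr_ge0 => k _; exact: sqr_ge0.
Qed.

Local Notation E := 'rV[R]_3.

(** Euclidean inversion fixes pointwise the sphere along which summands are glued, whereas
    [inversion], defined by the maximum norm, fixes the boundary of a cube. *)
Definition einv (v : E) : E := (sqnorm v)^-1 *: v.

Lemma sqnorm_einv v : sqnorm (einv v) = (sqnorm v)^-1.
Proof.
rewrite sqnormZ; have [->|v0] := eqVneq (sqnorm v) 0; first by rewrite mulr0 invr0.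
by rewrite expr2 -mulrA mulVf // mulr1.
Qed.

Lemma einvK : involutive einv.
Proof.
move=> v; rewrite {1}/einv sqnorm_einv invrK /einv scalerA.
have [->|v0] := eqVneq v 0; first by rewrite scaler0.
by rewrite mulfV ?scale1r // sqnorm_eq0.
Qed.

Lemma einv_neq0 v : v != 0 -> einv v != 0.
Proof. by rewrite -!sqnorm_gt0 sqnorm_einv invr_gt0. Qed.

Lemma einv_continuous v : v != 0 -> {for v, continuous einv}.
Proof.
move=> v0; apply: (@cont_scale R E v E); last exact: cont_id.
by apply: cont_inv; [rewrite sqnorm_eq0|exact: sqnorm_continuous].
Qed.

Lemma sqnorm_ball_compact r : compact [set v : E | sqnorm v <= r].
Proof.
apply: bounded_closed_compact.
  exists (r + 1); split; first exact: num_real.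
  move=> s rs v /= vr.
  have := norm_le_sqnorm v => h; have := le_trans h vr => {}h.
  have [v1|v1] := leP `|v| 1; last by apply: le_trans (ltW rs); nra.
  have r0 : 0 <= r by apply: le_trans vr; exact: sqnorm_ge0.
  by apply: le_trans v1 _; lra.
apply: (@preimage_closed _ _ (@sqnorm R 3) [set s | s <= r]).
  by move=> v _; exact: sqnorm_continuous.
exact: closed_le.
Qed.

Lemma einv_far_compact r : 0 < r ->
  compact [set v : E | v = 0 \/ r <= `|einv v|].
Proof.
move=> r0.
(* Clearing the denominator gives a closed condition that includes [v = 0]. *)
have -> : [set v : E | v = 0 \/ r <= `|einv v|] = [set v : E | r * sqnorm v - `|v| <= 0].
  apply/seteqP; split=> v /=.
    move=> [->|]; first by rewrite (_ : sqnorm 0 = 0) ?mulr0 ?normr0 ?subr0 //; apply/eqP; rewrite sqnorm_eq0.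
    rewrite normrZ ger0_norm ?invr_ge0 ?sqnorm_ge0 // subr_le0.
    have [->|v0] := eqVneq v 0.
      by rewrite (_ : sqnorm 0 = 0) ?mulr0 ?normr0 //; apply/eqP; rewrite sqnorm_eq0.
    by rewrite mulrC ler_pdivlMr // sqnorm_gt0.
  have [->|v0] := eqVneq v 0; first by left.
  rewrite subr_le0 => h; right.
  by rewrite normrZ ger0_norm ?invr_ge0 ?sqnorm_ge0 // mulrC ler_pdivlMr // sqnorm_gt0.
apply: bounded_closed_compact.
  exists r^-1; split; first exact: num_real.
  move=> s rs v /=; rewrite subr_le0 => vr; apply: le_trans (ltW rs).
  have [->|v0] := eqVneq v 0; first by rewrite normr0 invr_ge0 ltW.
  rewrite -[r^-1]mul1r ler_pdivlMr // mulrC.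
  have nv : 0 < `|v| by rewrite normr_gt0.
  rewrite -(ler_pM2r nv) mul1r -mulrA -expr2; apply: le_trans vr.
  by rewrite ler_pM2l // norm_le_sqnorm.
have fc : continuous (fun v : E => r * sqnorm v - `|v|).
  move=> v; apply: (@cont_subr R E v (fun v => r * sqnorm v) (fun v : E => `|v|)).
    by apply: (@cont_mul R E v (fun=> r)); [exact: cont_cst|exact: sqnorm_continuous].
  exact: norm_continuous.
apply: (@preimage_closed _ _ (fun v : E => r * sqnorm v - `|v|) [set s | s <= 0]).
  by move=> v _; exact: fc.
exact: closed_le.
Qed.

Lemma not_compact_space : ~ compact [set: E].
Proof.
move=> /compact_bounded[M [_ MP]].
pose a := `|M| + 1; have := MP a; have aM : M < a.
  by rewrite /a; apply: le_lt_trans (ler_norm M) _; rewrite ltrDl.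
move=> /(_ aM (const_mx (a + 1)) I).
have a0 : 0 < a by rewrite /a ltr_wpDl.
rewrite /= leNgt => /negP; apply.
have : `|(const_mx (a + 1) : E) 0 0| <= `|const_mx (a + 1) : E|.
  by rewrite [leRHS]mx_normrE; apply: (le_bigmax _ (fun ij => `|(const_mx (a + 1) : E) ij.1 ij.2|) (0, 0)).
by apply: lt_le_trans; rewrite mxE ger0_norm; lra.
Qed.

End EuclideanInversion.

(** * One-point compactifications of space *)

Section OnePoint.
Variable R : realType.
Local Notation E := 'rV[R]_3.

(** [f] extends [t] after the inverse of [s]. Continuity at [p] holds since the complement of a
    neighbourhood of [q] is compact, and so is its counterpart in [P]. *)
Lemma one_point_homeo (P Q : topologicalType) (p : P) (q : Q) (s : E -> P) (t : E -> Q) :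
  compact [set: P] -> hausdorff_space P -> compact [set: Q] -> hausdorff_space Q ->
  open_embedding s -> range s = ~` [set p] ->
  open_embedding t -> range t = ~` [set q] -> homeomorphic P Q.
Proof.
move=> cP hP cQ hQ os sr ot tr.
have [si sl] := (loc_homeo_embedding s).1 os.
have [ti tl] := (loc_homeo_embedding t).1 ot.
have rs x : x != p -> range s x by rewrite sr => /eqP.
have sp v : s v != p.
  by apply/eqP => vp; have : range s p by [exists v]; rewrite sr; apply.
have tq v : t v != q.
  by apply/eqP => vq; have : range t q by [exists v]; rewrite tr; apply.
pose s' := pinv s setT; pose t' := pinv t setT.
have s'K v : s' (s v) = v by rewrite /s' pinvK // => ? ? _ _; exact: si.
have t'K v : t' (t v) = v by rewrite /t' pinvK // => ? ? _ _; exact: ti.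
pose f x := if x == p then q else t (s' x).
have fs v : f (s v) = t v by rewrite /f (negbTE (sp v)) s'K.
have fp : f p = q by rewrite /f eqxx.
apply: (@compact_bij_homeo _ _ f) => //.
- move=> x; have [->|/rs[v _ <-]] := eqVneq x p; last first.
    apply: (@continuous_near _ _ (t \o s')).
      have : nbhs (s v) (range s).
        by apply: open_nbhs_nbhs; split; [exact: open_embedding_range|exists v].
      by apply: nbhsS => _ [w _ <-] /=; rewrite fs s'K.
    apply: continuous_comp; last exact: (tl _).1.
    exact: (@open_embedding_inv _ _ s s' os s'K).
  move=> U; rewrite fp nbhsE => -[V [oV Vq] VU].
  have cK : compact (t' @` (~` V)).
    apply: continuous_compact; last by apply: (subclosed_compact _ cQ) => //; exact: open_closedC.
    apply: continuous_in_subspaceT => y /set_mem nV.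
    have : range t y by rewrite tr => yq; apply: nV; rewrite yq.
    by move=> [v _ <-]; exact: (@open_embedding_inv _ _ t t' ot t'K).
  have csK : closed (s @` (t' @` (~` V))).
    apply: compact_closed => //; apply: continuous_compact => //.
    by apply: continuous_subspaceT => v; exact: (sl v).1.
  have : nbhs p (~` (s @` (t' @` (~` V)))).
    apply: open_nbhs_nbhs; split; first exact: closed_openC.
    by move=> [v _ /eqP]; rewrite (negbTE (sp v)).
  apply: nbhsS => z nz; apply: VU; apply: contrapT => nV.
  have [zp|/rs[v _ vx]] := eqVneq z p; first by apply: nV; rewrite /= zp fp.
  apply: nz; exists v => //; exists (t v); last exact: t'K.
  by rewrite -fs vx.
- move=> x y; have [->|/rs[v _ <-]] := eqVneq x p; have [->|/rs[w _ <-]] := eqVneq y p => //.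
  + by rewrite fp fs => /esym/eqP; rewrite (negbTE (tq w)).
  + by rewrite fp fs => /eqP; rewrite (negbTE (tq v)).
  + by rewrite !fs => /ti ->.
- move=> y; have [->|/eqP yq] := eqVneq y q; first by exists p.
  by have [v _ <-] : range t y; [rewrite tr|exists (s v)].
Qed.

End OnePoint.

(** * The collar of a connected sum *)

Section ConnectedSum.
Variable R : realType.
Local Notation E := 'rV[R]_3.

Section Sides.
Variables (P Q N : topologicalType) (phi : E -> P) (psi : E -> Q)
  (jP : punctured phi -> N) (jQ : punctured psi -> N).

(** The properties of the quotient that the argument uses, in a form symmetric in the two
    summands. *)
Definition glued_sides : Prop :=
  [/\ hausdorff_space P, hausdorff_space Q, open_embedding phi & open_embedding psi] /\
  [/\ (continuous jP /\ continuous jQ) /\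
        (forall U, open (jP @^-1` U) -> open (jQ @^-1` U) -> open U),
      (injective jP /\ injective jQ),
      forall x y, jP x = jQ y <->
        exists v, [/\ sphere v, set_val x = phi v & set_val y = psi v] &
      forall n, (exists x, jP x = n) \/ (exists y, jQ y = n)].

Hypothesis gs : glued_sides.

Let in_punctured (W : topologicalType) (f : E -> W) x :
  ~ (f @` [set v | sqnorm v < 1]) x -> exists y : punctured f, set_val y = x.
Proof.
move=> xf; have xf' : x \in ~` (f @` [set v | sqnorm v < 1]) by exact: mem_set.
by exists (exist _ x xf' : punctured f).
Qed.

Let out_punctured (W : topologicalType) (f : E -> W) (y : punctured f) :
  ~ (f @` [set v | sqnorm v < 1]) (set_val y).
Proof. by have /set_mem := valP y. Qed.

Let punctured_inj (W : topologicalType) (f : E -> W) (y z : punctured f) :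
  set_val y = set_val z -> y = z.
Proof. by move=> yz; apply: val_inj. Qed.

Let punctured_nbhs (W : topologicalType) (f : E -> W) (y : punctured f) (U : set (punctured f)) :
  nbhs y U -> exists V, [/\ open V, V (set_val y) & forall z, V (set_val z) -> U z].
Proof.
rewrite nbhsE => -[B [[V oV VB] By] BU]; exists V; split=> //.
  by move: By; rewrite -VB.
by move=> z Vz; apply: BU; rewrite -VB.
Qed.

Let punctured_pre_open (W : topologicalType) (f : E -> W) (V : set W) :
  open V -> open ((set_val : punctured f -> W) @^-1` V).
Proof. by move=> oV; exists V. Qed.

Let sqnorm_lt_open a : open [set v : E | sqnorm v < a].
Proof.
by apply: (@open_comp _ _ (@sqnorm R 3) [set s | s < a]);
  [move=> v _; exact: sqnorm_continuous|exact: open_lt].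
Qed.

(** The other side of the sphere, with its end closed up by [einv], extends
    each punctured summand to the complement of the center of the ball. *)
Lemma side_embedding : exists i : P -> N,
  [/\ forall x, x != phi 0 -> loc_homeo i x,
      forall x y, x != phi 0 -> y != phi 0 -> i x = i y -> x = y,
      forall x : punctured phi, i (set_val x) = jP x &
      forall v (y : punctured psi), v != 0 -> set_val y = psi v -> i (phi (einv v)) = jQ y].
Proof.
have [[hP hQ op oq] [[[jPc jQc] jo] [jPi jQi] jPQ js]] := gs.
have [pi pl] := (loc_homeo_embedding phi).1 op.
have [qi ql] := (loc_homeo_embedding psi).1 oq.
have far (v : E) (z : punctured psi) : set_val z = psi v -> 1 <= sqnorm v.
  move=> zv; rewrite leNgt; apply/negP => v1; have := @out_punctured _ _ z.
  by apply; exists v.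
have farP (v : E) (z : punctured phi) : set_val z = phi v -> 1 <= sqnorm v.
  move=> zv; rewrite leNgt; apply/negP => v1; have := @out_punctured _ _ z.
  by apply; exists v.
have mkQ (v : E) : 1 <= sqnorm v -> exists y : punctured psi, set_val y = psi v.
  move=> v1; apply: in_punctured => -[w w1 /qi wv].
  by move: w1; rewrite /= wv ltNge v1.
have mkP (v : E) : 1 <= sqnorm v -> exists y : punctured phi, set_val y = phi v.
  move=> v1; apply: in_punctured => -[w w1 /pi wv].
  by move: w1; rewrite /= wv ltNge v1.
have einv1 v : sqnorm v = 1 -> einv v = v :> E by rewrite /einv => ->; rewrite invr1 scale1r.
have sq0 : sqnorm (0 : E) = 0 by apply/eqP; rewrite sqnorm_eq0.
(* Outside the open ball [jP] gives the value; inside, [phi v] goes to the place of [psi (einv v)]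
   in the other piece. Both rules agree on the sphere, which [einv] fixes, and the centre gets an
   arbitrary value. *)
have ex x : exists n, (forall y : punctured phi, set_val y = x -> jP y = n) /\
    (forall v (y : punctured psi), v != 0 -> x = phi v -> set_val y = psi (einv v) -> jQ y = n).
  have [[v v1 vx]|nx] := pselect ((phi @` [set v | sqnorm v < 1]) x); last first.
    have [y yx] := in_punctured nx; exists (jP y); split.
      by move=> y' y'x; congr jP; apply: punctured_inj; rewrite y'x yx.
    move=> v z v0 xv zv; apply/esym/jPQ; exists v.
    have v1 : 1 <= sqnorm v.
      by rewrite leNgt; apply/negP => v1; apply: nx; exists v.
    have := far _ _ zv; rewrite sqnorm_einv => v2.
    have v3 : sqnorm v = 1.
      apply/eqP; rewrite eq_le v1 andbT -invf_ge1 //.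
      by rewrite (lt_le_trans ltr01).
    by rewrite yx zv xv (einv1 _ v3).
  have [v0|v0] := eqVneq v 0.
    have [|z _] := mkQ (const_mx 1 : E).
      rewrite /sqnorm (eq_bigr (fun=> 1)) ?sumr_const ?card_ord ?ler1n // => k _.
      by rewrite mxE expr1n.
    exists (jQ z); split=> [y yx|w y w0 xw].
      by have := farP v y; rewrite yx vx => /(_ erefl); rewrite v0 sq0 ler10.
    by move: w0; rewrite -(pi _ _ (etrans vx xw)) v0 eqxx.
  have [|z zv] := mkQ (einv v).
    by rewrite sqnorm_einv invf_ge1 ?sqnorm_gt0 // ltW.
  exists (jQ z); split=> [y yx|w y w0 xw yw].
    by have := farP v y; rewrite yx vx => /(_ erefl); rewrite leNgt v1.
  by congr jQ; apply: punctured_inj; rewrite yw zv (pi _ _ (etrans vx xw)).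
have [i iE] := choice ex.
have iP (y : punctured phi) : i (set_val y) = jP y by have [h _] := iE (set_val y); rewrite (h y).
have iQ v (y : punctured psi) : v != 0 -> set_val y = psi (einv v) -> i (phi v) = jQ y.
  by move=> v0 yv; have [_ h] := iE (phi v); rewrite (h v y).
have cases x : x != phi 0 -> (exists y : punctured phi, set_val y = x) \/
    exists v, exists y : punctured psi,
      [/\ v != 0, sqnorm v < 1, x = phi v & set_val y = psi (einv v)].
  move=> x0; have [[v v1 vx]|nx] := pselect ((phi @` [set v | sqnorm v < 1]) x); last first.
    by left; exact: in_punctured.
  right; exists v; have v0 : v != 0 by apply: contra_neq x0 => v0; rewrite -vx v0.
  have [|z zv] := mkQ (einv v); first by rewrite sqnorm_einv invf_ge1 ?sqnorm_gt0 // ltW.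
  by exists z.
have p0 (y : punctured phi) : set_val y != phi 0.
  by apply/eqP => /farP; rewrite sq0 ler10.
have ii x y : x != phi 0 -> y != phi 0 -> i x = i y -> x = y.
  have PQ (a : punctured phi) v (b : punctured psi) : v != 0 -> sqnorm v < 1 ->
      set_val b = psi (einv v) -> jP a <> jQ b.
    move=> v0 v1 bv /jPQ[w [w1 _]]; rewrite bv => /qi vw.
    move: w1; rewrite /sphere /= -vw sqnorm_einv => /eqP.
    by rewrite invr_eq1 => /eqP v2; move: v1; rewrite v2 ltxx.
  move=> /cases[[a <-]|[v [a [v0 v1 -> av]]]] /cases[[b <-]|[w [b [w0 w1 -> bw]]]].
  - by rewrite !iP => /jPi ->.
  - by rewrite iP (iQ w b) // => /(PQ _ _ _ w0 w1 bw).
  - by rewrite iP (iQ v a) // => /esym/(PQ _ _ _ v0 v1 av).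
  - rewrite (iQ v a) // (iQ w b) // => /jQi ab; move: av; rewrite ab bw.
    by move=> /qi/(can_inj (@einvK R)) ->.
have Dopen : open [set v : E | v != 0] by exact: punctured_open.
have side_open (W W' : topologicalType) (f : E -> W) (f' : E -> W') (V : set W') :
    (forall v, loc_homeo f v) -> (forall v, loc_homeo f' v) -> open V ->
    open (f @` [set v | v != 0 /\ V (f' (einv v))]).
  move=> fl fl' oV; apply: (im_open (fun v _ => fl v)).
  rewrite openE => v [v0 Vv].
  have n1 : nbhs v ((f' \o @einv R) @^-1` V).
    have cc : {for v, continuous (f' \o @einv R)}.
      by apply: continuous_comp; [exact: einv_continuous|exact: (fl' _).1].
    by apply: cc; exact: open_nbhs_nbhs.
  have n2 : nbhs v [set v : E | v != 0] by exact: open_nbhs_nbhs.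
  by apply: nbhsS (filterI n1 n2) => w [].
have ball_closed : closed (phi @` [set v | sqnorm v <= 1]).
  apply: compact_closed => //; apply: continuous_compact; last exact: sqnorm_ball_compact.
  by apply: continuous_subspaceT => v; exact: (pl v).1.
have nphi0 : open (~` [set phi 0]).
  by apply: closed_openC; apply: accessible_closed_set1; exact: hausdorff_accessible.
have ic x : x != phi 0 -> {for x, continuous i}.
  move=> x0 U Ux.
  (* [W1] controls the nearby points outside the open ball, and [W2] those in the closed ball. *)
  have [W1 [oW1 W1x W1U]] : exists W1, [/\ open W1, W1 x &
      forall y : punctured phi, W1 (set_val y) -> U (jP y)].
    have [[y yx]|nx] := pselect (exists y : punctured phi, set_val y = x).
      have /punctured_nbhs[V [oV Vy VU]] : nbhs y (jP @^-1` U).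
        by apply: jPc; rewrite -iP yx.
      by exists V; split=> //; rewrite -yx.
    exists (phi @` [set v | sqnorm v < 1]); split.
    - by apply: (im_open (fun v _ => pl v)); exact: sqnorm_lt_open.
    - by apply: contrapT => /in_punctured.
    - by move=> y [v v1 vy]; have := farP v y (esym vy); rewrite leNgt v1.
  have [W2 [oW2 W2x W2U]] : exists W2, [/\ open W2, W2 x &
      forall v (z : punctured psi), v != 0 -> W2 (phi v) -> set_val z = psi (einv v) -> U (jQ z)].
    have [[v v1 vx]|nx] := pselect ((phi @` [set v | sqnorm v <= 1]) x); last first.
      exists (~` (phi @` [set v | sqnorm v <= 1])); split=> //; first exact: closed_openC.
      move=> v z v0 nv zv; case: nv; exists v => //=.
      have := far _ _ zv; rewrite sqnorm_einv invf_ge1 //.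
      by rewrite sqnorm_gt0.
    have v0 : v != 0 by apply: contra_neq x0 => v0; rewrite -vx v0.
    have [|z zv] := mkQ (einv v); first by rewrite sqnorm_einv invf_ge1 ?sqnorm_gt0.
    have /punctured_nbhs[V [oV Vz VU]] : nbhs z (jQ @^-1` U).
      by apply: jQc; rewrite -(iQ v z) // vx.
    exists (phi @` [set v | v != 0 /\ V (psi (einv v))]); split.
    - exact: (side_open _ _ phi psi V pl ql oV).
    - by exists v => //; split=> //; rewrite -zv.
    - by move=> w z' w0 [w' [_ Vw] /pi <-] zw; apply: VU; rewrite zw.
  have n1 : nbhs x (W1 `&` W2 `&` ~` [set phi 0]).
    apply: open_nbhs_nbhs; split; first by apply: openI => //; exact: openI.
    by split=> //; exact/eqP.
  apply: nbhsS n1 => y [[y1 y2] /eqP /cases[[a ay]|[v [a [v0 v1 yv av]]]]] /=.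
    by rewrite -ay iP; apply: W1U; rewrite ay.
  by rewrite yv (iQ v a) //; apply: (W2U v) => //; rewrite -yv.
exists i; split=> //; last first.
  by move=> v y v0 yv; apply: iQ; rewrite ?einvK //; exact: einv_neq0.
move=> x x0; split; first exact: ic.
move=> U; rewrite nbhsE => -[W0 [oW0 W0x] WU].
pose W := W0 `&` ~` [set phi 0].
have oW : open W by exact: openI.
have Wx : W x by split=> //; exact/eqP.
apply: (@nbhsS _ _ (i @` W)); first by move=> _ [y [Wy _] <-]; exists y => //; exact: WU.
apply: open_nbhs_nbhs; split; last by exists x.
apply: jo.
  rewrite (_ : _ @^-1` _ = set_val @^-1` W); first exact: punctured_pre_open.
  apply/seteqP; split=> y /=; last by exists (set_val y) => //; exact: iP.
  move=> [z Wz]; rewrite -iP => /ii zy; rewrite -zy //; apply/eqP.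
  by case: Wz.
rewrite (_ : _ @^-1` _ = set_val @^-1` (psi @` [set w | w != 0 /\ W (phi (einv w))])).
  by apply: punctured_pre_open; exact: (side_open _ _ psi phi W ql pl oW).
apply/seteqP; split=> z /=.
  move=> [y Wy]; have /eqP y0 : y <> phi 0 by case: Wy.
  have [[a ay]|[v [a [v0 v1 yv av]]]] := cases y y0.
    rewrite -ay iP => /jPQ[v [v1 av zv]]; exists v; last by rewrite zv.
    by rewrite /= (einv1 _ v1) -av ay -sqnorm_gt0 v1.
  rewrite yv (iQ v a) // => /jQi <-; exists (einv v); last by rewrite av.
  by rewrite /= einvK -yv; split=> //; exact: einv_neq0.
move=> [w [w0 Ww] wz]; exists (phi (einv w)) => //.
by apply: iQ; rewrite ?einvK ?wz //; exact: einv_neq0.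
Qed.

End Sides.

Lemma glued_sides_sym (P Q N : topologicalType) (phi : E -> P) (psi : E -> Q)
    (jP : punctured phi -> N) (jQ : punctured psi -> N) :
  glued_sides jP jQ -> glued_sides jQ jP.
Proof.
move=> [[hP hQ op oq] [[[jPc jQc] jo] [jPi jQi] jPQ js]]; split; split=> //.
- by split=> // U oQ oP; exact: jo.
- move=> y x; split=> [/esym/jPQ|] [v [v1 v2 v3]]; first by exists v.
  by apply/esym/jPQ; exists v.
- by move=> n; have [] := js n; [right|left].
Qed.

(** The collar consists of both charts: [psi v] from the unit sphere outwards, continued inwards by
    [phi (einv v)]. What is left of a summand is the complement of its chart. *)
Lemma sides_split (P Q N : topologicalType) (phi : E -> P) (psi : E -> Q)
    (jP : punctured phi -> N) (jQ : punctured psi -> N) :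
  glued_sides jP jQ ->
  exists (k : E -> N) (A B : set N) (i : P -> N) (i' : Q -> N),
    [/\ splits k A B,
        (forall x, x != phi 0 -> loc_homeo i x) /\
          (forall x y, x != phi 0 -> y != phi 0 -> i x = i y -> x = y),
        (forall x, x != psi 0 -> loc_homeo i' x) /\
          (forall x y, x != psi 0 -> y != psi 0 -> i' x = i' y -> x = y),
        cored k A = i @` (~` [set phi 0]) /\ cored k B = i' @` (~` [set psi 0]) &
        (forall x, ~ range phi x -> A (i x)) /\ (forall x, ~ range psi x -> B (i' x))].
Proof.
move=> gs; have [i [il ii iP iQ]] := side_embedding gs.
have [i' [il' ii' iQ' iP']] := side_embedding (glued_sides_sym gs).
have [[hP hQ op oq] [[[jPc jQc] jo] [jPi jQi] jPQ js]] := gs.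
have [pi pl] := (loc_homeo_embedding phi).1 op.
have [qi ql] := (loc_homeo_embedding psi).1 oq.
pose k v := i' (psi v).
have sq0 : sqnorm (0 : E) = 0 by apply/eqP; rewrite sqnorm_eq0.
have in_p (W : topologicalType) (f : E -> W) x :
    ~ (f @` [set v | sqnorm v < 1]) x -> exists y : punctured f, set_val y = x.
  move=> xf; have xf' : x \in ~` (f @` [set v | sqnorm v < 1]) by exact: mem_set.
  by exists (exist _ x xf' : punctured f).
have out_p (W : topologicalType) (f : E -> W) (y : punctured f) :
    ~ (f @` [set v | sqnorm v < 1]) (set_val y) by have /set_mem := valP y.
have p0 (y : punctured phi) : set_val y != phi 0.
  by apply/eqP => y0; apply: (out_p _ _ y); exists 0; rewrite /= ?sq0.
have q0 (y : punctured psi) : set_val y != psi 0.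
  by apply/eqP => y0; apply: (out_p _ _ y); exists 0; rewrite /= ?sq0.
have phi0 v : v != 0 -> phi v != phi 0 by apply: contra_neq => /pi.
have psi0 v : v != 0 -> psi v != psi 0 by apply: contra_neq => /qi.
have kE v : v != 0 -> k v = i (phi (einv v)).
  move=> v0; have [v1|v1] := ltP (sqnorm v) 1; last first.
    have [|z zv] := in_p _ psi (psi v).
      by move=> [w w1 /qi wv]; move: w1; rewrite /= wv ltNge v1.
    by rewrite /k -zv iQ' (iQ v z).
  have [|y yv] := in_p _ phi (phi (einv v)).
    move=> [w w1 /pi wv]; move: w1; rewrite /= wv sqnorm_einv ltNge invf_ge1 ?sqnorm_gt0 //.
    by rewrite ltW.
  by rewrite -yv iP -(iP' (einv v) y) ?einvK //; exact: einv_neq0.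
pose A := [set n | exists2 x : punctured phi, jP x = n & ~ range phi (set_val x)].
pose B := [set n | exists2 y : punctured psi, jQ y = n & ~ range psi (set_val y)].
have Ai x : ~ range phi x -> A (i x).
  move=> nx; have [|y yx] := in_p _ phi x; first by move=> [v _ vx]; apply: nx; exists v.
  by exists y; rewrite -?iP yx.
have Bi x : ~ range psi x -> B (i' x).
  move=> nx; have [|y yx] := in_p _ psi x; first by move=> [v _ vx]; apply: nx; exists v.
  by exists y; rewrite -?iQ' yx.
have Ak v : v != 0 -> ~ A (k v).
  move=> v0 [x xv nx]; apply: nx; move: xv; rewrite kE // -iP.
  by move=> /ii ->; [exists (einv v)|exact: p0|exact: phi0 (einv_neq0 v0)].
have Bk v : v != 0 -> ~ B (k v).
  move=> v0 [x xv nx]; apply: nx; move: xv; rewrite /k -iQ'.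
  by move=> /ii' ->; [exists v|exact: q0|exact: psi0].
have imo (W : topologicalType) (f : W -> N) (c : W) (S : set W) :
    (forall x, x != c -> loc_homeo f x) -> open S -> ~ S c -> open (f @` S).
  move=> fl oS nS; rewrite openE => _ [x Sx <-].
  apply: (fl x _).2; last exact: open_nbhs_nbhs.
  by apply/eqP => xc; apply: nS; rewrite -xc.
exists k, A, B, i, i'; split=> //; last first.
- split; apply/seteqP; split=> n.
  + move=> [[x <- _]|[v v0 <-]]; first by exists (set_val x); [exact/eqP|exact: iP].
    by exists (phi (einv v)); [apply/eqP; exact: phi0 (einv_neq0 v0)|rewrite kE].
  + move=> [x /eqP x0 <-]; have [[w _ wx]|nx] := pselect (range phi x); last by left; exact: Ai.
    have w0 : w != 0 by apply: contra_neq x0 => w0; rewrite -wx w0.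
    by right; exists (einv w); [exact: einv_neq0|rewrite kE ?einvK ?wx //; exact: einv_neq0].
  + move=> [[x <- _]|[v v0 <-]]; first by exists (set_val x); [exact/eqP|exact: iQ'].
    by exists (psi v) => //; apply/eqP; exact: psi0.
  + move=> [x /eqP x0 <-]; have [[w _ wx]|nx] := pselect (range psi x); last by left; exact: Bi.
    have w0 : w != 0 by apply: contra_neq x0 => w0; rewrite -wx w0.
    by right; exists w => //; rewrite /k wx.
split; split=> //.
- by move=> v w v0 w0 /ii' vw; apply: qi; apply: vw; exact: psi0.
- move=> v v0; apply: (@loc_homeo_comp _ _ _ psi i'); first exact: ql.
  by apply: il'; exact: psi0.
- by move=> n [x xn nx] [y yn ny]; have /jPQ[v [_ xv _]] := etrans xn (esym yn);
    apply: nx; exists v.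
- move=> n; have [[x xn]|[y yn]] := js n.
    have [[w _ wx]|nx] := pselect (range phi (set_val x)); last by apply: Or31; exists x.
    have w0 : w != 0 by apply: contra_neq (p0 x) => w0; rewrite -wx w0.
    by apply: Or32; exists (einv w); [exact: einv_neq0|rewrite kE ?einvK ?wx ?iP //; exact: einv_neq0].
  have [[w _ wx]|nx] := pselect (range psi (set_val y)); last by apply: Or33; exists y.
  have w0 : w != 0 by apply: contra_neq (q0 y) => w0; rewrite -wx w0.
  by apply: Or32; exists w => //; rewrite /k wx iQ'.
- move=> r r0; rewrite (_ : open_core k A r =
    i @` (~` (phi @` [set w | w = 0 \/ r <= `|einv w|]))).
    apply: (imo _ _ (phi 0)) => //; last by apply; exists 0 => //; left.
    apply: closed_openC; apply: compact_closed => //; apply: continuous_compact.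
      by apply: continuous_subspaceT => v; exact: (pl v).1.
    exact: einv_far_compact.
  apply/seteqP; split=> n.
    move=> [[x <- nx]|[v [v0 vr] <-]].
      by exists (set_val x); [move=> [w _ wx]; apply: nx; exists w|exact: iP].
    exists (phi (einv v)); last by rewrite kE.
    move=> [w [->|wr] /pi wv].
      by have := einv_neq0 v0; rewrite -wv eqxx.
    by move: wr; rewrite wv einvK leNgt vr.
  move=> [x nx <-]; have [[w _ wx]|nx'] := pselect (range phi x); last by left; exact: Ai.
  have w0 : w != 0 by apply/eqP => w0; apply: nx; exists w => //; left.
  right; exists (einv w); last by rewrite kE ?einvK ?wx //; exact: einv_neq0.
  split; first exact: einv_neq0.
  by rewrite ltNge; apply/negP => rw; apply: nx; exists w => //; right.
- move=> r r0; rewrite (_ : _ `|` _ = i' @` (~` (psi @` [set w | `|w| <= r]))).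
    apply: (imo _ _ (psi 0)) => //; last by apply; exists 0; rewrite //= normr0 ltW.
    apply: closed_openC; apply: compact_closed => //; apply: continuous_compact.
      by apply: continuous_subspaceT => v; exact: (ql v).1.
    exact: ball0_compact.
  apply/seteqP; split=> n.
    move=> [[x <- nx]|[v rv <-]].
      by exists (set_val x); [move=> [w _ wx]; apply: nx; exists w|exact: iQ'].
    exists (psi v) => //; move=> [w wr /qi wv].
    by move: rv; rewrite -wv /= ltNge; rewrite wr.
  move=> [x nx <-]; have [[w _ wx]|nx'] := pselect (range psi x); last by left; exact: Bi.
  right; exists w; last by rewrite /k wx.
  by rewrite /= ltNge; apply/negP => wr; apply: nx; exists w.
Qed.

End ConnectedSum.

(** * Primeness of the quotient of a sphere *)

Section PrimeQuotient.
Variable R : realType.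
Local Notation E := 'rV[R]_3.

Lemma splits_homeo (N M : topologicalType) (h : M -> N) (h' : N -> M)
    (k : E -> N) (A B : set N) :
  cancel h h' -> cancel h' h -> continuous h -> continuous h' ->
  splits k A B -> splits (h' \o k) (h @^-1` A) (h @^-1` B).
Proof.
move=> hK hK' hc hc' [[ki kl kA kB] [AB cov oA oB]].
have op (S : set N) : open S -> open (h @^-1` S).
  by move=> oS; apply: open_comp => // z _; exact: hc.
have im (S : set E) : (h' \o k) @` S = h @^-1` (k @` S).
  apply/seteqP; split=> x; first by move=> [v Sv <-]; exists v => //=; rewrite hK'.
  by move=> [v Sv vx]; exists v => //=; rewrite vx hK.
split; split.
- by move=> v w Dv Dw /(can_inj hK') /(ki _ _ Dv Dw).
- move=> v Dv; apply: loc_homeo_comp; first exact: kl.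
  exact: loc_homeo_can hK' hK hc' hc _.
- by move=> v Dv /=; rewrite hK'; exact: kA.
- by move=> v Dv /=; rewrite hK'; exact: kB.
- by move=> x; exact: AB.
- by move=> x; rewrite im; exact: (cov (h x)).
- by move=> r r0; rewrite /open_core im -preimage_setU; apply: op; exact: oA.
- by move=> r r0; rewrite im -preimage_setU; apply: op; exact: oB.
Qed.

Lemma connected_sum_sides (P Q : topologicalType) (phi : E -> P) (psi : E -> Q) :
  hausdorff_space P -> hausdorff_space Q -> open_embedding phi -> open_embedding psi ->
  exists (jP : punctured phi -> connected_sum phi psi)
         (jQ : punctured psi -> connected_sum phi psi), glued_sides jP jQ.
Proof.
move=> hP hQ op oq.
have [pi pl] := (loc_homeo_embedding phi).1 op.
have [qi ql] := (loc_homeo_embedding psi).1 oq.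
pose X := {b : bool & punctured_pair phi psi b}.
pose inP (x : punctured phi) : X := existT (punctured_pair phi psi) true x.
pose inQ (y : punctured psi) : X := existT (punctured_pair phi psi) false y.
pose pr (p : X) : connected_sum phi psi :=
  \pi_{eq_quot (identified_equiv (@boundary_glued R P Q phi psi))} p.
have prE p q : pr p = pr q <->
    clos_refl_sym_trans X (@boundary_glued R P Q phi psi) p q.
  split=> [/eqmodP|h]; first by move=> /asboolP.
  by apply/eqmodP/asboolP.
(* A complete invariant of the classes: a boundary point of the second piece is sent to its partner
   in [P], and all other points stay. *)
pose c (p : X) : P + Q := match p with existT b z =>
  (if b as b0 return (punctured_pair phi psi b0 -> P + Q) then
    fun x => inl (set_val x)
  else fun y =>
    if `[< exists v, sphere v /\ set_val y = psi v >]
    then inl (phi (xget 0 [set v | sphere v /\ set_val y = psi v]))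
    else inr (set_val y)) z end.
have cP x : c (inP x) = inl (set_val x) by [].
have cQ v y : sphere v -> set_val y = psi v -> c (inQ y) = inl (phi v).
  move=> v1 yv; rewrite /c /inQ; case: asboolP => [_|[]]; last by exists v.
  by case: xgetP => [w _ [_ yw]|/(_ v)/=[]//]; rewrite (qi w v) // -yw.
have cQ' y : (forall v, sphere v -> set_val y <> psi v) -> c (inQ y) = inr (set_val y).
  by move=> ny; rewrite /c /inQ; case: asboolP => // -[v [v1 /ny]]; case.
have cE p q : clos_refl_sym_trans X (@boundary_glued R P Q phi psi) p q -> c p = c q.
  elim=> // {p q} [p q [x [y [v [v1 -> -> xv yv]]]]|p q r _ -> _ ->//].
  by rewrite -/(inP x) -/(inQ y) cP (cQ v y) // xv.
have vi (W : topologicalType) (f : E -> W) (y z : punctured f) :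
  set_val y = set_val z -> y = z by move=> yz; apply: val_inj.
exists (pr \o inP), (pr \o inQ); split; split=> //.
- split; first split.
  + move=> x; apply: continuous_comp; last exact: pi_continuous.
    exact: (@existT_continuous bool (punctured_pair phi psi) true).
  + move=> x; apply: continuous_comp; last exact: pi_continuous.
    exact: (@existT_continuous bool (punctured_pair phi psi) false).
  move=> U oP oQ; suff : open (pr @^-1` U) by [].
  by apply/sigT_openP => -[].
- split=> [x y /prE/cE|x y /prE/cE xy].
    by rewrite !cP => -[] /vi.
  have [[v [v1 xv]]|nx] := pselect (exists v, sphere v /\ set_val x = psi v);
  have [[w [w1 yw]]|ny] := pselect (exists v, sphere v /\ set_val y = psi v).
  + by move: xy; rewrite (cQ v) // (cQ w) // => -[] /pi vw; apply: vi; rewrite xv yw vw.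
  + move: xy; rewrite (cQ v) // (cQ' y) // => w w1 yw.
    by apply: ny; exists w.
  + move: xy; rewrite (cQ w y) // (cQ' x) // => v v1 xv.
    by apply: nx; exists v.
  + by move: xy; rewrite !cQ' => [[] /vi||] // v v1 xv; [apply: ny|apply: nx]; exists v.
- move=> x y; split=> [/prE/cE|[v [v1 xv yv]]].
    have [[v [v1 yv]]|ny] := pselect (exists v, sphere v /\ set_val y = psi v).
      by rewrite cP (cQ v) // => -[] xv; exists v.
    by rewrite cP cQ' // => v v1 yv; apply: ny; exists v.
  by apply/prE; apply: rst_step; exists x, y, v.
- move=> n; have [[[] z] zn] : exists p, pr p = n.
    by exists (repr n); rewrite /pr reprK.
  + by left; exists z.
  + by right; exists z.
Qed.

(** A surjective chart would make [R^3] compact. *)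
Lemma missed_point (P : topologicalType) (phi : E -> P) :
  compact [set: P] -> open_embedding phi -> exists x, ~ range phi x.
Proof.
move=> cP op; have [pi pl] := (loc_homeo_embedding phi).1 op.
apply: contrapT => nx; apply: (@not_compact_space R).
have sP x : exists v, phi v = x.
  have [[v _ vx]|nv] := pselect (range phi x); first by exists v.
  by case: nx; exists x.
have [q qP] := choice sP.
have qK : cancel phi q by move=> v; apply: pi.
rewrite (_ : [set: E] = q @` [set: P]).
  apply: continuous_compact => //; apply: continuous_subspaceT => x.
  by rewrite -(qP x); exact: (open_embedding_inv op qK).
by apply/seteqP; split=> // v _; exists (phi v).
Qed.

(** [i] carries [P] without [p] onto a cell, so both [P] and [T] are one-point compactifications of
    [R^3]. *)
Lemma summand_sphere (T P N : topologicalType) (p : P) (i : P -> N) (t : E -> N) (s : E -> T) (q : T) :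
  compact [set: P] -> hausdorff_space P -> compact [set: T] -> hausdorff_space T ->
  open_embedding s -> range s = ~` [set q] ->
  (forall x, x != p -> loc_homeo i x) ->
  (forall x y, x != p -> y != p -> i x = i y -> x = y) ->
  open_embedding t -> range t = i @` (~` [set p]) -> homeomorphic P T.
Proof.
move=> cP hP cT hT os sr il ii ot tr.
have [ti tl] := (loc_homeo_embedding t).1 ot.
have /choice[j jP] : forall n, exists x, (i @` (~` [set p])) n -> x != p /\ i x = n.
  move=> n; have [[x /eqP xp xn]|nn] := pselect ((i @` (~` [set p])) n); first by exists x.
  by exists p.
have jt v : j (t v) != p /\ i (j (t v)) = t v by apply: jP; rewrite -tr; exists v.
have jK x : x != p -> j (i x) = x.
  move=> xp; have [|jp ji] := jP (i x); first by exists x => //; exact/eqP.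
  exact: ii.
have onp : open (~` [set p]).
  by apply: closed_openC; apply: accessible_closed_set1; exact: hausdorff_accessible.
have jl v : loc_homeo j (t v).
  have [jp <-] := jt v; apply: (@loc_homeo_inv _ _ i j (~` [set p])) => //.
  - exact/eqP.
  - by move=> y /eqP; exact: jK.
  - by move=> y /eqP; exact: il.
apply: (@one_point_homeo R P T p q (j \o t) s) => //.
- apply/loc_homeo_embedding; split.
    by move=> v w /= vw; apply: ti; rewrite -(jt v).2 -(jt w).2 vw.
  by move=> v; apply: loc_homeo_comp; [exact: tl|exact: jl].
- apply/seteqP; split=> x; first by move=> [v _ <-]; apply/eqP; exact: (jt v).1.
  move=> /eqP xp; have : range t (i x) by rewrite tr; exists x => //; exact/eqP.
  by move=> [v _ vx]; exists v => //=; rewrite vx jK.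
Qed.

Section Cover.
Variables (T M : topologicalType) (g : T -> T) (pr : T -> M).
Hypotheses (cd : cover_data g pr) (cT : compact [set: T])
  (coT : connected [set: T])
  (charts : forall p : T, exists s : E -> T,
    open_embedding s /\ range s = ~` [set p]).
Variables (s0 : T) (pth : R -> T).
Hypotheses (pthc : continuous pth) (pth0 : forall t, t <= 0 -> pth t = s0)
  (pth1 : forall t, 1 <= t -> pth t = g s0).

Theorem cover_connected_sum (P Q : topologicalType) :
  compact [set: P] -> hausdorff_space P -> compact [set: Q] -> hausdorff_space Q ->
  is_connected_sum R M P Q -> homeomorphic P T \/ homeomorphic Q T.
Proof.
move=> cP hP cQ hQ [phi [psi [op oq [h [h' [hK hK' hc hc']]]]]].
have hT : hausdorff_space T by case: cd => -[].
have [jP [jQ gs]] := connected_sum_sides hP hQ op oq.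
have [k [A [B [i [i' [sN [il ii] [il' ii'] [cA cB] [Ai Bi]]]]]]] := sides_split gs.
have sM := splits_homeo hK hK' hc hc' sN.
have [||t [ot tr]] := innermost_side cd cT coT charts pthc pth0 pth1 sM.
- by have [x /Ai Ax] := missed_point cP op; exists (h' (i x)); rewrite /= hK'.
- by have [x /Bi Bx] := missed_point cQ oq; exists (h' (i' x)); rewrite /= hK'.
have [s [os sr]] := charts s0.
have oht : open_embedding (h \o t).
  by apply: (open_embedding_comp ot); exact: open_embedding_homeo hK hK' hc hc'.
have htr (S : set _) : range t = cored (h' \o k) (h @^-1` S) ->
    range (h \o t) = cored k S.
  move=> tS; have tv v : cored (h' \o k) (h @^-1` S) (t v) by rewrite -tS; exists v.
  have tn n : cored (h' \o k) (h @^-1` S) (h' n) -> range (h \o t) n.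
    by rewrite -tS => -[v _ vt]; exists v => //=; rewrite vt hK'.
  apply/seteqP; split=> n.
    move=> [v _ <-] /=; have [Sm|[w Dw wt]] := tv v; first by left.
    by right; exists w => //; rewrite -wt /= hK'.
  move=> [Sn|[v Dv <-]]; apply: tn; first by left; rewrite /= hK'.
  by right; exists v.
case: tr => /htr tr; [left|right].
- by apply: (@summand_sphere T P _ (phi 0) i (h \o t) s s0) => //; rewrite tr.
- by apply: (@summand_sphere T Q _ (psi 0) i' (h \o t) s s0) => //; rewrite tr.
Qed.

Theorem cover_not_sphere : ~ homeomorphic M T.
Proof.
move=> [h [h' [hK hK' hc hc']]].
have [F FP] := total_liftable cd charts s0 (fun z _ => hc' z).
have [[hT gc g3 gx] [pc po ps pE]] := cd.
(* [F \o h] is a section of the covering; its image would be clopen. *)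
pose S := [set x | F (h (pr x)) = x].
have Fc x : {for x, continuous (fun x => F (h (pr x)))}.
  apply: (@continuous_comp _ _ _ (h \o pr) F); last exact: (FP _ I).1.
  by apply: continuous_comp; [exact: pc|exact: hc].
have FE x : pr (F (h (pr x))) = pr x by rewrite (FP _ I).2 hK.
have ST : forall x, S x.
  have [x Sx] : exists x, S x by exists (F (h (pr s0))); rewrite /S /= FE.
  move=> y; apply: (@lift_unique _ _ _ _ cd _ setT (fun x => F (h (pr x))) id x) => //.
  by move=> z _; exact: cvg_id.
have := ST (g s0); rewrite /S /= (pr_g cd) (ST s0) => /esym/eqP.
by rewrite (negbTE (gx _)).
Qed.

End Cover.
End PrimeQuotient.

(** * The 3-sphere and the lens space *)

Section Quaternions.
Variable R : realType.
Local Notation E := 'rV[R]_3.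
Local Notation V4 := 'rV[R]_4.

Definition k0 : 'I_4 := @Ordinal 4 0 isT.
Definition k1 : 'I_4 := @Ordinal 4 1 isT.
Definition k2 : 'I_4 := @Ordinal 4 2 isT.
Definition k3 : 'I_4 := @Ordinal 4 3 isT.

Definition row4 (a b c d : R) : V4 := \row_j nth 0 [:: a; b; c; d] j.

Lemma row4E a b c d :
  ((row4 a b c d 0 k0 = a) * (row4 a b c d 0 k1 = b) *
   (row4 a b c d 0 k2 = c) * (row4 a b c d 0 k3 = d))%type.
Proof. by rewrite !mxE. Qed.

Lemma ord4P (P : 'I_4 -> Prop) : P k0 -> P k1 -> P k2 -> P k3 -> forall k, P k.
Proof.
move=> P0 P1 P2 P3 k; have : k \in [:: k0; k1; k2; k3] by case: k => -[|[|[|[|]]]].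
by rewrite !inE => /or4P[] /eqP ->.
Qed.

Lemma row4K (x : V4) : row4 (x 0 k0) (x 0 k1) (x 0 k2) (x 0 k3) = x.
Proof. by apply/rowP; apply: ord4P; rewrite row4E. Qed.

Lemma row4P (x y : V4) : x 0 k0 = y 0 k0 -> x 0 k1 = y 0 k1 ->
  x 0 k2 = y 0 k2 -> x 0 k3 = y 0 k3 -> x = y.
Proof. by move=> h0 h1 h2 h3; rewrite -(row4K x) -(row4K y) h0 h1 h2 h3. Qed.

Lemma sum4 (f : 'I_4 -> R) : \sum_i f i = f k0 + f k1 + f k2 + f k3.
Proof.
rewrite !big_ord_recl big_ord0 addr0 !addrA.
by congr (_ + _ + _ + _); congr f; apply: val_inj.
Qed.

Lemma sqnorm4 (x : V4) : sqnorm x = x 0 k0 ^+ 2 + x 0 k1 ^+ 2 + x 0 k2 ^+ 2 + x 0 k3 ^+ 2.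
Proof. exact: sum4. Qed.

Definition qmul (x y : V4) : V4 :=
  row4 (x 0 k0 * y 0 k0 - x 0 k1 * y 0 k1 - x 0 k2 * y 0 k2 - x 0 k3 * y 0 k3)
       (x 0 k0 * y 0 k1 + x 0 k1 * y 0 k0 + x 0 k2 * y 0 k3 - x 0 k3 * y 0 k2)
       (x 0 k0 * y 0 k2 - x 0 k1 * y 0 k3 + x 0 k2 * y 0 k0 + x 0 k3 * y 0 k1)
       (x 0 k0 * y 0 k3 + x 0 k1 * y 0 k2 - x 0 k2 * y 0 k1 + x 0 k3 * y 0 k0).

Definition qconj (x : V4) : V4 :=
  row4 (x 0 k0) (- x 0 k1) (- x 0 k2) (- x 0 k3).

Definition q1 : V4 := row4 1 0 0 0.

Lemma qmulA x y z : qmul x (qmul y z) = qmul (qmul x y) z.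
Proof. by apply: row4P; rewrite /qmul !row4E; ring. Qed.

Lemma qmul1 x : qmul q1 x = x.
Proof. by apply: row4P; rewrite /qmul /q1 !row4E; ring. Qed.

Lemma qmulr1 x : qmul x q1 = x.
Proof. by apply: row4P; rewrite /qmul /q1 !row4E; ring. Qed.

Lemma qmulV x : qmul x (qconj x) = sqnorm x *: q1.
Proof. by apply: row4P; rewrite /qmul /qconj /q1 sqnorm4 !mxE /=; ring. Qed.

Lemma qVmul x : qmul (qconj x) x = sqnorm x *: q1.
Proof. by apply: row4P; rewrite /qmul /qconj /q1 sqnorm4 !mxE /=; ring. Qed.

Lemma qmulZl a x y : qmul (a *: x) y = a *: qmul x y.
Proof. by apply: row4P; rewrite /qmul !mxE /=; ring. Qed.

Lemma qmulZr a x y : qmul x (a *: y) = a *: qmul x y.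
Proof. by apply: row4P; rewrite /qmul !mxE /=; ring. Qed.

Lemma qmulDl x y z : qmul (x + y) z = qmul x z + qmul y z.
Proof. by apply: row4P; rewrite /qmul !mxE /=; ring. Qed.

Lemma qmulDr x y z : qmul x (y + z) = qmul x y + qmul x z.
Proof. by apply: row4P; rewrite /qmul !mxE /=; ring. Qed.

Lemma sqnorm_qmul x y : sqnorm (qmul x y) = sqnorm x * sqnorm y.
Proof. by rewrite !sqnorm4 /qmul !row4E; ring. Qed.

Lemma sqnorm_qconj x : sqnorm (qconj x) = sqnorm x.
Proof. by rewrite !sqnorm4 /qconj !row4E; ring. Qed.

Lemma sqnorm_q1 : sqnorm q1 = 1.
Proof. by rewrite sqnorm4 /q1 !row4E; ring. Qed.

Lemma row4_cont (X : topologicalType) (x : X) (a b c d : X -> R) :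
  {for x, continuous a} -> {for x, continuous b} -> {for x, continuous c} ->
  {for x, continuous d} -> {for x, continuous (fun y => row4 (a y) (b y) (c y) (d y))}.
Proof.
move=> ac bc cc dc N [/= B Bn BN].
have nb (f : X -> R) (k : 'I_4) : {for x, continuous f} ->
    f x = row4 (a x) (b x) (c x) (d x) 0 k -> nbhs x (f @^-1` B 0 k).
  by move=> fc fx; apply: fc; rewrite fx; exact: Bn.
have na : nbhs x (a @^-1` B 0 k0) by apply: nb => //; rewrite row4E.
have nb' : nbhs x (b @^-1` B 0 k1) by apply: nb => //; rewrite row4E.
have nc : nbhs x (c @^-1` B 0 k2) by apply: nb => //; rewrite row4E.
have nd : nbhs x (d @^-1` B 0 k3) by apply: nb => //; rewrite row4E.
apply: nbhsS (filterI (filterI na nb') (filterI nc nd)) => y [[ya yb] [yc yd]].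
apply: BN => i; rewrite (ord1 i); apply: ord4P; rewrite row4E.
- exact: ya.
- exact: yb.
- exact: yc.
- exact: yd.
Qed.

Lemma coord4_cont (X : topologicalType) (x : X) (f : X -> V4) k :
  {for x, continuous f} -> {for x, continuous (fun y => f y 0 k)}.
Proof.
move=> fc; apply: (@cont_comp _ _ _ _ f (fun v : V4 => v 0 k)) => //.
exact: coord_continuous.
Qed.

Lemma qmul_cont (X : topologicalType) (x : X) (f h : X -> V4) :
  {for x, continuous f} -> {for x, continuous h} ->
  {for x, continuous (fun y => qmul (f y) (h y))}.
Proof.
move=> fc hc; have fk k := @coord4_cont X x f k fc; have hk k := @coord4_cont X x h k hc.
apply: row4_cont.
- by apply: cont_subr; [apply: cont_subr; [apply: cont_subr|]|]; apply: cont_mul.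
- by apply: cont_subr; [apply: cont_addr; [apply: cont_addr|]|]; apply: cont_mul.
- by apply: cont_addr; [apply: cont_addr; [apply: cont_subr|]|]; apply: cont_mul.
- by apply: cont_addr; [apply: cont_subr; [apply: cont_addr|]|]; apply: cont_mul.
Qed.

Lemma qconj_cont (X : topologicalType) (x : X) (f : X -> V4) :
  {for x, continuous f} -> {for x, continuous (fun y => qconj (f y))}.
Proof.
move=> fc; have fk k := @coord4_cont X x f k fc.
have opp (h : X -> R) : {for x, continuous h} -> {for x, continuous (fun y => - h y)}.
  by move=> hc; exact: (@cvgN _ R^o _ _ _ h _ hc).
by apply: row4_cont; try apply: opp.
Qed.

End Quaternions.

(** * The group of unit quaternions *)

Section Sphere.
Variable R : realType.
Local Notation E := 'rV[R]_3.
Local Notation V4 := 'rV[R]_4.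
Local Notation T := (S3 R).

Definition sval3 (x : T) : V4 := set_val x.

Lemma sval3_sphere (x : T) : sqnorm (sval3 x) = 1.
Proof. by have /set_mem := valP x. Qed.

Lemma sval3_inj : injective sval3.
Proof. exact: val_inj. Qed.

Lemma sval3_continuous : continuous sval3.
Proof. exact: initial_continuous. Qed.

Lemma sphere_cont (X : topologicalType) (x : X) (f : X -> T) :
  {for x, continuous (fun y => sval3 (f y))} -> {for x, continuous f}.
Proof.
move=> fc N; rewrite nbhsE => -[B [[V oV VB] By] BN].
have : nbhs x ((fun y => sval3 (f y)) @^-1` V).
  by apply: fc; apply: open_nbhs_nbhs; split=> //; move: By; rewrite -VB.
by apply: nbhsS => y Vy; apply: BN; rewrite -VB.
Qed.

Definition unit4 (x : V4) : V4 :=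
  if x == 0 then q1 R else (Num.sqrt (sqnorm x))^-1 *: x.

Lemma unit4_sphere x : (@sphere R 3) (unit4 x).
Proof.
rewrite /sphere /= /unit4; case: eqVneq => [_|x0]; first exact: sqnorm_q1.
rewrite sqnormZ exprVn sqr_sqrtr ?sqnorm_ge0 // mulVf //.
by rewrite sqnorm_eq0.
Qed.

(** Lets any nonzero vector on a ray stand for its point of the sphere; the value at 0 is
    arbitrary. *)
Definition toS (x : V4) : T := exist _ (unit4 x) (mem_set (unit4_sphere x)).

Lemma sval3_toS x : sval3 (toS x) = unit4 x. Proof. by []. Qed.

Lemma unit4_id x : sqnorm x = 1 -> unit4 x = x.
Proof.
move=> x1; rewrite /unit4 x1 sqrtr1 invr1 scale1r ifN //.
by rewrite -sqnorm_gt0 x1.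
Qed.

Lemma toSK (x : T) : toS (sval3 x) = x.
Proof. by apply: sval3_inj; rewrite sval3_toS unit4_id // sval3_sphere. Qed.

Lemma toSZ a (x : V4) : 0 < a -> toS (a *: x) = toS x.
Proof.
move=> a0; apply: sval3_inj; rewrite !sval3_toS /unit4 scaler_eq0 gt_eqF //=.
case: eqP => // /eqP x0.
rewrite sqnormZ sqrtrM ?sqr_ge0 // sqrtr_sqr ger0_norm ?(ltW a0) // invfM scalerA.
by rewrite mulrAC mulVf ?mul1r // gt_eqF.
Qed.

Lemma toS_eq (x y : V4) : x != 0 -> y != 0 -> toS x = toS y ->
  exists2 a, 0 < a & y = a *: x.
Proof.
move=> x0 y0 /(congr1 sval3); rewrite !sval3_toS /unit4 (negbTE x0) (negbTE y0) => xy.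
have sx : 0 < Num.sqrt (sqnorm x) by rewrite sqrtr_gt0 sqnorm_gt0.
have sy : 0 < Num.sqrt (sqnorm y) by rewrite sqrtr_gt0 sqnorm_gt0.
exists (Num.sqrt (sqnorm y) / Num.sqrt (sqnorm x)); first by rewrite divr_gt0.
by rewrite -scalerA xy scalerA divff ?scale1r // gt_eqF.
Qed.

Lemma toS_sval (x : V4) : x != 0 -> exists2 a, 0 < a & sval3 (toS x) = a *: x.
Proof.
move=> x0; exists (Num.sqrt (sqnorm x))^-1.
  by rewrite invr_gt0 sqrtr_gt0 sqnorm_gt0.
by rewrite sval3_toS /unit4 (negbTE x0).
Qed.

Lemma toS_cont (X : topologicalType) (x : X) (f : X -> V4) : f x != 0 ->
  {for x, continuous f} -> {for x, continuous (fun y => toS (f y))}.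
Proof.
move=> fx fc; apply: sphere_cont.
apply: (@continuous_near _ _ (fun y => (Num.sqrt (sqnorm (f y)))^-1 *: f y)).
  have : nbhs x (f @^-1` (~` [set 0])).
    apply: fc; apply: open_nbhs_nbhs; split; last exact/eqP.
    by apply: closed_openC; apply: accessible_closed_set1;
      apply: hausdorff_accessible; exact: norm_hausdorff.
  by apply: nbhsS => y /eqP fy; rewrite sval3_toS /unit4 (negbTE fy).
apply: (@cont_scale R X x V4) => //; apply: cont_inv.
  by rewrite gt_eqF // sqrtr_gt0 sqnorm_gt0.
apply: (@cont_comp _ _ _ _ (fun y => sqnorm (f y)) Num.sqrt); last exact: sqrt_continuous.
by apply: cont_comp fc _; exact: sqnorm_continuous.
Qed.

Lemma qmul_neq0 (x y : V4) : x != 0 -> y != 0 -> qmul x y != 0.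
Proof. by rewrite -!sqnorm_gt0 sqnorm_qmul => x0 y0; rewrite mulr_gt0. Qed.

Definition smul (x y : T) : T := toS (qmul (sval3 x) (sval3 y)).

Lemma sval3_smul x y : sval3 (smul x y) = qmul (sval3 x) (sval3 y).
Proof. by rewrite sval3_toS unit4_id // sqnorm_qmul !sval3_sphere mulr1. Qed.

Definition sinv (x : T) : T := toS (qconj (sval3 x)).

Lemma sval3_sinv x : sval3 (sinv x) = qconj (sval3 x).
Proof. by rewrite sval3_toS unit4_id // sqnorm_qconj sval3_sphere. Qed.

Definition s1 : T := toS (q1 R).

Lemma sval3_s1 : sval3 s1 = q1 R.
Proof. by rewrite sval3_toS unit4_id // sqnorm_q1. Qed.

Lemma smulA x y z : smul x (smul y z) = smul (smul x y) z.
Proof. by apply: sval3_inj; rewrite !sval3_smul qmulA. Qed.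

Lemma smul1 x : smul s1 x = x.
Proof. by apply: sval3_inj; rewrite sval3_smul sval3_s1 qmul1. Qed.

Lemma smulr1 x : smul x s1 = x.
Proof. by apply: sval3_inj; rewrite sval3_smul sval3_s1 qmulr1. Qed.

Lemma smulV x : smul x (sinv x) = s1.
Proof.
by apply: sval3_inj; rewrite sval3_smul sval3_sinv sval3_s1 qmulV sval3_sphere scale1r.
Qed.

Lemma sVmul x : smul (sinv x) x = s1.
Proof.
by apply: sval3_inj; rewrite sval3_smul sval3_sinv sval3_s1 qVmul sval3_sphere scale1r.
Qed.

Lemma smul_cont (X : topologicalType) (x : X) (f h : X -> T) :
  {for x, continuous f} -> {for x, continuous h} ->
  {for x, continuous (fun y => smul (f y) (h y))}.
Proof.
move=> fc hc; apply: toS_cont.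
  by apply: qmul_neq0; rewrite -sqnorm_gt0 sval3_sphere.
have sc (f' : X -> T) : {for x, continuous f'} ->
    {for x, continuous (fun y => sval3 (f' y))}.
  by move=> fc'; exact: (@cont_comp X x T V4 f' sval3 fc' (@sval3_continuous (f' x))).
exact: (@qmul_cont R X x _ _ (sc f fc) (sc h hc)).
Qed.

Lemma smulr_continuous p : continuous (fun x => smul x p).
Proof. by move=> x; exact: (@smul_cont T x id (fun=> p) (@cont_id _ x) (@cont_cst _ x _ p)). Qed.

Lemma smull_continuous p : continuous (fun x => smul p x).
Proof. by move=> x; exact: (@smul_cont T x (fun=> p) id (@cont_cst _ x _ p) (@cont_id _ x)). Qed.

Lemma mulr_homeo (p : T) : open_embedding (fun x => smul x p).
Proof.
apply: (@open_embedding_homeo _ _ _ (fun x => smul x (sinv p))).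
- by move=> x; rewrite -smulA smulV smulr1.
- by move=> x; rewrite -smulA sVmul smulr1.
- exact: smulr_continuous.
- exact: smulr_continuous.
Qed.

Lemma sphere_hausdorff : hausdorff_space T.
Proof.
have h : hausdorff_space V4 by exact: norm_hausdorff.
move=> x y xy; apply: sval3_inj; apply: h => A B Ax By.
have [z [Az Bz]] := xy _ _ (sval3_continuous Ax) (sval3_continuous By).
by exists (sval3 z).
Qed.

Lemma sphere_compact : compact [set: T].
Proof.
have cS : compact (@sphere R 3).
  apply: bounded_closed_compact.
    exists 1; split; first exact: num_real.
    move=> s s1' v /= v1; apply: le_trans (ltW s1').
    have := norm_le_sqnorm v; rewrite v1 => h.
    by rewrite -(@expr_le1 _ 2).
  apply: (@preimage_closed _ _ (@sqnorm R 4) [set 1]).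
    by move=> v _; exact: sqnorm_continuous.
  by apply: accessible_closed_set1; apply: hausdorff_accessible; exact: Rhausdorff.
rewrite (_ : [set: T] = toS @` (@sphere R 3)).
  apply: continuous_compact cS; apply: continuous_in_subspaceT => v /set_mem v1.
  by apply: (@toS_cont V4 v id); [rewrite -sqnorm_gt0 v1|exact: cont_id].
by apply/seteqP; split=> // x _; exists (sval3 x); [exact: sval3_sphere|exact: toSK].
Qed.

End Sphere.

(** * Stereographic charts and connectedness of the sphere *)

Section SphereCharts.
Variable R : realType.
Local Notation E := 'rV[R]_3.
Local Notation V4 := 'rV[R]_4.
Local Notation T := (S3 R).

Lemma open_embedding_pinv (X Y : topologicalType) (f : X -> Y) (h : Y -> X) (D : set Y) :
  continuous f -> cancel f h -> open D -> (forall x, D (f x)) ->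
  (forall y, D y -> f (h y) = y) -> (forall y, D y -> {for y, continuous h}) ->
  open_embedding f /\ range f = D.
Proof.
move=> fc fK oD fD hK hc; split.
  apply/open_embeddingP; split=> //; first exact: can_inj fK.
  move=> x N Nx.
  have n1 : nbhs (f x) (h @^-1` N) by apply: hc; rewrite ?fK.
  have n2 : nbhs (f x) D by exact: open_nbhs_nbhs.
  by apply: nbhsS (filterI n1 n2) => y [Ny Dy]; exists (h y) => //; exact: hK.
apply/seteqP; split=> [_ [x _ <-]//|y Dy]; exists (h y) => //; exact: hK.
Qed.

Definition j0 : 'I_3 := @Ordinal 3 0 isT.
Definition j1 : 'I_3 := @Ordinal 3 1 isT.
Definition j2 : 'I_3 := @Ordinal 3 2 isT.

Definition row3 (a b c : R) : E := \row_j nth 0 [:: a; b; c] j.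

Lemma row3E a b c :
  ((row3 a b c 0 j0 = a) * (row3 a b c 0 j1 = b) * (row3 a b c 0 j2 = c))%type.
Proof. by rewrite !mxE. Qed.

Lemma ord3P (P : 'I_3 -> Prop) : P j0 -> P j1 -> P j2 -> forall k, P k.
Proof.
move=> P0 P1 P2 k; have : k \in [:: j0; j1; j2] by case: k => -[|[|[|]]].
by rewrite !inE => /or3P[] /eqP ->.
Qed.

Lemma row3P (x y : E) : x 0 j0 = y 0 j0 -> x 0 j1 = y 0 j1 ->
  x 0 j2 = y 0 j2 -> x = y.
Proof. by move=> h0 h1 h2; apply/rowP; exact: ord3P. Qed.

Lemma sum3 (f : 'I_3 -> R) : \sum_i f i = f j0 + f j1 + f j2.
Proof.
rewrite !big_ord_recl big_ord0 addr0 !addrA.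
by congr (_ + _ + _); congr f; apply: val_inj.
Qed.

Lemma row3_cont (X : topologicalType) (x : X) (a b c : X -> R) :
  {for x, continuous a} -> {for x, continuous b} -> {for x, continuous c} ->
  {for x, continuous (fun y => row3 (a y) (b y) (c y))}.
Proof.
move=> ac bc cc N [/= B Bn BN].
have nb (f : X -> R) (k : 'I_3) : {for x, continuous f} ->
    f x = row3 (a x) (b x) (c x) 0 k -> nbhs x (f @^-1` B 0 k).
  by move=> fc fx; apply: fc; rewrite fx; exact: Bn.
have na : nbhs x (a @^-1` B 0 j0) by apply: nb => //; rewrite row3E.
have nb' : nbhs x (b @^-1` B 0 j1) by apply: nb => //; rewrite row3E.
have nc : nbhs x (c @^-1` B 0 j2) by apply: nb => //; rewrite row3E.
apply: nbhsS (filterI (filterI na nb') nc) => y [[ya yb] yc].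
apply: BN => i; rewrite (ord1 i); apply: ord3P; rewrite row3E.
- exact: ya.
- exact: yb.
- exact: yc.
Qed.

Lemma coord3_cont (X : topologicalType) (x : X) (f : X -> E) k :
  {for x, continuous f} -> {for x, continuous (fun y => f y 0 k)}.
Proof.
move=> fc; apply: (@cont_comp _ _ _ _ f (fun v : E => v 0 k)) => //.
exact: coord_continuous.
Qed.

Lemma sval3_coord_cont k : continuous (fun x : T => sval3 x 0 k).
Proof. by move=> x; exact: (@coord4_cont R T x (@sval3 R) k (@sval3_continuous R x)). Qed.

(** Inverse stereographic projection from [s1] in homogeneous form; the vector has length
    [sqnorm v + 1]. *)
Definition stereo (v : E) : T :=
  toS (row4 (sqnorm v - 1) (2 * v 0 j0) (2 * v 0 j1) (2 * v 0 j2)).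

Definition unstereo (x : T) : E :=
  (1 - sval3 x 0 k0)^-1 *: row3 (sval3 x 0 k1) (sval3 x 0 k2) (sval3 x 0 k3).

Lemma sqnorm3 (v : E) : sqnorm v = v 0 j0 ^+ 2 + v 0 j1 ^+ 2 + v 0 j2 ^+ 2.
Proof. exact: sum3. Qed.

Lemma sval3_stereo v : sval3 (stereo v) =
  (sqnorm v + 1)^-1 *: row4 (sqnorm v - 1) (2 * v 0 j0) (2 * v 0 j1) (2 * v 0 j2).
Proof.
have s0 : 0 < sqnorm v + 1 by rewrite ltr_wpDl ?sqnorm_ge0.
have h : sqnorm (row4 (sqnorm v - 1) (2 * v 0 j0) (2 * v 0 j1) (2 * v 0 j2)) = (sqnorm v + 1) ^+ 2.
  by rewrite sqnorm4 !row4E sqnorm3; ring.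
rewrite /stereo sval3_toS /unit4 ifN; last first.
  by rewrite -sqnorm_eq0 h expf_neq0 // gt_eqF.
by rewrite h sqrtr_sqr ger0_norm // ltW.
Qed.

Lemma stereo_k0 v : sval3 (stereo v) 0 k0 = (sqnorm v - 1) / (sqnorm v + 1).
Proof. by rewrite sval3_stereo mxE row4E mulrC. Qed.

Lemma s1_k0 (x : T) : (sval3 x 0 k0 == 1) = (x == s1 R).
Proof.
apply/eqP/eqP => [x0|->]; last by rewrite sval3_s1 row4E.
have := sval3_sphere x; rewrite sqnorm4 x0 expr1n => h.
have h3 : sval3 x 0 k1 ^+ 2 + sval3 x 0 k2 ^+ 2 + sval3 x 0 k3 ^+ 2 = 0 by lra.
move/eqP: h3; rewrite !paddr_eq0 ?addr_ge0 ?sqr_ge0 // !sqrf_eq0 => /andP[/andP[/eqP a /eqP b] /eqP c].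
by apply: sval3_inj; rewrite sval3_s1; apply: row4P; rewrite row4E.
Qed.

Lemma stereo_embedding : open_embedding stereo /\ range stereo = ~` [set s1 R].
Proof.
have s0 v : 0 < sqnorm (v : E) + 1 by rewrite ltr_wpDl ?sqnorm_ge0.
apply: (@open_embedding_pinv _ _ stereo unstereo).
- move=> v; apply: (@toS_cont R E v (fun v : E => row4 (sqnorm v - 1) (2 * v 0 j0) (2 * v 0 j1) (2 * v 0 j2))).
    rewrite -sqnorm_gt0 sqnorm4 !row4E.
    rewrite (_ : _ + _ = (sqnorm v + 1) ^+ 2); last by rewrite sqnorm3; ring.
    by rewrite exprn_gt0.
  have cc k : {for v, continuous (fun v : E => 2 * v 0 k)}.
    by apply: (@cont_mul R E v (fun=> 2)); [exact: cont_cst|exact: coord_continuous].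
  apply: row4_cont => //.
  by apply: (@cont_subr R E v (@sqnorm R 3) (fun=> 1)); [exact: sqnorm_continuous|exact: cont_cst].
- move=> v; rewrite /unstereo stereo_k0 sval3_stereo.
  have s1 := s0 v; have s2 : sqnorm v + 1 != 0 by rewrite gt_eqF.
  have -> : 1 - (sqnorm v - 1) / (sqnorm v + 1) = 2 / (sqnorm v + 1) by field.
  by apply: row3P; rewrite !mxE /=; field.
- apply: closed_openC; apply: accessible_closed_set1; apply: hausdorff_accessible.
  exact: sphere_hausdorff.
- move=> v; apply/eqP; rewrite -s1_k0 stereo_k0.
  by rewrite -subr_eq0; apply/eqP => h; have := s0 v => s1;
    have : (sqnorm v - 1) / (sqnorm v + 1) * (sqnorm v + 1) = sqnorm v + 1;
    [rewrite -[X in X * _](subrK 1) h add0r mul1r|rewrite divfK ?gt_eqF // => h2; lra].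
- move=> x /eqP; rewrite -s1_k0 => x0.
  have x1 : 1 - sval3 x 0 k0 != 0 by rewrite subr_eq0 eq_sym.
  have h := sval3_sphere x; rewrite sqnorm4 in h.
  set a := sval3 x 0 k0 in h x0 x1 *; set b := sval3 x 0 k1 in h *.
  set c := sval3 x 0 k2 in h *; set d := sval3 x 0 k3 in h *.
  have a2 : a ^+ 2 <= 1 by have := sqr_ge0 b; have := sqr_ge0 c; have := sqr_ge0 d; lra.
  have a1 : a < 1.
    rewrite lt_neqAle x0 /=; have [a0|a0] := leP 0 a; last by apply: ltW; apply: lt_trans a0 _.
    by have := a2; rewrite -[leRHS](expr1n _ 2) ler_sqr ?nnegrE.
  have sq : sqnorm (unstereo x) = (1 + a) / (1 - a).
    rewrite /unstereo sqnormZ sqnorm3 !row3E -/a -/b -/c -/d.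
    have -> : b ^+ 2 + c ^+ 2 + d ^+ 2 = (1 - a) * (1 + a) by rewrite -subr_sqr expr1n; lra.
    by field.
  apply: sval3_inj; rewrite sval3_stereo sq.
  have -> : (1 + a) / (1 - a) + 1 = 2 / (1 - a) by field.
  by apply: row4P; rewrite !mxE /= -/a -/b -/c -/d; field.
- move=> x /eqP; rewrite -s1_k0 => x0; apply: (@cont_scale R T x E).
    apply: cont_inv; first by rewrite subr_eq0 eq_sym.
    by apply: (@cont_subr R T x (fun=> 1)); [exact: cont_cst|exact: sval3_coord_cont].
  by apply: row3_cont; exact: sval3_coord_cont.
Qed.

Lemma sphere_charts (p : T) : exists s : E -> T,
  open_embedding s /\ range s = ~` [set p].
Proof.
have [os sr] := stereo_embedding.
exists ((fun x => smul x p) \o stereo); split.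
  by apply: open_embedding_comp os _; exact: mulr_homeo.
apply/seteqP; split=> x.
  move=> [v _ <-] /= vp; have : range stereo (s1 R).
    exists v => //; have := congr1 (fun y => smul y (sinv p)) vp.
    by rewrite -smulA !smulV smulr1.
  by rewrite sr; apply.
move=> xp; have : range stereo (smul x (sinv p)).
  rewrite sr => h; apply: xp; have := congr1 (fun y => smul y p) h.
  by rewrite -smulA sVmul smulr1 smul1.
by move=> [v _ vx]; exists v => //=; rewrite vx -smulA sVmul smulr1.
Qed.

Definition sm1 : T := toS (- q1 R).

Lemma sphere_connected : connected [set: T].
Proof.
have [s [os sr]] := sphere_charts (s1 R).
have [s' [os' sr']] := sphere_charts sm1.
have n1 : sm1 != s1 R.
  apply/eqP => /(congr1 (@sval3 R)); rewrite sval3_s1 sval3_toS unit4_id.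
    move=> /(congr1 (fun v : V4 => v 0 k0)); rewrite mxE /q1 row4E => h.
    by move: h; clear => h; lra.
  by rewrite -scaleN1r sqnormZ sqnorm_q1; ring.
have cs (t : E -> T) : open_embedding t -> connected (range t).
  move=> [ti tc _]; apply: connected_continuous_connected; last exact: continuous_subspaceT.
  by apply: (@star_connected R setT 0).
have -> : [set: T] = range s `|` range s'.
  apply/seteqP; split=> // x _; rewrite sr sr'.
  have [->|] := pselect (x = s1 R); last by left.
  by right=> /esym/eqP; rewrite (negbTE n1).
apply: connectedU (cs _ os) (cs _ os').
pose x : T := toS (row4 0 1 0 0).
have xE : sval3 x = row4 0 1 0 0.
  by rewrite sval3_toS unit4_id // sqnorm4 !row4E; ring.
exists x; rewrite sr sr'; split=> /= /(congr1 (@sval3 R)); rewrite xE ?sval3_s1.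
  by move=> /rowP/(_ k0); rewrite !mxE /= => /eqP; rewrite eq_sym oner_eq0.
rewrite sval3_toS unit4_id; last by rewrite -scaleN1r sqnormZ sqnorm_q1; ring.
by move=> /rowP/(_ k0); rewrite !mxE /= => /eqP; rewrite eq_sym oppr_eq0 oner_eq0.
Qed.

End SphereCharts.

Lemma orbit3_closed (X : Type) (g : X -> X) : (forall x, g (g (g x)) = x) ->
  forall x y, clos_refl_sym_trans X (fun x y => y = g x) x y ->
  [\/ y = x, y = g x | y = g (g x)].
Proof.
move=> g3 x y; elim=> {x y} [x y ->|x|x y _ [->|->|->]|x y z _ [->|->|->] _ [->|->|->]];
  rewrite ?g3; by [apply: Or31|apply: Or32|apply: Or33].
Qed.

(** * The lens space as a quotient of the sphere *)

Section LensSpace.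
Variable R : realType.
Local Notation E := 'rV[R]_3.
Local Notation V4 := 'rV[R]_4.
Local Notation T := (S3 R).

Definition rt3 : R := Num.sqrt 3.

Lemma rt3_gt0 : 0 < rt3. Proof. by rewrite sqrtr_gt0. Qed.
Lemma rt3_sqr : rt3 ^+ 2 = 3. Proof. by rewrite sqr_sqrtr. Qed.

Definition qom : V4 := row4 (- (1 / 2)) (rt3 / 2) 0 0.

Lemma sqnorm_qom : sqnorm qom = 1.
Proof. by rewrite sqnorm4 !row4E expr0n /= !addr0 sqrrN !expr_div_n rt3_sqr; field. Qed.

Definition om : T := toS qom.

Lemma sval3_om : sval3 om = qom.
Proof. by rewrite sval3_toS unit4_id // sqnorm_qom. Qed.

Lemma qom2 : qmul qom qom = row4 (- (1 / 2)) (- (rt3 / 2)) 0 0.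
Proof.
have h := rt3_sqr; rewrite expr2 in h.
apply: row4P; rewrite /qmul !row4E; try ring; last by field.
have -> : rt3 / 2 * (rt3 / 2) = rt3 * rt3 / 4 by field.
by rewrite h; field.
Qed.

Lemma om3 : smul om (smul om om) = s1 R.
Proof.
apply: sval3_inj; rewrite !sval3_smul sval3_om sval3_s1 qom2.
have h := rt3_sqr; rewrite expr2 in h.
apply: row4P; rewrite /qmul /q1 !row4E; try ring.
have -> : rt3 / 2 * - (rt3 / 2) = - (rt3 * rt3 / 4) by field.
by rewrite h; field.
Qed.

Definition rot (x : T) : T := smul om x.

Lemma rot3 x : rot (rot (rot x)) = x.
Proof. by rewrite /rot !smulA -(smulA om) om3 smul1. Qed.

Lemma om_neq1 : om != s1 R.
Proof.
apply/eqP => /(congr1 (@sval3 R)); rewrite sval3_om sval3_s1 => /rowP/(_ k0).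
by rewrite !row4E => h; lra.
Qed.

Lemma rot_neq x : rot x != x.
Proof.
apply: contra_neq om_neq1 => h; have := congr1 (fun y => smul y (sinv x)) h.
by rewrite -smulA smulV smulr1.
Qed.

Definition lens : topologicalType := identification_space (fun x y : T => y = rot x).

Definition lpr (x : T) : lens :=
  \pi_{eq_quot (identified_equiv (fun x y : T => y = rot x))} x.

Lemma lprE x y : lpr x = lpr y <-> [\/ y = x, y = rot x | y = rot (rot x)].
Proof.
have step z : lpr (rot z) = lpr z.
  by apply/eqmodP/asboolP; apply: rst_sym; apply: rst_step.
split=> [/eqmodP/asboolP|[->|->|->]]; rewrite ?step //.
exact: (orbit3_closed (@rot3)).
Qed.

Lemma lpr_continuous : continuous lpr. Proof. exact: pi_continuous. Qed.

Lemma rot_continuous : continuous rot.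
Proof. exact: smull_continuous. Qed.

Lemma lens_cover : cover_data rot lpr.
Proof.
split; split.
- exact: sphere_hausdorff.
- exact: rot_continuous.
- exact: rot3.
- exact: rot_neq.
- exact: lpr_continuous.
- apply: open_open_at => A oA.
  suff : open (lpr @^-1` (lpr @` A)) by [].
  rewrite (_ : _ @^-1` _ = A `|` rot @^-1` A `|` rot @^-1` (rot @^-1` A)).
    have op (S : set T) : open S -> open (rot @^-1` S).
      by move=> oS; apply: open_comp => // z _; exact: rot_continuous.
    by apply: openU; [apply: openU => //; exact: op|apply: (op); exact: op].
  apply/seteqP; split=> x.
    move=> [y Ay] /esym/lprE[xy|xy|xy]; [left; left|left; right|right];
      by rewrite /= -xy.
  have rl z : lpr (rot z) = lpr z by apply/esym/lprE; exact: Or32.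
  move=> [[Ax|Ax]|Ax]; first by exists x.
  - by exists (rot x); rewrite ?rl.
  - by exists (rot (rot x)); rewrite ?rl.
- by move=> m; exists (repr m); rewrite /lpr reprK.
- exact: lprE.
Qed.

Definition clamp (t : R) : R := Num.min 1 (Num.max 0 t).

Lemma clamp_continuous : continuous clamp.
Proof.
move=> t; apply: (@continuous_min _ _ (fun=> 1) _ t); first exact: cvg_cst.
by apply: (@continuous_max _ _ (fun=> 0) _ t); [exact: cvg_cst|exact: cvg_id].
Qed.

Lemma clamp01 t : 0 <= clamp t <= 1.
Proof. by rewrite /clamp le_min ler01 le_max lexx /= ge_min lexx. Qed.

Lemma clamp_le0 t : t <= 0 -> clamp t = 0.
Proof. by move=> t0; rewrite /clamp (max_idPl t0) (min_idPr ler01). Qed.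

Lemma clamp_ge1 t : 1 <= t -> clamp t = 1.
Proof.
by move=> t1; rewrite /clamp (max_idPr (le_trans ler01 t1)) (min_idPl t1).
Qed.

(** Its projection to [lens] is a loop whose lifts permute a fibre cyclically. *)
Definition omega_path (t : R) : T :=
  toS (row4 (1 - clamp t * (3 / 2)) (clamp t * (rt3 / 2)) 0 0).

Lemma omega_path_continuous : continuous omega_path.
Proof.
move=> t; apply: (@toS_cont R R t (fun t => row4 (1 - clamp t * (3 / 2)) (clamp t * (rt3 / 2)) 0 0)).
  apply/eqP => /rowP h; have := h k1; have := h k0; rewrite !mxE /= => h0 h1.
  have : clamp t != 0 by apply/eqP => c0; move: h0; rewrite c0 => ?; lra.
  have := rt3_gt0 => r0 c0; move/eqP: h1; rewrite !mulf_eq0 (negbTE c0) gt_eqF //=.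
  by rewrite invr_eq0 pnatr_eq0.
have cc (a : R) : {for t, continuous (fun t => clamp t * a)}.
  by apply: (@cont_mul R R t clamp (fun=> a)); [exact: clamp_continuous|exact: cont_cst].
apply: row4_cont; [|exact: cc|exact: cont_cst|exact: cont_cst].
by apply: (@cont_subr R R t (fun=> 1)); [exact: cont_cst|exact: cc].
Qed.

Lemma omega_path0 t : t <= 0 -> omega_path t = s1 R.
Proof.
move=> t0; rewrite /omega_path clamp_le0 //; congr toS.
by apply: row4P; rewrite !row4E; ring.
Qed.

Lemma omega_path1 t : 1 <= t -> omega_path t = rot (s1 R).
Proof.
move=> t0; rewrite /omega_path clamp_ge1 // /rot smulr1; congr toS.
by apply: row4P; rewrite !row4E; field.
Qed.

Lemma lens_prime : prime_3manifold R lens.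
Proof.
split.
  exact: (cover_not_sphere lens_cover (@sphere_connected R) (@sphere_charts R) (s1 R)).
move=> P Q [_ _ cP hP _] [_ _ cQ hQ _].
exact: (cover_connected_sum lens_cover (@sphere_compact R) (@sphere_connected R)
  (@sphere_charts R) omega_path_continuous omega_path0 omega_path1).
Qed.

Lemma lens_nonempty : [set: lens] !=set0.
Proof. by exists (lpr (s1 R)). Qed.

Lemma lens_setT : [set: lens] = lpr @` [set: T].
Proof. by apply/seteqP; split=> // m _; exists (repr m) => //; rewrite /lpr reprK. Qed.

Lemma lens_connected : connected [set: lens].
Proof.
rewrite lens_setT; apply: connected_continuous_connected; first exact: sphere_connected.
apply: continuous_subspaceT; exact: lpr_continuous.
Qed.

Lemma lens_compact : compact [set: lens].
Proof.
rewrite lens_setT; apply: continuous_compact; last exact: sphere_compact.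
apply: continuous_subspaceT; exact: lpr_continuous.
Qed.

(** [x] is separated from each of the three preimages of [n]; the neighbourhoods of [x] are
    intersected, and those of the preimages are first pulled back to [y]. *)
Lemma cover_hausdorff (X N : topologicalType) (h : X -> X) (pr : X -> N) :
  cover_data h pr -> hausdorff_space N.
Proof.
move=> [[hX hc h3 hx] [pc po ps pE]]; rewrite open_hausdorff => m n mn.
have [x xm] := ps m; have [y yn] := ps n.
have sep (z : X) : pr z = n -> exists A B : set X, [/\ open A, open B, A x, B z & A `&` B = set0].
  move=> zn; have /eqP xz : x <> z by move=> xz; move/eqP: mn; rewrite -xm -zn xz.
  move: hX; rewrite open_hausdorff => /(_ _ _ xz)[[A B] /=].
  by rewrite !inE => -[Ax Bz] [oA oB AB]; exists A, B.
have prh z : pr (h z) = pr z by apply/esym/pE; exact: Or32.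
have [A0 [B0 [oA0 oB0 Ax0 By0 AB0]]] := sep y yn.
have [A1 [B1 [oA1 oB1 Ax1 By1 AB1]]] := sep (h y) (etrans (prh y) yn).
have [A2 [B2 [oA2 oB2 Ax2 By2 AB2]]] := sep (h (h y)) (etrans (etrans (prh _) (prh y)) yn).
have op (S : set X) : open S -> open (h @^-1` S).
  by move=> oS; apply: open_comp => // z _; exact: hc.
have prop S : open S -> open (pr @` S) by apply: open_at_open; exact: po.
exists (pr @` (A0 `&` A1 `&` A2), pr @` (B0 `&` h @^-1` B1 `&` h @^-1` (h @^-1` B2))) => /=.
  by rewrite !inE; split; [exists x|exists y].
split.
- by apply: prop; apply: openI => //; exact: openI.
- apply: prop; apply: openI; last by apply: (op); exact: op.
  by apply: openI => //; exact: op.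
apply/eqP/seteqP; split=> // _ [[a [[a0 a1] a2] <-] [b [[b0 b1] b2]]] /pE[ab|ab|ab].
- have : (A0 `&` B0) a by split => //; rewrite ab.
  by rewrite AB0.
- have : (A1 `&` B1) a by split => //; rewrite ab.
  by rewrite AB1.
- have : (A2 `&` B2) a by split => //; rewrite ab.
  by rewrite AB2.
Qed.

Lemma lens_hausdorff : hausdorff_space lens.
Proof. exact: cover_hausdorff lens_cover. Qed.

End LensSpace.

(** * An oriented atlas of the lens space *)

Section Squash.
Variable R : realType.
Implicit Types a b z : R.

(** An increasing homeomorphism of the line onto the open interval from -1 to 1: it keeps the signs
    of differences, on which the homotopies below rely. *)
Definition squash a : R := a / (1 + `|a|).
Definition unsquash z : R := z / (1 - `|z|).

Lemma norm_squash a : `|squash a| = `|a| / (1 + `|a|).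
Proof. by rewrite normrM normfV (ger0_norm (_ : 0 <= 1 + `|a|)) // addr_ge0. Qed.

Lemma squash_lt1 a : `|squash a| < 1.
Proof. by rewrite norm_squash ltr_pdivrMr ?ltr_pwDl // mul1r ltrDr. Qed.

Lemma squashK : cancel squash unsquash.
Proof.
move=> a; have d0 : 1 + `|a| != 0 by rewrite gt_eqF // ltr_pwDl.
rewrite /unsquash norm_squash.
have -> : 1 - `|a| / (1 + `|a|) = (1 + `|a|)^-1 by field.
by rewrite /squash invrK divfK.
Qed.

Lemma unsquashK z : `|z| < 1 -> squash (unsquash z) = z.
Proof.
move=> z1; have d0 : 0 < 1 - `|z| by rewrite subr_gt0.
have d1 : 1 - `|z| != 0 by rewrite gt_eqF.
rewrite /squash /unsquash normrM normfV (gtr0_norm d0).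
have -> : 1 + `|z| / (1 - `|z|) = (1 - `|z|)^-1 by field.
by rewrite invrK divfK.
Qed.

Lemma squash_homo a b : a < b -> squash a < squash b.
Proof.
move=> ab; rewrite /squash ltr_pdivrMr ?ltr_pwDl // mulrAC ltr_pdivlMr ?ltr_pwDl //.
case: (ltrP a 0) => a0; case: (ltrP b 0) => b0;
  rewrite ?(ltr0_norm a0) ?(ger0_norm a0) ?(ltr0_norm b0) ?(ger0_norm b0); nra.
Qed.

Lemma sg_squash a b : Num.sg (squash a - squash b) = Num.sg (a - b).
Proof.
case: (ltrgtP a b) => [ab|ab|->]; last by rewrite !subrr.
  by rewrite !ltr0_sg // subr_lt0 // squash_homo.
by rewrite !gtr0_sg // subr_gt0 // squash_homo.
Qed.

Lemma sg_unsquash a b : `|a| < 1 -> `|b| < 1 ->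
  Num.sg (unsquash a - unsquash b) = Num.sg (a - b).
Proof. by move=> a1 b1; rewrite -sg_squash !unsquashK. Qed.

Lemma squash1_continuous : continuous squash.
Proof.
move=> a; apply: (@cont_mul R R a id (fun y => (1 + `|y|)^-1)); first exact: cont_id.
apply: cont_inv; first by rewrite gt_eqF // ltr_pwDl.
apply: (@cont_addr R R a (fun=> 1)); first exact: cont_cst.
exact: (@cont_norm R R a R^o id (@cont_id _ a)).
Qed.

Lemma unsquash1_cont z : `|z| < 1 -> {for z, continuous unsquash}.
Proof.
move=> z1; apply: (@cont_mul R R z id (fun y => (1 - `|y|)^-1)); first exact: cont_id.
apply: cont_inv; first by rewrite gt_eqF // subr_gt0.
apply: (@cont_subr R R z (fun=> 1)); first exact: cont_cst.
exact: (@cont_norm R R z R^o id (@cont_id _ z)).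
Qed.

End Squash.

(** * Central projection charts of the sphere *)

Section Gnomonic.
Variable R : realType.
Local Notation E := 'rV[R]_3.
Local Notation V4 := 'rV[R]_4.
Local Notation T := (S3 R).

(** The open cone over a cube in the hyperplane where the first coordinate is 1; it is narrow enough
    to be disjoint from its rotated copies. *)
Definition cone : set V4 :=
  [set x | [/\ `|x 0 k1| < x 0 k0, `|x 0 k2| < x 0 k0 & `|x 0 k3| < x 0 k0]].

Definition hom (v : E) : V4 :=
  row4 1 (squash (v 0 j0)) (squash (v 0 j1)) (squash (v 0 j2)).

Definition unhom (x : V4) : E :=
  row3 (unsquash (x 0 k1 / x 0 k0)) (unsquash (x 0 k2 / x 0 k0))
       (unsquash (x 0 k3 / x 0 k0)).

Lemma cone_gt0 x : cone x -> 0 < x 0 k0.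
Proof. by move=> [h _ _]; apply: le_lt_trans h. Qed.

Lemma cone_neq0 x : cone x -> x != 0.
Proof. by move/cone_gt0 => h; apply: contraTneq h => ->; rewrite mxE ltxx. Qed.

Lemma coneZ a x : 0 < a -> cone (a *: x) <-> cone x.
Proof. by move=> a0; rewrite /cone /= !mxE !normrM (gtr0_norm a0) !ltr_pM2l. Qed.

Lemma cone_ratio x : cone x -> [/\ `|x 0 k1 / x 0 k0| < 1,
  `|x 0 k2 / x 0 k0| < 1 & `|x 0 k3 / x 0 k0| < 1].
Proof.
move=> cx; have x0 := cone_gt0 cx; have [h1 h2 h3] := cx.
by rewrite !normrM !normfV !(gtr0_norm x0) !ltr_pdivrMr // !mul1r.
Qed.

Lemma cone_open : open cone.
Proof.
have oc k : open [set x : V4 | `|x 0 k| < x 0 k0].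
  have -> : [set x : V4 | `|x 0 k| < x 0 k0] =
      (fun x : V4 => x 0 k0 - `|x 0 k|) @^-1` [set r | 0 < r].
    by apply/seteqP; split=> x /=; rewrite subr_gt0.
  apply: open_comp; last exact: open_gt.
  move=> x _; apply: (@cont_subr R V4 x (fun x : V4 => x 0 k0)).
    exact: coord_continuous.
  by apply: (@cont_norm R V4 x R^o (fun x : V4 => x 0 k)); exact: coord_continuous.
rewrite (_ : cone = [set x : V4 | `|x 0 k1| < x 0 k0] `&`
  [set x : V4 | `|x 0 k2| < x 0 k0] `&` [set x : V4 | `|x 0 k3| < x 0 k0]).
  by apply: openI => //; exact: openI.
by apply/seteqP; split=> x; [case|case=> -[]].
Qed.

Lemma hom_cone v : cone (hom v).
Proof. by rewrite /cone /= !row4E !squash_lt1. Qed.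

Lemma homK : cancel hom unhom.
Proof.
by move=> v; rewrite /unhom !row4E !divr1 !squashK; apply: row3P; rewrite row3E.
Qed.

Lemma unhomZ a x : 0 < a -> unhom (a *: x) = unhom x.
Proof.
move=> a0; have h (b c : R) : a * b / (a * c) = b / c by rewrite -mulf_div divff ?mul1r // gt_eqF.
by rewrite /unhom !mxE !h.
Qed.

Lemma unhomK x : cone x -> hom (unhom x) = (x 0 k0)^-1 *: x.
Proof.
move=> cx; have [h1 h2 h3] := cone_ratio cx; have x0 := cone_gt0 cx.
rewrite /hom !row3E !unsquashK //; apply: row4P; rewrite !row4E mxE mulrC //.
by rewrite mulfV // gt_eqF.
Qed.

Lemma hom_continuous : continuous hom.
Proof.
have cc v k : {for v, continuous (fun v : E => squash (v 0 k))}.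
  apply: (@cont_comp _ _ _ _ (fun v : E => v 0 k) (@squash R)).
    exact: coord_continuous.
  exact: squash1_continuous.
move=> v; apply: (@row4_cont R E v (fun=> 1) (fun v => squash (v 0 j0))
  (fun v => squash (v 0 j1)) (fun v => squash (v 0 j2))) => //; exact: cont_cst.
Qed.

Lemma unhom_cont x : cone x -> {for x, continuous unhom}.
Proof.
move=> cx; have [h1 h2 h3] := cone_ratio cx; have x0 := cone_gt0 cx.
have cc k : `|x 0 k / x 0 k0| < 1 ->
    {for x, continuous (fun x : V4 => unsquash (x 0 k / x 0 k0))}.
  move=> h; apply: (@cont_comp _ _ _ _ (fun x : V4 => x 0 k / x 0 k0) (@unsquash R)).
    apply: (@cont_mul R V4 x (fun x : V4 => x 0 k)); first exact: coord_continuous.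
    by apply: cont_inv; [rewrite gt_eqF|exact: coord_continuous].
  exact: unsquash1_cont.
by apply: row3_cont; exact: cc.
Qed.

(** Central projection of the cube to the sphere; up to [squash], quaternion multiplication is a
    projective map in such charts. *)
Definition gnomonic (v : E) : T := toS (hom v).

Lemma gnomonic_unhom x : cone x -> gnomonic (unhom x) = toS x.
Proof. by move=> cx; rewrite /gnomonic unhomK // toSZ // invr_gt0 cone_gt0. Qed.

Lemma toS_cone x : cone x -> cone (sval3 (toS x)).
Proof.
by move=> cx; have [a a0 ->] := toS_sval (cone_neq0 cx); apply/coneZ.
Qed.

Lemma gnomonic_continuous : continuous gnomonic.
Proof.
move=> v; apply: (@toS_cont R E v hom); first exact: cone_neq0 (hom_cone v).
exact: hom_continuous.
Qed.

Lemma gnomonic_embedding :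
  open_embedding gnomonic /\ range gnomonic = @sval3 R @^-1` cone.
Proof.
apply: (@open_embedding_pinv _ _ gnomonic (unhom \o @sval3 R)).
- exact: gnomonic_continuous.
- move=> v /=; have [a a0 ->] := toS_sval (cone_neq0 (hom_cone v)).
  by rewrite unhomZ // homK.
- by apply: open_comp; [move=> x _; exact: sval3_continuous|exact: cone_open].
- by move=> v; exact: toS_cone (hom_cone v).
- by move=> x cx /=; rewrite gnomonic_unhom // toSK.
- move=> x cx; apply: (@cont_comp _ _ _ _ (@sval3 R) unhom).
    exact: sval3_continuous.
  exact: unhom_cont.
Qed.

End Gnomonic.

(** * Deformation of projective maps to the identity *)

Section Orientation.
Variable R : realType.
Local Notation E := 'rV[R]_3.
Local Notation V4 := 'rV[R]_4.

Lemma qconj1 : qconj (q1 R) = q1 R.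
Proof. by apply: row4P; rewrite /qconj /q1 !row4E ?oppr0. Qed.

Opaque qmul qconj.

(** Keeps a straight homotopy between maps with equal coordinate signs away from the origin. *)
Lemma sgn_line (x y : E) a b : 0 <= a -> 0 <= b -> a + b = 1 ->
  (forall k, Num.sg (x 0 k) = Num.sg (y 0 k)) -> y != 0 -> a *: x + b *: y != 0.
Proof.
move=> a0 b0 ab xy; apply: contra_neq => xy0; apply/rowP => k; rewrite mxE.
have := congr1 (fun v : E => v 0 k) xy0; rewrite !mxE => s0.
apply/eqP; apply: contraPT s0 => yk.
have [xs ys] : x 0 k = Num.sg (y 0 k) * `|x 0 k| /\ y 0 k = Num.sg (y 0 k) * `|y 0 k|.
  by rewrite -{1}xy -!numEsg.
apply/eqP; rewrite xs {2}ys !(mulrCA _ (Num.sg _)) -mulrDr mulf_neq0 ?sgr_eq0 //.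
have x0 : 0 < `|x 0 k| by rewrite normr_gt0 -sgr_eq0 xy sgr_eq0.
have y0 : 0 < `|y 0 k| by rewrite normr_gt0.
apply/eqP => h; have : 0 < a * `|x 0 k| + b * `|y 0 k|; last by rewrite h ltxx.
have [a1|a1] := eqVneq a 0; first by rewrite a1 add0r in ab; rewrite a1 ab mul0r add0r mul1r.
by apply: ltr_pwDl; [rewrite mulr_gt0 // lt0r a1|rewrite mulr_ge0].
Qed.

Definition pure (u : E) : V4 := row4 0 (u 0 j0) (u 0 j1) (u 0 j2).

(** Up to positive factors, the differential of the projective map induced by
    [x |-> w0 x w1], at the point with homogeneous coordinates [c]. *)
Definition proj_diff (c w0 w1 : V4) (u : E) : E :=
  let x := qmul (qmul w0 (pure u)) w1 in
  let p := qmul (qmul w0 c) w1 in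
  row3 (x 0 k1 * p 0 k0 - x 0 k0 * p 0 k1) (x 0 k2 * p 0 k0 - x 0 k0 * p 0 k2)
       (x 0 k3 * p 0 k0 - x 0 k0 * p 0 k3).

Lemma scale4E a (x : V4) k : (a *: x) 0 k = a * x 0 k. Proof. by rewrite mxE. Qed.
Lemma scale3E a (x : E) k : (a *: x) 0 k = a * x 0 k. Proof. by rewrite mxE. Qed.
Lemma add4E (x y : V4) k : (x + y) 0 k = x 0 k + y 0 k. Proof. by rewrite !mxE. Qed.
Lemma sub3E (x y : E) k : (x - y) 0 k = x 0 k - y 0 k. Proof. by rewrite !mxE. Qed.
Lemma sub4E (x y : V4) k : (x - y) 0 k = x 0 k - y 0 k. Proof. by rewrite !mxE. Qed.

Lemma row3_eq0 (a b c : R) : row3 a b c = 0 -> [/\ a = 0, b = 0 & c = 0].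
Proof.
by move=> /rowP h; have := h j0; have := h j1; have := h j2; rewrite !mxE /=; split.
Qed.

(** Otherwise the images of [pure u] and [c] would be proportional, hence so would [pure u] and [c]
    themselves; but the first coordinate is 0 for [pure u] and not for [c]. *)
Lemma proj_diff_neq0 (c w0 w1 : V4) (u : E) : w0 != 0 -> w1 != 0 -> c 0 k0 != 0 ->
  (qmul (qmul w0 c) w1) 0 k0 != 0 -> u != 0 -> proj_diff c w0 w1 u != 0.
Proof.
rewrite /proj_diff; set x := qmul (qmul w0 (pure u)) w1; set p := qmul (qmul w0 c) w1.
move=> w00 w10 c0 p0; apply: contra_neq => /row3_eq0[h0 h1 h2].
have xp : p 0 k0 *: x = x 0 k0 *: p.
  by apply: row4P; rewrite !scale4E; move: h0 h1 h2; clear; lra.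
have z0 : qmul (qmul w0 (p 0 k0 *: pure u - x 0 k0 *: c)) w1 = 0.
  rewrite -scaleNr qmulDr qmulDl !qmulZr !qmulZl -/x -/p xp.
  by rewrite scaleNr subrr.
have /eqP d0 : p 0 k0 *: pure u - x 0 k0 *: c == 0.
  by apply: contra_eqT z0 => d0; rewrite !qmul_neq0.
have x0 : x 0 k0 = 0.
  have := congr1 (fun v : V4 => v 0 k0) d0; rewrite sub4E !scale4E /pure row4E [RHS]mxE mulr0 sub0r => /eqP.
  by rewrite oppr_eq0 mulf_eq0 (negbTE c0) orbF => /eqP.
move: d0; rewrite x0 scale0r subr0 => /eqP; rewrite scaler_eq0 (negbTE p0) /= => /eqP u0.
by apply: row3P; [have := congr1 (fun v : V4 => v 0 k1) u0
  |have := congr1 (fun v : V4 => v 0 k2) u0|have := congr1 (fun v : V4 => v 0 k3) u0];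
  rewrite !mxE.
Qed.

Lemma proj_diffZ (c w0 w1 : V4) a (u : E) : proj_diff c w0 (a *: w1) u = a ^+ 2 *: proj_diff c w0 w1 u.
Proof.
rewrite /proj_diff !qmulZr; set x := qmul _ _; set p := qmul _ _.
by apply: row3P; rewrite scale3E !row3E !scale4E; ring.
Qed.

Lemma proj_diff1 (c : V4) (u : E) : proj_diff c (q1 R) (q1 R) u = c 0 k0 *: u.
Proof. by apply: row3P; rewrite /proj_diff !qmul1 !qmulr1 scale3E !row3E !row4E; ring. Qed.

Lemma proj_diff_cont (X : topologicalType) (x : X) (c : V4) (f h : X -> V4) (u : X -> E) :
  {for x, continuous f} -> {for x, continuous h} -> {for x, continuous u} ->
  {for x, continuous (fun y => proj_diff c (f y) (h y) (u y))}.
Proof.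
move=> fc hc uc.
have pc : {for x, continuous (fun y => pure (u y))}.
  apply: (@row4_cont R X x (fun=> 0) (fun y => u y 0 j0) (fun y => u y 0 j1) (fun y => u y 0 j2));
    [exact: cont_cst|exact: coord3_cont|exact: coord3_cont|exact: coord3_cont].
have xc : {for x, continuous (fun y => qmul (qmul (f y) (pure (u y))) (h y))}.
  exact: (@qmul_cont R X x _ h (@qmul_cont R X x f _ fc pc) hc).
have cc : {for x, continuous (fun y => qmul (qmul (f y) c) (h y))}.
  exact: (@qmul_cont R X x _ h (@qmul_cont R X x f _ fc (@cont_cst X x _ c)) hc).
have dc (g1 g2 : X -> V4) k : {for x, continuous g1} -> {for x, continuous g2} ->
    {for x, continuous (fun y => g1 y 0 k * g2 y 0 k0 - g1 y 0 k0 * g2 y 0 k)}.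
  move=> c1 c2; apply: (@cont_subr R X x (fun y => g1 y 0 k * g2 y 0 k0)).
    apply: (@cont_mul R X x (fun y => g1 y 0 k) (fun y => g2 y 0 k0)).
      exact: (@coord4_cont R X x g1 k c1).
    exact: (@coord4_cont R X x g2 k0 c2).
  apply: (@cont_mul R X x (fun y => g1 y 0 k0) (fun y => g2 y 0 k)).
    exact: (@coord4_cont R X x g1 k0 c1).
  exact: (@coord4_cont R X x g2 k c2).
exact: row3_cont (dc _ _ k1 xc cc) (dc _ _ k2 xc cc) (dc _ _ k3 xc cc).
Qed.

Section Homotopy.
Variables (w0 w1 c : V4).
Hypotheses (w00 : w0 != 0) (w10 : w1 != 0) (c0 : 0 < c 0 k0)
  (w01 : w0 0 k1 != 0 \/ w0 = q1 R) (p0 : 0 < (qmul (qmul w0 c) w1) 0 k0).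

Definition lpath (t : R) : V4 := (1 - t) *: w0 + t *: q1 R.
Definition ppath (t : R) : V4 := (1 - t) *: qmul (qmul w0 c) w1 + t *: c.
(** Chosen so that [c] is carried along [ppath] up to a positive factor. The first coordinate stays
    positive there, so the projective map remains defined at [c] during the deformation. *)
Definition rpath (t : R) : V4 := qmul (qconj c) (qmul (qconj (lpath t)) (ppath t)).

Lemma c_neq0 : c != 0.
Proof. by apply: contraTneq c0 => ->; rewrite mxE ltxx. Qed.

(** This is what [w01] is for: a nonzero second coordinate of [w0] vanishes only at the end of the
    segment, where the value is 1. *)
Lemma lpath_neq0 t : lpath t != 0.
Proof.
apply/eqP => h; have := congr1 (fun v : V4 => v 0 k0) h; have := congr1 (fun v : V4 => v 0 k1) h.
rewrite /lpath /q1 !mxE /= mulr0 addr0 mulr1 => h1 h0; case: w01 => [wk|we].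
  move/eqP: h1; rewrite mulf_eq0 (negbTE wk) orbF => /eqP t1.
  by move: h0; rewrite t1 mul0r add0r => t0; move: t1; rewrite t0 subr0; apply/eqP; rewrite oner_eq0.
by move: h0; rewrite we /q1 row4E mulr1 subrK; apply/eqP; rewrite oner_eq0.
Qed.

Lemma lrpath t : qmul (qmul (lpath t) c) (rpath t) =
  (sqnorm c * sqnorm (lpath t)) *: ppath t.
Proof.
rewrite /rpath -qmulA (qmulA c) qmulV qmulZl qmul1 qmulZr qmulA qmulV qmulZl qmul1.
by rewrite scalerA.
Qed.

Lemma ppath_gt0 t : 0 <= t <= 1 -> 0 < ppath t 0 k0.
Proof.
move=> /andP[t0 t1]; rewrite /ppath add4E !scale4E.
set P := (qmul _ _) 0 k0; have P0 : 0 < P by exact: p0.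
have [->|tn] := eqVneq t 0; first by rewrite subr0 mul1r mul0r addr0.
by rewrite ltr_wpDl ?mulr_ge0 ?mulr_gt0 ?subr_ge0 // ?ltW // lt0r tn t0.
Qed.

Lemma rpath_neq0 t : 0 <= t <= 1 -> rpath t != 0.
Proof.
move=> /ppath_gt0 h; apply: qmul_neq0; last apply: qmul_neq0.
- by rewrite -sqnorm_gt0 sqnorm_qconj sqnorm_gt0 c_neq0.
- by rewrite -sqnorm_gt0 sqnorm_qconj sqnorm_gt0 lpath_neq0.
- by apply: contraTneq h => ->; rewrite mxE ltxx.
Qed.

Definition path_diff (t : R) (u : E) : E := proj_diff c (lpath t) (rpath t) u.

Lemma path_diff_neq0 t u : 0 <= t <= 1 -> u != 0 -> path_diff t u != 0.
Proof.
move=> t01 u0; apply: proj_diff_neq0 => //.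
- exact: lpath_neq0.
- exact: rpath_neq0.
- by rewrite gt_eqF.
rewrite lrpath mxE mulf_neq0 //.
  by rewrite mulf_neq0 // gt_eqF // sqnorm_gt0 ?lpath_neq0 ?c_neq0.
by rewrite gt_eqF // ppath_gt0.
Qed.

Lemma path_diff0 u : exists2 a, 0 < a & path_diff 0 u = a *: proj_diff c w0 w1 u.
Proof.
have l0 : lpath 0 = w0 by rewrite /lpath subr0 scale1r scale0r addr0.
exists ((sqnorm c * sqnorm w0) ^+ 2).
  by rewrite exprn_gt0 // mulr_gt0 // sqnorm_gt0 // c_neq0.
suff -> : path_diff 0 u = proj_diff c w0 ((sqnorm c * sqnorm w0) *: w1) u by exact: proj_diffZ.
rewrite /path_diff l0; suff -> : rpath 0 = (sqnorm c * sqnorm w0) *: w1 by [].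
rewrite /rpath l0 /ppath subr0 scale1r scale0r addr0.
rewrite -!qmulA (qmulA (qconj w0)) qVmul qmulZl qmul1 qmulZr qmulA qVmul qmulZl qmul1.
by rewrite scalerA mulrC.
Qed.

Lemma path_diff1 u : exists2 a, 0 < a & path_diff 1 u = a *: u.
Proof.
have l1 : lpath 1 = q1 R by rewrite /lpath subrr scale1r scale0r add0r.
exists (sqnorm c ^+ 2 * c 0 k0).
  by rewrite mulr_gt0 // exprn_gt0 // sqnorm_gt0 c_neq0.
rewrite -scalerA -proj_diff1.
suff -> : path_diff 1 u = proj_diff c (q1 R) (sqnorm c *: q1 R) u by exact: proj_diffZ.
rewrite /path_diff l1; suff -> : rpath 1 = sqnorm c *: q1 R by [].
rewrite /rpath l1 /ppath subrr scale1r scale0r add0r.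
by rewrite qconj1 qmul1 qVmul.
Qed.

Lemma path_diff_cont (X : topologicalType) (x : X) (f : X -> R) (u : X -> E) :
  {for x, continuous f} -> {for x, continuous u} ->
  {for x, continuous (fun y => path_diff (f y) (u y))}.
Proof.
move=> fc uc.
have seg (a b : V4) : {for x, continuous (fun y => (1 - f y) *: a + f y *: b)}.
  apply: (@cont_add R X x V4); apply: (@cont_scale R X x V4) => //; try exact: cont_cst.
  by apply: (@cont_subr R X x (fun=> 1)) => //; exact: cont_cst.
have lc : {for x, continuous (fun y => lpath (f y))} by exact: seg.
have pc : {for x, continuous (fun y => ppath (f y))} by exact: seg.
have rc : {for x, continuous (fun y => rpath (f y))}.
  exact: (@qmul_cont R X x _ _ (@cont_cst X x _ (qconj c))
    (@qmul_cont R X x _ _ (@qconj_cont R X x _ lc) pc)).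
exact: (@proj_diff_cont X x c _ _ u lc rc uc).
Qed.

End Homotopy.
End Orientation.

Lemma sg_ratio (R : realType) (a b c d : R) : 0 < a -> 0 < c ->
  Num.sg (b / a - d / c) = Num.sg (b * c - a * d).
Proof.
move=> a0 c0; have an : a != 0 by rewrite gt_eqF.
have cn : c != 0 by rewrite gt_eqF.
have -> : b / a - d / c = (b * c - a * d) / (a * c) by field; rewrite an cn.
by rewrite sgrM [Num.sg (_^-1)]gtr0_sg ?mulr1 // invr_gt0 mulr_gt0.
Qed.

Section OrientationAt.
Variable R : realType.
Local Notation E := 'rV[R]_3.
Local Notation V4 := 'rV[R]_4.
Opaque qmul qconj path_diff.

Variables (w0 w1 : V4) (y : E).
Hypotheses (w00 : w0 != 0) (w10 : w1 != 0) (w01 : w0 0 k1 != 0 \/ w0 = q1 R).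

Definition pmap (v : E) : V4 := qmul (qmul w0 (hom v)) w1.

Hypothesis cy : cone (pmap y).

Definition hom_sub (v : E) : E :=
  row3 (squash (v 0 j0) - squash (y 0 j0)) (squash (v 0 j1) - squash (y 0 j1))
       (squash (v 0 j2) - squash (y 0 j2)).

Lemma homD v : hom v = hom y + pure (hom_sub v).
Proof.
by apply: row4P; rewrite add4E /hom /pure !row4E ?row3E ?addr0 // addrC subrK.
Qed.

Lemma pmapD v : pmap v = pmap y + qmul (qmul w0 (pure (hom_sub v))) w1.
Proof. by rewrite /pmap (homD v) qmulDr qmulDl. Qed.

Lemma sg_hom_sub v k : Num.sg (hom_sub v 0 k) = Num.sg ((v - y) 0 k).
Proof. by move: k; apply: ord3P; rewrite row3E sg_squash !mxE. Qed.

(** Holds exactly and not only to first order: the difference of two ratios has the sign of a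
    determinant, which is linear in the increment. *)
Lemma sg_unhom v k : cone (pmap v) ->
  Num.sg ((unhom (pmap v) - unhom (pmap y)) 0 k) =
  Num.sg (proj_diff (hom y) w0 w1 (hom_sub v) 0 k).
Proof.
move=> cv; have [v1 v2 v3] := cone_ratio cv; have [y1 y2 y3] := cone_ratio cy.
have v0 := cone_gt0 cv; have y0 := cone_gt0 cy.
have key l : Num.sg ((pmap v) 0 l / (pmap v) 0 k0 - (pmap y) 0 l / (pmap y) 0 k0) =
    Num.sg (qmul (qmul w0 (pure (hom_sub v))) w1 0 l * pmap y 0 k0 -
      qmul (qmul w0 (pure (hom_sub v))) w1 0 k0 * pmap y 0 l).
  rewrite sg_ratio // (pmapD v) !add4E; congr Num.sg.
  by set x := qmul _ w1; ring.
move: k; apply: ord3P; rewrite sub3E /unhom !row3E sg_unsquash // key;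
  by rewrite /proj_diff row3E -/(pmap y).
Qed.

Lemma pmap_continuous : continuous pmap.
Proof.
move=> v; have hc : {for v, continuous (@hom R)} by exact: hom_continuous.
exact: (@qmul_cont R E v _ _ (@qmul_cont R E v _ _ (@cont_cst E v _ w0) hc) (@cont_cst E v _ w1)).
Qed.

Lemma hom_sub_continuous : continuous hom_sub.
Proof.
move=> v; have cc k : {for v, continuous (fun v : E => squash (v 0 k) - squash (y 0 k))}.
  apply: (@cont_subr R E v (fun v : E => squash (v 0 k))); last exact: cont_cst.
  apply: (@cont_comp _ _ _ _ (fun v : E => v 0 k) (@squash R)).
    exact: coord_continuous.
  exact: squash1_continuous.
exact: row3_cont (cc j0) (cc j1) (cc j2).
Qed.

(** The homotopy goes straight from the increment of [h] to [path_diff] at time 0, then along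
    [path_diff], then straight to the identity. Equal coordinate signs keep the straight stages off
    the origin. *)
Lemma orientation_preserving_proj (h : E -> E) :
  (forall v, cone (pmap v) -> h v = unhom (pmap v)) -> orientation_preserving_at h y.
Proof.
move=> hE; have oC : open (pmap @^-1` @cone R).
  by apply: open_comp; [move=> v _; exact: pmap_continuous|exact: cone_open].
have /nbhs_ballP[d /= d0 dC] : nbhs y (pmap @^-1` @cone R) by exact: open_nbhs_nbhs.
near=> e; have e0 : 0 < e by near: e; exact: nbhs_right_gt.
have ed : e < d by near: e; exact: nbhs_right_lt.
have cv v : sphere v -> cone (pmap (y + e *: v)).
  move=> v1; apply: dC; rewrite -ball_normE /= opprD addrA subrr add0r normrN normrZ.
  rewrite (gtr0_norm e0); apply: le_lt_trans ed; rewrite ger_pMr //.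
  by rewrite -(@ler_pXn2r _ 2) ?nnegrE // expr1n -v1; exact: norm_le_sqnorm.
have c0 : 0 < hom y 0 k0 by rewrite row4E.
pose u (v : E) := hom_sub (y + e *: v).
have su v k : Num.sg (u v 0 k) = Num.sg (v 0 k).
  rewrite sg_hom_sub (addrC y) addrK scale3E.
  by rewrite sgrM gtr0_sg // mul1r.
have v0 v : sphere v -> v != 0 :> E.
  by move=> v1; rewrite -sqnorm_gt0 v1.
have u0 v : sphere v -> u v != 0.
  move=> /v0; apply: contra_neq => uv; apply/rowP => k; apply/eqP.
  by rewrite mxE -sgr_eq0 -su uv mxE sgr0.
pose D v := unhom (pmap (y + e *: v)) - unhom (pmap y).
pose L t v := path_diff w0 w1 (hom y) t (u v).
(* [a] falls from 1 to 0 in the first third of the time, [m] runs in the second, and [b] rises in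
   the last. *)
pose a (t : R) := clamp (- (3) * t + 1); pose b (t : R) := clamp (3 * t - 2).
pose m (t : R) := clamp (3 * t - 1).
pose H (q : R * E) := a q.1 *: D q.2 + (1 - a q.1 - b q.1) *: L (m q.1) q.2 + b q.1 *: q.2.
have sL v k : sphere v -> Num.sg (D v 0 k) = Num.sg (L 0 v 0 k).
  move=> v1; rewrite sg_unhom; last (exact: cv); rewrite /L.
  have [r r0 ->] := path_diff0 w1 w00 c0 (u v).
  by rewrite [X in _ = Num.sg X]scale3E [RHS]sgrM (gtr0_sg r0) mul1r.
have sv v k : Num.sg (L 1 v 0 k) = Num.sg (v 0 k).
  rewrite /L; have [r r0 ->] := path_diff1 w0 w1 c0 (u v).
  by rewrite scale3E sgrM gtr0_sg // mul1r su.
have L0 t v : 0 <= t <= 1 -> sphere v -> L t v != 0.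
  by move=> t01 v1; apply: path_diff_neq0 => //; [exact: cone_gt0|exact: u0].
exists H; split.
- apply: continuous_in_subspaceT => -[t v] /set_mem[/= _ v1].
  have c1 : {for (t, v), continuous (fun q : R * E => q.1)} by exact: cvg_fst.
  have c2 : {for (t, v), continuous (fun q : R * E => q.2)} by exact: cvg_snd.
  have cl (r s : R) : {for (t, v), continuous (fun q : R * E => clamp (r * q.1 + s))}.
    apply: (@cont_comp _ _ _ _ (fun q : R * E => r * q.1 + s) (@clamp R)).
      apply: (@cont_addr R _ _ (fun q : R * E => r * q.1) (fun=> s)); last exact: cont_cst.
      by apply: (@cont_mul R _ _ (fun=> r)); [exact: cont_cst|exact: c1].
    exact: clamp_continuous.
  have ca : {for (t, v), continuous (fun q : R * E => a q.1)}.
    exact: cl.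
  have cb : {for (t, v), continuous (fun q : R * E => b q.1)} by exact: cl.
  have cm : {for (t, v), continuous (fun q : R * E => m q.1)} by exact: cl.
  have cw : {for (t, v), continuous (fun q : R * E => y + e *: q.2)}.
    apply: (@cont_add R _ _ E (fun=> y)); first exact: cont_cst.
    by apply: (@cont_scale R _ _ E (fun=> e)); [exact: cont_cst|exact: c2].
  have cu : {for (t, v), continuous (fun q : R * E => u q.2)}.
    exact: (@cont_comp _ _ _ _ (fun q : R * E => y + e *: q.2) hom_sub cw (@hom_sub_continuous _)).
  have cp : {for (t, v), continuous (fun q : R * E => pmap (y + e *: q.2))}.
    exact: (@cont_comp _ _ _ _ (fun q : R * E => y + e *: q.2) pmap cw (@pmap_continuous _)).
  have cD : {for (t, v), continuous (fun q : R * E => D q.2)}.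
    apply: (@cont_sub R _ _ E (fun q : R * E => unhom (pmap (y + e *: q.2)))); last exact: cont_cst.
    exact: (@cont_comp _ _ _ _ (fun q : R * E => pmap (y + e *: q.2)) (@unhom R) cp (unhom_cont (cv _ v1))).
  have cL : {for (t, v), continuous (fun q : R * E => L (m q.1) q.2)}.
    exact: (@path_diff_cont R w0 w1 (hom y) _ _ (fun q : R * E => m q.1) (fun q => u q.2) cm cu).
  apply: (@cont_add R _ _ E (fun q : R * E => a q.1 *: D q.2 + (1 - a q.1 - b q.1) *: L (m q.1) q.2)).
    apply: (@cont_add R _ _ E (fun q : R * E => a q.1 *: D q.2)).
      exact: (@cont_scale R _ _ E _ _ ca cD).
    apply: (@cont_scale R _ _ E (fun q : R * E => 1 - a q.1 - b q.1) _ _ cL).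
    apply: (@cont_subr R _ _ (fun q : R * E => 1 - a q.1)) => //.
    by apply: (@cont_subr R _ _ (fun=> 1)) => //; exact: cont_cst.
  exact: (@cont_scale R _ _ E _ _ cb c2).
- move=> t v /andP[t0 t1] v1; rewrite /H /=; apply/eqP.
  have [a0 a1] := andP (clamp01 (- (3) * t + 1)); have [b0 b1] := andP (clamp01 (3 * t - 2)).
  rewrite -/(a t) -/(b t) in a0 a1 b0 b1.
  have [t3|t3] := leP t (1 / 3).
    have -> : m t = 0 by apply: clamp_le0; lra.
    have -> : b t = 0 by apply: clamp_le0; lra.
    rewrite subr0 scale0r addr0; apply: sgn_line => //; first by rewrite subr_ge0.
    - by rewrite addrC subrK.
    - by move=> k; exact: sL.
    by apply: L0 => //; rewrite lexx ler01.
  have -> : a t = 0 by apply: clamp_le0; lra.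
  rewrite subr0 scale0r add0r; have [t4|t4] := leP t (2 / 3).
    have -> : b t = 0 by apply: clamp_le0; lra.
    by rewrite subr0 scale1r scale0r addr0; apply: L0 => //; exact: clamp01.
  have -> : m t = 1 by apply: clamp_ge1; lra.
  apply: sgn_line => //; first by rewrite subr_ge0.
  - by rewrite subrK.
  exact: v0.
- move=> v v1; rewrite /H /=; have -> : a 0 = 1 by apply: clamp_ge1; lra.
  have -> : b 0 = 0 by apply: clamp_le0; lra.
  rewrite subr0 subrr !scale0r !addr0 scale1r /D -!hE //; exact: cv.
- move=> v v1; rewrite /H /=; have -> : a 1 = 0 by apply: clamp_le0; lra.
  have -> : b 1 = 1 by apply: clamp_ge1; lra.
  by rewrite subr0 subrr !scale0r !add0r scale1r.
Unshelve. all: by end_near.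
Qed.

End OrientationAt.

(** * Charts and transitions of the lens space *)

Section LensManifold.
Variable R : realType.
Local Notation E := 'rV[R]_3.
Local Notation V4 := 'rV[R]_4.
Local Notation T := (S3 R).

(** In the plane of the first two coordinates the cone stays within 45 degrees of the first axis,
    and the rotation turns by 120. *)
Lemma cone_rot (x : V4) : cone x -> ~ cone (qmul (qom R) x).
Proof.
move=> [h1 _ _] [g1 _ _]; move: h1 g1; rewrite /qmul /qom !row4E !mul0r !subr0 !addr0.
have r0 := rt3_gt0 R; have r3 := rt3_sqr R; rewrite !ltr_norml => /andP[a1 a2] /andP[b1 b2].
have r1 : 1 < rt3 R.
  by rewrite -(@ltr_pXn2r _ 2) ?nnegrE ?ler01 ?ltW // r3 expr1n; lra.
nra.
Qed.

(** Right translation by [s] commutes with the deck transformations, which multiply on the left. *)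
Definition lens_chart (s : T) (v : E) : lens R := lpr (smul (gnomonic v) s).

Lemma lens_chart_inj s : injective (lens_chart s).
Proof.
have [[gi _ _] gr] := gnomonic_embedding R.
have gc v : cone (sval3 (gnomonic v)) := toS_cone (hom_cone v).
have sc (x y : T) : smul x s = smul y s -> x = y.
  by move=> h; have := congr1 (fun z => smul z (sinv s)) h; rewrite -!smulA smulV !smulr1.
have nr v w : smul (gnomonic w) s <> rot (smul (gnomonic v) s).
  rewrite /rot smulA => /sc h; apply: (@cone_rot (sval3 (gnomonic v))) => //.
  by rewrite -sval3_om -sval3_smul -h.
move=> v w /lprE[/sc/gi//|/nr//|h]; have := congr1 (@rot R) h; rewrite rot3 => h'.
by case: (nr w v).
Qed.

Lemma lpr_open_at (x : T) : open_at (@lpr R) x.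
Proof. by have [_ [_ + _ _]] := lens_cover R; exact. Qed.

Lemma lens_chart_embedding s : open_embedding (lens_chart s).
Proof.
have [og _] := gnomonic_embedding R.
have /open_embeddingP[_ gc go] := open_embedding_comp og (mulr_homeo s).
apply/open_embeddingP; split; first exact: lens_chart_inj.
  move=> v; apply: (@continuous_comp _ _ _ ((fun x => smul x s) \o @gnomonic R) (@lpr R)).
    exact: gc.
  exact: lpr_continuous.
by move=> v; apply: (open_at_comp (go v)); exact: lpr_open_at.
Qed.

Lemma lens_chart_cover m : exists s, range (lens_chart s) m.
Proof.
have [x <-] : exists x : T, lpr x = m by have [_ [_ _ + _]] := lens_cover R; exact.
exists x, 0 => //; rewrite /lens_chart.
have -> : gnomonic (0 : E) = s1 R; last by rewrite smul1.
have s0 : squash 0 = 0 :> R by rewrite /squash mul0r.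
by congr toS; apply: row4P; rewrite !row4E // mxE s0.
Qed.

Lemma lpr_rot (x : T) : lpr (rot x) = lpr x.
Proof. by apply/esym/lprE; exact: Or32. Qed.

Lemma lens_deck (x y : T) : lpr x = lpr y -> exists w : T,
  [/\ y = smul w x, sval3 w 0 k1 != 0 \/ sval3 w = q1 R &
      forall z, lpr (smul w z) = lpr z].
Proof.
move/lprE => [->|->|->].
- exists (s1 R); split=> [||z]; rewrite ?smul1 //.
  by rewrite sval3_s1; right.
- exists (om R); split=> // [|z]; last exact: lpr_rot.
  by left; rewrite sval3_om row4E gt_eqF // divr_gt0 ?rt3_gt0.
exists (smul (om R) (om R)); split=> [||z]; rewrite -?smulA //; last by rewrite !lpr_rot.
by left; rewrite sval3_smul sval3_om qom2 row4E oppr_eq0 gt_eqF // divr_gt0 ?rt3_gt0.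
Qed.

(** In homogeneous coordinates the transition is [x |-> w x (b a^-1)] with a deck transformation
    [w]. *)
Lemma lens_transition (a b : T) (y : E) : range (lens_chart a) (lens_chart b y) ->
  orientation_preserving_at (transition (lens_chart a) (lens_chart b)) y.
Proof.
move=> [z _ /esym/lens_deck[w [wE w01 lw]]].
pose w1 := smul b (sinv a).
have pE v : exists2 r, 0 < r &
    sval3 (smul (smul w (gnomonic v)) w1) = r *: pmap (sval3 w) (sval3 w1) v.
  have [r r0 rE] := toS_sval (cone_neq0 (hom_cone v)).
  by exists r => //; rewrite !sval3_smul rE qmulZr qmulZl.
have nz (x : T) : sval3 x != 0 by rewrite -sqnorm_gt0 sval3_sphere.
apply: (@orientation_preserving_proj _ (sval3 w) (sval3 w1)) => //.
  have zE : gnomonic z = smul (smul w (gnomonic y)) w1.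
    have := congr1 (fun x => smul x (sinv a)) wE.
    by rewrite -smulA smulV smulr1 => ->; rewrite /w1 !smulA.
  have [r r0 rE] := pE y; apply/(coneZ _ r0); rewrite -rE -zE.
  exact: toS_cone (hom_cone z).
move=> v cv; apply: (@lens_chart_inj a); rewrite /transition.
have ex : lens_chart a (unhom (pmap (sval3 w) (sval3 w1) v)) = lens_chart b v.
  have [r r0 rE] := pE v; rewrite /lens_chart gnomonic_unhom // -(toSZ _ r0) -rE toSK.
  rewrite /w1 -!smulA sVmul smulr1 smulA.
  by rewrite -smulA lw.
by rewrite ex; apply: (@xgetPex _ 0 [set x | lens_chart a x = lens_chart b v]);
  exists (unhom (pmap (sval3 w) (sval3 w1) v)).
Qed.

Lemma lens_orientable : orientable R (lens R).
Proof.
exists (range lens_chart); split.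
- by move=> _ [s _ <-]; exact: lens_chart_embedding.
- by move=> m; have [s sm] := lens_chart_cover m; exists (lens_chart s) => //; exists s.
- by move=> _ _ y [a _ <-] [b _ <-]; exact: lens_transition.
Qed.

Lemma lens_locally_euclidean : locally_euclidean3 R (lens R).
Proof.
move=> m; have [s sm] := lens_chart_cover m.
by exists (lens_chart s) => //; exact: lens_chart_embedding.
Qed.

Lemma lens_second_countable : @second_countable (lens R).
Proof.
pose B (p : {ffun 'I_4 -> rat} * rat) : set (lens R) :=
  @lpr R @` [set x | forall k, `|sval3 x 0 k - ratr (p.1 k)| < ratr p.2].
exists (range B); first exact: (card_le_trans (card_image_le _ _) (countableP _)).
split=> [_ [p _ <-]|m N].
  apply: open_at_open => [x|]; first exact: lpr_open_at.
  rewrite openE => x /= xp.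
  have nk k : nbhs x [set x : T | `|sval3 x 0 k - ratr (p.1 k)| < ratr p.2].
    have c : {for x, continuous (fun x : T => ratr p.2 - `|sval3 x 0 k - ratr (p.1 k)|)}.
      apply: (@cont_subr R T x (fun=> ratr p.2)); first exact: cont_cst.
      apply: (@cont_norm R T x R^o).
      apply: (@cont_subr R T x (fun x : T => sval3 x 0 k)); last exact: cont_cst.
      exact: sval3_coord_cont.
    have n0 : nbhs (ratr p.2 - `|sval3 x 0 k - ratr (p.1 k)|) [set r : R | 0 < r].
      by apply: open_nbhs_nbhs; split; [exact: open_gt|rewrite /= subr_gt0].
    by apply: nbhsS (c _ n0) => z /=; rewrite subr_gt0.
  apply: nbhsS (filterI (filterI (nk k0) (nk k1)) (filterI (nk k2) (nk k3))).
  by move=> z [[z0 z1] [z2 z3]]; apply: ord4P.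
have [x <-] : exists x : T, lpr x = m by have [_ [_ _ + _]] := lens_cover R; exact.
move=> /(@lpr_continuous R x); rewrite nbhsE => -[S [[V oV VS] Sx] SN].
have /nbhs_ballP[e /= e0 eV] : nbhs (sval3 x) V.
  by apply: open_nbhs_nbhs; split=> //; move: Sx; rewrite -VS.
have e20 : 0 < e / 2 by rewrite divr_gt0.
have [r] := rat_in_itvoo e20; rewrite in_itv /= => /andP[r0 re].
have [q qE] : exists q : {ffun 'I_4 -> rat}, forall k, `|sval3 x 0 k - ratr (q k)| < ratr r.
  have q_ k : {q : rat | `|sval3 x 0 k - ratr q| < ratr r}.
    apply: cid; have : sval3 x 0 k - ratr r < sval3 x 0 k + ratr r by lra.
    move=> /rat_in_itvoo[q]; rewrite in_itv /= => /andP[h1 h2]; exists q.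
    by rewrite ltr_norml; apply/andP; split; lra.
  by exists [ffun k => sval (q_ k)] => k; rewrite ffunE; exact: svalP (q_ k).
exists (B (q, r)); first by split; [exists (q, r)|exists x].
move=> _ [z zq <-]; apply: SN; rewrite -VS; apply: eV.
split=> // i k; rewrite (ord1 i) /ball /= -/(sval3 z).
have := qE k; have := zq k; rewrite /= !ltr_norml => /andP[a1 a2] /andP[b1 b2].
by apply/andP; split; lra.
Qed.

Theorem lens_closed_3manifold : closed_3manifold R (lens R).
Proof.
split; [exact: lens_nonempty|exact: lens_connected|exact: lens_compact
  |exact: lens_hausdorff|split].
- exact: lens_second_countable.
- exact: lens_locally_euclidean.
Qed.

End LensManifold.

(** * Realizations and bistellar moves *)

Section Tables.
Local Open Scope nat_scope.

(** Entry [f] of row [t] is [(u, p)] when face [f] of tetrahedron [t] is glued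
    to a face of [u] by the permutation [m |-> nth 0 p m]. *)
Definition table := seq (seq (nat * seq nat)).

Definition glued (T : table) t f : nat * seq nat := nth (0, [::]) (nth [::] T t) f.

Definition wf_table (T : table) : bool :=
  (0 < size T) && all (fun r => (size r == 4) &&
    all (fun e => (e.1 < size T) && perm_eq e.2 (iota 0 4)) r) T.

Lemma wf_glued T t f : wf_table T -> t < size T -> f < 4 ->
  (glued T t f).1 < size T /\ perm_eq (glued T t f).2 (iota 0 4).
Proof.
move=> /andP[_ /allP h] tT f4; have := h _ (mem_nth [::] tT) => /andP[/eqP sr /allP hr].
by apply/andP; apply: hr; apply: mem_nth; rewrite sr.
Qed.

Definition perm_of (s : seq nat) : 'S_4 :=
  insubd (1%g : 'S_4) [ffun i : 'I_4 => inord (nth 0 s i) : 'I_4].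

Lemma perm_iota_lt n s m : perm_eq s (iota 0 n) -> m < n -> nth 0 s m < n.
Proof.
move=> sp mn; have ss : size s = n by rewrite (perm_size sp) size_iota.
by have := mem_nth 0 (_ : m < size s); rewrite ss (perm_mem sp) mem_iota; exact.
Qed.

Lemma perm_ofE s (i : 'I_4) : perm_eq s (iota 0 4) -> perm_of s i = nth 0 s i :> nat.
Proof.
move=> sp; have ss : size s = 4 by rewrite (perm_size sp).
have us : uniq s by rewrite (perm_uniq sp) iota_uniq.
have inj : injectiveb [ffun i : 'I_4 => inord (nth 0 s i) : 'I_4].
  apply/injectiveP => a b; rewrite !ffunE => /(congr1 val) /=.
  rewrite !inordK ?perm_iota_lt // => /eqP; rewrite nth_uniq ?ss // => /eqP h.
  exact: val_inj.
rewrite -pvalE /perm_of.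
have -> : pval (insubd (1%g : 'S_4) [ffun i : 'I_4 => inord (nth 0 s i) : 'I_4]) =
  [ffun i : 'I_4 => inord (nth 0 s i) : 'I_4] by exact: insubdK.
by rewrite ffunE inordK // perm_iota_lt.
Qed.

(** [(size T).-1.+1] is the size of a nonempty table in the form of a successor, as [inord]
    requires. *)
Definition gluing_of (T : table) : gluing 'I_(size T).-1.+1 :=
  [ffun F : 'I_(size T).-1.+1 * 'I_4 =>
    (inord (glued T F.1 F.2).1, perm_of (glued T F.1 F.2).2)].

Lemma wf_size T : wf_table T -> (size T).-1.+1 = size T.
Proof. by case/andP=> s0 _; rewrite prednK. Qed.

Lemma wf_ltn T (t : 'I_(size T).-1.+1) : wf_table T -> t < size T.
Proof. by move=> /wf_size h; rewrite -[X in _ < X]h. Qed.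

Lemma gluing_of1 T t f : wf_table T ->
  (gluing_of T (t, f)).1 = (glued T t f).1 :> nat.
Proof.
move=> wT; have [h _] := wf_glued wT (wf_ltn t wT) (ltn_ord f).
by rewrite ffunE /= inordK // (leq_trans h) // wf_size.
Qed.

Lemma gluing_of2 T t f i : wf_table T ->
  (gluing_of T (t, f)).2 i = nth 0 (glued T t f).2 i :> nat.
Proof.
move=> wT; have [_ h] := wf_glued wT (wf_ltn t wT) (ltn_ord f).
by rewrite ffunE perm_ofE.
Qed.

End Tables.

(** * Points of a realization in barycentric coordinates *)

Section Points.
Variable R : realType.
Local Notation V4 := 'rV[R]_4.

(** Barycentric coordinates as functions on numbers; values from [n] on are irrelevant. *)
Definition weight n (w : nat -> R) : Prop :=
  (forall m, (m < n)%N -> 0 <= w m) /\ \sum_(m <- iota 0 n) w m = 1.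

Lemma weight_perm n p (w w' : nat -> R) : perm_eq p (iota 0 n) ->
  (forall m, (m < n)%N -> w' (nth 0%N p m) = w m) -> weight n w -> weight n w'.
Proof.
move=> pp ww [w0 w1]; have sp : size p = n by rewrite (perm_size pp) size_iota.
split=> [m mn|].
  have mp : m \in p by rewrite (perm_mem pp) mem_iota.
  have ip : (index m p < n)%N by rewrite -sp index_mem.
  by rewrite -(nth_index 0%N mp) ww // w0.
rewrite -(perm_big _ pp) (big_nth 0%N) sp -w1 /index_iota subn0 big_seq [RHS]big_seq.
by apply: eq_bigr => m; rewrite mem_iota => mn; rewrite ww.
Qed.

Definition abs_sum (x : V4) : R := \sum_i `|x 0 i|.

(** A retraction onto the simplex, continuous off 0, so that points can be written down without a
    proof that they lie in it. *)
Definition to_simplex_row (x : V4) : V4 :=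
  if abs_sum x == 0 then delta_mx 0 ord0 else \row_i (`|x 0 i| / abs_sum x).

Lemma to_simplex_proof x : @simplex3 R (to_simplex_row x).
Proof.
rewrite /to_simplex_row; case: eqP => [_|/eqP x0]; split=> [i|].
- by rewrite mxE ler0n.
- rewrite (bigD1 ord0) //= mxE eqxx big1 ?addr0 // => i i0.
  by rewrite mxE (negbTE i0) andbF.
- by rewrite mxE mulr_ge0 // invr_ge0 sumr_ge0.
under eq_bigr do rewrite mxE.
by rewrite -mulr_suml mulfV.
Qed.

Definition to_simplex (x : V4) : set_type (@simplex3 R) :=
  exist _ (to_simplex_row x) (mem_set (to_simplex_proof x)).

Lemma set_val_to_simplex x : set_val (to_simplex x) = to_simplex_row x.
Proof. by []. Qed.

Lemma to_simplex_id x : @simplex3 R x -> set_val (to_simplex x) = x.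
Proof.
move=> [x0 x1]; have ax : abs_sum x = 1.
  by rewrite -x1; apply: eq_bigr => i _; rewrite ger0_norm.
rewrite set_val_to_simplex /to_simplex_row ax oner_eq0; apply/rowP => i.
by rewrite mxE divr1 ger0_norm.
Qed.

Lemma set_type_cont (X Y : topologicalType) (A : set Y) (x : X) (f : X -> set_type A) :
  {for x, continuous (fun y => set_val (f y))} -> {for x, continuous f}.
Proof.
move=> fc N; rewrite nbhsE => -[B [[V oV VB] By] BN].
have : nbhs x ((fun y => set_val (f y)) @^-1` V).
  by apply: fc; apply: open_nbhs_nbhs; split=> //; move: By; rewrite -VB.
by apply: nbhsS => y Vy; apply: BN; rewrite -VB.
Qed.

Definition weight_row (w : nat -> R) : V4 := \row_i w i.

Lemma weight_row_simplex w : weight 4 w -> @simplex3 R (weight_row w).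
Proof.
move=> [w0 w1]; split=> [i|]; first by rewrite mxE w0.
rewrite -w1 -[iota 0 4]/(index_iota 0 4) big_mkord.
by apply: eq_bigr => i _; rewrite mxE.
Qed.

Definition coords (x : set_type (@simplex3 R)) (m : nat) : R :=
  set_val x 0 (inord m).

Lemma coords_weight x : weight 4 (coords x).
Proof.
have /set_mem[x0 x1] := valP x; split=> [m _|]; first exact: x0.
rewrite -[iota 0 4]/(index_iota 0 4) big_mkord -x1.
by apply: eq_bigr => i _; rewrite /coords inord_val.
Qed.

Lemma coordsK x : to_simplex (weight_row (coords x)) = x.
Proof.
apply: val_inj; rewrite /= -[LHS]/(set_val (to_simplex (weight_row (coords x)))).
rewrite to_simplex_id; last by apply: weight_row_simplex; exact: coords_weight.
by apply/rowP => i; rewrite mxE /coords inord_val.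
Qed.

Lemma to_simplexK w m : weight 4 w -> (m < 4)%N ->
  coords (to_simplex (weight_row w)) m = w m.
Proof.
move=> ww m4; rewrite /coords to_simplex_id; last exact: weight_row_simplex.
by rewrite mxE inordK.
Qed.

Lemma to_simplex_cont (X : topologicalType) (x : X) (w : X -> nat -> R) :
  weight 4 (w x) -> (forall m, (m < 4)%N -> {for x, continuous (fun y => w y m)}) ->
  {for x, continuous (fun y => to_simplex (weight_row (w y)))}.
Proof.
move=> wx wc; apply: set_type_cont.
have ac : {for x, continuous (fun y => abs_sum (weight_row (w y)))}.
  apply: (@cont_sum R X x _ _ (fun i y => `|weight_row (w y) 0 i|)) => i.
  apply: (@cont_norm R X x R^o); apply: (@continuous_near _ _ (fun y => w y i)); last exact: wc.
  by near=> y; rewrite mxE.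
have a1 : abs_sum (weight_row (w x)) = 1.
  have [w0 w1] := weight_row_simplex wx; rewrite -w1.
  by apply: eq_bigr => i _; rewrite ger0_norm.
have az : \forall y \near x, abs_sum (weight_row (w y)) != 0.
  have : nbhs (abs_sum (weight_row (w x))) [set r : R | 0 < r].
    by apply: open_nbhs_nbhs; split; [exact: open_gt|rewrite /= a1].
  by move=> /ac; apply: nbhsS => y /= h; rewrite gt_eqF.
apply: (@continuous_near _ _ (fun y =>
  row4 (`|w y 0%N| / abs_sum (weight_row (w y))) (`|w y 1%N| / abs_sum (weight_row (w y)))
       (`|w y 2%N| / abs_sum (weight_row (w y))) (`|w y 3%N| / abs_sum (weight_row (w y))))).
  apply: nbhsS az => y h; rewrite set_val_to_simplex /to_simplex_row (negbTE h).
  by apply: row4P; rewrite row4E !mxE.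
have cc m : (m < 4)%N -> {for x, continuous (fun y => `|w y m| / abs_sum (weight_row (w y)))}.
  move=> m4; apply: (@cont_mul R X x (fun y => `|w y m|)).
    by apply: (@cont_norm R X x R^o); exact: wc.
  by apply: cont_inv => //; exact: nbhs_singleton az.
by apply: (@row4_cont R X x) (cc 0%N isT) (cc 1%N isT) (cc 2%N isT) (cc 3%N isT).
Unshelve. all: by end_near.
Qed.

Lemma coords_cont m : continuous (fun x => coords x m).
Proof.
move=> x; apply: (@coord4_cont R _ x (fun x : set_type (@simplex3 R) => set_val x)).
exact: initial_continuous.
Qed.

Lemma simplex_compact : compact [set: set_type (@simplex3 R)].
Proof.
have cS : compact (@simplex3 R).
  apply: bounded_closed_compact.
    exists 1; split; first exact: num_real.
    move=> s s1 v [v0 v1] /=; apply: le_trans (ltW s1).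
    have h := norm_le_sqnorm v; rewrite -(@expr_le1 _ 2) //; apply: le_trans h _.
    rewrite -(expr1n _ 2) -v1 sqnorm4 sum4.
    have := v0 k0; have := v0 k1; have := v0 k2; have := v0 k3.
    move: (v 0 k0) (v 0 k1) (v 0 k2) (v 0 k3) => a b c d d0 c0 b0 a0.
    have := mulr_ge0 a0 b0; have := mulr_ge0 a0 c0; have := mulr_ge0 a0 d0.
    have := mulr_ge0 b0 c0; have := mulr_ge0 b0 d0; have := mulr_ge0 c0 d0; nra.
  rewrite (_ : @simplex3 R = [set x : V4 | 0 <= x 0 k0] `&` [set x : V4 | 0 <= x 0 k1] `&`
    [set x : V4 | 0 <= x 0 k2] `&` [set x : V4 | 0 <= x 0 k3] `&` [set x : V4 | \sum_i x 0 i = 1]).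
    have cg k : closed [set x : V4 | 0 <= x 0 k].
      apply: (@preimage_closed _ _ (fun x : V4 => x 0 k) [set r | 0 <= r]).
        by move=> v _; exact: coord_continuous.
      exact: closed_ge.
    do !apply: closedI => //.
    apply: (@preimage_closed _ _ (fun x : V4 => \sum_i x 0 i) [set 1]).
      by move=> v _; apply: cont_sum => i; exact: coord_continuous.
    by apply: accessible_closed_set1; apply: hausdorff_accessible; exact: Rhausdorff.
  apply/seteqP; split=> x; first by move=> [x0 x1]; rewrite /setI /= !x0.
  by move=> [[[[? ?] ?] ?] x1]; split=> //; exact: ord4P.
have rowK (v : V4) : weight_row (fun m => v 0 (inord m)) = v.
  by apply/rowP => i; rewrite mxE inord_val.
rewrite (_ : [set: _] = (fun v : V4 => to_simplex (weight_row (fun m => v 0 (inord m)))) @` @simplex3 R).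
  apply: continuous_compact cS; apply: continuous_in_subspaceT => v /set_mem v1.
  apply: (@to_simplex_cont V4 v (fun v m => v 0 (inord m))).
    have := coords_weight (exist _ v (mem_set v1)); exact.
  by move=> m _; exact: coord_continuous.
apply/seteqP; split=> // x _; exists (set_val x); first exact: set_mem (valP x).
by rewrite rowK; apply: val_inj; rewrite -[LHS]/(set_val (to_simplex (set_val x)))
  to_simplex_id //; exact: set_mem (valP x).
Qed.

Section Realization.
Variable T : table.
Hypothesis wT : wf_table T.

Local Notation RT := (realization R (gluing_of T)).

Definition point_of (t : nat) (w : nat -> R) : RT :=
  \pi_{eq_quot (identified_equiv (@point_glued _ R (gluing_of T)))}
    (existT (fun _ => set_type (@simplex3 R)) (inord t) (to_simplex (weight_row w))).

Lemma point_of_ext t w w' : (forall m, (m < 4)%N -> w m = w' m) ->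
  point_of t w = point_of t w'.
Proof.
move=> ww; rewrite /point_of (_ : weight_row w = weight_row w') //.
by apply/rowP => i; rewrite !mxE ww.
Qed.

Lemma point_of_surj z : exists t w, [/\ (t < size T)%N, weight 4 w & z = point_of t w].
Proof.
have := reprK (z : {eq_quot (identified_equiv (@point_glued _ R (gluing_of T)))}).
case: (repr _) => t x <-; exists t, (coords x); split.
- exact: wf_ltn.
- exact: coords_weight.
by rewrite /point_of inord_val coordsK.
Qed.

Lemma point_of_glue t f w w' : (t < size T)%N -> (f < 4)%N -> weight 4 w -> w f = 0 ->
  (forall m, (m < 4)%N -> w' (nth 0%N (glued T t f).2 m) = w m) ->
  point_of t w = point_of (glued T t f).1 w'.
Proof.
move=> tT f4 ww wf0 wg; have [uT pp] := wf_glued wT tT f4.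
have ww' : weight 4 w' := weight_perm pp wg ww.
have sT : ((size T).-1.+1 = size T)%N := wf_size wT.
have tE : nat_of_ord (inord t : 'I_(size T).-1.+1) = t by rewrite inordK ?sT.
have fE : nat_of_ord (inord f : 'I_4) = f by rewrite inordK.
apply/eqmodP/asboolP; apply: rst_step; exists (inord f); split=> /=.
- by rewrite to_simplex_id ?mxE ?fE //; exact: weight_row_simplex.
- by apply: val_inj; rewrite /= gluing_of1 // tE fE inordK ?sT.
move=> i; rewrite -[_ 0 _]/(set_val (to_simplex (weight_row w')) 0 _) -[RHS]/(set_val (to_simplex (weight_row w)) 0 _).
rewrite !to_simplex_id; try exact: weight_row_simplex.
by rewrite !mxE gluing_of2 // tE fE wg.
Qed.

(** The universal property of the quotient, for maps given tetrahedron by tetrahedron. *)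
Lemma realization_rec (Y : topologicalType) (F : nat -> (nat -> R) -> Y) :
  (forall t w w', (forall m, (m < 4)%N -> w m = w' m) -> weight 4 w -> F t w = F t w') ->
  (forall t f w w', (t < size T)%N -> (f < 4)%N -> weight 4 w -> w f = 0 ->
    (forall m, (m < 4)%N -> w' (nth 0%N (glued T t f).2 m) = w m) ->
    F t w = F (glued T t f).1 w') ->
  (forall t, (t < size T)%N -> continuous (fun x => F t (coords x))) ->
  exists2 phi : RT -> Y, continuous phi &
    forall t w, (t < size T)%N -> weight 4 w -> phi (point_of t w) = F t w.
Proof.
move=> Fext Fglue Fc.
pose g (p : {t : 'I_(size T).-1.+1 & set_type (@simplex3 R)}) := F (tag p) (coords (tagged p)).
have gstep p q : point_glued (gluing_of T) p q -> g p = g q.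
  case: p q => [t x] [u x'] [f /= [xf tu xx]]; rewrite /g /=.
  have -> : (u : nat) = (glued T t f).1 by rewrite tu gluing_of1.
  apply: Fglue => //; first exact: wf_ltn.
  - exact: coords_weight.
  - by rewrite /coords inord_val.
  move=> m m4; rewrite /coords.
  have -> : inord (nth 0%N (glued T t f).2 m) = (gluing_of T (t, f)).2 (inord m : 'I_4).
    by apply: val_inj; rewrite /= gluing_of2 // !inordK // perm_iota_lt // (wf_glued wT (wf_ltn t wT) (ltn_ord f)).2.
  exact: xx.
have grst p q : clos_refl_sym_trans _ (point_glued (gluing_of T)) p q -> g p = g q.
  by elim=> {p q} [p q /gstep//|//|p q _ ->//|p q r _ -> _ ->].
pose Q := {eq_quot (identified_equiv (@point_glued _ R (gluing_of T)))}.
have gpi p : g (repr (\pi_Q p)) = g p.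
  have : \pi_Q (repr (\pi_Q p)) = \pi_Q p by exact: reprK.
  by move=> /eqmodP/asboolP/grst.
exists (g \o (fun z : RT => repr (z : Q))).
  apply: (@repr_comp_continuous _ Q Y g).
    exact: (@sigT_continuous _ (fun=> set_type (@simplex3 R)) Y (fun t x => F (nat_of_ord t) (coords x))
      (fun t => Fc _ (wf_ltn t wT))).
  by move=> p q /eqP pq; rewrite -gpi pq gpi.
move=> t w tT ww; rewrite /= gpi /g /= inordK ?wf_size //.
by apply: Fext => [m m4|]; [exact: to_simplexK|exact: coords_weight].
Qed.

Lemma point_of_cont (X : topologicalType) (x : X) t (w : X -> nat -> R) :
  weight 4 (w x) -> (forall m, (m < 4)%N -> {for x, continuous (fun y => w y m)}) ->
  {for x, continuous (fun y => point_of t (w y))}.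
Proof.
move=> wx wc; have c := to_simplex_cont wx wc.
apply: (@cont_comp _ _ _ _ (fun y => existT (fun _ : 'I_(size T).-1.+1 => set_type (@simplex3 R)) (inord t) (to_simplex (weight_row (w y))))); last exact: pi_continuous.
apply: (@cont_comp _ _ _ _ (fun y => to_simplex (weight_row (w y)))
  (existT (fun _ : 'I_(size T).-1.+1 => set_type (@simplex3 R)) (inord t))) => //.
Qed.

Lemma realization_compact : compact [set: RT].
Proof.
have cD : compact [set: set_type (@simplex3 R)] := simplex_compact.
have cS : compact [set: {t : 'I_(size T).-1.+1 & set_type (@simplex3 R)}].
  by apply: sigT_compact => //; exact: finite_finset.
have -> : [set: RT] = \pi_{eq_quot (identified_equiv (@point_glued _ R (gluing_of T)))} @` setT.
  apply/seteqP; split=> // z _; exists (repr (z : {eq_quot (identified_equiv (@point_glued _ R (gluing_of T)))})) => //.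
  exact: reprK.
apply: continuous_compact cS; apply: continuous_subspaceT; exact: pi_continuous.
Qed.

End Realization.
End Points.

(** * Bistellar moves on tables *)

Section Moves.
Local Open Scope nat_scope.

(** Tetrahedra of a ball triangulated by facets of the 4-simplex with vertices
    0, ..., 4: the entry [(i, (t, l))] says that [t] is the facet opposite [i]
    and that its vertex [m] is the vertex [nth 0 l m] of the 4-simplex. *)
Definition entry : Type := nat * (nat * seq nat).

Definition find_by (f : entry -> nat) (L : seq entry) k : option entry :=
  ohead [seq e <- L | f e == k].

Definition entry_index (e : entry) : nat := e.1.
Definition entry_tet (e : entry) : nat := e.2.1.
Definition entry_at := find_by entry_index.
Definition entry_of := find_by entry_tet.

(** In the other triangulation, the tetrahedron that contains face [f] of [t]
    and the positions of the vertices of [t] in it, vertex [f] being sent to the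
    new position opposite that face; [None] for a face inside the ball. *)
Definition outer (L L' : seq entry) (kk : seq nat) t f : option (nat * seq nat) :=
  if entry_of L t is Some e then
    if entry_at L' (nth 0 e.2.2 f) is Some e' then
      Some (e'.2.1, [seq index (if m == f then e.1 else nth 0 e.2.2 m) e'.2.2 | m <- iota 0 4])
    else None
  else Some (nth 0 kk t, iota 0 4).

(** A face on the boundary of the ball or outside it must be glued in [T'] as in [T]; a face inside
    the ball must be glued as in the 4-simplex. *)
Definition face_ok (T T' : table) L L' kk t f : bool :=
  let u := (glued T t f).1 in let p := (glued T t f).2 in
  match outer L L' kk t f with
  | Some (t', s) =>
    match outer L L' kk u (nth 0 p f) with
    | Some (u', s') =>
      [&& t' < size T', perm_eq s (iota 0 4), (glued T' t' (nth 0 s f)).1 == u' &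
        all (fun m => nth 0 (glued T' t' (nth 0 s f)).2 (nth 0 s m)
                      == nth 0 s' (nth 0 p m)) (iota 0 4)]
    | None => false
    end
  | None =>
    match entry_of L t, entry_of L u with
    | Some e, Some e' => (e'.1 == nth 0 e.2.2 f) &&
      all (fun m => nth 0 e'.2.2 (nth 0 p m)
                    == if m == f then e.1 else nth 0 e.2.2 m) (iota 0 4)
    | _, _ => false
    end
  end.

(** The tables [T] and [T'] differ by a bistellar move: the tetrahedra listed
    in [L] are replaced by those in [L'], and [kk] renumbers the others. *)
Definition move_ok (T T' : table) (L L' : seq entry) (kk kk' : seq nat) : bool :=
  [&& wf_table T, 0 < size L,
      perm_eq ([seq e.1 | e <- L] ++ [seq e.1 | e <- L']) (iota 0 5),
      uniq [seq e.2.1 | e <- L],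
      all (fun e => (e.2.1 < size T) && perm_eq (e.1 :: e.2.2) (iota 0 5)) L,
      all (fun t => (entry_of L t == None) ==>
        [&& nth 0 kk t < size T', entry_of L' (nth 0 kk t) == None &
            nth 0 kk' (nth 0 kk t) == t]) (iota 0 (size T)) &
      all (fun t => all (face_ok T T' L L' kk t) (iota 0 4)) (iota 0 (size T))].

Lemma find_by_some f L k e : find_by f L k = Some e -> e \in L /\ f e = k.
Proof.
rewrite /find_by; case E: [seq _ <- _ | _] => [//|e0 s] /= [<-].
have : e0 \in [seq e <- L | f e == k] by rewrite E mem_head.
by rewrite mem_filter => /andP[/eqP].
Qed.

Lemma find_by_none f L k e : find_by f L k = None -> e \in L -> f e <> k.
Proof.
rewrite /find_by; case E: [seq _ <- _ | _] => [|e0 s] //= _ eL /eqP ek.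
by have : e \in [seq e <- L | f e == k]; [rewrite mem_filter ek|rewrite E].
Qed.

Lemma uniq_map_inj (A B : eqType) (f : A -> B) s x y : uniq (map f s) ->
  x \in s -> y \in s -> f x = f y -> x = y.
Proof.
elim: s => //= z s IH /andP[zs us]; rewrite !inE => /predU1P[->|xs] /predU1P[->|ys] //.
- by move=> fz; move: zs; rewrite fz map_f.
- by move=> fz; move: zs; rewrite -fz map_f.
exact: IH.
Qed.

Lemma find_by_in f L e : uniq (map f L) -> e \in L -> find_by f L (f e) = Some e.
Proof.
move=> uL eL; case E: (find_by f L (f e)) => [e0|].
  by have [e0L fe] := find_by_some E; rewrite (uniq_map_inj uL e0L eL fe).
by have := find_by_none E eL.
Qed.

End Moves.

(** * Two complementary parts of the boundary of the 4-simplex *)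

Section BarycentricBall.
Variable R : realType.
Implicit Types (w y : nat -> R) (I J l s : seq nat).

Lemma sum_perm n s w : perm_eq s (iota 0 n) ->
  \sum_(a <- iota 0 n) w a = \sum_(a <- s) w a.
Proof. by move=> sn; exact/esym/perm_big. Qed.

Lemma sum_cst s (c : R) : \sum_(a <- s) c = c * (size s)%:R.
Proof. by rewrite big_const_seq count_predT iter_addr_0 mulr_natr. Qed.

Definition embed l w a : R := if a \in l then w (index a l) else 0.
Definition project l y m : R := y (nth 0%N l m).

Lemma weight_ge0 n w m : weight n w -> (m < n)%N -> 0 <= w m.
Proof. by case=> h _; exact: h. Qed.

Lemma weight_le1 n w m : weight n w -> (m < n)%N -> w m <= 1.
Proof.
move=> [w0 <-] mn; rewrite (bigD1_seq m) ?iota_uniq ?mem_iota //= lerDl.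
rewrite big_seq_cond sumr_ge0 // => a /andP[]; rewrite mem_iota => an _; exact: w0.
Qed.

Section Facet.
Variables (i : nat) (l : seq nat).
Hypothesis il : perm_eq (i :: l) (iota 0 5).

Lemma facet_size : size l = 4%N.
Proof. by have /perm_size[] := il. Qed.

Lemma facet_uniq : uniq l /\ i \notin l.
Proof. by have := perm_uniq il; rewrite iota_uniq /= => /andP[]. Qed.

Lemma facet_lt a : (a < 5)%N = (a == i) || (a \in l).
Proof. by have := perm_mem il a; rewrite mem_iota /= inE => ->. Qed.

Lemma facet_nth_lt m : (m < 4)%N -> (nth 0%N l m < 5)%N.
Proof. by move=> m4; rewrite facet_lt mem_nth ?orbT // facet_size. Qed.

Lemma embed_nth w m : (m < 4)%N -> embed l w (nth 0%N l m) = w m.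
Proof.
move=> m4; rewrite /embed mem_nth ?facet_size //.
by rewrite index_uniq ?facet_size //; case: facet_uniq.
Qed.

Lemma embed0 w : embed l w i = 0.
Proof. by rewrite /embed; have [_ /negbTE ->] := facet_uniq. Qed.

Lemma embed_weight w : weight 4 w -> weight 5 (embed l w).
Proof.
move=> [w0 w1]; split=> [a _|].
  rewrite /embed; case: ifP => // al; apply: w0.
  by rewrite -facet_size index_mem.
rewrite (sum_perm _ il) big_cons embed0 add0r (big_nth 0%N) facet_size -w1.
rewrite /index_iota subn0 big_seq [RHS]big_seq; apply: eq_bigr => m.
by rewrite mem_iota => m4; rewrite embed_nth.
Qed.

Lemma project_weight y : weight 5 y -> y i = 0 -> weight 4 (project l y).
Proof.
move=> [y0 y1] yi; split=> [m m4|]; first by apply: y0; exact: facet_nth_lt.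
move: y1; rewrite (sum_perm _ il) big_cons yi add0r (big_nth 0%N) facet_size.
by rewrite /index_iota subn0.
Qed.

Lemma embedK w m : (m < 4)%N -> project l (embed l w) m = w m.
Proof. exact: embed_nth. Qed.

Lemma projectK y a : y i = 0 -> (a < 5)%N -> embed l (project l y) a = y a.
Proof.
move=> yi; rewrite facet_lt => /predU1P[->|al]; first by rewrite embed0.
by rewrite /embed al /project nth_index.
Qed.

End Facet.

(** The initial value 1 is harmless, as weights are at most 1. *)
Definition minw J y : R := \big[Num.min/1]_(a <- J) y a.

Lemma minwP J y : (0 < size J)%N -> (forall a, a \in J -> y a <= 1) ->
  (exists2 a, a \in J & y a = minw J y) /\ (forall a, a \in J -> minw J y <= y a).
Proof.
rewrite /minw; elim: J => [//|a J IH] _ y1; rewrite big_cons.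
case: J IH y1 => [_ y1|b J IH y1].
  rewrite big_nil min_l ?y1 ?mem_head //.
  by split=> [|c]; [exists a; rewrite ?mem_head|rewrite inE => /eqP ->].
have [|//|[c cJ cE] h] := IH => [//|c cJ|]; first by apply: y1; rewrite inE cJ orbT.
split.
  have [ac|ca] := leP (y a) (\big[Num.min/1]_(j <- (b :: J)) y j).
    by exists a; rewrite ?mem_head // min_l.
  by exists c => //; rewrite inE cJ orbT.
move=> d; rewrite inE ge_min => /predU1P[->|dJ]; first by rewrite lexx.
by rewrite h ?orbT.
Qed.

Lemma minw_uniq J y a c : a \in J -> (forall b, b \in J -> y b <= 1) ->
  y a = c -> (forall b, b \in J -> c <= y b) -> minw J y = c.
Proof.
move=> aJ y1 ya cy; have J0 : (0 < size J)%N by case: J aJ {y1 cy}.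
have [[b bJ bE] h] := minwP J0 y1; apply/eqP; rewrite eq_le -{1}ya h //=.
by rewrite -bE cy.
Qed.

Definition shift I J y a : R :=
  if a \in J then y a - minw J y
  else y a + minw J y * (size J)%:R / (size I)%:R.

Lemma shift0 I J y a : minw J y = 0 -> shift I J y a = y a.
Proof. by move=> y0; rewrite /shift y0 !mul0r subr0 addr0 if_same. Qed.

Section Shift.
Variables I J : seq nat.
Hypotheses (IJ : perm_eq (I ++ J) (iota 0 5)) (I0 : (0 < size I)%N) (J0 : (0 < size J)%N).

Lemma IJ_lt a : (a < 5)%N = (a \in I) || (a \in J).
Proof. by have := perm_mem IJ a; rewrite mem_iota mem_cat => ->. Qed.

Lemma IJ_disj a : a \in I -> (a \in J) = false.
Proof.
have := perm_uniq IJ; rewrite iota_uniq cat_uniq => /and3P[_ /hasPn h _] aI.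
by apply: contraTF aI; exact: h.
Qed.

Lemma JI_perm : perm_eq (J ++ I) (iota 0 5).
Proof. by rewrite perm_catC. Qed.

Lemma weight_bounds y : weight 5 y ->
  (forall a, a \in I -> 0 <= y a <= 1) /\ (forall a, a \in J -> 0 <= y a <= 1).
Proof.
by move=> wy; split=> a ha; rewrite (weight_ge0 wy) ?(weight_le1 wy) // IJ_lt ha ?orbT.
Qed.

Lemma minw_ge0 y : weight 5 y -> 0 <= minw J y.
Proof.
move=> /weight_bounds[_ yJ].
by have [|[a /yJ/andP[a0 _] <-] _] := @minwP J y J0 => // b /yJ/andP[].
Qed.

Lemma shift_weight y : weight 5 y -> weight 5 (shift I J y).
Proof.
move=> wy; have m0 := minw_ge0 wy; have [yI yJ] := weight_bounds wy.
have [|_ mle] := @minwP J y J0; first by move=> a /yJ/andP[].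
split=> [a a5|].
  rewrite /shift; case: ifP => aJ; first by rewrite subr_ge0 mle.
  by rewrite addr_ge0 ?(weight_ge0 wy) // divr_ge0 // mulr_ge0.
have [_ <-] := wy; rewrite !(sum_perm _ IJ) !big_cat /=.
have -> : \sum_(a <- I) shift I J y a = \sum_(a <- I) y a + minw J y * (size J)%:R.
  transitivity (\sum_(a <- I) (y a + minw J y * (size J)%:R / (size I)%:R)).
    by rewrite big_seq [RHS]big_seq; apply: eq_bigr => a aI; rewrite /shift IJ_disj.
  rewrite big_split /= sum_cst divfK //.
  by rewrite pnatr_eq0 -lt0n.
have -> : \sum_(a <- J) shift I J y a = \sum_(a <- J) y a - minw J y * (size J)%:R.
  transitivity (\sum_(a <- J) (y a - minw J y)).
    by rewrite big_seq [RHS]big_seq; apply: eq_bigr => a aJ; rewrite /shift aJ.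
  by rewrite big_split /= sum_cst mulNr.
by rewrite addrACA subrr addr0.
Qed.

Lemma shift_min y : weight 5 y -> exists2 a, a \in J & shift I J y a = 0.
Proof.
move=> /weight_bounds[_ yJ].
have [|[a aJ aE] _] := @minwP J y J0; first by move=> a /yJ/andP[].
by exists a => //; rewrite /shift aJ aE subrr.
Qed.

(** The vanishing coordinate in [I] becomes the minimum over [I], which records how far the point
    was slid. *)
Lemma shiftK y a : weight 5 y -> (exists2 i, i \in I & y i = 0) -> (a < 5)%N ->
  shift J I (shift I J y) a = y a.
Proof.
move=> wy [i iI yi] a5; have [yI yJ] := weight_bounds wy.
have ws := shift_weight wy; have [sI sJ] := weight_bounds ws.
have mI : minw I (shift I J y) = minw J y * (size J)%:R / (size I)%:R.
  apply: (@minw_uniq I _ i) => //; first by move=> b /sI/andP[].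
    by rewrite /shift IJ_disj // yi add0r.
  by move=> b bI; rewrite /shift IJ_disj // lerDr; have /andP[] := yI _ bI.
have nI : (size I)%:R != 0 :> R by rewrite pnatr_eq0 -lt0n.
have nJ : (size J)%:R != 0 :> R by rewrite pnatr_eq0 -lt0n.
rewrite {1}/shift mI; case: ifP => aI; first by rewrite /shift IJ_disj // addrK.
move: a5; rewrite IJ_lt aI /= => aJ; rewrite /shift aJ.
by rewrite divfK // mulfK // subrK.
Qed.

Lemma minw_ext y y' : (forall a, (a < 5)%N -> y a = y' a) -> minw J y = minw J y'.
Proof.
move=> yy; rewrite /minw big_seq [RHS]big_seq; apply: eq_bigr => a aJ.
by rewrite yy // IJ_lt aJ orbT.
Qed.

Lemma shift_ext y y' a : (forall a, (a < 5)%N -> y a = y' a) -> (a < 5)%N ->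
  shift I J y a = shift I J y' a.
Proof. by move=> yy a5; rewrite /shift (minw_ext yy) yy. Qed.

End Shift.

Lemma shift_cont (X : topologicalType) (x : X) I J (y : X -> nat -> R) a :
  (forall b, {for x, continuous (fun z => y z b)}) ->
  {for x, continuous (fun z => shift I J (y z) a)}.
Proof.
move=> yc; have mc : {for x, continuous (fun z => minw J (y z))}.
  rewrite /minw; elim: J => [|b J IH].
    have -> : (fun z => \big[Num.min/1]_(a <- [::]) y z a) = fun=> 1.
      by apply/funext => z; rewrite big_nil.
    exact: cont_cst.
  have -> : (fun z => \big[Num.min/1]_(a <- b :: J) y z a) =
      fun z => Num.min (y z b) (\big[Num.min/1]_(c <- J) y z c).
    by apply/funext => z; rewrite big_cons.
  by apply: continuous_min => //; exact: yc.
rewrite /shift; case: (a \in J).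
  exact: (@cont_subr R X x (fun z => y z a) _ (yc a) mc).
apply: (@cont_addr R X x (fun z => y z a) _ (yc a)).
apply: (@cont_mul R X x (fun z => minw J (y z) * (size J)%:R)); last exact: cont_cst.
by apply: (@cont_mul R X x (fun z => minw J (y z))); [exact: mc|exact: cont_cst].
Qed.

End BarycentricBall.

(** * Points of the ball that a move replaces *)

Section MoveMap.
Variable R : realType.
Variables (T T' : table) (L L' : seq entry) (kk kk' : seq nat).

(** Read off in the first listed facet that contains the point. *)
Definition ball_point (y : nat -> R) : realization R (gluing_of T) :=
  let e := head (0, (0, [::]))%N [seq e <- L | y e.1 == 0] in
  point_of T e.2.1 (project e.2.2 y).

Hypothesis H : move_ok T T' L L' kk kk'.

Let wT : wf_table T. Proof. by case/and5P: H. Qed.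

Lemma move_data : [/\ (0 < size L)%N,
  perm_eq ([seq e.1 | e <- L] ++ [seq e.1 | e <- L']) (iota 0 5),
  uniq [seq e.2.1 | e <- L], uniq [seq e.1 | e <- L] &
  forall e, e \in L -> (e.2.1 < size T)%N /\ perm_eq (e.1 :: e.2.2) (iota 0 5)].
Proof.
case/and5P: H => _ L0 LL uL /and3P[/allP h _ _]; split=> //.
  by have := perm_uniq LL; rewrite iota_uniq cat_uniq => /andP[].
by move=> e /h/andP[].
Qed.

Lemma move_kept t : (t < size T)%N -> entry_of L t = None ->
  [/\ (nth 0%N kk t < size T')%N, entry_of L' (nth 0%N kk t) = None &
      nth 0%N kk' (nth 0%N kk t) = t].
Proof.
move=> tT tN; case/and5P: H => _ _ _ _ /and3P[_ /allP h _].
have := h t; rewrite mem_iota tT tN => /(_ isT) /= /and3P[h1 /eqP h2 /eqP h3].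
by split.
Qed.

Lemma move_face t f : (t < size T)%N -> (f < 4)%N -> face_ok T T' L L' kk t f.
Proof.
move=> tT f4; case/and5P: H => _ _ _ _ /and3P[_ _ /allP h].
have tI : t \in iota 0 (size T) by rewrite mem_iota.
by have /allP := h t tI; apply; rewrite mem_iota.
Qed.

(** A point of two listed facets is on their common face, inside the ball, and there [face_ok]
    demands the gluing of the 4-simplex. *)
Lemma ball_point_eq e y : e \in L -> weight 5 y -> y e.1 = 0 ->
  ball_point y = point_of T e.2.1 (project e.2.2 y).
Proof.
move=> eL wy ye; have [_ LL ut ui ed] := move_data; rewrite /ball_point.
case E: [seq e <- L | y e.1 == 0] => [|e0 s] /=.
  by have : e \in [seq e <- L | y e.1 == 0]; [rewrite mem_filter ye eqxx|rewrite E].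
have : e0 \in [seq e <- L | y e.1 == 0] by rewrite E mem_head.
rewrite mem_filter => /andP[/eqP ye0 e0L].
have [e0e|ne] := eqVneq e0.1 e.1; first by rewrite (uniq_map_inj ui e0L eL e0e).
have [t0 p0] := ed _ e0L; have [t1 p1] := ed _ eL.
have eI : (e.1 < 5)%N by rewrite (facet_lt p1) eqxx.
have el : e.1 \in e0.2.2 by move: eI; rewrite (facet_lt p0) eq_sym (negbTE ne).
pose f := index e.1 e0.2.2; have f4 : (f < 4)%N by rewrite -(facet_size p0) index_mem.
have lf : nth 0%N e0.2.2 f = e.1 by rewrite nth_index.
have := move_face t0 f4; rewrite /face_ok /outer.
have -> : entry_of L e0.2.1 = Some e0 by exact: (@find_by_in entry_tet).
rewrite lf; have -> : entry_at L' e.1 = None.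
  case E' : (entry_at L' e.1) => [e'|//]; have [e'L' e'e] := find_by_some E'.
  by have := IJ_disj LL (map_f _ eL); rewrite -[e.1]e'e (map_f (fun e => e.1) e'L').
case Eu : (entry_of L _) => [e2|//] /andP[/eqP e2i /allP h].
have [e2L e2t] := find_by_some Eu.
have e2e : e2 = e := uniq_map_inj ui e2L eL e2i; rewrite e2e in h e2t.
have w0 := project_weight p0 wy ye0.
rewrite (point_of_glue wT t0 f4 w0 (w' := project e.2.2 y)); first by rewrite -e2t.
  by rewrite /project lf.
move=> m m4; have mI : m \in iota 0 4 by rewrite mem_iota.
have /eqP hm := h m mI.
rewrite /project hm; case: eqP => [->|//]; by rewrite lf ye ye0.
Qed.

Lemma ball_point_ext y y' : (forall a, (a < 5)%N -> y a = y' a) ->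
  (exists2 e, e \in L & y e.1 = 0) -> ball_point y = ball_point y'.
Proof.
move=> yy [e eL ye]; have [_ _ _ _ ed] := move_data; rewrite /ball_point.
have e5 e' : e' \in L -> (e'.1 < 5)%N by move=> /ed[_ p]; rewrite (facet_lt p) eqxx.
have -> : [seq e <- L | y' e.1 == 0] = [seq e <- L | y e.1 == 0].
  by apply: eq_in_filter => e' e'L; rewrite yy // e5.
case E: [seq e <- L | y e.1 == 0] => [|e0 s] /=.
  by have : e \in [seq e <- L | y e.1 == 0]; [rewrite mem_filter ye eqxx|rewrite E].
have : e0 \in [seq e <- L | y e.1 == 0] by rewrite E mem_head.
rewrite mem_filter => /andP[_ e0L]; have [_ p0] := ed _ e0L.
by apply: point_of_ext => m m4; rewrite /project yy // (facet_nth_lt p0).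
Qed.

(** Finitely many closed conditions [y e.1 = 0] cover the space, and the map is continuous on
    each. *)
Lemma ball_point_cont (X : topologicalType) (x : X) (y : X -> nat -> R) :
  (forall z, weight 5 (y z)) -> (forall z, exists2 e, e \in L & y z e.1 = 0) ->
  (forall a, {for x, continuous (fun z => y z a)}) ->
  {for x, continuous (fun z => ball_point (y z))}.
Proof.
move=> wy zy yc N Nx; have [_ _ _ _ ed] := move_data.
have key e : e \in L -> nbhs x [set z | y z e.1 = 0 -> N (ball_point (y z))].
  move=> eL; have [_ p] := ed _ eL; have [y0|y0] := eqVneq (y x e.1) 0.
    have c : {for x, continuous (fun z => point_of T e.2.1 (project e.2.2 (y z)))}.
      apply: (point_of_cont (w := fun z => project e.2.2 (y z))) => [|m _]; last exact: yc.
      by apply: (project_weight p).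
    have Nx' : nbhs (point_of T e.2.1 (project e.2.2 (y x))) N by rewrite -ball_point_eq.
    by apply: nbhsS (c _ Nx') => z /= Nz yz; rewrite (ball_point_eq eL).
  have n0 : nbhs (y x e.1) (~` [set 0 : R]).
    apply: open_nbhs_nbhs; split; last exact/eqP.
    by apply: closed_openC; apply: accessible_closed_set1; apply: hausdorff_accessible;
      exact: Rhausdorff.
  by apply: nbhsS (yc _ _ n0) => z /= h /h.
have : nbhs x [set z | forall e, e \in L -> y z e.1 = 0 -> N (ball_point (y z))].
  elim: L key => [_|e s IH key]; first by apply: nbhsS filterT => z _ e.
  have k1 := key e (mem_head _ _).
  have k2 : nbhs x [set z | forall e, e \in s -> y z e.1 = 0 -> N (ball_point (y z))].
    by apply: IH => e' e's; apply: key; rewrite inE e's orbT.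
  apply: nbhsS (filterI k1 k2) => z [h1 h2] e'.
  by rewrite inE => /predU1P[->|]; [exact: h1|exact: h2].
by apply: nbhsS => z h; have [e eL ye] := zy z; exact: h eL ye.
Qed.

End MoveMap.

(** * The homeomorphism of a bistellar move *)

Section MoveHomeo.
Variable R : realType.

Definition move_map (T' : table) (L L' : seq entry) (kk : seq nat) t (w : nat -> R) :
    realization R (gluing_of T') :=
  if entry_of L t is Some e then
    ball_point T' L' (shift [seq e.1 | e <- L] [seq e.1 | e <- L'] (embed e.2.2 w))
  else point_of T' (nth 0%N kk t) w.

Variables (T T' : table) (L L' : seq entry) (kk kk' : seq nat).
Hypotheses (H : move_ok T T' L L' kk kk') (H' : move_ok T' T L' L kk' kk).
Local Notation I := [seq e.1 | e <- L].
Local Notation J := [seq e.1 | e <- L'].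
Local Notation F := (move_map T' L L' kk).

Let wT : wf_table T. Proof. by case/and5P: H. Qed.
Let wT' : wf_table T'. Proof. by case/and5P: H'. Qed.
Let IJ : perm_eq (I ++ J) (iota 0 5). Proof. by case: (move_data H). Qed.
Let I0 : (0 < size I)%N. Proof. by rewrite size_map; case: (move_data H). Qed.
Let J0 : (0 < size J)%N. Proof. by rewrite size_map; case: (move_data H'). Qed.

Lemma entry_data t e : entry_of L t = Some e ->
  [/\ e \in L, e.2.1 = t & perm_eq (e.1 :: e.2.2) (iota 0 5)].
Proof.
move=> te; have [eL et] := find_by_some te; have [_ _ _ _ ed] := move_data H.
by split=> //; have [] := ed _ eL.
Qed.

Lemma shift_zero (y : nat -> R) : weight 5 y ->
  exists2 e, e \in L' & shift I J y e.1 = 0.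
Proof. by move=> wy; have [_ /mapP[e eL' ->] ye] := shift_min IJ J0 wy; exists e. Qed.

Lemma move_map_ext t w w' : (forall m, (m < 4)%N -> w m = w' m) ->
  weight 4 w -> F t w = F t w'.
Proof.
move=> ww w4; rewrite /move_map; case E: (entry_of L t) => [e|]; last exact: point_of_ext.
have [eL et p] := entry_data E.
have ew a : (a < 5)%N -> embed e.2.2 w a = embed e.2.2 w' a.
  by move=> _; rewrite /embed; case: ifP => // al; rewrite ww // -(facet_size p) index_mem.
apply: (ball_point_ext H'); first by move=> a a5; exact: (shift_ext IJ).
by apply: shift_zero; exact: (embed_weight p).
Qed.

(** On the boundary of the ball [shift] is the identity: the coordinate opposite the new tetrahedron
    vanishes, so the minimum is 0. *)
Lemma move_map_outer t f t' s w v : (f < 4)%N -> outer L L' kk t f = Some (t', s) ->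
  perm_eq s (iota 0 4) -> weight 4 w -> w f = 0 ->
  (forall m, (m < 4)%N -> v (nth 0%N s m) = w m) ->
  F t w = point_of T' t' v.
Proof.
move=> f4; rewrite /outer /move_map; case E: (entry_of L t) => [e|]; last first.
  move=> [<- <-] _ w4 wf vw; apply: point_of_ext => m m4.
  by rewrite -vw //; move: m m4 => [|[|[|[|]]]].
have [eL et p] := entry_data E.
case E': (entry_at L' _) => [e'|//] /Some_inj/pair_equal_spec[<- sE] sp w4 wf vw.
have [e'L' e'i] := find_by_some E'; have [_ _ _ _ ed'] := move_data H'.
have [_ p'] := ed' _ e'L'; have w5 := embed_weight p w4.
have y0 : embed e.2.2 w e'.1 = 0 by rewrite -[e'.1]/(entry_index e') e'i (embed_nth p).
have min0 : minw J (embed e.2.2 w) = 0.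
  have [_ yJ] := weight_bounds IJ w5.
  by apply: (@minw_uniq R J _ e'.1) => [|b /yJ/andP[]||b /yJ/andP[]] //; exact: map_f.
have sy a : shift I J (embed e.2.2 w) a = embed e.2.2 w a by exact: shift0.
rewrite (ball_point_eq H' e'L') ?sy //; last exact: (shift_weight IJ).
apply: point_of_ext => n n4; rewrite /project sy.
have ns : n \in s by rewrite (perm_mem sp) mem_iota.
have ss : size s = 4%N by rewrite (perm_size sp).
have m4 : (index n s < 4)%N by rewrite -ss index_mem.
rewrite -{1}(nth_index 0%N ns) -{2}(nth_index 0%N ns) vw //.
move: (index n s) m4 => m m4; rewrite -sE (nth_map 0%N) ?size_iota // nth_iota // add0n.
have mem a : (a < 5)%N -> a != e'.1 -> a \in e'.2.2.
  by rewrite (facet_lt p') => /orP[->|].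
have fE : nth 0%N e.2.2 f = e'.1 by rewrite -e'i.
have [lu el] := facet_uniq p.
case: eqP => [->|/eqP mf].
  rewrite nth_index ?(embed0 p) ?wf //; apply: mem; first by rewrite (facet_lt p) eqxx.
  by apply: contraNneq el => ->; rewrite -fE mem_nth // (facet_size p).
rewrite nth_index ?(embed_nth p) //; apply: mem; first exact: (facet_nth_lt p).
by rewrite -fE nth_uniq ?(facet_size p).
Qed.

Lemma move_map_glue t f w w' : (t < size T)%N -> (f < 4)%N -> weight 4 w -> w f = 0 ->
  (forall m, (m < 4)%N -> w' (nth 0%N (glued T t f).2 m) = w m) ->
  F t w = F (glued T t f).1 w'.
Proof.
move=> tT f4 w4 wf wg; have [uT pp] := wf_glued wT tT f4.
have w4' : weight 4 w' := weight_perm pp wg w4.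
have wf' : w' (nth 0%N (glued T t f).2 f) = 0 by rewrite wg.
have pf4 := perm_iota_lt pp f4.
have := move_face H tT f4; rewrite /face_ok.
move: uT pp w4' wf' pf4 wg; set u := (glued T t f).1; set p := (glued T t f).2.
move=> uT pp w4' wf' pf4 wg.
case E: (outer L L' kk t f) => [[t' s]|].
  case E': (outer L L' kk u _) => [[u' s']|//] /and4P[tT' sp /eqP tu /allP h].
  have sp' : perm_eq s' (iota 0 4).
    have := move_face H uT pf4; rewrite /face_ok E'.
    by case: (outer _ _ _ _ _) => [[? ?]|] // /and4P[].
  have inv q m : perm_eq q (iota 0 4) -> (m < 4)%N -> index (nth 0%N q m) q = m.
    move=> qp m4; rewrite index_uniq ?(perm_size qp) //.
    by rewrite (perm_uniq qp) iota_uniq.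
  pose v n := w (index n s); pose v' n := w' (index n s').
  have vE m : (m < 4)%N -> v (nth 0%N s m) = w m by move=> m4; rewrite /v inv.
  have vE' m : (m < 4)%N -> v' (nth 0%N s' m) = w' m by move=> m4; rewrite /v' inv.
  rewrite (move_map_outer f4 E sp w4 wf vE) (move_map_outer pf4 E' sp' w4' wf' vE').
  have v4 : weight 4 v := weight_perm sp vE w4.
  rewrite (point_of_glue wT' tT' (perm_iota_lt sp f4) v4 (w' := v')) ?tu ?vE //.
  move=> n n4; have ns : n \in s by rewrite (perm_mem sp) mem_iota.
  have m4 : (index n s < 4)%N by rewrite -[X in (_ < X)%N](perm_size sp) index_mem.
  rewrite -(nth_index 0%N ns); move: (index n s) m4 => m m4.
  have mI : m \in iota 0 4 by rewrite mem_iota.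
  by rewrite (eqP (h m mI)) vE' ?perm_iota_lt // wg // vE.
rewrite /move_map; case Et: (entry_of L t) => [e|//]; case Eu: (entry_of L u) => [e'|//].
move=> /andP[/eqP e'f /allP h].
have [eL _ q] := entry_data Et; have [e'L _ q'] := entry_data Eu.
have key m : (m < 4)%N -> nth 0%N e'.2.2 (nth 0%N p m) = if m == f then e.1 else nth 0%N e.2.2 m.
  by move=> m4; apply/eqP; apply: h; rewrite mem_iota.
apply: (ball_point_ext H'); last by apply: shift_zero; exact: (embed_weight q).
move=> a a5; apply: (shift_ext IJ) => // {a5}a; rewrite (facet_lt q) => /predU1P[->|al].
  have := key f f4; rewrite eqxx => <-; rewrite (embed_nth q') // wf' .
  by rewrite key // eqxx (embed0 q).
have m4 : (index a e.2.2 < 4)%N by rewrite -(facet_size q) index_mem.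
rewrite -(nth_index 0%N al); move: (index a e.2.2) m4 => m m4.
rewrite (embed_nth q) //; have [->|mf] := eqVneq m f; first by rewrite wf -e'f (embed0 q').
by have := key m m4; rewrite (negbTE mf) => <-; rewrite (embed_nth q') ?perm_iota_lt // wg.
Qed.

Lemma move_map_cont t : (t < size T)%N -> continuous (fun x => F t (coords x)).
Proof.
move=> tT x; rewrite /move_map; case E: (entry_of L t) => [e|]; last first.
  apply: (point_of_cont (w := fun x => coords x)); first exact: coords_weight.
  by move=> m _; exact: coords_cont.
have [eL et p] := entry_data E.
have w5 z : weight 5 (embed e.2.2 (coords z : nat -> R)) by apply: (embed_weight p); exact: coords_weight.
apply: (ball_point_cont H' (y := fun z => shift I J (embed e.2.2 (coords z)))).
- by move=> z; exact: (shift_weight IJ).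
- by move=> z; exact: shift_zero.
move=> a; apply: (shift_cont (y := fun z => embed e.2.2 (coords z))) => b.
by rewrite /embed; case: (b \in e.2.2); [exact: coords_cont|exact: cont_cst].
Qed.

Lemma move_mapK t w : (t < size T)%N -> weight 4 w -> exists t' w',
  [/\ (t' < size T')%N, weight 4 w', F t w = point_of T' t' w' &
      move_map T L' L kk' t' w' = point_of T t w].
Proof.
move=> tT w4; case E: (entry_of L t) => [e|]; last first.
  have [kT kN kkK] := move_kept H tT E; exists (nth 0%N kk t), w.
  by rewrite /move_map E kN kkK.
have [eL et p] := entry_data E; have w5 := embed_weight p w4.
have ws := shift_weight IJ I0 J0 w5.
have [e' e'L' ye'] := shift_zero w5; have [_ _ ut' _ ed'] := move_data H'.
have [tT' p'] := ed' _ e'L'.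
exists e'.2.1, (project e'.2.2 (shift I J (embed e.2.2 w))).
have wp := project_weight p' ws ye'; split=> //.
  by rewrite /move_map E; exact: (ball_point_eq H').
rewrite /move_map (_ : entry_of L' e'.2.1 = Some e'); last exact: (@find_by_in entry_tet).
have y0 : embed e.2.2 w e.1 = 0 by exact: embed0.
have back a : (a < 5)%N ->
    shift J I (embed e'.2.2 (project e'.2.2 (shift I J (embed e.2.2 w)))) a = embed e.2.2 w a.
  move=> a5; rewrite -[RHS](shiftK IJ I0 J0 w5) //; last by exists e.1 => //; exact: map_f.
  by apply: (shift_ext (JI_perm IJ)) => // b b5; rewrite (projectK p').
rewrite (ball_point_ext H (y' := embed e.2.2 w)) //; last first.
  by exists e => //; rewrite back // (facet_lt p) eqxx.
rewrite (ball_point_eq H eL) // et; apply: point_of_ext => m m4; exact: (embedK p).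
Qed.

Lemma move_continuous_map : exists2 phi : realization R (gluing_of T) -> realization R (gluing_of T'),
  continuous phi & forall t w, (t < size T)%N -> weight 4 w -> phi (point_of T t w) = F t w.
Proof.
apply: realization_rec => //.
- exact: move_map_ext.
- exact: move_map_glue.
- exact: move_map_cont.
Qed.

End MoveHomeo.

Theorem move_homeomorphic (R : realType) T T' L L' kk kk' :
  move_ok T T' L L' kk kk' -> move_ok T' T L' L kk' kk ->
  homeomorphic (realization R (gluing_of T)) (realization R (gluing_of T')).
Proof.
move=> H H'; have [phi phic phiE] := move_continuous_map R H H'.
have [psi psic psiE] := move_continuous_map R H' H.
have wT : wf_table T by case/and5P: H.
have wT' : wf_table T' by case/and5P: H'.
exists phi, psi; split=> // z.
  have [t [w [tT w4 ->]]] := point_of_surj wT z.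
  have [t' [w' [tT' w4' e1 e2]]] := move_mapK H H' tT w4.
  by rewrite phiE // e1 psiE.
have [t [w [tT w4 ->]]] := point_of_surj wT' z.
have [t' [w' [tT' w4' e1 e2]]] := move_mapK H' H tT w4.
by rewrite psiE // e1 phiE.
Qed.

(** * A triangulation of the lens space with three tetrahedra *)

Section LensTriangulation.
Variable R : realType.
Local Notation V4 := 'rV[R]_4.
Local Notation T := (S3 R).

(** The join triangulation of the sphere by the 3-fold subdivisions of the two
    circles [C] and [C j], divided by the rotation: tetrahedron [b] has vertices
    1, omega, omega^b j, omega^(b+1) j. *)
Definition lens_table : table :=
  [:: [:: (2, [:: 1; 0; 2; 3]); (1, [:: 1; 0; 2; 3]); (1, [:: 0; 1; 3; 2]); (2, [:: 0; 1; 3; 2])];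
      [:: (0, [:: 1; 0; 2; 3]); (2, [:: 1; 0; 2; 3]); (2, [:: 0; 1; 3; 2]); (0, [:: 0; 1; 3; 2])];
      [:: (1, [:: 1; 0; 2; 3]); (0, [:: 1; 0; 2; 3]); (0, [:: 0; 1; 3; 2]); (1, [:: 0; 1; 3; 2])]]%N.

(** The quaternion [(a + b omega) + (c + d omega) j]. *)
Definition eis (a b c d : R) : V4 :=
  row4 (a - b / 2) (b * (rt3 R / 2)) (c - d / 2) (d * (rt3 R / 2)).

Lemma eis_inj a b c d a' b' c' d' : eis a b c d = eis a' b' c' d' ->
  [/\ a = a', b = b', c = c' & d = d'].
Proof.
have r0 : rt3 R / 2 != 0 by rewrite gt_eqF // divr_gt0 ?rt3_gt0.
move=> h; have h0 := congr1 (fun v : V4 => v 0 k0) h; have h1 := congr1 (fun v : V4 => v 0 k1) h.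
have h2 := congr1 (fun v : V4 => v 0 k2) h; have h3 := congr1 (fun v : V4 => v 0 k3) h.
move: h0 h1 h2 h3; rewrite !row4E => h0 /(mulIf r0) h1 h2 /(mulIf r0) h3.
by split=> //; move: h0 h2; rewrite h1 h3; clear; lra.
Qed.

Lemma eisZ s a b c d : s *: eis a b c d = eis (s * a) (s * b) (s * c) (s * d).
Proof. by apply: row4P; rewrite scale4E !row4E; ring. Qed.

Lemma eis_rot a b c d : qmul (qom R) (eis a b c d) = eis (- b) (a - b) (- d) (c - d).
Proof.
have r2 : rt3 R * rt3 R = 3 by rewrite -expr2 rt3_sqr.
apply: row4P; rewrite /qmul !row4E; try by field.
  by transitivity (- a / 2 + b / 4 - b * (rt3 R * rt3 R) / 4); [field|rewrite r2; field].
by transitivity (- c / 2 + d / 4 - d * (rt3 R * rt3 R) / 4); [field|rewrite r2; field].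
Qed.

Lemma eis_surj (x : V4) : exists a b c d, x = eis a b c d.
Proof.
have r0 : rt3 R != 0 by rewrite gt_eqF // rt3_gt0.
exists (x 0 k0 + x 0 k1 / rt3 R), (x 0 k1 / (rt3 R / 2)), (x 0 k2 + x 0 k3 / rt3 R), (x 0 k3 / (rt3 R / 2)).
by apply: row4P; rewrite !row4E; field.
Qed.

Lemma eis_cont (X : topologicalType) (x : X) (a b c d : X -> R) :
  {for x, continuous a} -> {for x, continuous b} -> {for x, continuous c} ->
  {for x, continuous d} -> {for x, continuous (fun y => eis (a y) (b y) (c y) (d y))}.
Proof.
have m (f : X -> R) (s : R) : {for x, continuous f} -> {for x, continuous (fun y => f y * s)}.
  by move=> fc; apply: (@cont_mul R X x f (fun=> s)) => //; exact: cont_cst.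
move=> ac bc cc dc; apply: (@row4_cont R X x (fun y => a y - b y / 2) (fun y => b y * (rt3 R / 2))
  (fun y => c y - d y / 2) (fun y => d y * (rt3 R / 2))).
- by apply: (@cont_subr R X x a) => //; exact: m.
- exact: m.
- by apply: (@cont_subr R X x c) => //; exact: m.
- exact: m.
Qed.

Lemma toS_rot (x : V4) : x != 0 -> toS (qmul (qom R) x) = rot (toS x).
Proof.
move=> x0; have [s s0 sE] := toS_sval x0.
by rewrite /rot /smul sE sval3_om qmulZr toSZ.
Qed.

(** The weighted sum of the four vertices, with omega^2 written as -1 - omega. *)
Definition join_point t (w : nat -> R) : V4 :=
  match t with
  | 0%N => eis (w 0%N) (w 1%N) (w 2%N) (w 3%N)
  | 1%N => eis (w 0%N) (w 1%N) (- w 3%N) (w 2%N - w 3%N)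
  | _ => eis (w 0%N) (w 1%N) (w 3%N - w 2%N) (- w 2%N)
  end.

Lemma weight4 (w : nat -> R) : weight 4 w <->
  [/\ [/\ 0 <= w 0%N, 0 <= w 1%N, 0 <= w 2%N & 0 <= w 3%N] &
      w 0%N + w 1%N + w 2%N + w 3%N = 1].
Proof.
have sE : \sum_(m <- iota 0 4) w m = w 0%N + w 1%N + w 2%N + w 3%N.
  by rewrite /= !big_cons big_nil addr0 !addrA.
rewrite /weight sE; split=> [[w0 ->]|[[h0 h1 h2 h3] ->]]; split=> //; first by split; exact: w0.
by move=> [|[|[|[|]]]].
Qed.

Lemma join_point_neq0 t w : weight 4 w -> join_point t w != 0.
Proof.
move=> /weight4[[h0 h1 h2 h3] hs]; have e0 : (0 : V4) = eis 0 0 0 0.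
  by apply: row4P; rewrite /eis !row4E mxE; ring.
apply/eqP; rewrite e0 => e; suff : (1 : R) = 0 by move/eqP; rewrite oner_eq0.
move: e; rewrite /join_point; case: t => [|[|t]] /eis_inj[]; move: hs; clear; lra.
Qed.

Definition lens_point t (w : nat -> R) : lens R := lpr (toS (join_point t w)).

Lemma lens_point_ext t w w' : (forall m, (m < 4)%N -> w m = w' m) -> weight 4 w ->
  lens_point t w = lens_point t w'.
Proof. by move=> ww _; rewrite /lens_point /join_point; case: t => [|[|t]]; rewrite !ww. Qed.

Lemma lpr_toS_rot (x : V4) : x != 0 -> lpr (toS (qmul (qom R) x)) = lpr (toS x).
Proof. by move=> x0; rewrite toS_rot // lpr_rot. Qed.

Lemma forall4 (P : nat -> Prop) : (forall m, (m < 4)%N -> P m) ->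
  [/\ P 0%N, P 1%N, P 2%N & P 3%N].
Proof. by move=> h; split; exact: h. Qed.

Definition next t : nat := if t is 0%N then 1%N else if t is 1%N then 2%N else 0%N.

(** Rotation takes the face opposite omega to the face opposite 1 in the next tetrahedron. *)
Lemma join_point_rot t w w' : (t < 3)%N -> w 1%N = 0 ->
  [/\ w' 1%N = w 0%N, w' 0%N = w 1%N, w' 2%N = w 2%N & w' 3%N = w 3%N] ->
  join_point (next t) w' = qmul (qom R) (join_point t w).
Proof.
move=> t3 w1 [e0 e1 e2 e3]; move: t t3 => [|[|[|]]] //= _; rewrite eis_rot e0 e1 e2 e3;
  by congr eis; rewrite ?w1; ring.
Qed.

Lemma lens_wf : wf_table lens_table. Proof. by []. Qed.

Lemma lens_point_glue t f w w' : (t < 3)%N -> (f < 4)%N -> weight 4 w -> w f = 0 ->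
  (forall m, (m < 4)%N -> w' (nth 0%N (glued lens_table t f).2 m) = w m) ->
  lens_point t w = lens_point (glued lens_table t f).1 w'.
Proof.
move=> t3 f4 w4 wf wg.
have w4' : weight 4 w' by apply: weight_perm wg w4; case: (wf_glued lens_wf t3 f4).
have key s v v' : (s < 3)%N -> weight 4 v -> v 1%N = 0 ->
    [/\ v' 1%N = v 0%N, v' 0%N = v 1%N, v' 2%N = v 2%N & v' 3%N = v 3%N] ->
    lens_point (next s) v' = lens_point s v.
  move=> s3 v4 v1 vv; rewrite /lens_point (join_point_rot s3 v1 vv) lpr_toS_rot //.
  exact: join_point_neq0.
have [e0 e1 e2 e3] := forall4 wg.
move: f f4 wf e0 e1 e2 e3 {wg} => [|[|[|[|]]]] //= _ wf.
- move: t t3 => [|[|[|]]] //= _ e0 e1 e2 e3.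
  + by apply: (key 2%N) => //; rewrite ?e0 ?e1 ?e2 ?e3.
  + by apply: (key 0%N) => //; rewrite ?e0 ?e1 ?e2 ?e3.
  + by apply: (key 1%N) => //; rewrite ?e0 ?e1 ?e2 ?e3.
- by move: t t3 => [|[|[|]]] //= _ e0 e1 e2 e3; apply/esym;
    [apply: (key 0%N)|apply: (key 1%N)|apply: (key 2%N)]; rewrite ?e0 ?e1 ?e2 ?e3.
- move: t t3 => [|[|[|]]] //= _ e0 e1 e2 e3; rewrite /lens_point /=;
    congr (lpr (toS (eis _ _ _ _))); rewrite -?e0 -?e1 -?e3 -?e2 // ?e2 ?wf; ring.
- move: t t3 => [|[|[|]]] //= _ e0 e1 e2 e3; rewrite /lens_point /=;
    congr (lpr (toS (eis _ _ _ _))); rewrite -?e0 -?e1 -?e2 -?e3 // ?e3 ?wf; ring.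
Qed.

Lemma lens_point_cont t : continuous (fun x => lens_point t (coords x)).
Proof.
move=> x; apply: (@cont_comp _ _ _ _ (fun x => toS (join_point t (coords x))) (@lpr R)); last exact: lpr_continuous.
apply: (@toS_cont R _ x (fun x => join_point t (coords x))).
  by apply: join_point_neq0; exact: coords_weight.
have cc m := @coords_cont R m x.
have cs m n : {for x, continuous (fun x => coords x m - coords x n)}.
  exact: (@cont_subr R _ x _ _ (cc m) (cc n)).
have cn m : {for x, continuous (fun x => - coords x m)}.
  by move=> N; have := @continuousN R R^o _ _ _ (cc m); exact.
rewrite /join_point; case: t => [|[|_]].
- exact: eis_cont (cc _) (cc _) (cc _) (cc _).
- exact: eis_cont (cc _) (cc _) (cn _) (cs _ _).
- exact: eis_cont (cc _) (cc _) (cs _ _) (cn _).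
Qed.

(** The sector spanned by 1 and omega and its multiples by omega and omega^2 cover the plane. *)
Lemma sector (a b : R) : exists a' b', [/\ 0 <= a', 0 <= b' &
  [\/ a = a' /\ b = b', a = - b' /\ b = a' - b' | a = b' - a' /\ b = - a']].
Proof.
have [a0|a0] := leP 0 a; have [b0|b0] := leP 0 b.
- by exists a, b; split=> //; apply: Or31.
- by exists (- b), (a - b); split; try lra; apply: Or33; split; lra.
- by exists (b - a), (- a); split; try lra; apply: Or32; split; lra.
have [ab|ab] := leP a b.
  by exists (b - a), (- a); split; try lra; apply: Or32; split; lra.
by exists (- b), (a - b); split; try lra; apply: Or33; split; lra.
Qed.

(** A deck transformation brings the first complex coordinate into the basic sector; the sector of
    the second then names the tetrahedron. *)
Lemma lens_point_surj m : exists t w, [/\ (t < 3)%N, weight 4 w & lens_point t w = m].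
Proof.
have [x <-] : exists x : T, lpr x = m by have [_ [_ _ + _]] := lens_cover R; exact.
have [a [b [c [d xE]]]] := eis_surj (sval3 x).
have x0 : sval3 x != 0 by rewrite -sqnorm_gt0 sval3_sphere.
have [a' [b' [a0 b0 ab]]] := sector a b.
have [c1 [d1 [lx e0]]] : exists c1 d1, lpr x = lpr (toS (eis a' b' c1 d1)) /\ eis a' b' c1 d1 != 0.
  rewrite -[x in lpr x]toSK xE; have e0 : eis a b c d != 0 by rewrite -xE.
  case: ab => -[aE bE].
  - by exists c, d; rewrite -aE -bE.
  - exists (d - c), (- c).
    have rE : qmul (qom R) (eis a' b' (d - c) (- c)) = eis a b c d.
      by rewrite eis_rot aE bE; congr eis; ring.
    have n0 : eis a' b' (d - c) (- c) != 0.
      by apply: contra_neq e0 => z; rewrite -rE z; apply: row4P; rewrite /qmul !row4E !mxE; ring.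
    by rewrite -rE lpr_toS_rot.
  exists (- d), (c - d); have rE : qmul (qom R) (eis a b c d) = eis a' b' (- d) (c - d).
    by rewrite eis_rot aE bE; congr eis; ring.
  by rewrite -rE lpr_toS_rot // qmul_neq0 // -sqnorm_gt0 sqnorm_qom.
have [c' [d' [c0 d0 cd]]] := sector c1 d1.
pose s := a' + b' + c' + d'.
have [t [t3 jE]] : exists t, (t < 3)%N /\ forall w : nat -> R, w 0%N = s^-1 * a' -> w 1%N = s^-1 * b' ->
    w 2%N = s^-1 * c' -> w 3%N = s^-1 * d' -> join_point t w = s^-1 *: eis a' b' c1 d1.
  case: cd => -[-> ->]; [exists 0%N|exists 1%N|exists 2%N]; split=> // w h0 h1 h2 h3;
    rewrite /join_point eisZ h0 h1 h2 h3; congr eis; ring.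
have s0 : 0 < s.
  rewrite lt0r /s !addr_ge0 // andbT; apply: contraNneq e0 => sz.
  have [-> -> -> ->] : [/\ a' = 0, b' = 0, c1 = 0 & d1 = 0] by case: cd => -[-> ->]; split; lra.
  by apply/eqP; apply: row4P; rewrite /eis !row4E mxE; ring.
pose w m := s^-1 * nth 0 [:: a'; b'; c'; d'] m.
exists t, w; split=> //.
  apply/weight4; rewrite /w /= !mulr_ge0 ?invr_ge0 ?(ltW s0) //.
  by rewrite -!mulrDr mulVf // gt_eqF.
by rewrite /lens_point jE // lx toSZ // invr_gt0.
Qed.

Lemma glued_lens t : (t < 3)%N -> [/\ glued lens_table t 1 = (next t, [:: 1; 0; 2; 3])%N,
  glued lens_table t 2 = (next t, [:: 0; 1; 3; 2])%N &
  glued lens_table (next t) 3 = (t, [:: 0; 1; 3; 2])%N].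
Proof. by move: t => [|[|[|]]]. Qed.

Lemma join_pointZ t w s : join_point t (fun m => s * w m) = s *: join_point t w.
Proof. by rewrite /join_point; case: t => [|[|t]]; rewrite eisZ; congr eis; ring. Qed.

Lemma join_point_eq t w t' w' : (t < 3)%N -> (t' < 3)%N ->
  (forall m, (m < 4)%N -> 0 <= w m) -> (forall m, (m < 4)%N -> 0 <= w' m) ->
  join_point t' w' = join_point t w ->
  [\/ t = t' /\ [/\ w' 0%N = w 0%N, w' 1%N = w 1%N, w' 2%N = w 2%N & w' 3%N = w 3%N],
    t' = next t /\ [/\ w' 0%N = w 0%N, w' 1%N = w 1%N, w' 3%N = w 2%N, w' 2%N = w 3%N & w 2%N = 0] |
    t = next t' /\ [/\ w' 0%N = w 0%N, w' 1%N = w 1%N, w' 3%N = w 2%N, w' 2%N = w 3%N & w 3%N = 0]].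
Proof.
move=> t3 t3' /forall4[_ _ h2 h3] /forall4[_ _ g2 g3]; move: h2 h3 g2 g3.
move: t t3 t' t3' => [|[|[|]]] //= _ [|[|[|]]] //= _ h2 h3 g2 g3 /eis_inj[e0 e1 e2 e3].
- by apply: Or31.
- by apply: Or32; split=> //; split; lra.
- by apply: Or33; split=> //; split; lra.
- by apply: Or33; split=> //; split; lra.
- by apply: Or31; split=> //; split; lra.
- by apply: Or32; split=> //; split; lra.
- by apply: Or32; split=> //; split; lra.
- by apply: Or33; split=> //; split; lra.
- by apply: Or31; split=> //; split; lra.
Qed.

Lemma swap_glued (w w' : nat -> R) : [/\ w' 0%N = w 0%N, w' 1%N = w 1%N, w' 3%N = w 2%N & w' 2%N = w 3%N] ->
  forall m, (m < 4)%N -> w' (nth 0%N [:: 0; 1; 3; 2]%N m) = w m.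
Proof. by move=> [e0 e1 e2 e3] [|[|[|[|]]]]. Qed.

Lemma join_point_inj t w t' w' s : (t < 3)%N -> (t' < 3)%N -> weight 4 w -> weight 4 w' ->
  0 < s -> join_point t' w' = s *: join_point t w ->
  point_of lens_table t w = point_of lens_table t' w'.
Proof.
move=> t3 t3' w4 w4' s0; rewrite -join_pointZ => e.
have [_ hs] := (weight4 w).1 w4; have [_ gs] := (weight4 w').1 w4'.
have sw m : (m < 4)%N -> 0 <= s * w m by move=> m4; rewrite mulr_ge0 ?(ltW s0) //; exact: w4.1.
have key := join_point_eq t3 t3' sw w4'.1 e.
(* Both weights sum to 1, which leaves no room for a factor. *)
have s1 : s = 1.
  have hs' : s * w 0%N + s * w 1%N + s * w 2%N + s * w 3%N = s by rewrite -!mulrDr hs mulr1.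
  by move: gs hs' key; clear => gs hs'; case=> -[_]; [case|case|case]; lra.
move: key; rewrite s1 !mul1r => -[[-> [e0 e1 e2 e3]]|[-> [e0 e1 e2 e3 z]]|[-> [e0 e1 e2 e3 z]]].
- by apply: point_of_ext => -[|[|[|[|]]]].
- have [_ g _] := glued_lens t3.
  rewrite (point_of_glue lens_wf t3 (f := 2%N) (w' := w')) //; first by rewrite g.
  by rewrite g; exact: swap_glued.
have [_ _ g] := glued_lens t3'; have n3 : (next t' < 3)%N by case: (t') t3' => [|[|[|]]].
rewrite (point_of_glue lens_wf n3 (f := 3%N) (w' := w')) //; first by rewrite g.
by rewrite g; exact: swap_glued.
Qed.

Lemma join_point_inj_rot t w t' w' s : (t < 3)%N -> (t' < 3)%N -> weight 4 w -> weight 4 w' ->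
  0 < s -> join_point t' w' = s *: qmul (qom R) (join_point t w) ->
  point_of lens_table t w = point_of lens_table t' w'.
Proof.
move=> t3 t3' w4 w4' s0 e.
have [[h0 h1 h2 h3] hs] := (weight4 w).1 w4; have [[g0 g1 g2 g3] gs] := (weight4 w').1 w4'.
(* After the rotation the coefficient of 1 is a negative multiple of [w 1], yet it equals the
   nonnegative [w' 0]. *)
have w1 : w 1%N = 0.
  have : w' 0%N = s * - w 1%N.
    by move: e; move: t t3 t' t3' => [|[|[|]]] //= _ [|[|[|]]] //= _; rewrite eis_rot eisZ => /eis_inj[].
  move=> wE; have := g0; rewrite wE mulrN oppr_ge0 pmulr_rle0 // => h.
  by apply/eqP; rewrite eq_le h.
pose v m := nth 0 [:: w 1%N; w 0%N; w 2%N; w 3%N] m.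
have v4 : weight 4 v by apply/weight4; split=> //; rewrite /v /= -hs; ring.
have n3 : (next t < 3)%N by move: t t3 {e} => [|[|[|]]].
have -> : point_of lens_table t w = point_of lens_table (next t) v.
  have [g _ _] := glued_lens t3.
  rewrite (point_of_glue lens_wf t3 (f := 1%N) (w' := v)) //; rewrite g //.
  by move=> [|[|[|[|]]]].
apply: (join_point_inj n3 t3' v4 w4' s0); rewrite e; congr (_ *: _).
by apply/esym; apply: join_point_rot.
Qed.

Theorem lens_triangulated : homeomorphic (realization R (gluing_of lens_table)) (lens R).
Proof.
have [phi phic phiE] := @realization_rec R lens_table lens_wf (lens R) lens_point
  lens_point_ext lens_point_glue (fun t _ => @lens_point_cont t).
apply: (@compact_bij_homeo _ _ phi) => //.
- exact: realization_compact.
- exact: lens_hausdorff.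
- move=> p q; have [t [w [t3 w4 ->]]] := point_of_surj lens_wf p.
  have [t' [w' [t3' w4' ->]]] := point_of_surj lens_wf q.
  rewrite !phiE // => /lprE; have j0 := join_point_neq0 t w4; have j0' := join_point_neq0 t' w4'.
  have r0 (x : V4) : x != 0 -> qmul (qom R) x != 0.
    by move=> x0; rewrite qmul_neq0 // -sqnorm_gt0 sqnorm_qom.
  case=> [e|e|e].
  + have [s s0 sE] := toS_eq j0 j0' (esym e); exact: join_point_inj s0 sE.
  + rewrite -toS_rot // in e; have [s s0 sE] := toS_eq (r0 _ j0) j0' (esym e).
    exact: join_point_inj_rot s0 sE.
  have {}e : rot (toS (join_point t' w')) = toS (join_point t w) by rewrite e rot3.
  rewrite -toS_rot // in e; have [s s0 sE] := toS_eq (r0 _ j0') j0 e.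
  by apply/esym; exact: join_point_inj_rot s0 sE.
- move=> m; have [t [w [t3 w4 <-]]] := lens_point_surj m.
  by exists (point_of lens_table t w); rewrite phiE.
Qed.

End LensTriangulation.

Section LensChains.
Variable R : realType.

(** Found by a computer search: chains of bistellar moves lead from [lens_table]
    to [table_a] and to [table_b]. The last move of each chain replaces four
    tetrahedra around a vertex by one. *)
Definition table_a1 : table :=
  [:: [:: (1, [:: 0; 1; 2; 3]); (1, [:: 0; 1; 2; 3]); (3, [:: 2; 0; 1; 3]); (2, [:: 1; 2; 3; 0])];
      [:: (0, [:: 0; 1; 2; 3]); (0, [:: 0; 1; 2; 3]); (2, [:: 0; 1; 2; 3]); (3, [:: 0; 1; 3; 2])];
      [:: (0, [:: 3; 0; 1; 2]); (3, [:: 2; 0; 1; 3]); (1, [:: 0; 1; 2; 3]); (3, [:: 0; 1; 2; 3])];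
      [:: (2, [:: 1; 2; 0; 3]); (0, [:: 1; 2; 0; 3]); (1, [:: 0; 1; 3; 2]); (2, [:: 0; 1; 2; 3])]]%N.

Definition table_a2 : table :=
  [:: [:: (2, [:: 0; 2; 1; 3]); (3, [:: 2; 0; 1; 3]); (1, [:: 2; 0; 1; 3]); (2, [:: 2; 0; 3; 1])];
      [:: (3, [:: 1; 0; 2; 3]); (0, [:: 1; 2; 0; 3]); (4, [:: 2; 3; 0; 1]); (4, [:: 2; 3; 0; 1])];
      [:: (0, [:: 0; 2; 1; 3]); (0, [:: 1; 3; 0; 2]); (3, [:: 0; 1; 2; 3]); (4, [:: 0; 1; 3; 2])];
      [:: (0, [:: 1; 2; 0; 3]); (1, [:: 1; 0; 2; 3]); (2, [:: 0; 1; 2; 3]); (4, [:: 0; 1; 2; 3])];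
      [:: (1, [:: 2; 3; 0; 1]); (1, [:: 2; 3; 0; 1]); (2, [:: 0; 1; 3; 2]); (3, [:: 0; 1; 2; 3])]]%N.

Definition table_a3 : table :=
  [:: [:: (2, [:: 1; 2; 0; 3]); (2, [:: 1; 2; 0; 3]); (1, [:: 2; 3; 0; 1]); (1, [:: 2; 3; 0; 1])];
      [:: (0, [:: 2; 3; 0; 1]); (0, [:: 2; 3; 0; 1]); (3, [:: 2; 3; 0; 1]); (3, [:: 2; 3; 0; 1])];
      [:: (3, [:: 2; 0; 1; 3]); (0, [:: 2; 0; 1; 3]); (0, [:: 2; 0; 1; 3]); (3, [:: 0; 1; 2; 3])];
      [:: (1, [:: 2; 3; 0; 1]); (1, [:: 2; 3; 0; 1]); (2, [:: 1; 2; 0; 3]); (2, [:: 0; 1; 2; 3])]]%N.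

Definition table_a4 : table :=
  [:: [:: (1, [:: 2; 0; 1; 3]); (2, [:: 1; 0; 2; 3]); (3, [:: 1; 2; 0; 3]); (1, [:: 0; 1; 2; 3])];
      [:: (2, [:: 1; 2; 0; 3]); (3, [:: 2; 1; 0; 3]); (0, [:: 1; 2; 0; 3]); (0, [:: 0; 1; 2; 3])];
      [:: (0, [:: 1; 0; 2; 3]); (1, [:: 2; 0; 1; 3]); (3, [:: 0; 1; 2; 3]); (4, [:: 0; 1; 3; 2])];
      [:: (0, [:: 2; 0; 1; 3]); (1, [:: 2; 1; 0; 3]); (2, [:: 0; 1; 2; 3]); (4, [:: 0; 1; 2; 3])];
      [:: (4, [:: 1; 0; 2; 3]); (4, [:: 1; 0; 2; 3]); (2, [:: 0; 1; 3; 2]); (3, [:: 0; 1; 2; 3])]]%N.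

Definition table_a : table :=
  [:: [:: (0, [:: 1; 0; 2; 3]); (0, [:: 1; 0; 2; 3]); (1, [:: 0; 1; 2; 3]); (1, [:: 0; 1; 2; 3])];
      [:: (1, [:: 1; 2; 3; 0]); (1, [:: 3; 0; 1; 2]); (0, [:: 0; 1; 2; 3]); (0, [:: 0; 1; 2; 3])]]%N.

Definition table_b2 : table :=
  [:: [:: (2, [:: 0; 2; 1; 3]); (3, [:: 2; 0; 1; 3]); (1, [:: 0; 1; 2; 3]); (2, [:: 2; 0; 3; 1])];
      [:: (4, [:: 0; 2; 3; 1]); (3, [:: 2; 1; 0; 3]); (0, [:: 0; 1; 2; 3]); (4, [:: 3; 0; 2; 1])];
      [:: (0, [:: 0; 2; 1; 3]); (0, [:: 1; 3; 0; 2]); (3, [:: 0; 1; 2; 3]); (4, [:: 0; 1; 3; 2])];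
      [:: (0, [:: 1; 2; 0; 3]); (1, [:: 2; 1; 0; 3]); (2, [:: 0; 1; 2; 3]); (4, [:: 0; 1; 2; 3])];
      [:: (1, [:: 0; 3; 1; 2]); (1, [:: 1; 3; 2; 0]); (2, [:: 0; 1; 3; 2]); (3, [:: 0; 1; 2; 3])]]%N.

Definition table_b3 : table :=
  [:: [:: (1, [:: 0; 2; 3; 1]); (2, [:: 0; 1; 2; 3]); (2, [:: 0; 1; 2; 3]); (1, [:: 3; 0; 2; 1])];
      [:: (0, [:: 0; 3; 1; 2]); (0, [:: 1; 3; 2; 0]); (3, [:: 2; 3; 0; 1]); (3, [:: 2; 3; 0; 1])];
      [:: (3, [:: 2; 0; 1; 3]); (0, [:: 0; 1; 2; 3]); (0, [:: 0; 1; 2; 3]); (3, [:: 0; 1; 2; 3])];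
      [:: (1, [:: 2; 3; 0; 1]); (1, [:: 2; 3; 0; 1]); (2, [:: 1; 2; 0; 3]); (2, [:: 0; 1; 2; 3])]]%N.

Definition table_b4 : table :=
  [:: [:: (1, [:: 2; 0; 1; 3]); (2, [:: 1; 0; 2; 3]); (3, [:: 1; 2; 0; 3]); (1, [:: 0; 1; 2; 3])];
      [:: (2, [:: 1; 2; 0; 3]); (3, [:: 2; 1; 0; 3]); (0, [:: 1; 2; 0; 3]); (0, [:: 0; 1; 2; 3])];
      [:: (0, [:: 1; 0; 2; 3]); (1, [:: 2; 0; 1; 3]); (3, [:: 0; 1; 2; 3]); (4, [:: 0; 1; 3; 2])];
      [:: (0, [:: 2; 0; 1; 3]); (1, [:: 2; 1; 0; 3]); (2, [:: 0; 1; 2; 3]); (4, [:: 0; 1; 2; 3])];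
      [:: (4, [:: 1; 3; 0; 2]); (4, [:: 2; 0; 3; 1]); (2, [:: 0; 1; 3; 2]); (3, [:: 0; 1; 2; 3])]]%N.

Definition table_b : table :=
  [:: [:: (0, [:: 1; 3; 0; 2]); (0, [:: 2; 0; 3; 1]); (1, [:: 0; 1; 2; 3]); (1, [:: 0; 1; 2; 3])];
      [:: (1, [:: 1; 2; 3; 0]); (1, [:: 3; 0; 1; 2]); (0, [:: 0; 1; 2; 3]); (0, [:: 0; 1; 2; 3])]]%N.

Lemma move_lens_a1 : homeomorphic (realization R (gluing_of lens_table)) (realization R (gluing_of table_a1)).
Proof.
by apply: (@move_homeomorphic R _ _
  [:: (0, (0, [:: 1; 2; 3; 4])); (1, (2, [:: 2; 0; 3; 4]))]%N
  [:: (2, (1, [:: 0; 1; 3; 4])); (3, (2, [:: 0; 1; 2; 4])); (4, (3, [:: 0; 1; 2; 3]))]%N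
  [:: 0; 0; 0]%N [:: 1; 0; 0; 0]%N).
Qed.

Lemma move_a1_a2 : homeomorphic (realization R (gluing_of table_a1)) (realization R (gluing_of table_a2)).
Proof.
by apply: (@move_homeomorphic R _ _
  [:: (0, (1, [:: 2; 3; 1; 4])); (1, (2, [:: 2; 3; 0; 4]))]%N
  [:: (2, (2, [:: 0; 1; 3; 4])); (3, (3, [:: 0; 1; 2; 4])); (4, (4, [:: 0; 1; 2; 3]))]%N
  [:: 0; 0; 0; 1]%N [:: 0; 3; 0; 0; 0]%N).
Qed.

Lemma move_a2_a3 : homeomorphic (realization R (gluing_of table_a2)) (realization R (gluing_of table_a3)).
Proof.
by apply: (@move_homeomorphic R _ _
  [:: (0, (2, [:: 2; 3; 1; 4])); (1, (3, [:: 2; 3; 0; 4])); (2, (0, [:: 0; 1; 3; 4]))]%N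
  [:: (3, (2, [:: 0; 1; 2; 4])); (4, (3, [:: 0; 1; 2; 3]))]%N
  [:: 0; 0; 0; 0; 1]%N [:: 1; 4; 0; 0]%N).
Qed.

Lemma move_a3_a4 : homeomorphic (realization R (gluing_of table_a3)) (realization R (gluing_of table_a4)).
Proof.
by apply: (@move_homeomorphic R _ _
  [:: (0, (0, [:: 2; 3; 1; 4])); (1, (1, [:: 0; 4; 2; 3]))]%N
  [:: (2, (2, [:: 0; 1; 3; 4])); (3, (3, [:: 0; 1; 2; 4])); (4, (4, [:: 0; 1; 2; 3]))]%N
  [:: 0; 0; 0; 1]%N [:: 2; 3; 0; 0; 0]%N).
Qed.

Lemma move_a4_a : homeomorphic (realization R (gluing_of table_a4)) (realization R (gluing_of table_a)).
Proof.
by apply: (@move_homeomorphic R _ _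
  [:: (0, (0, [:: 1; 2; 3; 4])); (1, (1, [:: 2; 3; 0; 4])); (2, (2, [:: 0; 1; 3; 4])); (3, (3, [:: 0; 1; 2; 4]))]%N
  [:: (4, (1, [:: 0; 1; 2; 3]))]%N
  [:: 0; 0; 0; 0; 0]%N [:: 4; 0]%N).
Qed.

Lemma move_a1_b2 : homeomorphic (realization R (gluing_of table_a1)) (realization R (gluing_of table_b2)).
Proof.
by apply: (@move_homeomorphic R _ _
  [:: (0, (0, [:: 2; 3; 1; 4])); (1, (3, [:: 3; 0; 2; 4]))]%N
  [:: (2, (2, [:: 0; 1; 3; 4])); (3, (3, [:: 0; 1; 2; 4])); (4, (4, [:: 0; 1; 2; 3]))]%N
  [:: 0; 0; 1; 0]%N [:: 1; 2; 0; 0; 0]%N).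
Qed.

Lemma move_b2_b3 : homeomorphic (realization R (gluing_of table_b2)) (realization R (gluing_of table_b3)).
Proof.
by apply: (@move_homeomorphic R _ _
  [:: (0, (2, [:: 2; 3; 1; 4])); (1, (3, [:: 2; 3; 0; 4])); (2, (0, [:: 0; 1; 3; 4]))]%N
  [:: (3, (2, [:: 0; 1; 2; 4])); (4, (3, [:: 0; 1; 2; 3]))]%N
  [:: 0; 0; 0; 0; 1]%N [:: 1; 4; 0; 0]%N).
Qed.

Lemma move_b3_b4 : homeomorphic (realization R (gluing_of table_b3)) (realization R (gluing_of table_b4)).
Proof.
by apply: (@move_homeomorphic R _ _
  [:: (0, (0, [:: 1; 2; 3; 4])); (1, (1, [:: 0; 4; 2; 3]))]%N
  [:: (2, (2, [:: 0; 1; 3; 4])); (3, (3, [:: 0; 1; 2; 4])); (4, (4, [:: 0; 1; 2; 3]))]%N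
  [:: 0; 0; 0; 1]%N [:: 2; 3; 0; 0; 0]%N).
Qed.

Lemma move_b4_b : homeomorphic (realization R (gluing_of table_b4)) (realization R (gluing_of table_b)).
Proof.
by apply: (@move_homeomorphic R _ _
  [:: (0, (0, [:: 1; 2; 3; 4])); (1, (1, [:: 2; 3; 0; 4])); (2, (2, [:: 0; 1; 3; 4])); (3, (3, [:: 0; 1; 2; 4]))]%N
  [:: (4, (1, [:: 0; 1; 2; 3]))]%N
  [:: 0; 0; 0; 0; 0]%N [:: 4; 0]%N).
Qed.

Lemma table_a_lens : homeomorphic (realization R (gluing_of table_a)) (lens R).
Proof.
apply: homeomorphic_trans (lens_triangulated R); apply: homeomorphic_sym.
apply: homeomorphic_trans move_lens_a1 _; apply: homeomorphic_trans move_a1_a2 _.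
apply: homeomorphic_trans move_a2_a3 _; apply: homeomorphic_trans move_a3_a4 _.
exact: move_a4_a.
Qed.

Lemma table_b_lens : homeomorphic (realization R (gluing_of table_b)) (lens R).
Proof.
apply: homeomorphic_trans (lens_triangulated R); apply: homeomorphic_sym.
apply: homeomorphic_trans move_lens_a1 _; apply: homeomorphic_trans move_a1_b2 _.
apply: homeomorphic_trans move_b2_b3 _; apply: homeomorphic_trans move_b3_b4 _.
exact: move_b4_b.
Qed.

End LensChains.

(** * The Pachner graph *)

Section Represents.
Local Open Scope nat_scope.

(** Links a permutation to its list of images, on which the enumeration computes. *)
Definition permutes (p : 'S_4) (P : seq nat) : Prop :=
  size P = 4 /\ forall i : 'I_4, p i = nth 0 P i :> nat.

Definition perm_list (p : 'S_4) : seq nat := [seq (p (inord m) : nat) | m <- iota 0 4].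
Definition list_inv (P : seq nat) : seq nat := [seq index m P | m <- iota 0 4].
Definition pcomp (P Q : seq nat) : seq nat := [seq nth 0 Q (nth 0 P m) | m <- iota 0 4].
Definition pswap a b : seq nat :=
  [seq if m == a then b else if m == b then a else m | m <- iota 0 4].
Definition perms4 : seq (seq nat) := permutations (iota 0 4).

Lemma nth_map_iota (F : nat -> nat) n m : m < n -> nth 0 [seq F x | x <- iota 0 n] m = F m.
Proof. by move=> mn; rewrite (nth_map 0) ?size_iota // nth_iota. Qed.

Lemma perm_iota n s : uniq s -> size s = n -> (forall x, x \in s -> x < n) ->
  perm_eq s (iota 0 n).
Proof.
move=> us ss sn; apply: uniq_perm => //; first exact: iota_uniq.
have [] := uniq_min_size us (_ : {subset s <= iota 0 n}); rewrite ?size_iota ?ss //.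
by move=> x /sn xn; rewrite mem_iota.
Qed.

Lemma permutes_list p : permutes p (perm_list p).
Proof. by split=> [|i]; rewrite /perm_list ?size_map // nth_map_iota // inord_val. Qed.

Lemma permutes_inj p q P : permutes p P -> permutes q P -> p = q.
Proof. by move=> [_ hp] [_ hq]; apply/permP => i; apply: val_inj; rewrite /= hp hq. Qed.

Lemma permutes_fun p P Q : permutes p P -> permutes p Q -> P = Q.
Proof.
move=> [sP hP] [sQ hQ]; apply: (@eq_from_nth _ 0) => [|i]; rewrite ?sP ?sQ // => i4.
by rewrite -(hP (Ordinal i4)) -(hQ (Ordinal i4)).
Qed.

Lemma permutes_uniq p P : permutes p P -> uniq P.
Proof.
move=> [sP hP]; apply/(uniqP 0) => i j; rewrite !inE sP => i4 j4.
rewrite -(hP (Ordinal i4)) -(hP (Ordinal j4)) => h.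
by have /perm_inj/(congr1 val) : p (Ordinal i4) = p (Ordinal j4) by apply: val_inj.
Qed.

Lemma permutes_perm p P : permutes p P -> P \in perms4.
Proof.
move=> pP; rewrite mem_permutations perm_sym; have [sP hP] := pP.
rewrite perm_sym; apply: perm_iota => //; first exact: permutes_uniq pP.
move=> x /(nthP 0)[i]; rewrite sP => i4 <-; rewrite -(hP (Ordinal i4)); exact: ltn_ord.
Qed.

Lemma permutes_of P : perm_eq P (iota 0 4) -> permutes (perm_of P) P.
Proof. by move=> PP; split=> [|i]; [rewrite (perm_size PP)|exact: perm_ofE]. Qed.

Lemma permutes1 : permutes 1%g (iota 0 4).
Proof. by split=> // i; rewrite perm1 nth_iota. Qed.

Lemma permutesM p q P Q : permutes p P -> permutes q Q -> permutes (p * q)%g (pcomp P Q).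
Proof.
move=> [sP hP] [sQ hQ]; split=> [|i]; first by rewrite size_map.
by rewrite permM nth_map_iota // hQ hP.
Qed.

Lemma permutes_index p P (i : 'I_4) : permutes p P -> index (p i : nat) P = i.
Proof. by move=> pP; have [sP hP] := pP; rewrite hP index_uniq ?sP // (permutes_uniq pP). Qed.

Lemma permutesV p P : permutes p P -> permutes p^-1%g (list_inv P).
Proof.
move=> pP; split=> [|i]; first by rewrite size_map.
by rewrite nth_map_iota // -(permutes_index (p^-1%g i) pP) permKV.
Qed.

Lemma permutes_tperm (a b : 'I_4) : permutes (tperm a b) (pswap a b).
Proof.
split=> [|i]; first by rewrite size_map.
rewrite nth_map_iota //; case: tpermP => [->|->|/eqP ia /eqP ib]; rewrite ?eqxx //.
  by case: eqP => // ->.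
have va : (i == a :> nat) = false by apply/negbTE; apply: contraNneq ia => /val_inj ->.
have vb : (i == b :> nat) = false by apply/negbTE; apply: contraNneq ib => /val_inj ->.
by rewrite va vb.
Qed.

Definition represents (S : finType) (enc : S -> nat) (G : gluing S) (T : table) : Prop :=
  [/\ injective enc, forall x, enc x < size T, forall j, j < size T -> exists x, enc x = j &
      forall x (f : 'I_4), enc (G (x, f)).1 = (glued T (enc x) f).1 /\
        permutes (G (x, f)).2 (glued T (enc x) f).2].

Lemma represents_gluing_of T : wf_table T -> represents (@nat_of_ord _) (gluing_of T) T.
Proof.
move=> wT; split; first exact: val_inj.
- by move=> x; exact: wf_ltn.
- by move=> j jT; exists (inord j); rewrite inordK // wf_size.
move=> x f; split; first exact: gluing_of1.
have [_ p] := wf_glued wT (wf_ltn x wT) (ltn_ord f).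
by rewrite ffunE /=; exact: permutes_of.
Qed.

Lemma represents_iso (S S' : finType) enc enc' (G : gluing S) (G' : gluing S') T :
  represents enc G T -> represents enc' G' T -> isomorphic G G'.
Proof.
move=> [ei el es eG] [ei' el' es' eG'].
have [s sE] := choice (fun x => es' _ (el x)); have [s' sE'] := choice (fun x => es _ (el' x)).
exists s, (fun=> 1%g); split.
  by exists s' => x; [apply: ei; rewrite sE' sE|apply: ei'; rewrite sE sE'].
move=> t f; rewrite perm1 invg1 mul1g mulg1.
have [h1 h2] := eG t f; have := eG' (s t) f; rewrite sE => -[h1' h2'].
rewrite [LHS]surjective_pairing; congr pair; last exact: permutes_inj h2' h2.
by apply: ei'; rewrite h1' sE h1.
Qed.

Definition mktable n (F : nat -> nat -> nat * seq nat) : table :=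
  [seq [seq F x g | g <- iota 0 4] | x <- iota 0 n].

Lemma size_mktable n F : size (mktable n F) = n.
Proof. by rewrite size_map size_iota. Qed.

Lemma glued_mktable n F x g : x < n -> g < 4 -> glued (mktable n F) x g = F x g.
Proof.
move=> xn g4; rewrite /glued (nth_map 0) ?size_iota // (nth_map 0) ?size_iota //.
by rewrite !nth_iota.
Qed.

(** Tetrahedron [t] becomes [x = nth 0 sg t], and its vertex [i] becomes
    [nth 0 (nth [::] rh x) i]. *)
Definition relabel_entry (T : table) (sg : seq nat) (rh : seq (seq nat)) x g :=
  let r := nth [::] rh x in
  let e := glued T (index x sg) (index g r) in
  let y := nth 0 sg e.1 in
  (y, pcomp (pcomp (list_inv r) e.2) (nth [::] rh y)).

Definition relabelled T sg rh : table := mktable (size T) (relabel_entry T sg rh).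

(** Reduces the arbitrary isomorphic gluings in the definition of a move to finitely many
    relabellings of one table. *)
Lemma represents_relabelled (S S' : finType) enc (enc' : S' -> nat) (G : gluing S)
    (G' : gluing S') T :
  represents enc G T -> isomorphic G G' -> injective enc' ->
  (forall x, enc' x < size T) -> (forall j, j < size T -> exists x, enc' x = j) ->
  exists sg rh, [/\ sg \in permutations (iota 0 (size T)), size rh = size T,
    all (mem perms4) rh & represents enc' G' (relabelled T sg rh)].
Proof.
move=> [ei el es eG] [s [r [[s' sK sK'] sG]]] ei' el' es'.
pose n := size T.
have [dec decE] : exists dec : nat -> option S, forall x, dec (enc x) = Some x.
  exists (fun j => [pick x | enc x == j]) => x.
  by case: pickP => [y /eqP/ei ->|/(_ x)] //; rewrite eqxx.
have [dec' decE'] : exists dec : nat -> option S', forall x, dec (enc' x) = Some x.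
  exists (fun j => [pick x | enc' x == j]) => x.
  by case: pickP => [y /eqP/ei' ->|/(_ x)] //; rewrite eqxx.
pose sg := mkseq (fun t => oapp (fun x => enc' (s x)) 0 (dec t)) n.
pose rh := mkseq (fun x => oapp (fun x => perm_list (r (s' x))) [::] (dec' x)) n.
have sgE x : nth 0 sg (enc x) = enc' (s x) by rewrite nth_mkseq ?el // decE.
have rhE x : nth [::] rh (enc' (s x)) = perm_list (r x).
  by rewrite nth_mkseq ?el' // decE' /= sK.
have usg : uniq sg.
  apply/(uniqP 0) => i j; rewrite !inE size_mkseq => /es[x <-] /es[y <-].
  by rewrite !sgE => /ei'/(can_inj sK) ->.
have isg x : index (enc' (s x)) sg = enc x.
  by rewrite -sgE index_uniq // size_mkseq; exact: el.
exists sg, rh; split.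
- rewrite mem_permutations; apply: perm_iota => //; first by rewrite size_mkseq.
  by move=> y /(nthP 0)[i]; rewrite size_mkseq => /es[x <-] <-; rewrite sgE.
- by rewrite size_mkseq.
- apply/allP => P /(nthP [::])[i]; rewrite size_mkseq => /es'[x <-] <-.
  by rewrite -(sK' x) rhE; exact: permutes_perm (permutes_list _).
split=> // [x|j|x f]; rewrite ?size_mktable //; first exact: es'.
rewrite -(sK' x); move: (s' x) => {}x; rewrite glued_mktable ?el' // /relabel_entry.
rewrite isg rhE -[f](permKV (r x)); move: ((r x)^-1 f)%g => {}f.
rewrite (permutes_index _ (permutes_list _)); have [h1 h2] := eG x f.
rewrite -h1 sgE rhE sG /=; split=> //.
by apply: permutesM (permutes_list _); apply: permutesM h2; exact: permutesV (permutes_list _).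
Qed.

Lemma relabelled_iso (S : finType) enc (G : gluing S) T sg rh :
  represents enc G T -> perm_eq sg (iota 0 (size T)) -> size rh = size T ->
  all (mem perms4) rh ->
  exists G' : gluing S, isomorphic G G' /\
    represents (fun x => nth 0 sg (enc x)) G' (relabelled T sg rh).
Proof.
move=> [ei el es eG] psg srh prh.
have usg : uniq sg by rewrite (perm_uniq psg) iota_uniq.
have ssg : size sg = size T by rewrite (perm_size psg) size_iota.
have lsg x : nth 0 sg (enc x) < size T by exact: perm_iota_lt.
pose r x := perm_of (nth [::] rh (nth 0 sg (enc x))).
have rP x : permutes (r x) (nth [::] rh (nth 0 sg (enc x))).
  apply: permutes_of; have /allP := prh => /(_ (nth [::] rh (nth 0 sg (enc x)))).
  by rewrite mem_nth ?srh // => /(_ isT) /=; rewrite mem_permutations.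
pose G' : gluing S := [ffun F : S * 'I_4 => let e := G (F.1, (r F.1)^-1%g F.2) in
  (e.1, ((r F.1)^-1 * e.2 * r e.1)%g)].
exists G'; split.
  by exists id, r; split; [exists id|move=> t f; rewrite ffunE /= permK].
split=> [x y|x|j|x f]; rewrite ?size_mktable //.
- move=> /eqP; rewrite nth_uniq ?ssg ?el // => /eqP; exact: ei.
- move=> jT; have js' : j \in sg by rewrite (perm_mem psg) mem_iota.
  have [|x xE] := es (index j sg); first by rewrite -ssg index_mem.
  by exists x; rewrite xE nth_index.
rewrite glued_mktable ?ltn_ord // /relabel_entry index_uniq ?ssg ?el // ffunE /=.
have fE : index (f : nat) (nth [::] rh (nth 0 sg (enc x))) = ((r x)^-1 f)%g.
  by rewrite -[f in LHS](permKV (r x)) (permutes_index _ (rP x)).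
rewrite fE; have [h1 h2] := eG x ((r x)^-1 f)%g; rewrite -h1; split=> //.
by apply: permutesM (rP _); apply: permutesM h2; exact: permutesV (rP _).
Qed.

(** A labelled traversal from vertex labelling [r] of tetrahedron [t]; every
    new tetrahedron is labelled so that it is glued by the identity. *)
Fixpoint traverse (T : table) n (i : nat) (s : seq (nat * seq nat)) :=
  if n is n'.+1 then
    traverse T n' i.+1 (foldl (fun s g =>
      let t := (nth (0, [::]) s i).1 in let r := (nth (0, [::]) s i).2 in
      let e := glued T t (index g r) in
      if e.1 \in [seq a.1 | a <- s] then s else rcons s (e.1, pcomp (list_inv e.2) r))
      s (iota 0 4))
  else s.

(** The checks guarantee a relabelling of [T] whatever the traversal returns, so equal codes imply
    isomorphism and [None] can only make a test fail. *)
Definition code (T : table) t r : option table :=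
  let s := traverse T (size T) 0 [:: (t, r)] in
  let sg := [seq index t [seq a.1 | a <- s] | t <- iota 0 (size T)] in
  let rh := [seq a.2 | a <- s] in
  if [&& perm_eq sg (iota 0 (size T)), size rh == size T & all (mem perms4) rh]
  then Some (relabelled T sg rh) else None.

Lemma code_iso (S S' : finType) enc enc' (G : gluing S) (G' : gluing S') T T' t r t' r' X :
  represents enc G T -> represents enc' G' T' -> code T t r = Some X ->
  code T' t' r' = Some X -> isomorphic G G'.
Proof.
rewrite /code => GT GT'; case: ifP => // /and3P[p1 /eqP s1 a1] [x1].
case: ifP => // /and3P[p2 /eqP s2 a2] [x2].
have [G1 [i1 g1]] := relabelled_iso GT p1 s1 a1.
have [G2 [i2 g2]] := relabelled_iso GT' p2 s2 a2.
rewrite x1 -x2 in g1; apply: isomorphic_trans i1 _.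
by apply: isomorphic_trans (represents_iso g1 g2) _; exact: isomorphic_sym.
Qed.

Definition codes (C : seq table) : seq (option table) :=
  flatten [seq [seq code T t r | t <- iota 0 (size T), r <- perms4] | T <- C].

(** Comparisons that evaluate faster than the generic [==]. *)
Fixpoint seq_eqb (A : Type) (e : A -> A -> bool) (s s' : seq A) : bool :=
  match s, s' with
  | [::], [::] => true
  | x :: s, y :: s' => if e x y then seq_eqb e s s' else false
  | _, _ => false
  end.

Definition table_eqb : table -> table -> bool :=
  seq_eqb (seq_eqb (fun e e' => if eqn e.1 e'.1 then seq_eqb eqn e.2 e'.2 else false)).

Lemma seq_eqbP (A : Type) (e : A -> A -> bool) : (forall x y, e x y -> x = y) ->
  forall s s', seq_eqb e s s' -> s = s'.
Proof.
move=> ee; elim=> [|x s IH] [|y s'] //=; case E: (e x y) => // /IH ->.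
by rewrite (ee _ _ E).
Qed.

Lemma table_eqbP T T' : table_eqb T T' -> T = T'.
Proof.
apply: seq_eqbP; apply: seq_eqbP => -[u P] [v Q] /=; case E: (eqn u v) => //.
by move/seq_eqbP => ->; [rewrite (eqnP E)|move=> x y /eqnP].
Qed.

(** One traversal of [T] is enough, because [codes] contains the traversals of the listed tables
    from all starting labellings. *)
Definition known (cs : seq (option table)) (T : table) : bool :=
  if code T 0 (iota 0 4) is Some X then
    has (fun c => if c is Some Y then table_eqb X Y else false) cs
  else false.

Lemma known_iso (S : finType) enc (G : gluing S) T C : all wf_table C ->
  represents enc G T -> known (codes C) T ->
  exists2 T', T' \in C & isomorphic (gluing_of T') G.
Proof.
move=> /allP wC GT; rewrite /known; case E: (code T _ _) => [X|//] /hasP[[Y|//]].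
move=> /flatten_mapP[T' T'C] /allpairsP[[t r] /= [_ _ e]] /table_eqbP XY.
rewrite -XY in e; exists T' => //.
exact: code_iso (represents_gluing_of (wC _ T'C)) GT (esym e) E.
Qed.

End Represents.

(** * The 2-3 move and its inverse on tables *)

Section TableMoves.
Local Open Scope nat_scope.

Lemma face_pairing_iso (S S' : finType) (G : gluing S) (G' : gluing S') :
  isomorphic G G' -> face_pairing G -> face_pairing G'.
Proof.
move=> [s [r [[s' sK sK'] sG]]] GP.
pose h (F : S * 'I_4) : S' * 'I_4 := (s F.1, r F.1 F.2).
have hE F : glued_face G' (h F) = h (glued_face G F).
  by case: F => t f; rewrite /glued_face /h /= sG /= !permM permK.
have hS F : exists F0, F = h F0.
  by case: F => t f; exists (s' t, (r (s' t))^-1%g f); rewrite /h /= sK' permKV.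
have hI : injective h.
  by move=> [t f] [u g] [/(can_inj sK) ->] /perm_inj ->.
move=> F; have [[t f] ->] := hS F; have [h1 h2 h3] := GP (t, f); split.
- by rewrite hE (inj_eq hI).
- by rewrite !hE h2.
rewrite hE /h [(glued_face _ _).2]/= -[(glued_face G (t, f)).1]/(G (t, f)).1.
have -> : G' (s (G (t, f)).1, r (G (t, f)).1 (glued_face G (t, f)).2) =
    (s (G (glued_face G (t, f))).1, ((r (G (t, f)).1)^-1 * (G (glued_face G (t, f))).2
      * r (G (glued_face G (t, f))).1)%g) by rewrite sG.
rewrite /= h3 sG /= !invMg invgK !mulgA.
have -> : (G (glued_face G (t, f))).1 = t by have := congr1 fst h2.
by [].
Qed.

Variable k : nat.

Definition enc_old (x : 'I_k + bool) : nat :=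
  match x with inl t => t | inr true => k | inr false => k.+1 end.

Definition enc_new (x : 'I_k + 'I_3) : nat :=
  match x with inl t => t | inr i => k + i end.

Lemma enc_old_inj : injective enc_old.
Proof.
move=> [t|[|]] [u|[|]] //=; try by move=> h; exfalso; have := ltn_ord t; lia.
- by move=> /val_inj ->.
- by move=> h; exfalso; have := ltn_ord u; lia.
- by move=> h; exfalso; lia.
- by move=> h; exfalso; have := ltn_ord u; lia.
- by move=> h; exfalso; lia.
Qed.

Lemma enc_old_lt x : enc_old x < k + 2.
Proof. by case: x => [t|[|]] /=; [have := ltn_ord t|..]; lia. Qed.

Lemma enc_old_surj j : j < k + 2 -> exists x, enc_old x = j.
Proof.
move=> jk; have [jl|jl] := ltnP j k; first by exists (inl (Ordinal jl)).
by have [->|jn] := eqVneq j k; [exists (inr true)|exists (inr false) => /=; lia].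
Qed.

Lemma enc_new_inj : injective enc_new.
Proof.
move=> [t|i] [u|l] //=.
- by move=> /val_inj ->.
- by move=> h; exfalso; have := ltn_ord t; lia.
- by move=> h; exfalso; have := ltn_ord u; lia.
by move=> /addnI/val_inj ->.
Qed.

Lemma enc_new_lt x : enc_new x < k + 3.
Proof. by case: x => [t|i] /=; [have := ltn_ord t|have := ltn_ord i]; lia. Qed.

Lemma enc_new_surj j : j < k + 3 -> exists x, enc_new x = j.
Proof.
move=> jk; have [jl|jl] := ltnP j k; first by exists (inl (Ordinal jl)).
have j3 : j - k < 3 by lia.
by exists (inr (Ordinal j3)) => /=; lia.
Qed.

(** With [new_labels], the effect of [new_tet] and [relabel] on numbers. *)
Definition new_index a f : nat := if a < k then a else k + f.
Definition new_labels a f : seq nat := if a == k then pswap f 3 else iota 0 4.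

(** The old face that becomes face [g] of [j], unless the latter is inside the
    bipyramid. *)
Definition old_face_of j g : option (nat * nat) :=
  if j < k then Some (j, g) else if g == 3 then Some (k, j - k)
  else if g == j - k then Some (k.+1, g) else None.

Implicit Types F : outer_face 'I_k.

Lemma equatorE (i : 'I_3) : equator i = i :> nat.
Proof. by rewrite /= /bump leqNgt ltn_ord. Qed.

Lemma equator_neq_apex (i : 'I_3) : equator i != apex.
Proof. by rewrite eq_sym; exact: neq_lift. Qed.

Lemma equator_inj : injective equator.
Proof. exact: lift_inj. Qed.

Lemma apexP (f : 'I_4) : f = apex \/ exists i, f = equator i.
Proof. by case: (unliftP apex f) => [i|] ->; [right; exists i|left]. Qed.

Lemma enc_new_tet F : enc_new (new_tet F) = new_index (enc_old (old_face F).1) (old_face F).2.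
Proof.
case: F => [[t f]|[[] i]]; rewrite /new_index [old_face _]/=.
- by rewrite /= ltn_ord.
- by rewrite ltnn equatorE.
rewrite ifN; last by rewrite -leqNgt leqnSn.
by congr (k + _); exact: (esym (equatorE i)).
Qed.

Lemma relabel_permutes F :
  permutes (relabel F) (new_labels (enc_old (old_face F).1) (old_face F).2).
Proof.
case: F => [[t f]|[[] i]]; rewrite /new_labels [old_face _]/=.
- by rewrite ltn_eqF ?ltn_ord //; exact: permutes1.
- by rewrite eqxx; exact: permutes_tperm.
by rewrite /enc_old /= gtn_eqF //; exact: permutes1.
Qed.

Lemma new_face_false i : new_face (inr (false, i) : outer_face 'I_k) = (inr i, equator i).
Proof. by rewrite /new_face /= perm1. Qed.

Lemma new_face_true i : new_face (inr (true, i) : outer_face 'I_k) = (inr i, apex).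
Proof. by rewrite /new_face /= tpermL. Qed.

Lemma new_face_inl t f : new_face (inl (t, f) : outer_face 'I_k) = (inl t, f).
Proof. by rewrite /new_face /= perm1. Qed.

Lemma new_face_inj : injective (@new_face 'I_k).
Proof.
move=> [[t f]|[[] i]] [[u g]|[[] l]]; rewrite ?new_face_true ?new_face_false ?new_face_inl //.
- by move=> [-> ->].
- by move=> [->].
- by move=> /pair_equal_spec[_ /eqP]; rewrite eq_sym (negbTE (equator_neq_apex l)).
- by move=> /pair_equal_spec[_ /eqP]; rewrite (negbTE (equator_neq_apex i)).
by move=> [->].
Qed.

Variant old_face_of_spec (x : 'I_k + 'I_3) (f : 'I_4) : option (nat * nat) -> Prop :=
| OldFace F of new_face F = (x, f) :
    old_face_of_spec x f (Some (enc_old (old_face F).1, nat_of_ord (old_face F).2))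
| InnerFace i l of x = inr i & f = equator l & i != l : old_face_of_spec x f None.

Lemma old_face_ofP x f : old_face_of_spec x f (old_face_of (enc_new x) f).
Proof.
rewrite /old_face_of; case: x => [t|i] /=.
  by rewrite ltn_ord; exact: (@OldFace _ _ (inl (t, f))) (new_face_inl t f).
rewrite ifN; last by rewrite -leqNgt leq_addr.
rewrite addKn; have [fa|[l fl]] := apexP f.
  rewrite fa eqxx -equatorE; exact: (@OldFace _ _ (inr (true, i))) (new_face_true i).
rewrite fl equatorE ifN ?(ltn_eqF (ltn_ord l)) //; case: eqP => [/val_inj li|li].
  rewrite li -equatorE; exact: (@OldFace _ _ (inr (false, i))) (new_face_false i).
by apply: (@InnerFace _ _ i l) => //; apply/eqP => il; apply: li; rewrite il.
Qed.

(** [standard_move23] solved for the gluing after the move; the last case is a face inside the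
    bipyramid. *)
Definition up_entry (T : table) j g : nat * seq nat :=
  if old_face_of j g is Some (a, f) then
    let e := glued T a f in
    let h := nth 0 e.2 f in
    (new_index e.1 h, pcomp (pcomp (list_inv (new_labels a f)) e.2) (new_labels e.1 h))
  else (k + g, pswap (j - k) g).

Definition up_table T : table := mktable (k + 3) (up_entry T).

(** [standard_move23] solved for the gluing before the move. The final default does not arise for a
    gluing that a move produces. *)
Definition down_entry (T : table) a f : nat * seq nat :=
  if (k <= a) && (f == 3) then (if a == k then k.+1 else k, iota 0 4)
  else
    let l := new_labels a f in
    let e := glued T (new_index a f) (nth 0 l f) in
    if old_face_of e.1 (nth 0 e.2 (nth 0 l f)) is Some (b, h) then
      (b, pcomp (pcomp l e.2) (list_inv (new_labels b h)))
    else (0, [::]).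

Definition down_table T : table := mktable (k + 2) (down_entry T).

Lemma old_faceP (x : 'I_k + bool) (f : 'I_4) :
  (exists a, x = inr a /\ f = apex) \/ exists F, old_face F = (x, f).
Proof.
case: x => [t|a]; first by right; exists (inl (t, f)).
by have [->|[i ->]] := apexP f; [left; exists a|right; exists (inr (a, i))].
Qed.

Section StandardMove.
Variables (A : gluing ('I_k + bool)%type) (B : gluing ('I_k + 'I_3)%type).
Hypotheses (AB : standard_move23 A B) (PA : face_pairing A).

Lemma apex_glued : A (inr true, apex) = (inr false, 1%g) /\ A (inr false, apex) = (inr true, 1%g).
Proof.
have [h _ _] := AB; split=> //; have [_ h2 h3] := PA (inr true, apex).
move: h2 h3; rewrite /glued_face h /= perm1 invg1 => h2 h3.
by rewrite [LHS]surjective_pairing h3; congr pair; have := congr1 fst h2.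
Qed.

(** The two apex faces are paired with each other, so an outer face can only be paired with an outer
    face. *)
Lemma outer_glued F : exists F', glued_face A (old_face F) = old_face F'.
Proof.
have [h1 h2] := apex_glued; have [_ hF _] := PA (old_face F).
case E: (glued_face A (old_face F)) => [x f].
have [[a [xa fa]]|[F' F'E]] := old_faceP x f; last by exists F'.
exfalso; move: hF; rewrite E xa fa.
have -> : glued_face A (inr a, apex) = (inr (~~ a), apex).
  by case: (a); rewrite /glued_face ?h1 ?h2 /= perm1.
case: (F) => [[t g]|[b i]] // /pair_equal_spec[_ /eqP].
by rewrite eq_sym (negbTE (equator_neq_apex i)).
Qed.

Lemma represents_up T : represents enc_old A T -> represents enc_new B (up_table T).
Proof.
move=> [ei el es eA]; have [_ inner outer] := AB; split=> [|x|j|x f];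
  rewrite ?size_mktable; [exact: enc_new_inj|exact: enc_new_lt|exact: enc_new_surj|].
rewrite glued_mktable ?enc_new_lt // /up_entry.
case: old_face_ofP => [F FE|i l -> -> il]; last first.
  by rewrite inner // !equatorE /= addKn -!equatorE; split=> //; exact: permutes_tperm.
have [F' F'E] := outer_glued F; rewrite -FE (outer _ _ F'E).
case E: (old_face F) => [a g]; have [h1 h2] := eA a g.
have [Fa Fp] : (A (a, g)).1 = (old_face F').1 /\ (A (a, g)).2 g = (old_face F').2.
  by move: F'E; rewrite E => <-.
have hg : nth 0 (glued T (enc_old a) g).2 g = (old_face F').2 by rewrite -Fp (proj2 h2).
rewrite -h1 Fa [(a, g).1]/= [(a, g).2]/= hg; split; first exact: enc_new_tet.
have pF := relabel_permutes F; rewrite E in pF.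
by apply: permutesM (relabel_permutes F'); apply: permutesM h2; exact: permutesV pF.
Qed.

Lemma represents_down T : represents enc_new B T -> represents enc_old A (down_table T).
Proof.
move=> [ei el es eB]; have [_ inner outer] := AB; split=> [|x|j|x f];
  rewrite ?size_mktable; [exact: enc_old_inj|exact: enc_old_lt|exact: enc_old_surj|].
rewrite glued_mktable ?enc_old_lt // /down_entry.
have [[a [-> ->]]|[F FE]] := old_faceP x f.
  have [h1 h2] := apex_glued; rewrite [nat_of_ord apex]/= eqxx andbT.
  by case: a; rewrite ?h1 ?h2 /= ?leqnn ?leqnSn ?eqxx ?gtn_eqF //; split=> //; exact: permutes1.
rewrite ifN; last first.
  case: F FE => [[t g]|[b i]] [<- <-] /=; first by rewrite negb_and -ltnNge ltn_ord.
  by rewrite negb_and -[bump _ _]/(nat_of_ord (equator i)) equatorE (ltn_eqF (ltn_ord i)) orbT.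
have [F' F'E] := outer_glued F; have oF := outer _ _ F'E.
have rF := relabel_permutes F; have rF' := relabel_permutes F'; have tF := enc_new_tet F.
rewrite FE in rF tF.
have hn : nth 0 (new_labels (enc_old x) f) f = (new_face F).2 by rewrite -(proj2 rF) /= FE.
have [h1 h2] := eB (new_face F).1 (new_face F).2.
rewrite [(x, f).1]/= [(x, f).2]/= in tF rF.
rewrite -tF hn -h1 -(proj2 h2) -surjective_pairing oF.
have e2 : ((relabel F)^-1 * (A (old_face F)).2 * relabel F')%g (new_face F).2 = (new_face F').2.
  rewrite -[(new_face F).2]/(relabel F (old_face F).2).
  by rewrite -[(new_face F').2]/(relabel F' (old_face F').2) !permM permK -F'E.
rewrite e2 -[new_tet F']/((new_face F').1); case: old_face_ofP => [F2|i l]; last first.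
  case: (F') => [[t g]|[[] i']]; rewrite ?new_face_true ?new_face_false ?new_face_inl // => -[->].
    by move=> /eqP; rewrite eq_sym (negbTE (equator_neq_apex l)).
  by move=> /equator_inj ->; rewrite eqxx.
rewrite -surjective_pairing => /new_face_inj ->.
have -> : A (x, f) = A (old_face F) by rewrite FE.
split; first by rewrite -F'E.
have -> : (A (old_face F)).2 = (relabel F * ((relabel F)^-1 * (A (old_face F)).2 * relabel F') * (relabel F')^-1)%g.
  by rewrite !mulgA mulgV mul1g mulgK.
apply: permutesM (permutesV rF'); apply: permutesM rF _.
by move: h2; rewrite -surjective_pairing oF.
Qed.

End StandardMove.

End TableMoves.

(** * Enumeration of the moves on a table *)

Section Enumeration.
Local Open Scope nat_scope.

(** [(x, g, e)] requires face [g] of [x] to be glued as described by [e]. *)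
Definition requirement : Type := (nat * nat) * (nat * seq nat).

Definition meets T sg rh (c : requirement) : bool :=
  relabel_entry T sg rh c.1.1 c.1.2 == c.2.

(** Tests [fin] on all labellings that meet the requirements [cs], choosing the
    labels of the last tetrahedra first and pruning as soon as possible. *)
Fixpoint all_labels (cs : seq requirement) T sg j (sfx : seq (seq nat))
    (fin : seq (seq nat) -> bool) : bool :=
  if all (fun c => [|| c.1.1 < j, c.2.1 < j | meets T sg (nseq j [::] ++ sfx) c]) cs then
    if j is j'.+1 then all (fun r => all_labels cs T sg j' (r :: sfx) fin) perms4
    else fin sfx
  else true.

Lemma all_labelsS cs T sg j sfx fin : all_labels cs T sg j.+1 sfx fin =
  if all (fun c => [|| c.1.1 < j.+1, c.2.1 < j.+1 | meets T sg (nseq j.+1 [::] ++ sfx) c]) cs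
  then all (fun r => all_labels cs T sg j (r :: sfx) fin) perms4 else true.
Proof. by []. Qed.

Lemma all_labelsP cs T sg fin pre sfx : all_labels cs T sg (size pre) sfx fin ->
  all (mem perms4) pre -> all (meets T sg (pre ++ sfx)) cs -> fin (pre ++ sfx).
Proof.
elim/last_ind: pre sfx => [|pre r IH] sfx.
  by move=> /= h _ cs0; move: h; rewrite ifT //; apply: sub_all cs0 => c ->; rewrite !orbT.
rewrite size_rcons all_rcons cat_rcons => h /andP[rp pp] cs0; apply: IH => //.
move: h; rewrite all_labelsS ifT; first by move=> h; exact: (allP h _ rp).
apply/allP => c cc; have := allP cs0 c cc; rewrite /meets /relabel_entry => /eqP ce.
(* [relabel_entry] consults only the labels of the two tetrahedra that a requirement names, so the
   requirement can be tested as soon as these are fixed. *)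
have nE x : size pre < x ->
    nth [::] (nseq (size pre).+1 [::] ++ sfx) x = nth [::] (pre ++ r :: sfx) x.
  by move=> xj; rewrite -cat_rcons !nth_cat size_nseq size_rcons ltnNge xj.
have [//|cj] := ltnP c.1.1 (size pre).+1; rewrite (nE _ cj).
have [|yj] := ltnP c.2.1 (size pre).+1; rewrite ?orbT //.
by rewrite -ce in yj; rewrite (nE _ yj) ce eqxx.
Qed.

(** This and [edge_requirement] are the clauses of [standard_move23] on the faces inside the
    bipyramid: a labelling that meets them exhibits a place where the move applies. *)
Definition apex_requirement k : seq requirement := [:: ((k, 3), (k.+1, iota 0 4))].

Definition edge_requirement k : seq requirement :=
  [seq ((k + c.1, c.2), (k + c.2, pswap c.1 c.2)) |
    c <- [:: (0, 1); (0, 2); (1, 0); (1, 2); (2, 0); (2, 1)]].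

Definition up_ok (cs : seq (option table)) k T : bool :=
  all (fun sg => all_labels (apex_requirement k) T sg (size T) [::]
    (fun rh => known cs (up_table k (relabelled T sg rh)))) (permutations (iota 0 (size T))).

Definition down_ok (cs : seq (option table)) k T : bool :=
  all (fun sg => all_labels (edge_requirement k) T sg (size T) [::]
    (fun rh => known cs (down_table k (relabelled T sg rh)))) (permutations (iota 0 (size T))).

Variable C : seq table.
Hypothesis wC : all wf_table C.

Lemma meets_represented (S : finType) (enc : S -> nat) (G : gluing S) T sg rh x (g : 'I_4) e :
  represents enc G (relabelled T sg rh) -> enc (G (x, g)).1 = e.1 ->
  permutes (G (x, g)).2 e.2 -> meets T sg rh ((enc x, nat_of_ord g), e).
Proof.
move=> [_ el _ eG] e1 e2; have [h1 h2] := eG x g; rewrite /meets [_.1.1]/= [_.1.2]/=.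
rewrite glued_mktable // in h1 h2; last by have := el x; rewrite size_mktable.
apply/eqP; rewrite [LHS]surjective_pairing [RHS]surjective_pairing -h1 e1.
by rewrite (permutes_fun h2 e2).
Qed.

Lemma up_closed k (A : gluing ('I_k + bool)%type) (B : gluing ('I_k + 'I_3)%type) T :
  T \in C -> size T = k + 2 -> up_ok (codes C) k T -> isomorphic (gluing_of T) A ->
  standard_move23 A B -> face_pairing A ->
  exists2 T', T' \in C & isomorphic (gluing_of T') B.
Proof.
move=> TC sT /allP up TA AB PA; have wT := allP wC T TC.
have [|j|sg [rh [psg srh prh rA]]] :=
  represents_relabelled (represents_gluing_of wT) TA (@enc_old_inj k).
- by rewrite sT; exact: enc_old_lt.
- by rewrite sT; exact: enc_old_surj.
have h := up _ psg; rewrite -srh in h.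
have := all_labelsP h prh; rewrite cats0 => /(_ _)/(known_iso wC (represents_up AB PA rA)); apply.
rewrite /= andbT; have [a1 _] := apex_glued AB PA.
apply: (meets_represented (x := inr true) (g := apex) rA); rewrite a1 //.
exact: permutes1.
Qed.

Lemma down_closed k (A : gluing ('I_k + bool)%type) (B : gluing ('I_k + 'I_3)%type) T :
  T \in C -> size T = k + 3 -> down_ok (codes C) k T -> isomorphic (gluing_of T) B ->
  standard_move23 A B -> face_pairing A ->
  exists2 T', T' \in C & isomorphic (gluing_of T') A.
Proof.
move=> TC sT /allP dn TB AB PA; have wT := allP wC T TC.
have [|j|sg [rh [psg srh prh rB]]] :=
  represents_relabelled (represents_gluing_of wT) TB (@enc_new_inj k).
- by rewrite sT; exact: enc_new_lt.
- by rewrite sT; exact: enc_new_surj.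
have h := dn _ psg; rewrite -srh in h.
have := all_labelsP h prh; rewrite cats0 => /(_ _)/(known_iso wC (represents_down AB PA rB)); apply.
have [_ inner _] := AB.
have key (i l : 'I_3) : i != l -> meets T sg rh ((k + i, l : nat), (k + l, pswap i l)).
  move=> il; have := @meets_represented _ _ _ T sg rh (inr i) (equator l) (k + l, pswap i l) rB.
  rewrite inner // equatorE; apply=> //.
  by rewrite -(equatorE i) -(equatorE l); exact: permutes_tperm.
pose o0 : 'I_3 := ord0; pose o1 : 'I_3 := @Ordinal 3 1 isT; pose o2 : 'I_3 := @Ordinal 3 2 isT.
by rewrite /= (key o0 o1) // (key o0 o2) // (key o1 o0) // (key o1 o2) // (key o2 o0) // (key o2 o1).
Qed.

End Enumeration.

(** * Tables as nodes of the Pachner graph *)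

Section Triangulations.

Definition triangulation_of (T : table) : triangulation :=
  existT (fun n => gluing 'I_n) (size T).-1.+1 (gluing_of T).

Lemma class_ofP (T T' : triangulation) :
  class_of T = class_of T' <-> isomorphic (tagged T) (tagged T').
Proof.
split=> [/eqmodP/asboolP//|h]; by apply/eqmodP/asboolP.
Qed.

Lemma isomorphic_card (S S' : finType) (G : gluing S) (G' : gluing S') :
  isomorphic G G' -> #|S| = #|S'|.
Proof. by move=> [s [_ [bs _]]]; exact: bij_eq_card bs. Qed.

Lemma level_class_of (T : triangulation) : level (class_of T) = tag T.
Proof.
have : class_of (repr (class_of T : {eq_quot isomorphic_equiv})) = class_of T by exact: reprK.
by move=> /class_ofP/isomorphic_card; rewrite !card_ord.
Qed.

Definition pairing_ok (T : table) : bool :=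
  all (fun t => all (fun f => let e := glued T t f in let g := nth 0%N e.2 f in
    ((e.1, g) != (t, f)) && (glued T e.1 g == (t, list_inv e.2))) (iota 0 4)) (iota 0 (size T)).

Lemma face_pairing_table T : wf_table T -> pairing_ok T -> face_pairing (gluing_of T).
Proof.
move=> wT /allP ok [t f]; have [_ el _ eG] := represents_gluing_of wT.
have tI : (t : nat) \in iota 0 (size T) by rewrite mem_iota /= el.
have fI : (f : nat) \in iota 0 4 by rewrite mem_iota /= ltn_ord.
have /andP[n1 /eqP n2] := allP (ok _ tI) _ fI; have [h1 h2] := eG t f.
have hf := proj2 h2 f; rewrite -h1 -hf in n1 n2.
have [g1 g2] := eG (gluing_of T (t, f)).1 ((gluing_of T (t, f)).2 f).
rewrite n2 /= in g1 g2; have pV := permutesV h2.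
have e2 : (gluing_of T (glued_face (gluing_of T) (t, f))).2 = ((gluing_of T (t, f)).2)^-1%g.
  exact: permutes_inj g2 pV.
split=> //.
rewrite /glued_face [(t, f).2]/= -/(glued_face (gluing_of T) (t, f)) e2.
by rewrite permK; congr pair; apply: val_inj.
Qed.

(** Adds the vertices of neighbouring tetrahedra identified with those of [s]. *)
Definition spread (T : table) (s : seq (nat * nat)) : seq (nat * nat) :=
  undup (s ++ [seq ((glued T v.1 f).1, nth 0%N (glued T v.1 f).2 v.2) | v <- s,
    f <- [seq f <- iota 0 4 | f != v.2]]).

(** The number of rounds affects only whether the test succeeds, since every position reached is
    identified with the initial one. *)
Definition one_vertex_ok (T : table) : bool :=
  all (fun v => all (fun w => w \in iter (size T).*2 (spread T) [:: v])
    [seq (t, i) | t <- iota 0 (size T), i <- iota 0 4])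
    [seq (t, i) | t <- iota 0 (size T), i <- iota 0 4].

Lemma one_vertex_table T : wf_table T -> one_vertex_ok T -> #|vertices (gluing_of T)| = 1%N.
Proof.
move=> wT ok; have [_ el _ eG] := represents_gluing_of wT.
pose e (v : 'I_(size T).-1.+1 * 'I_4) : nat * nat := (v.1 : nat, v.2 : nat).
have eI : injective e by move=> [a b] [c d] [/val_inj -> /val_inj ->].
have step v n w : w \in iter n (spread T) [:: e v] ->
    exists2 u, w = e u & connect (vertex_glued (gluing_of T)) v u.
  elim: n w => [|n IH] w; first by rewrite inE => /eqP ->; exists v.
  rewrite iterS mem_undup mem_cat => /orP[/IH//|/allpairsPdep[x [f [/IH[u -> vu]]]]].
  rewrite mem_filter mem_iota => /andP[fu f4] ->.
  pose f' : 'I_4 := Ordinal f4; have [h1 h2] := eG u.1 f'.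
  exists ((gluing_of T (u.1, f')).1, (gluing_of T (u.1, f')).2 u.2).
    by rewrite /e /= h1 (proj2 h2).
  apply: connect_trans vu (connect1 _); apply/existsP; exists f'.
  by rewrite /= !eqxx !andbT; apply: contraNneq fu => h; rewrite /e /= -h.
have conn u v : connect (vertex_glued (gluing_of T)) u v.
  have mem x : e x \in [seq (t, i) | t <- iota 0 (size T), i <- iota 0 4].
    by apply: allpairs_f; rewrite mem_iota /= ?el ?ltn_ord.
  by have /step[w /eI ->] := allP (allP ok _ (mem u)) _ (mem v).
apply/eqP/cards1P; exists [set: 'I_(size T).-1.+1 * 'I_4]%SET; apply/setP => D; rewrite inE.
apply/imsetP/eqP => [[v _ ->]|->].
  by apply/setP => u; rewrite !inE conn.
by exists (inord 0, ord0) => //; apply/setP => u; rewrite !inE conn.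
Qed.

End Triangulations.

(** * The component of one node in the lowest levels *)

Section Component.

Definition component_table3 : table :=
  [:: [:: (0, [:: 1; 0; 2; 3]); (0, [:: 1; 0; 2; 3]); (1, [:: 0; 1; 2; 3]); (2, [:: 0; 1; 2; 3])];
      [:: (2, [:: 0; 2; 1; 3]); (2, [:: 3; 1; 2; 0]); (0, [:: 0; 1; 2; 3]); (2, [:: 0; 1; 3; 2])];
      [:: (1, [:: 0; 2; 1; 3]); (1, [:: 3; 1; 2; 0]); (1, [:: 0; 1; 3; 2]); (0, [:: 0; 1; 2; 3])]]%N.

Definition component_table4a : table :=
  [:: [:: (0, [:: 1; 0; 2; 3]); (0, [:: 1; 0; 2; 3]); (1, [:: 0; 1; 2; 3]); (1, [:: 0; 1; 2; 3])];
      [:: (2, [:: 0; 1; 2; 3]); (3, [:: 0; 1; 2; 3]); (0, [:: 0; 1; 2; 3]); (0, [:: 0; 1; 2; 3])];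
      [:: (1, [:: 0; 1; 2; 3]); (3, [:: 1; 0; 2; 3]); (2, [:: 1; 2; 3; 0]); (2, [:: 3; 0; 1; 2])];
      [:: (2, [:: 1; 0; 2; 3]); (1, [:: 0; 1; 2; 3]); (3, [:: 1; 2; 3; 0]); (3, [:: 3; 0; 1; 2])]]%N.

Definition component_table4b : table :=
  [:: [:: (0, [:: 1; 0; 2; 3]); (0, [:: 1; 0; 2; 3]); (1, [:: 0; 1; 2; 3]); (2, [:: 0; 1; 2; 3])];
      [:: (2, [:: 2; 3; 1; 0]); (3, [:: 0; 1; 2; 3]); (0, [:: 0; 1; 2; 3]); (3, [:: 3; 2; 1; 0])];
      [:: (3, [:: 3; 1; 0; 2]); (3, [:: 3; 2; 1; 0]); (1, [:: 3; 2; 0; 1]); (0, [:: 0; 1; 2; 3])];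
      [:: (1, [:: 3; 2; 1; 0]); (1, [:: 0; 1; 2; 3]); (2, [:: 3; 2; 1; 0]); (2, [:: 2; 1; 3; 0])]]%N.

Definition component_table4c : table :=
  [:: [:: (1, [:: 0; 1; 2; 3]); (1, [:: 0; 1; 2; 3]); (2, [:: 0; 1; 2; 3]); (3, [:: 0; 1; 2; 3])];
      [:: (0, [:: 0; 1; 2; 3]); (0, [:: 0; 1; 2; 3]); (2, [:: 0; 2; 1; 3]); (3, [:: 1; 2; 3; 0])];
      [:: (3, [:: 2; 0; 3; 1]); (1, [:: 0; 2; 1; 3]); (0, [:: 0; 1; 2; 3]); (3, [:: 2; 0; 3; 1])];
      [:: (1, [:: 3; 0; 1; 2]); (2, [:: 1; 3; 0; 2]); (2, [:: 1; 3; 0; 2]); (0, [:: 0; 1; 2; 3])]]%N.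

(** The nodes of the component of [table_b] in levels at most 4. *)
Definition component : seq table :=
  [:: table_b; component_table3; component_table4a; component_table4b; component_table4c].

Lemma component_wf : all wf_table component. Proof. by []. Qed.

(** A table of size 4 is only moved down, as a 2-3 move would leave the levels considered; a 3-2
    move requires at least three tetrahedra. *)
Lemma component_moves : all (fun T =>
  (if (size T <= 3)%N then up_ok (codes component) (size T - 2) T else true) &&
  (if (3 <= size T)%N then down_ok (codes component) (size T - 3) T else true)) component.
Proof. by vm_compute. Qed.

Definition same_glueing (T T' : table) : bool :=
  all (fun t => all (fun f => glued T t f == glued T' t f) (iota 0 4)) (iota 0 (size T')).

Lemma represents_same (S : finType) (enc : S -> nat) (G : gluing S) T T' :
  represents enc G T -> represents enc G T' -> same_glueing T T'.
Proof.
move=> [_ _ _ eG] [_ _ es eG']; apply/allP => t; rewrite mem_iota => /es[x <-].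
apply/allP => f; rewrite mem_iota => f4.
have [h1 h2] := eG x (Ordinal f4); have [h1' h2'] := eG' x (Ordinal f4).
apply/eqP; rewrite [LHS]surjective_pairing [RHS]surjective_pairing.
by rewrite -[LHS]/(_, _) -h1 h1' (permutes_fun h2 h2').
Qed.

Lemma table_a_relabellings : all (fun sg => all_labels [::] table_a sg 2 [::]
  (fun rh => ~~ same_glueing (relabelled table_a sg rh) table_b)) (permutations (iota 0 2)).
Proof. by vm_compute. Qed.

(** An isomorphism would be one of finitely many relabellings of [table_a], all of which are
    compared with [table_b]. *)
Lemma table_a_not_b : ~ isomorphic (gluing_of table_a) (gluing_of table_b).
Proof.
move=> ab; have [_ el es _] := represents_gluing_of (isT : wf_table table_b).
have [sg [rh [psg srh prh rb]]] := represents_relabelled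
  (represents_gluing_of (isT : wf_table table_a)) ab (@val_inj _ _ _) el es.
have h := allP table_a_relabellings _ psg; rewrite -[2%N]/(size table_a) -srh in h.
have := all_labelsP h prh isT; rewrite cats0 => /negP; apply.
exact: represents_same rb (represents_gluing_of _).
Qed.

Variables (R : realType) (M : topologicalType).

Lemma node_pairing (T : triangulation) : pachner_node R M (class_of T) -> face_pairing (tagged T).
Proof. by move=> [T' /class_ofP TT' [PT' _ _]]; exact: face_pairing_iso (isomorphic_sym TT') PT'. Qed.

Lemma table_card T : T \in component -> #|'I_(size T).-1.+1| = size T.
Proof. by move=> TC; rewrite card_ord wf_size // (allP component_wf _ TC). Qed.

Lemma component_closed T d : T \in component ->
  pachner_arc R M (class_of (triangulation_of T)) d -> (level d <= 4)%N ->
  exists2 T', T' \in component & d = class_of (triangulation_of T').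
Proof.
move=> TC /asboolP[nc nd [T1 [T2 [c1 d2 mv]]]]; rewrite d2 level_class_of => l4.
have /andP[up dn] := allP component_moves _ TC.
have TT1 : isomorphic (gluing_of T) (tagged T1) by have /class_ofP := c1.
case: mv => -[k [A [B [hA hB AB]]]].
- have TA := isomorphic_trans TT1 hA.
  have sT : size T = (k + 2)%N.
    by rewrite -(table_card TC) (isomorphic_card TA) card_sum card_ord card_bool.
  have s2 : tag T2 = (k + 3)%N.
    by have := isomorphic_card hB; rewrite card_sum !card_ord.
  rewrite s2 in l4; rewrite sT addnK ifT in up; last by rewrite (leq_add2r 2 k 1); lia.
  have PA : face_pairing A by apply: face_pairing_iso hA _; apply: node_pairing; rewrite -c1.
  have [T' T'C T'B] := up_closed component_wf TC sT up TA AB PA.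
  by exists T' => //; apply/class_ofP; apply: isomorphic_trans hB (isomorphic_sym T'B).
have TB := isomorphic_trans TT1 hB.
have sT : size T = (k + 3)%N.
  by rewrite -(table_card TC) (isomorphic_card TB) card_sum !card_ord.
rewrite sT addnK ifT in dn; last by rewrite leq_addl.
have PA : face_pairing A by apply: face_pairing_iso hA _; apply: node_pairing; rewrite -d2.
have [T' T'C T'A] := down_closed component_wf TC sT dn TB AB PA.
by exists T' => //; apply/class_ofP; apply: isomorphic_trans hA (isomorphic_sym T'A).
Qed.

Lemma component_path T s : T \in component ->
  path (pachner_arc R M) (class_of (triangulation_of T)) s ->
  all (fun d => (level d <= 4)%N) s ->
  exists2 T', T' \in component & last (class_of (triangulation_of T)) s = class_of (triangulation_of T').
Proof.
elim: s T => [|d s IH] T TC /=; first by exists T.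
move=> /andP[cd ds] /andP[d4 s4]; have [T' T'C dE] := component_closed TC cd d4.
by rewrite dE in ds *; exact: IH.
Qed.

(** The level excludes all listed tables except [table_b]. *)
Lemma table_a_not_in T : T \in component -> class_of (triangulation_of table_a) <> class_of (triangulation_of T).
Proof.
move=> TC e; have := congr1 level e; rewrite !level_class_of.
move: TC e; rewrite !inE => /or4P[/eqP->|/eqP->|/eqP->|/orP[]/eqP->] //.
by move=> /class_ofP/table_a_not_b.
Qed.

End Component.

Lemma lens_node (R : realType) (T : table) : wf_table T -> pairing_ok T -> one_vertex_ok T ->
  homeomorphic (realization R (gluing_of T)) (lens R) ->
  one_vertex_triangulation_of R (lens R) (triangulation_of T).
Proof.
by move=> wT pT vT hT; split; [exact: face_pairing_table|exact: one_vertex_table|].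
Qed.

Theorem theorem5p2 (R : realType) :
  exists M : topologicalType,
    [/\ closed_3manifold R M, orientable R M, prime_3manifold R M &
      exists (b : nat) (nu1 nu2 : isomorphism_class),
        [/\ base_level R M b,
            pachner_node R M nu1 /\ level nu1 = b,
            pachner_node R M nu2 /\ level nu2 = b &
            forall s : seq isomorphism_class,
              path (pachner_arc R M) nu1 s -> last nu1 s = nu2 ->
              (3 <= excess_height nu1 s)%N]].
Proof.
exists (lens R); split.
- exact: lens_closed_3manifold.
- exact: lens_orientable.
- exact: lens_prime.
have va := @lens_node R table_a isT isT isT (table_a_lens R).
have vb := @lens_node R table_b isT isT isT (table_b_lens R).
exists 2%N, (class_of (triangulation_of table_b)), (class_of (triangulation_of table_a)).
split.
(* Level 2 is the least that [base_level] admits, so minimality is immediate. *)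
- by split=> //; exists (triangulation_of table_b).
- by rewrite level_class_of; split=> //; exists (triangulation_of table_b).
- by rewrite level_class_of; split=> //; exists (triangulation_of table_a).
move=> s ps ls; rewrite /excess_height; case: ex_minnP => h wh _.
(* Height below 3 over end points at level 2 confines the path to levels up to 4. *)
rewrite leqNgt; apply/negP => h3.
move: wh; rewrite /within_height ls !level_class_of /= => /andP[_ s4].
have [|T TC] := @component_path R (lens R) table_b s (mem_head _ _) ps.
  by apply: sub_all s4 => d /leq_trans; apply; lia.
by rewrite ls; exact: table_a_not_in.
Qed.
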